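(* Let $n\ge 5$ be an integer, let $\omega>0$, and consider the differential equation \[ \dot z=z^{n}+P_{n-1}(t)z^{n-1}+\dots+P_{1}(t)z+P_{0}(t), \] where $z$ is complex-valued and $P_0,\dots,P_{n-1}$ are real-valued continuous functions on $[0,\omega]$. Let $K$ be a real number with $K>\max_{0\le t\le\omega}|P_0(t)|$. Suppose that for all $0\le t\le\omega$: \[ P_{n-2}(t)\le 0, \] \[ |P_i(t)|\le \frac{K-K^{(n-2)/n}P_{n-2}(t)-|P_0(t)|}{(n-4)\,K^{i/n}}\sin\!\Big(\frac{\pi}{n-2}\Big)\quad\text{for all } i\in\{2,\dots,n-1\}\setminus\{n-2\}, \] and \[ |P_1(t)|\ge \frac{K+|P_0(t)|-K^{(n-2)/n}P_{n-2}(t)+\frac{n-3}{n-4}\big(K-K^{(n-2)/n}P_{n-2}(t)-|P_0(t)|\big)\sin\!\big(\frac{\pi}{n-2}\big)}{K^{1/n}}. \] Then the equation has exactly $n$ complex periodic solutions (counted with multiplicity).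
   Context: For $c\in\mathbb{C}$ let $z(t,c)$ be the solution with $z(0,c)=c$, and let $Q$ be the (open) set of $c$ for which $z(t,c)$ is defined on all of $[0,\omega]$. The displacement function is $q(c)=z(\omega,c)-c$ on $Q$; it is holomorphic. A solution $\varphi$ is called periodic if $\varphi(0)=\varphi(\omega)$ (the $P_i$ need not be periodic), i.e. $\varphi(0)$ is a zero of $q$; its multiplicity is the multiplicity of $\varphi(0)$ as a zero of $q$, and a periodic solution of multiplicity $k$ is counted as $k$ solutions. $K^{i/n}$ denotes the positive real $n$-th root of $K^i$. *)

(* Defs.v *)
From Stdlib Require Import Reals Lra List.
From Coquelicot Require Import Coquelicot.
Open Scope R_scope.

Definition cont_on (a b : R) (f : R -> R) : Prop :=
  forall t, a <= t <= b ->
    filterlim f (within (fun s => a <= s <= b) (locally t)) (locally (f t)).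

Definition rhs (n : nat) (P : nat -> R -> R) (t : R) (z : C) : C :=
  Cplus (pow_n (K := C_Ring) z n)
        (sum_n (G := C_AbelianMonoid)
               (fun i => Cmult (RtoC (P i t)) (pow_n (K := C_Ring) z i)) (n - 1)).

Definition is_solution (n : nat) (P : nat -> R -> R) (w : R) (c : C) (phi : R -> C) : Prop :=
  phi 0 = c /\
  (forall t, 0 <= t <= w ->
     filterlim phi (within (fun s => 0 <= s <= w) (locally t)) (locally (phi t))) /\
  (forall t, 0 < t < w ->
     @is_derive R_AbsRing C_R_NormedModule phi t (rhs n P t (phi t))).

Definition in_Q (n : nat) (P : nat -> R -> R) (w : R) (c : C) : Prop :=
  exists phi, is_solution n P w c phi.

(* Graph of the displacement function q(c) = z(w,c) - c on Q
   (q is a function since solutions are unique). *)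
Definition displacement (n : nat) (P : nat -> R -> R) (w : R) (c v : C) : Prop :=
  exists phi, is_solution n P w c phi /\ v = Cminus (phi w) c.

Definition zero_mult (n : nat) (P : nat -> R -> R) (w : R) (c : C) (k : nat) : Prop :=
  exists (r : R) (h : C -> C), 0 < r /\
    (forall z : C, ball (M := C_UniformSpace) c r z ->
        displacement n P w z (Cmult (pow_n (K := C_Ring) (Cminus z c) k) (h z)) /\
        @ex_derive C_AbsRing C_NormedModule h z) /\
    h c <> RtoC 0.

Definition num_periodic_solutions (n : nat) (P : nat -> R -> R) (w : R) (N : nat) : Prop :=
  exists (cs : list C) (ks : list nat),
    length cs = length ks /\
    NoDup cs /\
    (forall j, (j < length cs)%nat ->
        zero_mult n P w (nth j cs (RtoC 0)) (nth j ks 0%nat)) /\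
    (forall c, displacement n P w c (RtoC 0) -> List.In c cs) /\
    fold_right Nat.add 0%nat ks = N.

(* Main.v *)
Require Import Defs.
From Stdlib Require Import Reals Lra Lia List Classical ClassicalEpsilon FunctionalExtensionality FinFun.
From Coquelicot Require Import Coquelicot.
Open Scope R_scope.

(* Put m = n - 2. The coefficient bounds, read at |z| slightly below K^(1/n), say two
   things. The linear term dominates on a circle, so there the field points strictly
   inwards or strictly outwards according to the sign of P_1. Outside that circle the field
   crosses the rays arg z = k pi / m (k not divisible by m) strictly, with directions
   alternating in k. These rays bound sectors of opening pi / m and two of opening
   2 pi / m around the real axis, each of them invariant after possibly reversing time,
   and the periodic solutions are counted separately in the disc and in the sectors.

   In each region the displacement q is compared with an explicit function E having the
   expected zeros: on the boundary of a large compact piece, q / E avoids the closed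
   negative half line. A holomorphic function g with this boundary property has no zero,
   by the maximum principle applied to 1 / (g + s). In a sector the comparison is made in
   the coordinate W(z) = z^m + r^(2m) / z^m, which maps the part outside the disc of a
   sector of opening pi / m onto a half plane. Solutions can escape to infinity in finite
   time only along the real axis; the sectors around it are symmetric, which allows one
   to work in their upper halves. Time reversal and z -> -z reduce the remaining cases.
   The disc holds one periodic solution, the sectors together n - 1. *)

(** * Complex numbers *)

(** Across the ray of angle theta the monomial z^i has component rho^i sin((i - 1) theta). For theta
    = k pi / m the terms z and z^(n-1) are therefore tangent, z^n and P_(n-2) z^(n-2) push to the
    same side, and only the constant term and the n - 4 indices 2, ..., n - 3 can oppose: this is
    the n - 4 of the hypothesis. At modulus K^(1/n) the estimate on the rays is strict already,
    because the term i = 2 carries sin theta instead of 1, while the estimate on the circle is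
    strict only further in; hence a radius slightly smaller, where both hold.

    The obstacle is escape along the real axis, which leaves the displacement undefined on part of
    the sectors around it. These are truncated by the size of the whole orbit, and the new boundary
    consists of starts whose orbit just reaches a large modulus. In u = z^(-(n-1)) infinity is the
    origin and the flow almost a translation, so such an orbit either goes round the origin and ends
    at a definite angle to the axis, or runs out of time while far out and close to it. Both cases
    control the argument of the displacement. Since W is real on the sides and on the circle, real
    polynomials in W serve as comparison functions. *)

Lemma Rmin_bounds a b : Rmin a b <= a /\ Rmin a b <= b.
Proof. split; [apply Rmin_l | apply Rmin_r]. Qed.

Lemma Rmax_bounds a b : a <= Rmax a b /\ b <= Rmax a b.
Proof. split; [apply Rmax_l | apply Rmax_r]. Qed.

(** Besides sign goals it closes whatever [assumption] or [lra] closes; many of its calls are of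
    that kind. *)
Ltac pos := first [assumption | lra | match goal with
 | |- 0 < _ * _ => apply Rmult_lt_0_compat; pos
 | |- 0 < _ / _ => apply Rdiv_lt_0_compat; pos
 | |- 0 < / _ => apply Rinv_0_lt_compat; pos
 | |- 0 < _ ^ _ => apply pow_lt; pos
 | |- 0 < exp _ => apply exp_pos
 | |- 0 < Rmin _ _ => apply Rmin_pos; pos
 | |- 0 <= _ * _ => apply Rmult_le_pos; pos
 | |- 0 <= / _ => left; apply Rinv_0_lt_compat; pos
 | |- 0 <= _ ^ _ => apply pow_le; pos
 | |- 0 <= Rabs _ => apply Rabs_pos
 | |- 0 <= Cmod _ => apply Cmod_ge_0
 end].

Lemma Im_le_Cmod (z : C) : Rabs (Im z) <= Cmod z.
Proof.
 eapply Rle_trans; [| apply Rmax_Cmod]. apply Rmax_r.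
Qed.

Lemma Re_sub_le (x y : C) : Rabs (Re x - Re y) <= Cmod (x - y).
Proof. apply (re_le_Cmod (x - y)%C). Qed.

Lemma Im_sub_le (x y : C) : Rabs (Im x - Im y) <= Cmod (x - y).
Proof. apply (Im_le_Cmod (x - y)%C). Qed.

Lemma Cmod_le_Re_Im (z : C) : Cmod z <= Rabs (Re z) + Rabs (Im z).
Proof.
 destruct z as [x y]; unfold Cmod, Re, Im; simpl fst; simpl snd.
 apply Rsqr_incr_0_var; [| generalize (Rabs_pos x) (Rabs_pos y); lra]. rewrite Rsqr_sqrt by nra. unfold Rsqr.
 generalize (Rabs_pos x) (Rabs_pos y) (pow2_abs x) (pow2_abs y). nra.
Qed.

Lemma Cmod_sub_sym (x y : C) : Cmod (x - y) = Cmod (y - x).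
Proof. rewrite <- Cmod_opp. f_equal. ring. Qed.

Lemma Cmod_sub_diag (x : C) : Cmod (x - x) = 0.
Proof. rewrite <- Cmod_0. f_equal. ring. Qed.

Lemma Cmod_triangle_sub (x y z : C) : Cmod (x - z) <= Cmod (x - y) + Cmod (y - z).
Proof. replace (x - z)%C with ((x - y) + (y - z))%C by ring. apply Cmod_triangle. Qed.

Lemma Cmod_triangle_minus (x y : C) : Cmod (x - y) <= Cmod x + Cmod y.
Proof. rewrite <- (Cmod_opp y). apply Cmod_triangle. Qed.

Lemma Cmod_reverse (x y : C) : Cmod x - Cmod y <= Cmod (x - y).
Proof.
 assert (H := Cmod_triangle (x - y) y). replace (x - y + y)%C with x in H by ring. lra.
Qed.

Lemma Rabs_Cmod_sub (x y : C) : Rabs (Cmod x - Cmod y) <= Cmod (x - y).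
Proof. apply Rabs_le. generalize (Cmod_reverse x y) (Cmod_reverse y x). rewrite (Cmod_sub_sym y x). lra. Qed.

Lemma Cmod2_Re_Im (z : C) : Cmod z * Cmod z = Re z * Re z + Im z * Im z.
Proof. generalize (Cmod2_alt z). simpl. lra. Qed.

Lemma Csub_neq_0 (x y : C) : x <> y -> (x - y)%C <> 0%C.
Proof.
 intros H E; apply H. replace x with ((x - y) + y)%C by ring. rewrite E. ring.
Qed.

Lemma C_eq (x y : C) : Re x = Re y -> Im x = Im y -> x = y.
Proof. destruct x, y; unfold Re, Im; simpl; congruence. Qed.

(** * Holomorphic functions *)

(* Holomorphy near [c], with the remainder of the first order expansion
   uniformly quadratic; this forces the derivative [d] to be Lipschitz. *)
Definition hol_with (f d : C -> C) (c : C) (r M : R) : Prop :=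
 0 < r /\ 0 <= M /\
 forall x y, Cmod (x - c) < r -> Cmod (y - c) < r ->
  Cmod (f y - f x - (y - x) * d x) <= M * (Cmod (y - x) * Cmod (y - x)).

Definition hol (f : C -> C) (c : C) : Prop := exists d r M, hol_with f d c r M.

Lemma hol_with_near f d c r M : hol_with f d c r M ->
 forall z, Cmod (z - c) < r -> hol_with f d z (r - Cmod (z - c)) M.
Proof.
 intros (Hr & HM & H) z Hz. split; [lra | split; [assumption |]]. intros x y Hx Hy. apply H.
 - generalize (Cmod_triangle_sub x z c). lra.
 - generalize (Cmod_triangle_sub y z c). lra.
Qed.

Lemma hol_near f c : hol f c -> exists r, 0 < r /\ forall z, Cmod (z - c) < r -> hol f z.
Proof.
 intros (d & r & M & H). exists r. split; [apply H |].
 intros z Hz. exists d, (r - Cmod (z - c)), M. apply hol_with_near; assumption.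
Qed.

(** Adding the expansions from x to c and from c to x cancels the values of [f] and leaves (x - c)
    (d x - d c), so [d] moves by at most 2 M |x - c|. *)
Lemma hol_with_deriv_bound f d c r M : hol_with f d c r M ->
 forall x, Cmod (x - c) < r -> Cmod (d x) <= Cmod (d c) + 2 * M * r.
Proof.
 intros (Hr & HM & H) x Hx. destruct (Ceq_dec x c) as [-> | Hne].
 - assert (0 <= M * r) by nra. lra.
 - assert (Hc : Cmod (c - c) < r).
  { rewrite Cmod_sub_diag. exact Hr. }
  assert (H1 := H x c Hx Hc). assert (H2 := H c x Hc Hx).
  assert (Hp : 0 < Cmod (x - c)) by (apply Cmod_gt_0, Csub_neq_0, Hne). rewrite (Cmod_sub_sym c x) in H1.
  assert (H3 : Cmod ((x - c) * (d x - d c)) <= 2 * (M * (Cmod (x - c) * Cmod (x - c)))).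
  { replace ((x - c) * (d x - d c))%C
    with ((f c - f x - (c - x) * d x) + (f x - f c - (x - c) * d c))%C by ring.
   eapply Rle_trans; [apply Cmod_triangle |]. lra. }
  rewrite Cmod_mult in H3. assert (H4 : Cmod (d x - d c) <= 2 * M * Cmod (x - c)).
  { apply Rmult_le_reg_l with (Cmod (x - c)); lra. }
  assert (M * Cmod (x - c) <= M * r) by (apply Rmult_le_compat_l; lra). generalize (Cmod_reverse (d x) (d c)). lra.
Qed.

Lemma hol_with_lip f d c r M : hol_with f d c r M ->
 forall x y, Cmod (x - c) < r -> Cmod (y - c) < r ->
 Cmod (f y - f x) <= (Cmod (d c) + 4 * M * r) * Cmod (y - x).
Proof.
 intros Hh x y Hx Hy. assert (Hb := hol_with_deriv_bound f d c r M Hh x Hx).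
 destruct Hh as (Hr & HM & H). assert (H1 := H x y Hx Hy).
 replace (f y - f x)%C with ((f y - f x - (y - x) * d x) + (y - x) * d x)%C by ring.
 eapply Rle_trans; [apply Cmod_triangle |]. rewrite Cmod_mult. assert (Hyx : Cmod (y - x) <= 2 * r).
 { generalize (Cmod_triangle_sub y c x). rewrite (Cmod_sub_sym c x). lra. }
 generalize (Cmod_ge_0 (y - x)). intros Hp. assert (M * (Cmod (y - x) * Cmod (y - x)) <= M * (2 * r * Cmod (y - x))).
 { apply Rmult_le_compat_l; [exact HM |]. apply Rmult_le_compat_r; assumption. }
 nra.
Qed.

Lemma hol_lip f c : hol f c -> exists r L, 0 < r /\ 0 <= L /\
 forall x y, Cmod (x - c) < r -> Cmod (y - c) < r ->
 Cmod (f y - f x) <= L * Cmod (y - x).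
Proof.
 intros (d & r & M & H). exists r, (Cmod (d c) + 4 * M * r).
 generalize (Cmod_ge_0 (d c)). destruct H as (Hr & HM & H0). repeat split; [assumption | nra |].
 apply hol_with_lip. repeat split; assumption.
Qed.

Definition ccont_at (f : C -> C) (c : C) : Prop :=
 forall eps, 0 < eps -> exists r, 0 < r /\
  forall z, Cmod (z - c) < r -> Cmod (f z - f c) < eps.

Lemma hol_ccont f c : hol f c -> ccont_at f c.
Proof.
 intros H eps He. destruct (hol_lip f c H) as (r & L & Hr & HL & Hl). exists (Rmin r (eps / (L + 1))). split.
 - apply Rmin_pos; [assumption | apply Rdiv_lt_0_compat; lra].
 - intros z Hz. destruct (Rmin_bounds r (eps / (L + 1))) as [H1 H2]. assert (Hcc : Cmod (c - c) < r).
  { rewrite Cmod_sub_diag. exact Hr. }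
  eapply Rle_lt_trans; [apply (Hl c z); [exact Hcc | lra] |]. assert (Hlt : Cmod (z - c) < eps / (L + 1)) by lra.
  apply Rlt_div_r in Hlt; [| lra]. generalize (Cmod_ge_0 (z - c)). nra.
Qed.

Lemma hol_const k c : hol (fun _ => k) c.
Proof.
 exists (fun _ => RtoC 0), 1, 0. repeat split; [lra | lra |].
 intros x y _ _. replace (k - k - (y - x) * 0)%C with (RtoC 0) by ring. rewrite Cmod_0. lra.
Qed.

Lemma hol_id c : hol (fun z => z) c.
Proof.
 exists (fun _ => RtoC 1), 1, 0. repeat split; [lra | lra |].
 intros x y _ _. replace (y - x - (y - x) * 1)%C with (RtoC 0) by ring. rewrite Cmod_0. lra.
Qed.

Lemma hol_ext_loc f g c r : 0 < r -> (forall z, Cmod (z - c) < r -> f z = g z) -> hol f c -> hol g c.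
Proof.
 intros Hr He (d & r1 & M & Hr1 & HM & H).
 exists d, (Rmin r r1), M. repeat split; [apply Rmin_pos; assumption | assumption |].
 intros x y Hx Hy. destruct (Rmin_bounds r r1) as [H1 H2]. rewrite <- !He by lra. apply H; lra.
Qed.

Lemma hol_plus f g c : hol f c -> hol g c -> hol (fun z => f z + g z)%C c.
Proof.
 intros (d1 & r1 & M1 & Hr1 & HM1 & H1) (d2 & r2 & M2 & Hr2 & HM2 & H2).
 exists (fun z => d1 z + d2 z)%C, (Rmin r1 r2), (M1 + M2). repeat split; [apply Rmin_pos; assumption | lra |].
 intros x y Hx Hy. destruct (Rmin_bounds r1 r2) as [Hm1 Hm2].
 replace (f y + g y - (f x + g x) - (y - x) * (d1 x + d2 x))%C
  with ((f y - f x - (y - x) * d1 x) + (g y - g x - (y - x) * d2 x))%C by ring.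
 eapply Rle_trans; [apply Cmod_triangle |].
 assert (A := H1 x y ltac:(lra) ltac:(lra)). assert (B := H2 x y ltac:(lra) ltac:(lra)). lra.
Qed.

Lemma hol_mult f g c : hol f c -> hol g c -> hol (fun z => f z * g z)%C c.
Proof.
 intros (d1 & r1 & M1 & Hf) (d2 & r2 & M2 & Hg). set (r := Rmin r1 r2).
 destruct (Rmin_bounds r1 r2) as [Hm1 Hm2]. fold r in Hm1, Hm2.
 assert (Hr : 0 < r) by (apply Rmin_pos; [apply Hf | apply Hg]).
 set (L1 := Cmod (d1 c) + 4 * M1 * r1). set (L2 := Cmod (d2 c) + 4 * M2 * r2).
 set (B1 := Cmod (f c) + L1 * r). set (B2 := Cmod (g c) + L2 * r).
 assert (Hlf := hol_with_lip _ _ _ _ _ Hf). assert (Hlg := hol_with_lip _ _ _ _ _ Hg). fold L1 in Hlf. fold L2 in Hlg.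
 destruct Hf as (Hr1 & HM1 & Hf). destruct Hg as (Hr2 & HM2 & Hg).
 assert (HL1 : 0 <= L1) by (unfold L1; generalize (Cmod_ge_0 (d1 c)); nra).
 assert (HL2 : 0 <= L2) by (unfold L2; generalize (Cmod_ge_0 (d2 c)); nra).
 assert (Hcc : forall s, 0 < s -> Cmod (c - c) < s).
 { intros s Hs. rewrite Cmod_sub_diag. exact Hs. }
 assert (Hbf : forall x, Cmod (x - c) < r -> Cmod (f x) <= B1).
 { intros x Hx. assert (A := Hlf c x (Hcc _ Hr1) ltac:(lra)). generalize (Cmod_reverse (f x) (f c)). unfold B1.
  assert (L1 * Cmod (x - c) <= L1 * r) by (apply Rmult_le_compat_l; lra). lra. }
 assert (Hbg : forall x, Cmod (x - c) < r -> Cmod (g x) <= B2).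
 { intros x Hx. assert (A := Hlg c x (Hcc _ Hr2) ltac:(lra)). generalize (Cmod_reverse (g x) (g c)). unfold B2.
  assert (L2 * Cmod (x - c) <= L2 * r) by (apply Rmult_le_compat_l; lra). lra. }
 assert (HB1 : 0 <= B1) by (unfold B1; generalize (Cmod_ge_0 (f c)); nra).
 assert (HB2 : 0 <= B2) by (unfold B2; generalize (Cmod_ge_0 (g c)); nra).
 (* The constant collects, in order, the remainder of [f] times a bound for [g], a bound for [f]
    times the remainder of [g], and the product of the two increments. *)
 exists (fun z => d1 z * g z + f z * d2 z)%C, r, (M1 * B2 + B1 * M2 + L1 * L2). repeat split; [assumption | nra |].
 intros x y Hx Hy. replace (f y * g y - f x * g x - (y - x) * (d1 x * g x + f x * d2 x))%C
  with ((f y - f x - (y - x) * d1 x) * g x + f x * (g y - g x - (y - x) * d2 x)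
     + (f y - f x) * (g y - g x))%C by ring.
 eapply Rle_trans; [apply Cmod_triangle |]. eapply Rle_trans; [apply Rplus_le_compat_r, Cmod_triangle |].
 rewrite !Cmod_mult. assert (A1 := Hf x y ltac:(lra) ltac:(lra)). assert (A2 := Hg x y ltac:(lra) ltac:(lra)).
 assert (A3 := Hlf x y ltac:(lra) ltac:(lra)). assert (A4 := Hlg x y ltac:(lra) ltac:(lra)).
 assert (A5 := Hbf x Hx). assert (A6 := Hbg x Hx). set (D := Cmod (y - x)) in *.
 assert (T1 := Rmult_le_compat _ _ _ _ (Cmod_ge_0 _) (Cmod_ge_0 _) A1 A6).
 assert (T2 := Rmult_le_compat _ _ _ _ (Cmod_ge_0 _) (Cmod_ge_0 _) A5 A2).
 assert (T3 := Rmult_le_compat _ _ _ _ (Cmod_ge_0 _) (Cmod_ge_0 _) A3 A4). nra.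
Qed.

Lemma hol_with_inv c : c <> RtoC 0 ->
 exists r M, hol_with (fun z => / z)%C (fun z => - (/ z * / z))%C c r M.
Proof.
 intros Hc. assert (Hp : 0 < Cmod c) by (apply Cmod_gt_0, Hc). set (k := Cmod c / 2). exists k, (/ (k * k * k)).
 assert (Hk : 0 < k) by (unfold k; lra). assert (Ek : Cmod c = 2 * k) by (unfold k; lra). clearbody k.
 repeat split; [assumption | left; apply Rinv_0_lt_compat; repeat apply Rmult_lt_0_compat; assumption |].
 intros x y Hx Hy. assert (Kx : k <= Cmod x).
 { generalize (Cmod_reverse c x). rewrite Cmod_sub_sym. lra. }
 assert (Ky : k <= Cmod y).
 { generalize (Cmod_reverse c y). rewrite Cmod_sub_sym. lra. }
 assert (Hx0 : x <> RtoC 0) by (apply Cmod_gt_0; lra). assert (Hy0 : y <> RtoC 0) by (apply Cmod_gt_0; lra).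
 replace (/ y - / x - (y - x) * - (/ x * / x))%C
  with ((y - x) * (y - x) * (/ x * / x * / y))%C by (field; split; assumption).
 rewrite !Cmod_mult, !Cmod_inv by assumption. rewrite (Rmult_comm (/ (k * k * k))). apply Rmult_le_compat_l.
 - generalize (Cmod_ge_0 (y - x)); nra.
 - rewrite <- !Rinv_mult. apply Rinv_le_contravar; [repeat apply Rmult_lt_0_compat; assumption |].
  repeat apply Rmult_le_compat; try lra. apply Rmult_le_pos; lra.
Qed.

Lemma hol_inv_pt c : c <> RtoC 0 -> hol (fun z => / z)%C c.
Proof. intros Hc. eexists. apply hol_with_inv, Hc. Qed.

Lemma hol_comp f g c : hol f c -> hol g (f c) -> hol (fun z => g (f z)) c.
Proof.
 intros Hf (d2 & r2 & M2 & Hg). destruct (hol_ccont f c Hf r2) as (r3 & Hr3 & Hc3); [apply Hg |].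
 destruct Hf as (d1 & r1 & M1 & Hf). assert (Hlf := hol_with_lip _ _ _ _ _ Hf).
 assert (Hbg := hol_with_deriv_bound _ _ _ _ _ Hg). set (L1 := Cmod (d1 c) + 4 * M1 * r1) in *.
 set (B2 := Cmod (d2 (f c)) + 2 * M2 * r2) in *. destruct Hf as (Hr1 & HM1 & Hf). destruct Hg as (Hr2 & HM2 & Hg).
 assert (HB2 : 0 <= B2) by (unfold B2; generalize (Cmod_ge_0 (d2 (f c))); nra).
 exists (fun z => d2 (f z) * d1 z)%C, (Rmin r1 r3), (M2 * (L1 * L1) + B2 * M1).
 repeat split; [apply Rmin_pos; assumption | nra |]. intros x y Hx Hy. destruct (Rmin_bounds r1 r3) as [Hm1 Hm3].
 assert (Ex := Hc3 x ltac:(lra)). assert (Ey := Hc3 y ltac:(lra)).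
 replace (g (f y) - g (f x) - (y - x) * (d2 (f x) * d1 x))%C
  with ((g (f y) - g (f x) - (f y - f x) * d2 (f x)) + d2 (f x) * (f y - f x - (y - x) * d1 x))%C by ring.
 eapply Rle_trans; [apply Cmod_triangle |]. rewrite Cmod_mult.
 assert (A1 := Hg _ _ Ex Ey). assert (A2 := Hf x y ltac:(lra) ltac:(lra)).
 assert (A3 := Hlf x y ltac:(lra) ltac:(lra)). assert (A4 := Hbg _ Ex).
 assert (T1 := Rmult_le_compat _ _ _ _ (Cmod_ge_0 _) (Cmod_ge_0 _) A3 A3).
 assert (T2 := Rmult_le_compat _ _ _ _ (Cmod_ge_0 _) (Cmod_ge_0 _) A4 A2).
 apply Rmult_le_compat_l with (r := M2) in T1; [| assumption]. nra.
Qed.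

Lemma hol_inv f c : hol f c -> f c <> RtoC 0 -> hol (fun z => / f z)%C c.
Proof. intros Hf H0. apply (hol_comp f (fun z => / z)%C); [assumption | apply hol_inv_pt, H0]. Qed.

Lemma hol_opp f c : hol f c -> hol (fun z => - f z)%C c.
Proof.
 intros H. apply hol_ext_loc with (fun z => RtoC (-1) * f z)%C 1; [lra | |].
 - intros z _. ring.
 - apply hol_mult; [apply hol_const | exact H].
Qed.

Lemma hol_minus f g c : hol f c -> hol g c -> hol (fun z => f z - g z)%C c.
Proof. intros Hf Hg. apply hol_plus; [exact Hf | apply hol_opp, Hg]. Qed.

Lemma hol_div f g c : hol f c -> hol g c -> g c <> RtoC 0 -> hol (fun z => f z / g z)%C c.
Proof. intros Hf Hg H0. apply hol_mult; [exact Hf | apply hol_inv; assumption]. Qed.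

Lemma hol_pow f c n : hol f c -> hol (fun z => f z ^ n)%C c.
Proof.
 intros H. induction n as [| n IH]; simpl.
 - apply hol_const.
 - apply (hol_mult f (fun z => f z ^ n)%C); assumption.
Qed.

Lemma hol_is_derive f c : hol f c -> @ex_derive C_AbsRing C_NormedModule f c.
Proof.
 intros (d & r & M & Hr & HM & H). exists (d c). split.
 - apply (@is_linear_scal_l C_AbsRing C_NormedModule).
 - intros x Hx eps. apply (@is_filter_lim_locally_unique C_AbsRing (AbsRing_NormedModule C_AbsRing)) in Hx.
  rewrite <- Hx. clear x Hx. assert (He : 0 < Rmin r (eps / (M + 1))).
  { apply Rmin_pos; [assumption | apply Rdiv_lt_0_compat; [apply eps | lra]]. }
  apply (@locally_le_locally_norm C_AbsRing (AbsRing_NormedModule C_AbsRing)). exists (mkposreal _ He). intros y Hy.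
  change (Cmod (y - c) < Rmin r (eps / (M + 1))) in Hy.
  change (Cmod ((f y - f c) - (y - c) * d c) <= eps * Cmod (y - c)).
  destruct (Rmin_bounds r (eps / (M + 1))) as [H1 H2]. assert (Hcc : Cmod (c - c) < r).
  { rewrite Cmod_sub_diag. exact Hr. }
  eapply Rle_trans; [apply (H c y Hcc); lra |]. rewrite <- Rmult_assoc. apply Rmult_le_compat_r; [apply Cmod_ge_0 |].
  assert (Hlt : Cmod (y - c) < eps / (M + 1)) by lra. apply Rlt_div_r in Hlt; [| lra].
  generalize (Cmod_ge_0 (y - c)). nra.
Qed.

(** * Curves in the complex plane *)

(** Continuity is asked on the whole line, so that integrals and compositions carry no side
    conditions; solutions are extended beyond their time interval by clamping. *)
Definition cvcont (phi : R -> C) : Prop :=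
 forall t, continuous (fun s => Re (phi s)) t /\ continuous (fun s => Im (phi s)) t.

Lemma continuous_eps (f : R -> R) t : continuous f t <->
 forall eps, 0 < eps -> exists d, 0 < d /\ forall s, Rabs (s - t) < d -> Rabs (f s - f t) < eps.
Proof.
 split.
 - intros H eps He. apply filterlim_locally with (eps := mkposreal eps He) in H.
  destruct H as [d Hd]. exists d. split; [apply d |]. intros s Hs. apply (Hd s), Hs.
 - intros H. apply filterlim_locally. intros eps. destruct (H eps (cond_pos eps)) as (d & Hd & Hs).
  exists (mkposreal d Hd). intros s H1. apply Hs, H1.
Qed.

Lemma cvcont_eps phi : cvcont phi <->
 forall t eps, 0 < eps -> exists d, 0 < d /\ forall s, Rabs (s - t) < d -> Cmod (phi s - phi t) < eps.
Proof.
 split.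
 - intros H t eps He. destruct (H t) as [H1 H2].
  destruct (proj1 (continuous_eps _ _) H1 (eps / 2) ltac:(lra)) as (d1 & Hd1 & K1).
  destruct (proj1 (continuous_eps _ _) H2 (eps / 2) ltac:(lra)) as (d2 & Hd2 & K2).
  exists (Rmin d1 d2). split; [pos |]. intros s Hs. destruct (Rmin_bounds d1 d2) as [Hm1 Hm2].
  eapply Rle_lt_trans; [apply Cmod_le_Re_Im |]. assert (A := K1 s ltac:(lra)). assert (B := K2 s ltac:(lra)).
  change (Rabs (Re (phi s) - Re (phi t)) + Rabs (Im (phi s) - Im (phi t)) < eps). lra.
 - intros H t; split; apply continuous_eps; intros eps He;
   destruct (H t eps He) as (d & Hd & K); exists d; (split; [lra |]); intros s Hs;
   (eapply Rle_lt_trans; [| apply (K s Hs)]).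
  + eapply Rle_trans; [| apply re_le_Cmod]. right. reflexivity.
  + eapply Rle_trans; [| apply Im_le_Cmod]. right. reflexivity.
Qed.

Lemma cvcont_const k : cvcont (fun _ => k).
Proof. intros t; split; apply continuous_const. Qed.

Lemma cvcont_plus f g : cvcont f -> cvcont g -> cvcont (fun t => f t + g t)%C.
Proof.
 intros Hf Hg t. destruct (Hf t), (Hg t). split; apply (continuous_plus (V := R_NormedModule)); assumption.
Qed.

Lemma cvcont_opp f : cvcont f -> cvcont (fun t => - f t)%C.
Proof. intros Hf t. destruct (Hf t). split; apply (continuous_opp (V := R_NormedModule)); assumption. Qed.

Lemma cvcont_minus f g : cvcont f -> cvcont g -> cvcont (fun t => f t - g t)%C.
Proof. intros Hf Hg. apply cvcont_plus; [pos | apply cvcont_opp, Hg]. Qed.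

Lemma cvcont_mult f g : cvcont f -> cvcont g -> cvcont (fun t => f t * g t)%C.
Proof.
 intros Hf Hg t. destruct (Hf t) as [F1 F2], (Hg t) as [G1 G2]. split.
 - apply (continuous_minus (V := R_NormedModule) (fun s => Re (f s) * Re (g s)) (fun s => Im (f s) * Im (g s)));
   apply (continuous_mult (K := R_AbsRing)); assumption.
 - apply (continuous_plus (V := R_NormedModule) (fun s => Re (f s) * Im (g s)) (fun s => Im (f s) * Re (g s)));
   apply (continuous_mult (K := R_AbsRing)); assumption.
Qed.

Lemma cvcont_RtoC (f : R -> R) : (forall t, continuous f t) -> cvcont (fun t => RtoC (f t)).
Proof. intros H t; split; [apply H | apply continuous_const]. Qed.

Lemma cvcont_comp f (phi : R -> C) : cvcont phi -> (forall t, ccont_at f (phi t)) -> cvcont (fun t => f (phi t)).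
Proof.
 intros H Hf. apply cvcont_eps. intros t eps He. destruct (Hf t eps He) as (r & Hr & K).
 destruct (proj1 (cvcont_eps phi) H t r Hr) as (d & Hd & K2). exists d. split; [lra |]. intros s Hs. apply K, K2, Hs.
Qed.

Lemma cvcont_pow f n : cvcont f -> cvcont (fun t => f t ^ n)%C.
Proof.
 intros H. apply (cvcont_comp (fun z => z ^ n)%C f H). intros t. apply hol_ccont, (hol_pow (fun z => z)), hol_id.
Qed.

Lemma continuous_Cmod f t : cvcont f -> continuous (fun s => Cmod (f s)) t.
Proof.
 intros H. apply continuous_eps. intros eps He.
 destruct (proj1 (cvcont_eps f) H t eps He) as (d & Hd & K). exists d. split; [lra |].
 intros s Hs. eapply Rle_lt_trans; [apply Rabs_Cmod_sub | apply (K s Hs)].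
Qed.

Definition cder (phi : R -> C) (t : R) (v : C) : Prop :=
 is_derive (fun s => Re (phi s)) t (Re v) /\ is_derive (fun s => Im (phi s)) t (Im v).

Lemma is_derive_eps (f : R -> R) t v : is_derive f t v <->
 forall eps, 0 < eps -> exists d, 0 < d /\
  forall s, Rabs (s - t) < d -> Rabs (f s - f t - (s - t) * v) <= eps * Rabs (s - t).
Proof.
 split.
 - intros [_ H] eps He. destruct (H t (fun P HP => HP) (mkposreal eps He)) as [d Hd].
  exists d. split; [apply d |]. intros s Hs. apply (Hd s), Hs.
 - intros H. split; [apply is_linear_scal_l |]. intros x Hx eps.
  apply (@is_filter_lim_locally_unique R_AbsRing (AbsRing_NormedModule R_AbsRing)) in Hx. rewrite <- Hx.
  destruct (H eps (cond_pos eps)) as (d & Hd & K). exists (mkposreal d Hd). intros s Hs. apply (K s), Hs.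
Qed.

Lemma cder_eps phi t v : cder phi t v <->
 forall eps, 0 < eps -> exists d, 0 < d /\
  forall s, Rabs (s - t) < d -> Cmod (phi s - phi t - RtoC (s - t) * v) <= eps * Rabs (s - t).
Proof.
 assert (E1 : forall s, Re (phi s - phi t - RtoC (s - t) * v) = Re (phi s) - Re (phi t) - (s - t) * Re v).
 { intros s. unfold Re, Im. simpl. ring. }
 assert (E2 : forall s, Im (phi s - phi t - RtoC (s - t) * v) = Im (phi s) - Im (phi t) - (s - t) * Im v).
 { intros s. unfold Re, Im. simpl. ring. }
 split.
 - intros [H1 H2] eps He. destruct (proj1 (is_derive_eps _ _ _) H1 (eps / 2) ltac:(lra)) as (d1 & Hd1 & K1).
  destruct (proj1 (is_derive_eps _ _ _) H2 (eps / 2) ltac:(lra)) as (d2 & Hd2 & K2).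
  exists (Rmin d1 d2). split; [pos |]. intros s Hs. destruct (Rmin_bounds d1 d2) as [Hm1 Hm2].
  eapply Rle_trans; [apply Cmod_le_Re_Im |]. rewrite E1, E2.
  assert (A := K1 s ltac:(lra)). assert (B := K2 s ltac:(lra)). lra.
 - intros H; split; apply is_derive_eps; intros eps He;
   destruct (H eps He) as (d & Hd & K); exists d; (split; [lra |]); intros s Hs;
   (eapply Rle_trans; [| apply (K s Hs)]).
  + rewrite <- E1. apply re_le_Cmod.
  + rewrite <- E2. apply Im_le_Cmod.
Qed.

Lemma cder_comp f d c r M phi t v : hol_with f d c r M -> Cmod (phi t - c) < r ->
 cder phi t v -> cder (fun s => f (phi s)) t (d (phi t) * v)%C.
Proof.
 intros Hh Hc H. apply cder_eps. intros eps He. assert (Hn := hol_with_near f d c r M Hh (phi t) Hc).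
 set (r' := r - Cmod (phi t - c)) in *. destruct Hn as (Hr' & HM & K).
 set (D := Cmod (d (phi t))). assert (HD : 0 <= D) by apply Cmod_ge_0.
 set (V := Cmod v). assert (HV : 0 <= V) by apply Cmod_ge_0. set (e1 := eps / (2 * (D + 1))).
 assert (He1 : 0 < e1) by (apply Rdiv_lt_0_compat; lra).
 destruct (proj1 (cder_eps _ _ _) H (Rmin 1 e1) ltac:(apply Rmin_pos; lra)) as (d1 & Hd1 & K1).
 set (d2 := Rmin (r' / (V + 1)) (eps / (2 * (M + 1) * ((V + 1) * (V + 1))))). assert (Hd2 : 0 < d2).
 { apply Rmin_pos; apply Rdiv_lt_0_compat; try lra. apply Rmult_lt_0_compat; nra. }
 exists (Rmin d1 d2). split; [pos |]. intros s Hs. destruct (Rmin_bounds d1 d2) as [Hm1 Hm2].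
 assert (Hm3 := Rmin_l (r' / (V + 1)) (eps / (2 * (M + 1) * ((V + 1) * (V + 1))))). fold d2 in Hm3.
 assert (Hm4 := Rmin_r (r' / (V + 1)) (eps / (2 * (M + 1) * ((V + 1) * (V + 1))))). fold d2 in Hm4.
 destruct (Rmin_bounds 1 e1) as [Hm5 Hm6]. assert (A := K1 s ltac:(lra)).
 set (h := Rabs (s - t)) in *. assert (Hh0 : 0 <= h) by apply Rabs_pos.
 assert (B : Cmod (phi s - phi t) <= (V + 1) * h).
 { replace (phi s - phi t)%C with ((phi s - phi t - RtoC (s - t) * v) + RtoC (s - t) * v)%C by ring.
  eapply Rle_trans; [apply Cmod_triangle |]. rewrite Cmod_mult, Cmod_R. fold h V. nra. }
 assert (Hlt : h < r' / (V + 1)) by lra. apply Rmult_lt_compat_r with (r := V + 1) in Hlt; [| lra].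
 replace (r' / (V + 1) * (V + 1)) with r' in Hlt by (field; lra). assert (Hpt : Cmod (phi t - phi t) < r').
 { rewrite Cmod_sub_diag. exact Hr'. }
 assert (Cq := K (phi t) (phi s) Hpt ltac:(lra)). replace (f (phi s) - f (phi t) - RtoC (s - t) * (d (phi t) * v))%C
  with ((f (phi s) - f (phi t) - (phi s - phi t) * d (phi t))
     + d (phi t) * (phi s - phi t - RtoC (s - t) * v))%C by ring.
 eapply Rle_trans; [apply Cmod_triangle |]. rewrite Cmod_mult. fold D.
 assert (Hlt2 : h * (2 * (M + 1) * ((V + 1) * (V + 1))) <= eps).
 { apply Rle_trans with (eps / (2 * (M + 1) * ((V + 1) * (V + 1))) * (2 * (M + 1) * ((V + 1) * (V + 1)))).
  - apply Rmult_le_compat_r; [| lra]. apply Rmult_le_pos; nra.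
  - right. field. lra. }
 assert (P1 : M * (Cmod (phi s - phi t) * Cmod (phi s - phi t)) <= eps / 2 * h).
 { apply Rle_trans with (M * (((V + 1) * h) * ((V + 1) * h))).
  - apply Rmult_le_compat_l; [lra |]. apply Rmult_le_compat; try apply Cmod_ge_0; exact B.
  - nra. }
 assert (P2 : D * Cmod (phi s - phi t - RtoC (s - t) * v) <= eps / 2 * h).
 { apply Rle_trans with (D * (e1 * h)).
  - apply Rmult_le_compat_l; [lra |]. eapply Rle_trans; [exact A |]. apply Rmult_le_compat_r; [lra | lra].
  - rewrite <- Rmult_assoc. apply Rmult_le_compat_r; [lra |].
   apply Rle_trans with ((D + 1) * e1); [nra |]. right. unfold e1. field. lra. }
 lra.
Qed.

Lemma cder_const k t : cder (fun _ => k) t 0%C.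
Proof. split; apply @is_derive_const. Qed.

Lemma cder_plus f g t u v : cder f t u -> cder g t v -> cder (fun s => f s + g s)%C t (u + v)%C.
Proof. intros [F1 F2] [G1 G2]; split; apply @is_derive_plus; assumption. Qed.

Lemma cder_opp f t u : cder f t u -> cder (fun s => - f s)%C t (- u)%C.
Proof. intros [F1 F2]; split; apply (@is_derive_opp R_AbsRing R_NormedModule); assumption. Qed.

Lemma cder_minus f g t u v : cder f t u -> cder g t v -> cder (fun s => f s - g s)%C t (u - v)%C.
Proof. intros. apply cder_plus; [pos | apply cder_opp; assumption]. Qed.

Lemma is_derive_Rmult (f g : R -> R) t u v : is_derive f t u -> is_derive g t v ->
 is_derive (fun s => f s * g s) t (u * g t + f t * v).
Proof. intros Hf Hg. exact (is_derive_mult f g t u v Hf Hg Rmult_comm). Qed.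

Lemma is_derive_Rplus (f g : R -> R) t u v : is_derive f t u -> is_derive g t v ->
 is_derive (fun s => f s + g s) t (u + v).
Proof. intros Hf Hg. exact (is_derive_plus f g t u v Hf Hg). Qed.

Lemma is_derive_Rminus (f g : R -> R) t u v : is_derive f t u -> is_derive g t v ->
 is_derive (fun s => f s - g s) t (u - v).
Proof. intros Hf Hg. exact (is_derive_minus f g t u v Hf Hg). Qed.

Lemma is_derive_eq (f : R -> R) (t u v : R) : is_derive f t u -> u = v -> is_derive f t v.
Proof. intros H <-. exact H. Qed.

Lemma cder_mult f g t u v : cder f t u -> cder g t v -> cder (fun s => f s * g s)%C t (u * g t + f t * v)%C.
Proof.
 intros [F1 F2] [G1 G2]. split.
 - eapply is_derive_eq.
  + exact (is_derive_Rminus _ _ _ _ _ (is_derive_Rmult _ _ _ _ _ F1 G1) (is_derive_Rmult _ _ _ _ _ F2 G2)).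
  + unfold Re, Im. simpl. ring.
 - eapply is_derive_eq.
  + exact (is_derive_Rplus _ _ _ _ _ (is_derive_Rmult _ _ _ _ _ F1 G2) (is_derive_Rmult _ _ _ _ _ F2 G1)).
  + unfold Re, Im. simpl. ring.
Qed.

Lemma cder_ext f g t u : (forall s, f s = g s) -> cder f t u -> cder g t u.
Proof.
 intros E [H1 H2]. split; [revert H1 | revert H2]; apply is_derive_ext; intros s; rewrite E; reflexivity.
Qed.

Lemma cder_id t : cder (fun s => s) t 1%C.
Proof. split; [exact (is_derive_id t) | exact (is_derive_const 0 t)]. Qed.

(** * Integrals along curves and the Cauchy formula *)

Definition CInt (phi : R -> C) (a b : R) : C :=
 (RInt (fun t => Re (phi t)) a b, RInt (fun t => Im (phi t)) a b).

Lemma cvcont_ex_RInt phi a b : cvcont phi ->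
 ex_RInt (fun t => Re (phi t)) a b /\ ex_RInt (fun t => Im (phi t)) a b.
Proof. intros H. split; apply @ex_RInt_continuous; intros t _; apply H. Qed.

Lemma CInt_ext f g a b : a <= b -> (forall t, a <= t <= b -> f t = g t) -> CInt f a b = CInt g a b.
Proof.
 intros Hab H. unfold CInt. f_equal; apply RInt_ext; intros t;
  rewrite Rmin_left, Rmax_right by assumption; intros Ht; rewrite H; lra || reflexivity.
Qed.

Lemma CInt_plus f g a b : cvcont f -> cvcont g -> CInt (fun t => f t + g t)%C a b = (CInt f a b + CInt g a b)%C.
Proof.
 intros Hf Hg. destruct (cvcont_ex_RInt f a b Hf), (cvcont_ex_RInt g a b Hg).
 apply C_eq; simpl; apply (RInt_plus (V := R_CompleteNormedModule)); assumption.
Qed.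

Lemma RInt_lin (f g : R -> R) u v a b : ex_RInt f a b -> ex_RInt g a b ->
 RInt (fun t => u * f t + v * g t) a b = u * RInt f a b + v * RInt g a b.
Proof.
 intros Hf Hg. apply is_RInt_unique. apply (is_RInt_plus (V := R_NormedModule) (fun t => u * f t) (fun t => v * g t));
  apply (is_RInt_scal (V := R_NormedModule));
  apply (RInt_correct (V := R_CompleteNormedModule)); assumption.
Qed.

Lemma CInt_scal k f a b : cvcont f -> CInt (fun t => k * f t)%C a b = (k * CInt f a b)%C.
Proof.
 intros Hf. destruct (cvcont_ex_RInt f a b Hf) as [H1 H2]. apply C_eq; simpl.
 - transitivity (Re k * RInt (fun t => Re (f t)) a b + - Im k * RInt (fun t => Im (f t)) a b).
  + rewrite <- RInt_lin by assumption. apply RInt_ext. intros; unfold Re, Im; simpl; ring.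
  + unfold Re, Im; simpl; ring.
 - transitivity (Re k * RInt (fun t => Im (f t)) a b + Im k * RInt (fun t => Re (f t)) a b).
  + rewrite <- RInt_lin by assumption. apply RInt_ext. intros; unfold Re, Im; simpl; ring.
  + unfold Re, Im; simpl; ring.
Qed.

Lemma CInt_minus f g a b : cvcont f -> cvcont g -> CInt (fun t => f t - g t)%C a b = (CInt f a b - CInt g a b)%C.
Proof.
 intros Hf Hg. destruct (cvcont_ex_RInt f a b Hf), (cvcont_ex_RInt g a b Hg).
 apply C_eq; simpl; apply (RInt_minus (V := R_CompleteNormedModule)); assumption.
Qed.

(** The factor 2 is the price of bounding the real and imaginary parts separately. *)
Lemma CInt_bound f a b M : a <= b -> cvcont f -> (forall t, a <= t <= b -> Cmod (f t) <= M) ->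
 Cmod (CInt f a b) <= 2 * M * (b - a).
Proof.
 intros Hab Hf H. destruct (cvcont_ex_RInt f a b Hf) as [E1 E2]. eapply Rle_trans; [apply Cmod_le_Re_Im |]. simpl.
 assert (A : forall g : R -> R, ex_RInt g a b -> (forall t, a <= t <= b -> Rabs (g t) <= M) ->
      Rabs (RInt g a b) <= (b - a) * M).
 { intros g Hg Hb. apply (norm_RInt_le_const (V := R_NormedModule) g a b); try assumption.
  apply (RInt_correct (V := R_CompleteNormedModule)), Hg. }
 assert (A1 := A _ E1 (fun t Ht => Rle_trans _ _ _ (re_le_Cmod _) (H t Ht))).
 assert (A2 := A _ E2 (fun t Ht => Rle_trans _ _ _ (Im_le_Cmod _) (H t Ht))). unfold Re, Im in *. simpl in *. lra.
Qed.

Lemma CInt_ftc F f a b : cvcont f -> (forall t, cder F t (f t)) -> CInt f a b = (F b - F a)%C.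
Proof.
 intros Hf H. apply C_eq; simpl; apply is_RInt_unique;
  [apply (is_RInt_derive (fun t => Re (F t))) | apply (is_RInt_derive (fun t => Im (F t)))];
  intros t _; try apply H; apply Hf.
Qed.

Definition el (x : R) : C := (cos x, sin x).

Lemma Cmod_el x : Cmod (el x) = 1.
Proof.
 unfold Cmod, el; simpl. rewrite !Rmult_1_r. generalize (sin2_cos2 x); unfold Rsqr; intros H.
 replace (cos x * cos x + sin x * sin x) with 1 by lra. apply sqrt_1.
Qed.

Lemma el_plus x y : el (x + y) = (el x * el y)%C.
Proof. apply C_eq; simpl; [rewrite cos_plus | rewrite sin_plus]; ring. Qed.

Lemma el_0 : el 0 = 1%C.
Proof. apply C_eq; simpl; [apply cos_0 | apply sin_0]. Qed.

Lemma el_neq_0 x : el x <> 0%C.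
Proof. apply Cmod_gt_0. rewrite Cmod_el. lra. Qed.

Lemma el_opp x : (el x * el (- x))%C = 1%C.
Proof. rewrite <- el_plus. replace (x + - x) with 0 by ring. apply el_0. Qed.

Lemma el_pow x n : (el x ^ n)%C = el (INR n * x).
Proof.
 induction n as [| n IH].
 - simpl. rewrite Rmult_0_l, el_0. reflexivity.
 - rewrite S_INR. simpl Cpow. rewrite IH, <- el_plus. f_equal. ring.
Qed.

Lemma el_2PI : el (2 * PI) = 1%C.
Proof. apply C_eq; simpl; [apply cos_2PI | apply sin_2PI]. Qed.

Lemma cder_el t : cder el t (Ci * el t)%C.
Proof.
 split; simpl.
 - replace (0 * cos t - 1 * sin t) with (- sin t) by ring. apply is_derive_cos.
 - replace (0 * sin t + 1 * cos t) with (cos t) by ring. apply is_derive_sin.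
Qed.

Lemma cvcont_el : cvcont el.
Proof.
 intros t. destruct (cder_el t) as [H1 H2]. split; apply @ex_derive_continuous; eexists; eassumption.
Qed.

Definition circ (rho t : R) : C := (RtoC rho * el t)%C.

Lemma cvcont_circ rho : cvcont (circ rho).
Proof. apply cvcont_mult; [apply cvcont_const | apply cvcont_el]. Qed.

Lemma Cmod_circ rho t : 0 <= rho -> Cmod (circ rho t) = rho.
Proof. intros H. unfold circ. rewrite Cmod_mult, Cmod_el, Cmod_R, Rabs_pos_eq; lra. Qed.

Lemma cder_circ rho t : cder (circ rho) t (Ci * circ rho t)%C.
Proof.
 unfold circ. replace (Ci * (RtoC rho * el t))%C with (0 * el t + rho * (Ci * el t))%C by ring.
 apply (cder_mult (fun _ => rho) el); [apply cder_const | apply cder_el].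
Qed.

Lemma hol_with_d_lip f d c r M : hol_with f d c r M ->
 forall x y, Cmod (x - c) < r -> Cmod (y - c) < r -> Cmod (d x - d y) <= 2 * M * Cmod (x - y).
Proof.
 intros (Hr & HM & H) x y Hx Hy. destruct (Ceq_dec x y) as [-> | Hne].
 - rewrite Cmod_sub_diag. generalize (Cmod_ge_0 (y - y)). nra.
 - assert (H1 := H x y Hx Hy). assert (H2 := H y x Hy Hx).
  assert (Hp : 0 < Cmod (x - y)) by (apply Cmod_gt_0, Csub_neq_0, Hne). rewrite (Cmod_sub_sym y x) in H1.
  apply Rmult_le_reg_l with (Cmod (x - y)); [lra |]. rewrite <- Cmod_mult. replace ((x - y) * (d x - d y))%C
   with ((f y - f x - (y - x) * d x) + (f x - f y - (x - y) * d y))%C by ring.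
  eapply Rle_trans; [apply Cmod_triangle |]. lra.
Qed.

Lemma const_of_quadratic (g : R -> C) Q :
 (forall x y, 0 < x <= 1 -> 0 <= y <= 1 -> Cmod (g y - g x) <= Q * ((y - x) * (y - x))) -> g 1 = g 0.
Proof.
 intros H. assert (HQ : 0 <= Q).
 { assert (A := H (1/2) 1 ltac:(lra) ltac:(lra)). generalize (Cmod_ge_0 (g 1 - g (1/2))). lra. }
 assert (K : forall N, (0 < N)%nat -> forall k, (k <= N)%nat ->
   Cmod (g (INR k / INR N) - g 0) <= INR k * (Q * (/ INR N * / INR N))).
 { intros N HN. assert (HN' : 0 < INR N) by (apply lt_0_INR; exact HN). induction k as [| k IH]; intros Hk.
  - simpl. replace (0 / INR N) with 0 by lra. rewrite Cmod_sub_diag. lra.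
  - rewrite S_INR. assert (Hkn : INR (S k) <= INR N) by (apply le_INR; exact Hk). rewrite S_INR in Hkn.
   assert (Hk0 := pos_INR k). eapply Rle_trans; [apply (Cmod_triangle_sub _ (g (INR k / INR N))) |].
   assert (A : 0 < (INR k + 1) / INR N <= 1).
   { split; [pos |]. apply Rmult_le_reg_r with (INR N); [lra |]. field_simplify; lra. }
   assert (B : 0 <= INR k / INR N <= 1) by nra. assert (A1 := H _ _ A B). rewrite Cmod_sub_sym.
   replace ((INR k / INR N - (INR k + 1) / INR N) * (INR k / INR N - (INR k + 1) / INR N))
    with (/ INR N * / INR N) in A1 by lra.
   assert (A2 := IH ltac:(lia)). lra. }
 assert (L : Cmod (g 1 - g 0) <= 0).
 { apply Rnot_lt_le. intros Hpos. destruct (archimed_cor1 (Cmod (g 1 - g 0) / (Q + 1))) as (N & HN & HN0).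
  { pos. }
  assert (A := K N HN0 N (Nat.le_refl N)). assert (HN' : 0 < INR N) by (apply lt_0_INR; exact HN0).
  replace (INR N / INR N) with 1 in A by (field; lra).
  replace (INR N * (Q * (/ INR N * / INR N))) with (Q * / INR N) in A by (field; lra). apply Rlt_div_r in HN; [| lra].
  assert (0 < / INR N) by pos. nra. }
 assert (E : (g 1 - g 0)%C = 0%C).
 { apply Cmod_eq_0. generalize (Cmod_ge_0 (g 1 - g 0)). lra. }
 replace (g 1) with ((g 1 - g 0) + g 0)%C by ring. rewrite E. ring.
Qed.

Section Cauchy.
Variables (f d : C -> C) (c : C) (r M rho : R).
Hypothesis Hf : hol_with f d c r M.
Hypothesis Hrho : 0 < rho < r.

Lemma circle_kernel_neq z t : Cmod z < rho -> (circ rho t - z)%C <> 0%C.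
Proof.
 intros Hz. apply Cmod_gt_0. generalize (Cmod_reverse (circ rho t) z). rewrite Cmod_circ by lra. lra.
Qed.

Lemma cvcont_kernel z : Cmod z < rho -> cvcont (fun t => / (circ rho t - z))%C.
Proof.
 intros Hz. apply (cvcont_comp (fun y => / y)%C (fun t => circ rho t - z)%C).
 - apply cvcont_minus; [apply cvcont_circ | apply cvcont_const].
 - intros t. apply hol_ccont, hol_inv_pt, circle_kernel_neq, Hz.
Qed.

(** The circle is contracted to [z]: at parameter l the function is read at z + l (zeta - z) while
    the kernel stays fixed, and the integral does not depend on l. The integral of the kernel is
    left unevaluated, so no winding number is computed. *)
Lemma Cauchy_formula z : Cmod z < rho ->
 CInt (fun t => f (c + circ rho t) * (circ rho t * / (circ rho t - z)))%C 0 (2 * PI)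
 = (f (c + z) * CInt (fun t => circ rho t * / (circ rho t - z)) 0 (2 * PI))%C.
Proof.
 intros Hz. set (k := (fun t => circ rho t * / (circ rho t - z))%C).
 set (p := fun (l t : R) => (c + (z + l * (circ rho t - z)))%C). assert (Hpi := PI_RGT_0).
 assert (Ck : cvcont k) by (apply cvcont_mult; [apply cvcont_circ | apply cvcont_kernel, Hz]).
 assert (Cp : forall l, cvcont (p l)).
 { intros l. apply cvcont_plus; [apply cvcont_const |]. apply cvcont_plus; [apply cvcont_const |].
  apply cvcont_mult; [apply cvcont_const |]. apply cvcont_minus; [apply cvcont_circ | apply cvcont_const]. }
 assert (Bp : forall l t, 0 <= l <= 1 -> Cmod (p l t - c) < r).
 { intros l t Hl. unfold p. replace (c + (z + l * (circ rho t - z)) - c)%C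
   with (RtoC (1 - l) * z + l * circ rho t)%C by (rewrite RtoC_minus; ring).
  eapply Rle_lt_trans; [apply Cmod_triangle |]. rewrite !Cmod_mult, !Cmod_R, !Rabs_pos_eq, Cmod_circ by lra. nra. }
 assert (Cf : forall l, 0 <= l <= 1 -> cvcont (fun t => f (p l t))).
 { intros l Hl. apply (cvcont_comp f (p l) (Cp l)). intros t. apply hol_ccont.
  exists d, (r - Cmod (p l t - c)), M. apply hol_with_near; [pos | apply Bp, Hl]. }
 assert (Cd : forall l, 0 <= l <= 1 -> cvcont (fun t => d (p l t))).
 { intros l Hl. apply (cvcont_comp d (p l) (Cp l)). intros t eps He. assert (HM : 0 <= M) by apply Hf.
  exists (Rmin (r - Cmod (p l t - c)) (eps / (2 * M + 1))). split.
  - apply Rmin_pos; [generalize (Bp l t Hl); lra | pos].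
  - intros y Hy. destruct (Rmin_bounds (r - Cmod (p l t - c)) (eps / (2 * M + 1))) as [Hm1 Hm2].
   eapply Rle_lt_trans; [apply (hol_with_d_lip _ _ _ _ _ Hf) |].
   + generalize (Cmod_triangle_sub y (p l t) c). lra.
   + apply Bp, Hl.
   + assert (Hlt : Cmod (y - p l t) < eps / (2 * M + 1)) by lra. apply Rlt_div_r in Hlt; [| lra].
    generalize (Cmod_ge_0 (y - p l t)). nra. }
 set (A := fun l => CInt (fun t => f (p l t) * k t)%C 0 (2 * PI)).
 (* For l > 0 the integrand, multiplied by l i, is the derivative of the closed curve t -> f (p l
    t). This integral is the derivative in l of the deformed integral [A]. *)
 assert (Z : forall l, 0 < l <= 1 -> CInt (fun t => d (p l t) * circ rho t)%C 0 (2 * PI) = 0%C).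
 { intros l Hl. assert (E : CInt (fun t => (RtoC l * Ci) * (d (p l t) * circ rho t))%C 0 (2 * PI) = 0%C).
  { rewrite (CInt_ftc (fun t => f (p l t))).
   - unfold p, circ. rewrite el_2PI, el_0. ring.
   - apply cvcont_mult; [apply cvcont_const |]. apply cvcont_mult; [apply Cd; lra | apply cvcont_circ].
   - intros t. replace (RtoC l * Ci * (d (p l t) * circ rho t))%C
     with (d (p l t) * (0 + (0 + (0 * (circ rho t - z) + l * (Ci * circ rho t - 0)))))%C by ring.
    apply (cder_comp f d c r M (p l)); [pos | apply Bp; lra |].
    apply cder_plus; [apply cder_const |]. apply cder_plus; [apply cder_const |].
    apply (cder_mult (fun _ => l) (fun t => circ rho t - z)%C); [apply cder_const |].
    apply cder_minus; [apply cder_circ | apply cder_const]. }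
  rewrite CInt_scal in E by (apply cvcont_mult; [apply Cd; lra | apply cvcont_circ]).
  assert (Hne : (RtoC l * Ci)%C <> 0%C).
  { apply Cmod_gt_0. rewrite Cmod_mult, Cmod_Ci, Cmod_R, Rabs_pos_eq; lra. }
  apply (f_equal (Cmult (/ (RtoC l * Ci)))) in E. rewrite Cmult_assoc, Cinv_l, Cmult_1_l in E by exact Hne.
  rewrite E. ring. }
 assert (Q : A 1 = A 0).
 { apply (const_of_quadratic A (2 * (M * (2 * rho * rho)) * (2 * PI - 0))). intros x y Hx Hy.
  assert (Cx : cvcont (fun t => RtoC (y - x) * (d (p x t) * circ rho t))%C).
  { apply cvcont_mult; [apply cvcont_const |]. apply cvcont_mult; [apply Cd; lra | apply cvcont_circ]. }
  assert (Cfx : cvcont (fun t => f (p x t) * k t)%C) by (apply cvcont_mult; [apply Cf; lra | pos]).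
  assert (Cfy : cvcont (fun t => f (p y t) * k t)%C) by (apply cvcont_mult; [apply Cf; lra | pos]).
  assert (E : (A y - A x)%C = CInt (fun t => f (p y t) * k t - f (p x t) * k t
         - RtoC (y - x) * (d (p x t) * circ rho t))%C 0 (2 * PI)).
  { rewrite CInt_minus by (try apply cvcont_minus; assumption). rewrite CInt_minus by assumption.
   rewrite CInt_scal by (apply cvcont_mult; [apply Cd; lra | apply cvcont_circ]). rewrite Z by lra. unfold A. ring. }
  rewrite E. replace (2 * (M * (2 * rho * rho)) * (2 * PI - 0) * ((y - x) * (y - x)))
   with (2 * (M * (2 * rho * rho) * ((y - x) * (y - x))) * (2 * PI - 0)) by ring.
  apply CInt_bound; [lra | apply cvcont_minus; [apply cvcont_minus |]; assumption |]. intros t _. unfold k.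
  assert (Hne := circle_kernel_neq z t Hz).
  replace (f (p y t) * (circ rho t * / (circ rho t - z)) - f (p x t) * (circ rho t * / (circ rho t - z))
       - RtoC (y - x) * (d (p x t) * circ rho t))%C
   with ((f (p y t) - f (p x t) - (p y t - p x t) * d (p x t)) * (circ rho t * / (circ rho t - z)))%C.
  2:{ unfold p. rewrite RtoC_minus. field. exact Hne. }
  rewrite !Cmod_mult, Cmod_inv, Cmod_circ by (assumption || lra). set (D := Cmod (circ rho t - z)).
  assert (HD : 0 < D) by (apply Cmod_gt_0; exact Hne). assert (HD2 : D <= 2 * rho).
  { unfold D. eapply Rle_trans; [apply Cmod_triangle_minus |]. rewrite Cmod_circ; lra. }
  destruct Hf as (_ & HM & HH). assert (B := HH (p x t) (p y t) ltac:(apply Bp; lra) ltac:(apply Bp; lra)).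
  replace (p y t - p x t)%C with (RtoC (y - x) * (circ rho t - z))%C in B |- * by
   (unfold p; rewrite RtoC_minus; ring).
  rewrite !(Cmod_mult (RtoC (y - x))), Cmod_R in B. fold D in B.
  replace (Rabs (y - x) * D * (Rabs (y - x) * D)) with ((Rabs (y - x) * Rabs (y - x)) * (D * D)) in B by ring.
  rewrite <- Rabs_mult, (Rabs_pos_eq ((y - x) * (y - x))) in B by apply Rle_0_sqr.
  eapply Rle_trans; [apply Rmult_le_compat_r; [| exact B] |].
  { pos. }
  replace (M * ((y - x) * (y - x) * (D * D)) * (rho * / D))
   with (M * ((y - x) * (y - x)) * (rho * D)) by (field; lra).
  replace (M * (2 * rho * rho) * ((y - x) * (y - x)))
   with (M * ((y - x) * (y - x)) * (rho * (2 * rho))) by ring.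
  apply Rmult_le_compat_l; [apply Rmult_le_pos; [lra | apply Rle_0_sqr] |]. apply Rmult_le_compat_l; lra. }
 unfold A in Q. rewrite (CInt_ext (fun t => f (c + circ rho t) * (circ rho t * / (circ rho t - z)))%C
          (fun t => f (p 1 t) * k t)%C), Q.
 - rewrite (CInt_ext _ (fun t => f (c + z) * k t)%C); [apply CInt_scal, Ck | lra |].
  intros t _. unfold p. f_equal. f_equal. ring.
 - lra.
 - intros t _. unfold p, k. f_equal. f_equal. ring.
Qed.

Lemma CInt_circle_one : CInt (fun _ => 1%C) 0 (2 * PI) = RtoC (2 * PI).
Proof.
 rewrite (CInt_ftc (fun t => t)).
 - rewrite <- RtoC_minus. f_equal. ring.
 - apply cvcont_const.
 - intros t. apply cder_id.
Qed.

Lemma mean_value : CInt (fun t => f (c + circ rho t))%C 0 (2 * PI) = (RtoC (2 * PI) * f c)%C.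
Proof.
 assert (Hpi := PI_RGT_0). assert (H0 : Cmod 0 < rho) by (rewrite Cmod_0; lra). assert (A := Cauchy_formula 0 H0).
 assert (E : forall t, (circ rho t * / (circ rho t - 0) = 1)%C).
 { intros t. generalize (circle_kernel_neq 0 t H0). intros Hne.
  replace (circ rho t - 0)%C with (circ rho t) in * by ring. apply Cinv_r, Hne. }
 rewrite (CInt_ext _ (fun t => f (c + circ rho t))%C) in A;
  [| lra | intros t _; rewrite E; ring].
 rewrite (CInt_ext (fun t => circ rho t * / (circ rho t - 0))%C (fun _ => 1%C)) in A;
  [| lra | intros t _; apply E].
 rewrite CInt_circle_one in A. rewrite A. replace (c + 0)%C with c by ring. ring.
Qed.

(** The first order remainder of the kernel at x is exactly (y - x)^2 / ((zeta - x)^2 (zeta - y)),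
    and with h = rho / 2 both points stay at distance at least h from the circle. *)
Lemma hol_Cauchy_type (m : R -> C) B : cvcont m -> (forall t, 0 <= t <= 2 * PI -> Cmod (m t) <= B) ->
 hol (fun z => CInt (fun t => m t * / (circ rho t - z))%C 0 (2 * PI)) 0%C.
Proof.
 intros Cm HB. assert (Hpi := PI_RGT_0).
 assert (HB0 : 0 <= B) by (generalize (HB 0 ltac:(lra)) (Cmod_ge_0 (m 0)); lra).
 set (h := rho / 2). assert (Hh : 0 < h) by (unfold h; lra).
 assert (Eh : rho = 2 * h) by (unfold h; lra). clearbody h.
 exists (fun z => CInt (fun t => m t * (/ (circ rho t - z) * / (circ rho t - z)))%C 0 (2 * PI)),
  h, (2 * (B * / (h * h * h)) * (2 * PI - 0)).
 assert (Hh3 : 0 < / (h * h * h)) by pos. repeat split; [lra | pos |]. intros x y Hx Hy.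
 replace (x - 0)%C with x in Hx by ring. replace (y - 0)%C with y in Hy by ring. assert (Hx' : Cmod x < rho) by lra.
 assert (Hy' : Cmod y < rho) by lra. assert (C1 := cvcont_kernel x Hx'). assert (C2 := cvcont_kernel y Hy').
 assert (Cxx := cvcont_mult _ _ Cm (cvcont_mult _ _ C1 C1)).
 assert (Cx := cvcont_mult _ _ Cm C1). assert (Cy := cvcont_mult _ _ Cm C2).
 rewrite <- (CInt_scal (y - x)%C) by exact Cxx. rewrite <- CInt_minus by assumption.
 assert (Cxx' := cvcont_mult _ _ (cvcont_const (y - x)%C) Cxx).
 rewrite <- CInt_minus by first [assumption | apply cvcont_minus; assumption].
 replace (2 * (B * / (h * h * h)) * (2 * PI - 0) * (Cmod (y - x) * Cmod (y - x)))
  with (2 * (B * / (h * h * h) * (Cmod (y - x) * Cmod (y - x))) * (2 * PI - 0)) by ring.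
 apply CInt_bound; [lra | |].
 - apply cvcont_minus; [apply cvcont_minus; assumption |]. apply cvcont_mult; [apply cvcont_const | pos].
 - intros t Ht. assert (N1 := circle_kernel_neq x t Hx'). assert (N2 := circle_kernel_neq y t Hy').
  assert (L : forall z, Cmod z < h -> h <= Cmod (circ rho t - z)).
  { intros z Hz. generalize (Cmod_reverse (circ rho t) z). rewrite Cmod_circ by lra. lra. }
  replace (m t * / (circ rho t - y) - m t * / (circ rho t - x)
       - (y - x) * (m t * (/ (circ rho t - x) * / (circ rho t - x))))%C
   with (m t * (/ ((circ rho t - x) * (circ rho t - x) * (circ rho t - y)) * ((y - x) * (y - x))))%C
   by (field; split; assumption).
  rewrite !Cmod_mult, Cmod_inv, !Cmod_mult by (repeat apply Cmult_neq_0; assumption). rewrite (Rmult_assoc B).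
  apply Rmult_le_compat; [pos | | apply HB, Ht |].
  + apply Rmult_le_pos; [left; apply Rinv_0_lt_compat |].
   * repeat apply Rmult_lt_0_compat; apply Cmod_gt_0; assumption.
   * pos.
  + apply Rmult_le_compat_r; [pos |]. assert (Lx := L x Hx). assert (Ly := L y Hy). apply Rinv_le_contravar; [pos |].
   repeat apply Rmult_le_compat; try (apply Rmult_le_pos); lra.
Qed.

End Cauchy.

(** * Divided differences and the maximum principle *)

Lemma hol_shift f c : hol (fun z => f (c + z))%C 0 -> hol f c.
Proof.
 intros H. apply hol_ext_loc with (fun z => (fun y => f (c + y)%C) (z - c)%C) 1; [lra | |].
 - intros z _. f_equal. ring.
 - apply (hol_comp (fun z => z - c)%C (fun y => f (c + y)%C)).
  + apply hol_minus; [apply hol_id | apply hol_const].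
  + replace (c - c)%C with (RtoC 0) by ring. exact H.
Qed.

(* Near [c] both [f] and [1] are Cauchy integrals over one small circle, and the
   divided difference at the centre of a Cauchy integral is again a Cauchy integral. *)
Lemma hol_slope_at f c : hol f c ->
 exists g rho, 0 < rho /\ hol g c /\
  forall z, Cmod (z - c) < rho -> f z = (f c + (z - c) * g z)%C.
Proof.
 intros (d & r & M & Hf). set (rho := r / 2).
 assert (Hr : 0 < r) by apply Hf. assert (Hrho : 0 < rho < r) by (unfold rho; lra). assert (Hpi := PI_RGT_0).
 set (fc := fun t => f (c + circ rho t)%C). assert (Hcirc : forall t, Cmod (c + circ rho t - c) < r).
 { intros t. replace (c + circ rho t - c)%C with (circ rho t) by ring. rewrite Cmod_circ; lra. }
 assert (Cfc : cvcont fc).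
 { apply (cvcont_comp f (fun t => c + circ rho t)%C).
  - apply cvcont_plus; [apply cvcont_const | apply cvcont_circ].
  - intros t. apply hol_ccont. eexists. eexists. exists M. apply hol_with_near; [exact Hf | apply Hcirc]. }
 assert (H00 : Cmod 0 < rho) by (rewrite Cmod_0; lra). assert (Hcc : Cmod (c - c) < r).
 { rewrite Cmod_sub_diag. lra. }
 set (Bf := Cmod (f c) + (Cmod (d c) + 4 * M * r) * rho). assert (HBf : forall t, Cmod (fc t) <= Bf).
 { intros t. unfold fc, Bf. assert (A := hol_with_lip _ _ _ _ _ Hf c _ Hcc (Hcirc t)).
  replace (c + circ rho t - c)%C with (circ rho t) in A by ring. rewrite Cmod_circ in A by lra.
  generalize (Cmod_reverse (f (c + circ rho t)%C) (f c)). lra. }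
 assert (K : forall m : R -> C, cvcont m -> forall z, Cmod z < rho ->
   CInt (fun t => m t * (circ rho t * / (circ rho t - z)))%C 0 (2 * PI)
   = (CInt m 0 (2 * PI) + z * CInt (fun t => m t * / (circ rho t - z))%C 0 (2 * PI))%C).
 { intros m Cm z Hz. assert (Ck := cvcont_kernel r rho Hrho z Hz).
  rewrite <- CInt_scal by (apply cvcont_mult; assumption).
  rewrite <- CInt_plus by (try apply cvcont_mult; try apply cvcont_const; try apply cvcont_mult; assumption).
  apply CInt_ext; [lra |]. intros t _. assert (Hne := circle_kernel_neq r rho Hrho z t Hz). field. exact Hne. }
 set (Phi1 := fun z => CInt (fun t => fc t * / (circ rho t - z))%C 0 (2 * PI)).
 set (N1 := fun z => CInt (fun t => 1 * / (circ rho t - z))%C 0 (2 * PI)). assert (HPhi : hol Phi1 0%C).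
 { apply (hol_Cauchy_type r rho Hrho fc Bf); [pos | intros; apply HBf]. }
 assert (HN : hol N1 0%C).
 { apply (hol_Cauchy_type r rho Hrho (fun _ => 1%C) 1); [apply cvcont_const | intros; rewrite Cmod_1; lra]. }
 (* [N] is the integral of zeta / (zeta - z), written as 2 pi plus z times a Cauchy integral. Its
    constancy is not established: [N] does not vanish near 0, and dividing by it is enough. *)
 set (P0 := CInt fc 0 (2 * PI)). set (N := fun z => (RtoC (2 * PI) + z * N1 z)%C).
 assert (HNh : hol N 0%C) by (apply hol_plus; [apply hol_const | apply hol_mult; [apply hol_id | pos]]).
 assert (E : forall z, Cmod z < rho -> (P0 + z * Phi1 z = f (c + z) * N z)%C).
 { intros z Hz. unfold P0, Phi1. rewrite <- K by assumption.
  etransitivity; [exact (Cauchy_formula f d c r M rho Hf Hrho z Hz) |]. f_equal.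
  unfold N, N1. rewrite <- CInt_circle_one. rewrite <- (K (fun _ => 1%C)) by (apply cvcont_const || assumption).
  apply CInt_ext; [lra |]. intros; ring. }
 assert (E0 : (P0 = f c * RtoC (2 * PI))%C).
 { assert (A := E 0%C H00). unfold N in A. replace (c + 0)%C with c in A by ring.
  replace (RtoC (2 * PI) + 0 * N1 0%C)%C with (RtoC (2 * PI)) in A by ring. rewrite <- A. ring. }
 assert (N0 : N 0%C <> 0%C).
 { unfold N. replace (RtoC (2 * PI) + 0 * N1 0%C)%C with (RtoC (2 * PI)) by ring.
  intros A. apply RtoC_inj in A. lra. }
 destruct (hol_ccont N 0%C HNh (Cmod (N 0%C))) as (r1 & Hr1 & Hn); [apply Cmod_gt_0, N0 |].
 set (g := fun z => ((Phi1 z - f c * N1 z) / N z)%C). exists (fun z => g (z - c)%C), (Rmin rho r1). repeat split.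
 - pos.
 - apply hol_shift. apply hol_ext_loc with g 1; [lra | |].
  + intros z _. f_equal. ring.
  + apply hol_div; [| pos | pos]. apply hol_minus; [pos | apply hol_mult; [apply hol_const | pos]].
 - intros z Hz. destruct (Rmin_bounds rho r1) as [Hm1 Hm2].
  assert (A := E (z - c)%C ltac:(lra)). replace (c + (z - c))%C with z in A by ring. assert (Nz : N (z - c)%C <> 0%C).
  { intros Z. assert (B := Hn (z - c)%C). rewrite Z in B. replace (z - c - 0)%C with (z - c)%C in B by ring.
   replace (0 - N 0%C)%C with (- N 0%C)%C in B by ring. rewrite Cmod_opp in B. assert (B' := B ltac:(lra)). lra. }
  assert (F : f z = ((P0 + (z - c) * Phi1 (z - c)%C) / N (z - c)%C)%C).
  { rewrite A. field. exact Nz. }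
  rewrite F, E0. unfold g. unfold N at 1. unfold N in Nz.
  replace (f c + (z - c) * ((Phi1 (z - c)%C - f c * N1 (z - c)%C) / N (z - c)%C))%C
   with ((f c * N (z - c)%C + (z - c) * (Phi1 (z - c)%C - f c * N1 (z - c)%C)) / N (z - c)%C)%C
   by (unfold N; field; exact Nz).
  unfold N. f_equal. ring.
Qed.

(** Away from c the function [q] is literally the difference quotient, so the factorisation holds at
    every z, even where [f] is not holomorphic; only the value at c comes from the local slope. *)
Lemma hol_slope f c : hol f c ->
 exists q, (forall z, f z = f c + (z - c) * q z)%C /\ forall z, hol f z -> hol q z.
Proof.
 intros Hf. destruct (hol_slope_at f c Hf) as (g & rho & Hrho & Hg & E).
 exists (fun z => if Ceq_dec z c then g c else ((f z - f c) / (z - c))%C). split.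
 - intros z. destruct (Ceq_dec z c) as [-> | Hne]; [ring |]. field. apply Csub_neq_0, Hne.
 - intros z Hz. destruct (Ceq_dec z c) as [-> | Hne].
  + apply hol_ext_loc with g rho; [lra | | pos]. intros y Hy. destruct (Ceq_dec y c) as [-> | Hyc]; [reflexivity |].
   rewrite (E y Hy). field. apply Csub_neq_0, Hyc.
  + apply hol_ext_loc with (fun y => (f y - f c) / (y - c))%C (Cmod (z - c)).
   * apply Cmod_gt_0, Csub_neq_0, Hne.
   * intros y Hy. destruct (Ceq_dec y c) as [-> | Hyc]; [| reflexivity]. rewrite Cmod_sub_sym in Hy. lra.
   * apply hol_div; [| | apply Csub_neq_0, Hne];
     apply hol_minus; (assumption || apply hol_id || apply hol_const).
Qed.

Lemma fix_slope (f : C -> C) a : hol f a -> f a = a ->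
 exists q, (forall z, f z - z = (z - a) * q z)%C /\ forall z, hol f z -> hol q z.
Proof.
 intros Hf Ha. assert (Hd : forall z, hol f z -> hol (fun z => f z - z)%C z).
 { intros z Hz. apply hol_minus; [pos | apply hol_id]. }
 destruct (hol_slope _ a (Hd a Hf)) as (q & E & H). exists q. split; [| intros z Hz; apply H, Hd, Hz].
 intros z. rewrite E, Ha. ring.
Qed.

(* Integrate over a small circle: the mean of [|H|^2 + eps |z|^2] exceeds its value at the centre. *)
Lemma no_local_max H c eps delta : hol H c -> 0 < eps -> 0 < delta ->
 (forall z, Cmod (z - c) < delta ->
   Cmod (H z) ^ 2 + eps * Cmod z ^ 2 <= Cmod (H c) ^ 2 + eps * Cmod c ^ 2) -> False.
Proof.
 intros (d & r & M & Hf) He Hd Hmax. set (rho := Rmin r delta / 2). assert (Hr : 0 < r) by apply Hf.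
 assert (Hm := Rmin_pos r delta Hr Hd). destruct (Rmin_bounds r delta) as [Hm1 Hm2].
 assert (Hrho : 0 < rho < r) by (unfold rho; lra). assert (Hpi := PI_RGT_0).
 assert (Hrd : rho < delta) by (unfold rho; lra). clearbody rho. set (Hc := fun t => H (c + circ rho t)%C).
 assert (CHc : cvcont Hc).
 { apply (cvcont_comp H (fun t => c + circ rho t)%C).
  - apply cvcont_plus; [apply cvcont_const | apply cvcont_circ].
  - intros t. apply hol_ccont. eexists. eexists. exists M. apply hol_with_near; [exact Hf |].
   replace (c + circ rho t - c)%C with (circ rho t) by ring. rewrite Cmod_circ; lra. }
 (* [Re Psi] is the part linear in the increments: subtracting |H(c + zeta) - H(c)|^2 + eps rho^2
    from the growth of |H|^2 + eps |z|^2 leaves exactly [Re Psi]. Its mean is zero, whereas a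
    maximum at the centre makes it at most - eps rho^2. *)
 set (Psi := fun t => (RtoC 2 * Cconj (H c) * (Hc t - H c) + RtoC (2 * eps) * Cconj c * circ rho t)%C).
 assert (C1 : cvcont (fun t => Hc t - H c)%C) by (apply cvcont_minus; [pos | apply cvcont_const]).
 assert (I1 : CInt (fun t => Hc t - H c)%C 0 (2 * PI) = 0%C).
 { rewrite CInt_minus by (assumption || apply cvcont_const). unfold Hc. rewrite (mean_value H d c r M rho Hf Hrho).
  replace (CInt (fun _ => H c) 0 (2 * PI)) with (CInt (fun t => H c * 1)%C 0 (2 * PI))
   by (apply CInt_ext; [lra | intros; ring]).
  rewrite CInt_scal, CInt_circle_one by apply cvcont_const. ring. }
 assert (I2 : CInt (circ rho) 0 (2 * PI) = 0%C).
 { assert (A : CInt (fun t => Ci * circ rho t)%C 0 (2 * PI) = 0%C).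
  { rewrite (CInt_ftc (circ rho)).
   - unfold circ. rewrite el_2PI, el_0. ring.
   - apply cvcont_mult; [apply cvcont_const | apply cvcont_circ].
   - apply cder_circ. }
  rewrite CInt_scal in A by apply cvcont_circ. apply (f_equal (Cmult (- Ci))) in A.
  replace (- Ci * (Ci * CInt (circ rho) 0 (2 * PI)))%C
   with (- (Ci * Ci) * CInt (circ rho) 0 (2 * PI))%C in A by ring.
  replace (Ci * Ci)%C with (RtoC (-1)) in A by (apply C_eq; simpl; ring).
  transitivity (- RtoC (-1) * CInt (circ rho) 0 (2 * PI))%C; [| rewrite A; ring].
  rewrite <- RtoC_opp. replace (- -1) with 1 by ring. ring. }
 assert (CPsi : cvcont Psi).
 { apply cvcont_plus; apply cvcont_mult; try apply cvcont_const; [pos | apply cvcont_circ]. }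
 assert (I3 : CInt Psi 0 (2 * PI) = 0%C).
 { unfold Psi. rewrite CInt_plus by (apply cvcont_mult; [apply cvcont_const |]; first [exact C1 | apply cvcont_circ]).
  rewrite (CInt_scal _ _ _ _ C1), (CInt_scal _ _ _ _ (cvcont_circ rho)), I1, I2. ring. }
 assert (B : forall t, Re (Psi t) <= - (eps * rho ^ 2)).
 { intros t. assert (A := Hmax (c + circ rho t)%C). replace (c + circ rho t - c)%C with (circ rho t) in A by ring.
  rewrite Cmod_circ in A by lra. specialize (A Hrd). fold (Hc t) in A. rewrite !Cmod2_alt in A.
  assert (Q := Cmod2_Re_Im (circ rho t)). rewrite Cmod_circ in Q by lra.
  unfold Psi. destruct (Hc t) as [h1 h2], (H c) as [k1 k2], (circ rho t) as [u v], c as [a b].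
  unfold Re, Im in *; simpl in *. generalize (Rle_0_sqr (h1 - k1)) (Rle_0_sqr (h2 - k2)). unfold Rsqr. nra. }
 assert (J : RInt (fun t => Re (Psi t)) 0 (2 * PI) = 0).
 { apply (f_equal Re) in I3. exact I3. }
 assert (J2 : RInt (fun t => Re (Psi t)) 0 (2 * PI) <= RInt (fun _ => - (eps * rho ^ 2)) 0 (2 * PI)).
 { apply RInt_le; [lra | apply (cvcont_ex_RInt Psi _ _ CPsi) | apply ex_RInt_const | intros; apply B]. }
 rewrite RInt_const in J2. unfold scal in J2; simpl in J2. unfold mult in J2; simpl in J2.
 assert (0 < eps * rho ^ 2) by pos. simpl in *. nra.
Qed.

(** * Compactness in the plane *)

(** A Lebesgue number argument: a condition that only gets easier as its tolerance shrinks, and that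
    holds near each point with some tolerance, holds on the disc with a single one. *)
Lemma box_uniform (X : R) (Q : C -> R -> Prop) :
 (forall y d d', Q y d -> 0 < d' <= d -> Q y d') ->
 (forall z, exists delta d, 0 < delta /\ 0 < d /\ forall y, Cmod (y - z) < delta -> Q y d) ->
 exists d, 0 < d /\ forall y, Cmod y <= X -> Q y d.
Proof.
 intros Hanti Hloc. assert (Hch : forall z, {d : posreal | forall y, Cmod (y - z) < 2 * d -> Q y d}).
 { intros z. apply constructive_indefinite_description. destruct (Hloc z) as (delta & d & Hde & Hd & H).
  assert (Hp : 0 < Rmin (delta / 2) d) by pos. exists (mkposreal _ Hp). simpl. intros y Hy.
  destruct (Rmin_bounds (delta / 2) d) as [H1 H2]. apply Hanti with d; [apply H; lra | lra]. }
 destruct (compactness_value_2d (- X) X (- X) X (fun x y => proj1_sig (Hch (x, y)))) as [d Hd].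
 exists d. split; [apply d |]. intros y Hy. apply NNPP. intros Hn.
 assert (H1 := re_le_Cmod y). assert (H2 := Im_le_Cmod y). apply Rabs_le_between in H1. apply Rabs_le_between in H2.
 apply (Hd (Re y) (Im y)); [lra | lra |]. intros (u & v & _ & _ & Hu & Hv & Hle). apply Hn.
 destruct (Hch (u, v)) as [e He]. simpl in *. apply Hanti with e; [| split; [apply d | lra]].
 apply He. eapply Rle_lt_trans; [apply Cmod_le_Re_Im |]. change (Rabs (Re y - u) + Rabs (Im y - v) < 2 * e). lra.
Qed.

Definition ccompact (K : C -> Prop) : Prop :=
 (exists X, forall z, K z -> Cmod z <= X) /\
 (forall z, ~ K z -> exists d, 0 < d /\ forall y, Cmod (y - z) < d -> ~ K y).

Definition ccont_on (K : C -> Prop) (u : C -> R) : Prop :=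
 forall z eps, K z -> 0 < eps ->
  exists d, 0 < d /\ forall y, K y -> Cmod (y - z) < d -> Rabs (u y - u z) < eps.

(** [box_uniform] is used twice, with the condition u <= 1 / d to bound [u], and with u <= S - d to
    contradict that a supremum S is not attained. *)
Lemma ccompact_max K u z0 : ccompact K -> ccont_on K u -> K z0 ->
 exists z, K z /\ forall y, K y -> u y <= u z.
Proof.
 intros [[X HX] Hcl] Hu Hz0. assert (Hb : exists B, forall y, K y -> u y <= B).
 { destruct (box_uniform X (fun y d => K y -> u y <= / d)) as (d & Hd & H).
  - intros y d d' H [Hd' Hle] Ky. eapply Rle_trans; [apply H, Ky |]. apply Rinv_le_contravar; lra.
  - intros z. destruct (classic (K z)) as [Kz | Kz].
   + destruct (Hu z 1 Kz ltac:(lra)) as (de & Hde & H).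
    set (B := Rabs (u z) + 1). assert (HB : 0 < B) by (unfold B; generalize (Rabs_pos (u z)); lra).
    exists de, (/ B). repeat split; [lra | pos |]. intros y Hy Ky. rewrite Rinv_inv. unfold B.
    assert (A := H y Ky Hy). apply Rabs_lt_between in A. generalize (Rle_abs (u z)). lra.
   + destruct (Hcl z Kz) as (de & Hde & H). exists de, 1. repeat split; [lra | lra |].
    intros y Hy Ky. destruct (H y Hy Ky).
  - exists (/ d). intros y Ky. apply H; [apply HX, Ky | pos]. }
 destruct Hb as [B HB]. destruct (completeness (fun v => exists y, K y /\ v = u y)) as [S [HS1 HS2]].
 { exists B. intros v (y & Ky & ->). apply HB, Ky. }
 { exists (u z0), z0. split; [pos | lra]. }
 apply NNPP. intros Hn. assert (Hlt : forall z, K z -> u z < S).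
 { intros z Kz. apply Rnot_le_lt. intros Hle. apply Hn. exists z. split; [pos |].
  intros y Ky. eapply Rle_trans; [| exact Hle]. apply HS1. exists y. split; [pos | lra]. }
 destruct (box_uniform X (fun y d => K y -> u y <= S - d)) as (d & Hd & H).
 - intros y d d' H [Hd' Hle] Ky. specialize (H Ky). lra.
 - intros z. destruct (classic (K z)) as [Kz | Kz].
  + assert (A := Hlt z Kz). destruct (Hu z ((S - u z) / 2) Kz ltac:(lra)) as (de & Hde & H).
   exists de, ((S - u z) / 2). repeat split; [lra | lra |].
   intros y Hy Ky. assert (A2 := H y Ky Hy). apply Rabs_lt_between in A2. lra.
  + destruct (Hcl z Kz) as (de & Hde & H). exists de, 1. repeat split; [lra | lra |].
   intros y Hy Ky. destruct (H y Hy Ky).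
 - assert (A : S <= S - d).
  { apply HS2. intros v (y & Ky & ->). apply H; [apply HX, Ky | pos]. }
  lra.
Qed.

Definition gcont_on (K : C -> Prop) (g : C -> C) : Prop :=
 forall z eps, K z -> 0 < eps ->
  exists d, 0 < d /\ forall y, K y -> Cmod (y - z) < d -> Cmod (g y - g z) < eps.

(** The plane slit along (-oo, 0]. *)
Definition off_ray (v : C) : Prop := 0 < Re v \/ Im v <> 0.

Definition inner (K : C -> Prop) (z : C) : Prop :=
 exists d, 0 < d /\ forall y, Cmod (y - z) < d -> K y.

Lemma ccompact_sub (K P : C -> Prop) : ccompact K ->
 (forall z, K z -> ~ P z -> exists d, 0 < d /\ forall y, K y -> Cmod (y - z) < d -> ~ P y) ->
 ccompact (fun z => K z /\ P z).
Proof.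
 intros [[X HX] Hcl] H. split; [exists X; intros z [Kz _]; apply HX, Kz |].
 intros z Hz. destruct (classic (K z)) as [Kz | Kz].
 - destruct (H z Kz ltac:(intros Pz; apply Hz; split; assumption)) as (d & Hd & B).
  exists d. split; [lra |]. intros y Hy [Ky Py]. exact (B y Ky Hy Py).
 - destruct (Hcl z Kz) as (d & Hd & B). exists d. split; [lra |]. intros y Hy [Ky _]. exact (B y Hy Ky).
Qed.

(* If [g] vanished, let [-s] be the lowest point of the ray [(-oo, 0]] in [g(K)];
   then [1 / (g + s')] with [s'] slightly above [s] is large inside and bounded on the rest. *)
Lemma ray_lemma K g : ccompact K -> gcont_on K g ->
 (forall z, K z -> off_ray (g z) \/ (hol g z /\ inner K z)) ->
 forall z, K z -> g z <> 0%C.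
Proof.
 intros HK Hg Hbd z0 Kz0 E0. assert (HKc := HK). destruct HK as [[X HX] Hcl].
 assert (HX0 : 0 <= X) by (generalize (HX z0 Kz0) (Cmod_ge_0 z0); lra). set (K1 := fun z => K z /\ ~ off_ray (g z)).
 assert (HK1 : ccompact K1).
 { apply (ccompact_sub K (fun z => ~ off_ray (g z)) HKc). intros z Kz Hn. apply NNPP in Hn. destruct Hn as [Ho | Ho].
  - destruct (Hg z (Re (g z)) Kz Ho) as (d & Hd & H). exists d. split; [lra |].
   intros y Ky Hy Hn. apply Hn. left. assert (B := Re_sub_le (g y) (g z)).
   assert (A := H y Ky Hy). apply Rabs_le_between in B. lra.
  - destruct (Hg z (Rabs (Im (g z))) Kz ltac:(apply Rabs_pos_lt, Ho)) as (d & Hd & H).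
   exists d. split; [lra |]. intros y Ky Hy Hn. apply Hn. right. intros E.
   assert (A := H y Ky Hy). assert (B := Im_sub_le (g y) (g z)). rewrite E, Rabs_minus_sym, Rminus_0_r in B. lra. }
 destruct (ccompact_max K1 (fun z => - Re (g z)) z0 HK1) as (zs & [Kzs Ns] & Hs).
 { intros z eps [Kz _] He. destruct (Hg z eps Kz He) as (d & Hd & H). exists d. split; [lra |].
  intros y [Ky _] Hy. eapply Rle_lt_trans; [| apply (H y Ky Hy)].
  replace (- Re (g y) - - Re (g z)) with (- (Re (g y) - Re (g z))) by ring. rewrite Rabs_Ropp. apply Re_sub_le. }
 { split; [pos |]. rewrite E0. intros [A | A]; simpl in A; [lra | lra]. }
 set (s := - Re (g zs)). assert (Ezs : g zs = RtoC (- s)).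
 { apply C_eq; unfold s; simpl; [ring |]. apply NNPP. intros A. apply Ns. right. exact A. }
 assert (Hs0 : 0 <= s).
 { unfold s. apply Rnot_lt_le. intros A. apply Ns. left. lra. }
 assert (Hmaxs : forall z t, K z -> 0 <= t -> g z = RtoC (- t) -> t <= s).
 { intros z t Kz Ht Ez. assert (A := Hs z). rewrite Ez in A. unfold s. simpl in A.
  replace t with (- - t) by ring. apply A. split; [pos |]. rewrite Ez. intros [B | B]; simpl in B; [lra | lra]. }
 set (Kb := fun z => K z /\ ~ (hol g z /\ inner K z)).
 assert (Hdist : exists del, 0 < del /\ forall z t, Kb z -> 0 <= t -> del <= Cmod (g z + t)).
 { destruct (classic (exists zb, Kb zb)) as [[zb Hzb] | Hno].
  2:{ exists 1. split; [lra |]. intros z t Hz. destruct Hno. exists z. exact Hz. }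
  set (D := fun z => Rmax (Re (g z)) (Rabs (Im (g z)))). assert (HKb : ccompact Kb).
  { apply (ccompact_sub K (fun z => ~ (hol g z /\ inner K z)) HKc). intros z Kz Hn. apply NNPP in Hn.
   destruct Hn as [Hh (d & Hd & Hin)]. destruct (hol_near g z Hh) as (r & Hr & Hn).
   exists (Rmin d r). split; [pos |]. intros y Ky Hy Hny. apply Hny. destruct (Rmin_bounds d r) as [M1 M2].
   split; [apply Hn; lra |]. exists (d - Cmod (y - z)). split; [lra |].
   intros x Hx. apply Hin. generalize (Cmod_triangle_sub x y z). lra. }
  destruct (ccompact_max Kb (fun z => - D z) zb HKb) as (zm & Hzm & Hm).
  - intros z eps [Kz _] He. destruct (Hg z eps Kz He) as (d & Hd & H). exists d. split; [lra |].
   intros y [Ky _] Hy. eapply Rle_lt_trans; [| apply (H y Ky Hy)].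
   assert (A := Re_sub_le (g y) (g z)). assert (B := Im_sub_le (g y) (g z)).
   assert (B2 := Rabs_triang_inv2 (Im (g y)) (Im (g z))).
   apply Rabs_le_between in A. assert (B3 := Rle_trans _ _ _ B2 B). apply Rabs_le_between in B3.
   unfold D. apply Rabs_le.
   unfold Rmax. destruct (Rle_dec (Re (g y)) (Rabs (Im (g y)))), (Rle_dec (Re (g z)) (Rabs (Im (g z)))); lra.
  - pos.
  - exists (D zm). split.
   + destruct Hzm as [Kzm Hnm]. destruct (Hbd zm Kzm) as [Ho | Hi]; [| destruct (Hnm Hi)].
    unfold D. destruct Ho as [Ho | Ho].
    * eapply Rlt_le_trans; [exact Ho | apply Rmax_l].
    * eapply Rlt_le_trans; [apply Rabs_pos_lt, Ho | apply Rmax_r].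
   + intros z t Hz Ht. assert (A := Hm z Hz). apply Rle_trans with (D z); [lra |]. unfold D. apply Rmax_lub.
    * assert (B := re_le_Cmod (g z + t)%C). change (Re (g z + t)%C) with (Re (g z) + t) in B.
     apply Rabs_le_between in B. lra.
    * assert (B := Im_le_Cmod (g z + t)%C).
     change (Im (g z + t)%C) with (Im (g z) + 0) in B. rewrite Rplus_0_r in B. exact B. }
 (* At [zs] the modulus of 1 / (g + t) is 2 / del, on [Kb] it is at most 1 / del, and [eps] keeps
    the term eps |z|^2 below 1 / del^2. The maximum of [u] is at least 4 / del^2, so it sits at an
    interior point of holomorphy. *)
 destruct Hdist as (del & Hdel & Hdist). set (t := s + del / 2). assert (Hnz : forall z, K z -> (g z + t)%C <> 0%C).
 { intros z Kz E. assert (A : g z = RtoC (- t)).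
  { rewrite RtoC_opp. replace (g z) with ((g z + t) - t)%C by ring. rewrite E. ring. }
  generalize (Hmaxs z t Kz ltac:(unfold t; lra) A). unfold t. lra. }
 set (H := fun z => (/ (g z + t))%C). set (eps := / (del ^ 2 * (X ^ 2 + 1))). assert (Hd2 : 0 < del ^ 2) by pos.
 assert (HX2 : 0 <= X ^ 2) by pos. assert (Heps : 0 < eps) by (apply Rinv_0_lt_compat; nra).
 set (u := fun z => Cmod (H z) ^ 2 + eps * Cmod z ^ 2). assert (HcH : gcont_on K H).
 { intros z e Kz He. destruct (hol_ccont _ _ (hol_inv_pt _ (Hnz z Kz)) e He) as (d1 & Hd1 & A).
  destruct (Hg z d1 Kz Hd1) as (d2 & Hd2' & B). exists d2. split; [lra |].
  intros y Ky Hy. unfold H. apply A. replace (g y + t - (g z + t))%C with (g y - g z)%C by ring.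
  apply B; assumption. }
 assert (HuC : ccont_on K u).
 { intros z e Kz He. set (L := 2 * Cmod (H z) + 1 + eps * (2 * Cmod z + 1) + 1). assert (HL : 0 < L).
  { unfold L. generalize (Cmod_ge_0 (H z)) (Cmod_ge_0 z). intros. assert (0 <= eps * (2 * Cmod z + 1)) by pos. lra. }
  set (k := Rmin 1 (e / L)). destruct (Rmin_bounds 1 (e / L)) as [M1 M2]. fold k in M1, M2.
  assert (Hk : 0 < k) by (apply Rmin_pos; [lra | pos]). destruct (HcH z k Kz Hk) as (d & Hd & A).
  exists (Rmin d k). split; [pos |]. intros y Ky Hy. destruct (Rmin_bounds d k) as [M3 M4].
  assert (Sq : forall p q : C, Cmod (p - q) < k -> Rabs (Cmod p ^ 2 - Cmod q ^ 2) <= (2 * Cmod q + 1) * k).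
  { intros p q Hpq. assert (B := Rabs_Cmod_sub p q). assert (P := Cmod_ge_0 p). assert (Q := Cmod_ge_0 q).
   replace (Cmod p ^ 2 - Cmod q ^ 2) with ((Cmod p + Cmod q) * (Cmod p - Cmod q)) by ring.
   rewrite Rabs_mult. apply Rmult_le_compat; try apply Rabs_pos; [| lra].
   apply Rabs_le_between in B. rewrite Rabs_pos_eq; lra. }
  assert (S1 := Sq _ _ (A y Ky ltac:(lra))). assert (S2 := Sq y z ltac:(lra)). unfold u.
  replace (Cmod (H y) ^ 2 + eps * Cmod y ^ 2 - (Cmod (H z) ^ 2 + eps * Cmod z ^ 2))
   with ((Cmod (H y) ^ 2 - Cmod (H z) ^ 2) + eps * (Cmod y ^ 2 - Cmod z ^ 2)) by ring.
  eapply Rle_lt_trans; [apply Rabs_triang |]. rewrite Rabs_mult, (Rabs_pos_eq eps) by lra.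
  apply (Rmult_le_compat_l eps) in S2; [| lra]. apply Rle_div_r in M2; [| lra]. unfold L in M2. lra. }
 destruct (ccompact_max K u zs HKc HuC Kzs) as (zm & Kzm & Hm). assert (U1 : 4 / del ^ 2 <= u zm).
 { apply Rle_trans with (u zs); [| apply Hm, Kzs]. unfold u, H. rewrite Ezs.
  replace (RtoC (- s) + t)%C with (RtoC (del / 2)). 2:{ rewrite <- RtoC_plus. f_equal. unfold t. field. }
  rewrite Cmod_inv, Cmod_R, Rabs_pos_eq by (try lra; intros E; apply RtoC_inj in E; lra).
  assert (0 <= eps * Cmod zs ^ 2) by pos. replace (4 / del ^ 2) with ((/ (del / 2)) ^ 2) by (field; lra). lra. }
 destruct (classic (Kb zm)) as [Hb | Hb].
 - assert (A := Hdist zm t Hb ltac:(unfold t; lra)). assert (U2 : u zm <= / del ^ 2 + / del ^ 2).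
  { unfold u, H. rewrite Cmod_inv by (apply Hnz, Kzm). apply Rplus_le_compat.
   - rewrite pow_inv. apply Rinv_le_contravar; [lra |]. apply pow_incr. lra.
   - assert (B : Cmod zm ^ 2 <= X ^ 2) by (apply pow_incr; split; [pos | apply HX, Kzm]).
    apply Rle_trans with (eps * (X ^ 2 + 1)); [nra |]. right. unfold eps. field. split; lra. }
  assert (0 < / del ^ 2) by pos. replace (4 / del ^ 2) with (4 * / del ^ 2) in U1 by lra. lra.
 - assert (Hi : hol g zm /\ inner K zm).
  { apply NNPP. intros Hn. apply Hb. split; assumption. }
  destruct Hi as [Hh (d & Hd & Hin)]. apply (no_local_max H zm eps d); [| lra | lra |].
  + apply (hol_inv (fun z => g z + t)%C); [apply hol_plus; [pos | apply hol_const] | apply Hnz, Kzm].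
  + intros z Hz. apply Hm, Hin, Hz.
Qed.

(** * Differential inequalities *)

Lemma mvt (f df : R -> R) a b : a < b ->
 (forall x, a < x < b -> is_derive f x (df x)) -> (forall x, continuous f x) ->
 exists c, a < c < b /\ f b - f a = df c * (b - a).
Proof.
 intros Hab Hd Hc. assert (pr1 : forall c, a < c < b -> derivable_pt f c).
 { intros c Hcc. apply ex_derive_Reals_0. eexists. apply Hd, Hcc. }
 destruct (MVT f id a b pr1 (fun c _ => derivable_pt_id c) Hab) as (c & P & E).
 - intros c _. apply continuity_pt_filterlim, Hc.
 - intros c _. apply derivable_continuous_pt, derivable_pt_id.
 - exists c. split; [exact P |]. rewrite derive_pt_id in E. unfold id in E.
  assert (E2 : derive_pt f c (pr1 c P) = df c).
  { apply derive_pt_eq_0, is_derive_Reals, Hd, P. }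
  rewrite E2 in E. lra.
Qed.

Lemma nonincreasing (f df : R -> R) a b : a <= b ->
 (forall x, a < x < b -> is_derive f x (df x)) -> (forall x, continuous f x) ->
 (forall x, a < x < b -> df x <= 0) -> f b <= f a.
Proof.
 intros [Hab | ->] Hd Hc Hn; [| lra]. destruct (mvt f df a b Hab Hd Hc) as (c & P & E). specialize (Hn c P).
 assert (df c * (b - a) <= 0) by nra. lra.
Qed.

Lemma derive_compare (g dg h dh : R -> R) a b : a <= b ->
 (forall x, a < x < b -> is_derive g x (dg x)) -> (forall x, continuous g x) ->
 (forall x, a < x < b -> is_derive h x (dh x)) -> (forall x, continuous h x) ->
 (forall x, a < x < b -> Rabs (dg x) <= dh x) -> Rabs (g b - g a) <= h b - h a.
Proof.
 intros Hab Hg Cg Hh Ch H. assert (A := nonincreasing (fun x => g x - h x) (fun x => dg x - dh x) a b Hab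
   (fun x Hx => is_derive_Rminus _ _ _ _ _ (Hg x Hx) (Hh x Hx))
   (fun x => continuous_minus (V := R_NormedModule) _ _ x (Cg x) (Ch x))).
 assert (B := nonincreasing (fun x => - h x - g x) (fun x => - dh x - dg x) a b Hab
   (fun x Hx => is_derive_Rminus _ _ _ _ _ (is_derive_opp (V := R_NormedModule) _ _ _ (Hh x Hx)) (Hg x Hx))
   (fun x => continuous_minus (V := R_NormedModule) _ _ x (continuous_opp (V := R_NormedModule) _ x (Ch x)) (Cg x))).
 simpl in *. assert (A' := A ltac:(intros x Hx; specialize (H x Hx); apply Rabs_le_between in H; lra)).
 assert (B' := B ltac:(intros x Hx; specialize (H x Hx); apply Rabs_le_between in H; lra)). apply Rabs_le. lra.
Qed.

Lemma cder_compare phi v (h dh : R -> R) a b : a <= b -> cvcont phi ->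
 (forall x, a < x < b -> cder phi x (v x)) ->
 (forall x, a < x < b -> is_derive h x (dh x)) -> (forall x, continuous h x) ->
 (forall x, a < x < b -> Cmod (v x) <= dh x) -> Cmod (phi b - phi a) <= 2 * (h b - h a).
Proof.
 intros Hab Cphi Hd Hh Ch H. eapply Rle_trans; [apply Cmod_le_Re_Im |].
 assert (A := derive_compare (fun t => Re (phi t)) (fun t => Re (v t)) h dh a b Hab
  (fun x Hx => proj1 (Hd x Hx)) (fun x => proj1 (Cphi x)) Hh Ch
  (fun x Hx => Rle_trans _ _ _ (re_le_Cmod _) (H x Hx))).
 assert (B := derive_compare (fun t => Im (phi t)) (fun t => Im (v t)) h dh a b Hab
  (fun x Hx => proj2 (Hd x Hx)) (fun x => proj2 (Cphi x)) Hh Ch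
  (fun x Hx => Rle_trans _ _ _ (Im_le_Cmod _) (H x Hx))).
 change (Rabs (Re (phi b) - Re (phi a)) + Rabs (Im (phi b) - Im (phi a)) <= 2 * (h b - h a)). lra.
Qed.

(** The function D exp(- k (x - a)) - q (x - a) is nonincreasing, because the weight is at most 1
    and absorbs the forcing [q]. *)
Lemma gronwall_upper (D dD : R -> R) a b k q : a <= b -> 0 <= q -> 0 <= k ->
 (forall x, a < x < b -> is_derive D x (dD x)) -> (forall x, continuous D x) ->
 (forall x, a < x < b -> dD x <= k * D x + q) ->
 D b <= (D a + q * (b - a)) * exp (k * (b - a)).
Proof.
 intros Hab Hq Hk Hd Hc H. assert (A := nonincreasing (fun x => D x * exp (- k * (x - a)) - q * (x - a))
  (fun x => (dD x * exp (- k * (x - a)) + D x * (- k * exp (- k * (x - a)))) - q) a b Hab).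
 simpl in A. assert (A1 : D b * exp (- k * (b - a)) - q * (b - a) <= D a * exp (- k * (a - a)) - q * (a - a)).
 { apply A.
  - intros x Hx. apply (is_derive_Rminus (fun x => D x * exp (- k * (x - a))) (fun x => q * (x - a))).
   + apply (is_derive_Rmult D (fun x => exp (- k * (x - a)))); [apply Hd, Hx |].
    auto_derive; [exact I | unfold Rminus; ring].
   + auto_derive; [exact I | lra].
  - intros x.
   apply (continuous_minus (V := R_NormedModule) (fun x => D x * exp (- k * (x - a))) (fun x => q * (x - a))).
   + apply (continuous_mult (K := R_AbsRing) D (fun x => exp (- k * (x - a)))); [apply Hc |].
    apply (ex_derive_continuous (fun y => exp (- k * (y - a)))). auto_derive. exact I.
   + apply (ex_derive_continuous (fun y => q * (y - a))). auto_derive. exact I.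
  - intros x Hx. specialize (H x Hx). assert (E1 : exp (- k * (x - a)) <= 1).
   { rewrite <- exp_0. destruct (Rle_lt_or_eq_dec 0 k Hk) as [Hk1 | <-].
    - left. apply exp_increasing. nra.
    - right. f_equal. ring. }
   assert (E2 := exp_pos (- k * (x - a))). assert ((dD x - k * D x) * exp (- k * (x - a)) <= q * exp (- k * (x - a)))
    by nra.
   assert (q * exp (- k * (x - a)) <= q * 1) by nra. lra. }
 replace (- k * (a - a)) with 0 in A1 by ring. rewrite exp_0 in A1.
 assert (E : exp (- k * (b - a)) * exp (k * (b - a)) = 1).
 { rewrite <- exp_plus. replace (- k * (b - a) + k * (b - a)) with 0 by ring. apply exp_0. }
 assert (Hp := exp_pos (k * (b - a))). apply Rle_trans with (D b * exp (- k * (b - a)) * exp (k * (b - a))).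
 - rewrite Rmult_assoc, E. lra.
 - nra.
Qed.

(** This is the upper inequality for D run backwards in time. It shows that distinct solutions
    separate or approach at most exponentially, hence never meet. *)
Lemma gronwall_lower (D dD : R -> R) a b k : a <= b -> 0 <= k ->
 (forall x, a < x < b -> is_derive D x (dD x)) -> (forall x, continuous D x) ->
 (forall x, a < x < b -> - k * D x <= dD x) ->
 D a * exp (- k * (b - a)) <= D b.
Proof.
 intros Hab Hk Hd Hc H.
 assert (U := gronwall_upper (fun x => D (a + b - x)) (fun x => (0 - 1) * dD (a + b - x)) a b k 0 Hab (Rle_refl 0) Hk).
 cbv beta in U. replace (a + b - b) with a in U by ring. replace (a + b - a) with b in U by ring.
 assert (E : exp (k * (b - a)) * exp (- k * (b - a)) = 1).
 { rewrite <- exp_plus. replace (k * (b - a) + - k * (b - a)) with 0 by ring. apply exp_0. }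
 assert (Hp := exp_pos (- k * (b - a))). assert (V : D a <= (D b + 0 * (b - a)) * exp (k * (b - a))); [apply U |
  apply (Rmult_le_compat_r (exp (- k * (b - a)))) in V; [rewrite Rmult_assoc, E in V; lra | lra]].
 - intros x Hx. apply (is_derive_comp D (fun x => a + b - x)); [apply Hd; lra |].
  apply (is_derive_Rminus (fun _ => a + b) (fun x => x)); [apply (is_derive_const (a + b)) | apply (is_derive_id x)].
 - intros x. apply (continuous_comp (fun x => a + b - x) D); [| apply Hc].
  apply (continuous_minus (V := R_NormedModule)); [apply continuous_const | apply continuous_id].
 - intros x Hx. generalize (H (a + b - x) ltac:(lra)). lra.
Qed.

Definition sqdist (phi psi : R -> C) (t : R) : R := Cmod (phi t - psi t) * Cmod (phi t - psi t).

Lemma sqdist_derive phi psi u v t : cder phi t u -> cder psi t v ->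
 is_derive (sqdist phi psi) t
  (2 * (Re (phi t - psi t) * Re (u - v) + Im (phi t - psi t) * Im (u - v))).
Proof.
 intros Hu Hv. destruct (cder_minus _ _ _ _ _ Hu Hv) as [H1 H2].
 apply is_derive_ext with (fun s => Re (phi s - psi s) * Re (phi s - psi s) + Im (phi s - psi s) * Im (phi s - psi s)).
 - intros s. symmetry. apply Cmod2_Re_Im.
 - eapply is_derive_eq.
  + exact (is_derive_Rplus _ _ _ _ _ (is_derive_Rmult _ _ _ _ _ H1 H1) (is_derive_Rmult _ _ _ _ _ H2 H2)).
  + lra.
Qed.

Lemma sqdist_continuous phi psi t : cvcont phi -> cvcont psi -> continuous (sqdist phi psi) t.
Proof.
 intros H1 H2. unfold sqdist.
 apply (continuous_mult (K := R_AbsRing)); apply continuous_Cmod, cvcont_minus; assumption.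
Qed.

Lemma Re_Im_Cauchy_Schwarz (z w : C) : Rabs (Re z * Re w + Im z * Im w) <= Cmod z * Cmod w.
Proof.
 rewrite <- (Cmod_conj w), <- Cmod_mult.
 replace (Re z * Re w + Im z * Im w) with (Re (z * Cconj w)) by (unfold Re, Im; simpl; ring). apply re_le_Cmod.
Qed.

Lemma Re_Im_bound (z v : C) B : Cmod v <= B -> Rabs (Re z * Re v + Im z * Im v) <= Cmod z * B.
Proof.
 intros H. eapply Rle_trans; [apply Re_Im_Cauchy_Schwarz |]. apply Rmult_le_compat_l; [pos | exact H].
Qed.

(** The squared distance is used because it is differentiable also where the curves meet; the
    inequality 2 q d <= d^2 + q^2 turns the forcing into the rate 2 L + 1. *)
Lemma gronwall_curves phi psi u v a b L q : a <= b -> 0 <= L -> 0 <= q -> cvcont phi -> cvcont psi ->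
 (forall t, a < t < b -> cder phi t (u t)) -> (forall t, a < t < b -> cder psi t (v t)) ->
 (forall t, a < t < b -> Cmod (u t - v t) <= L * Cmod (phi t - psi t) + q) ->
 sqdist phi psi b <= (sqdist phi psi a + q * q * (b - a)) * exp ((2 * L + 1) * (b - a)).
Proof.
 intros Hab HL Hq C1 C2 H1 H2 H.
 apply (gronwall_upper _ (fun t => 2 * (Re (phi t - psi t) * Re (u t - v t) + Im (phi t - psi t) * Im (u t - v t))));
  [exact Hab | nra | lra | | intros; apply sqdist_continuous; assumption |]; intros t Ht.
 - apply sqdist_derive; [apply H1, Ht | apply H2, Ht].
 - assert (A := Re_Im_bound (phi t - psi t) _ _ (H t Ht)). apply Rabs_le_between in A. unfold sqdist.
  generalize (Rle_0_sqr (Cmod (phi t - psi t) - q)). unfold Rsqr. nra.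
Qed.

Lemma gronwall_curves_lower phi psi u v a b L : a <= b -> 0 <= L -> cvcont phi -> cvcont psi ->
 (forall t, a < t < b -> cder phi t (u t)) -> (forall t, a < t < b -> cder psi t (v t)) ->
 (forall t, a < t < b -> Cmod (u t - v t) <= L * Cmod (phi t - psi t)) ->
 sqdist phi psi a * exp (- (2 * L) * (b - a)) <= sqdist phi psi b.
Proof.
 intros Hab HL C1 C2 H1 H2 H.
 apply (gronwall_lower _ (fun t => 2 * (Re (phi t - psi t) * Re (u t - v t) + Im (phi t - psi t) * Im (u t - v t))));
  [exact Hab | lra | | intros; apply sqdist_continuous; assumption |]; intros t Ht.
 - apply sqdist_derive; [apply H1, Ht | apply H2, Ht].
 - assert (A := Re_Im_bound (phi t - psi t) _ _ (H t Ht)). apply Rabs_le_between in A. unfold sqdist. nra.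
Qed.

(** * Continuity method and barriers *)

(** Induction along an interval: the set of good times extends to the right of each of its points
    and contains its limits. It propagates bounds that are only known to hold as long as they have
    held so far. *)
Lemma real_ind a b (P : R -> Prop) : P a ->
 (forall t, a <= t < b -> (forall s, a <= s <= t -> P s) ->
   exists d, 0 < d /\ forall s, t < s < t + d -> s <= b -> P s) ->
 (forall t, a < t <= b -> (forall s, a <= s < t -> P s) -> P t) ->
 forall t, a <= t <= b -> P t.
Proof.
 intros Ha Ho Hc t0 Ht0. set (E := fun t => a <= t <= b /\ forall s, a <= s <= t -> P s).
 destruct (completeness E) as [T [HT1 HT2]].
 { exists b. intros t [H _]. lra. }
 { exists a. split; [lra |]. intros s Hs. replace s with a by lra. exact Ha. }
 assert (HaT : a <= T).
 { apply HT1. split; [lra |]. intros s Hs. replace s with a by lra. exact Ha. }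
 assert (HTb : T <= b) by (apply HT2; intros t [H _]; lra). assert (HlT : forall s, a <= s < T -> P s).
 { intros s Hs. apply NNPP. intros Hn. assert (A : T <= s); [| lra]. apply HT2. intros t [Ht1 Ht2].
  apply Rnot_lt_le. intros Hlt. apply Hn, Ht2. lra. }
 assert (HPT : forall s, a <= s <= T -> P s).
 { intros s Hs. destruct (Req_dec s T) as [-> | Hne]; [| apply HlT; lra].
  destruct (Req_dec a T) as [<- | Hne2]; [pos | apply Hc; [lra | pos]]. }
 destruct (Req_dec T b) as [-> | Hne]; [apply HPT; lra |]. exfalso. destruct (Ho T ltac:(lra) HPT) as (d & Hd & H).
 set (t1 := Rmin (T + d / 2) b). destruct (Rmin_bounds (T + d / 2) b) as [M1 M2].
 assert (Ht1 : T < t1) by (apply Rmin_glb_lt; lra). fold t1 in M1, M2.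
 assert (A : t1 <= T); [| lra]. apply HT1. split; [lra |].
 intros s Hs. destruct (Rle_dec s T); [apply HPT; lra | apply H; lra].
Qed.

Lemma continuous_pos (g : R -> R) t k : continuous g t -> k < g t ->
 exists d, 0 < d /\ forall s, Rabs (s - t) < d -> k < g s.
Proof.
 intros H Hk. destruct (proj1 (continuous_eps g t) H (g t - k) ltac:(lra)) as (d & Hd & A).
 exists d. split; [lra |]. intros s Hs. specialize (A s Hs). apply Rabs_lt_between in A. lra.
Qed.

(** Two barriers are treated together because each derivative has a known sign only where the other
    function is nonnegative, as at the two sides of a sector. The sign conditions cover the end
    times, where the functions need not be differentiable; the mean value theorem with continuous
    [d1], [d2] bridges this. *)
Lemma barrier2 (g1 d1 g2 d2 : R -> R) a b : a <= b ->
 (forall t, continuous g1 t) -> (forall t, continuous g2 t) ->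
 (forall t, continuous d1 t) -> (forall t, continuous d2 t) ->
 (forall t, a < t < b -> is_derive g1 t (d1 t)) -> (forall t, a < t < b -> is_derive g2 t (d2 t)) ->
 0 <= g1 a -> 0 <= g2 a ->
 (forall t, a <= t <= b -> g1 t = 0 -> 0 <= g2 t -> 0 < d1 t) ->
 (forall t, a <= t <= b -> g2 t = 0 -> 0 <= g1 t -> 0 < d2 t) ->
 forall t, a <= t <= b -> 0 <= g1 t /\ 0 <= g2 t /\ (a < t -> 0 < g1 t /\ 0 < g2 t).
Proof.
 intros Hab Cg1 Cg2 Cd1 Cd2 D1 D2 I1 I2 B1 B2.
 assert (Fwd : forall (g d : R -> R) t, (forall t, continuous g t) -> (forall t, continuous d t) ->
  (forall t, a < t < b -> is_derive g t (d t)) -> a <= t < b -> 0 <= g t -> (g t = 0 -> 0 < d t) ->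
  exists e, 0 < e /\ forall s, t < s < t + e -> s <= b -> 0 <= g s).
 { intros g d t Cg Cd D Ht Hg Hz. destruct (Req_dec (g t) 0) as [E | E].
  - destruct (continuous_pos d t 0 (Cd t) (Hz E)) as (e & He & A). exists e. split; [lra |].
   intros s Hs Hsb. destruct (mvt g d t s ltac:(lra)) as (c & Hcc & Ec).
   + intros x Hx. apply D. lra.
   + pos.
   + assert (0 < d c) by (apply A; rewrite Rabs_pos_eq; lra). nra.
  - destruct (continuous_pos g t 0 (Cg t) ltac:(lra)) as (e & He & A). exists e. split; [lra |].
   intros s Hs _. left. apply A. rewrite Rabs_pos_eq; lra. }
 assert (W : forall t, a <= t <= b -> 0 <= g1 t /\ 0 <= g2 t).
 { apply (real_ind a b (fun t => 0 <= g1 t /\ 0 <= g2 t)).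
  - lra.
  - intros t Ht Hall. destruct (Hall t ltac:(lra)) as [P1 P2].
   destruct (Fwd g1 d1 t Cg1 Cd1 D1 Ht P1 (fun E => B1 t ltac:(lra) E P2)) as (e1 & He1 & A1).
   destruct (Fwd g2 d2 t Cg2 Cd2 D2 Ht P2 (fun E => B2 t ltac:(lra) E P1)) as (e2 & He2 & A2).
   exists (Rmin e1 e2). destruct (Rmin_bounds e1 e2) as [M1 M2].
   split; [pos |]. intros s Hs Hsb. split; [apply A1 | apply A2]; lra.
  - intros t Ht Hall.
   assert (Cl : forall g : R -> R, (forall t, continuous g t) -> (forall s, a <= s < t -> 0 <= g s) -> 0 <= g t).
   { intros g Cg Hg. apply Rnot_lt_le. intros Hlt. destruct (continuous_pos (fun s => - g s) t 0) as (e & He & A).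
    - apply (continuous_opp (V := R_NormedModule)), Cg.
    - lra.
    - set (s := Rmax a (t - e / 2)). destruct (Rmax_bounds a (t - e / 2)) as [M1 M2].
     fold s in M1, M2. assert (Hs : s < t) by (apply Rmax_lub_lt; lra).
     assert (Z := A s ltac:(rewrite Rabs_left; lra)). assert (Y := Hg s ltac:(lra)). lra. }
   split; apply Cl; try assumption; intros s Hs; apply Hall; lra. }
 assert (Str : forall (g d : R -> R) t, (forall t, continuous g t) -> (forall t, continuous d t) ->
  (forall t, a < t < b -> is_derive g t (d t)) -> a < t <= b -> (forall s, a <= s <= b -> 0 <= g s) ->
  (g t = 0 -> 0 < d t) -> 0 < g t).
 { intros g d t Cg Cd D Ht Hg Hz. destruct (Hg t ltac:(lra)) as [Hp | E]; [lra |]. exfalso.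
  destruct (continuous_pos d t 0 (Cd t) (Hz (eq_sym E))) as (e & He & A).
  set (s := Rmax a (t - e / 2)). destruct (Rmax_bounds a (t - e / 2)) as [M1 M2].
  fold s in M1, M2. assert (Hs : s < t) by (apply Rmax_lub_lt; lra). destruct (mvt g d s t Hs) as (c & Hcc & Ec).
  - intros x Hx. apply D. lra.
  - pos.
  - assert (0 < d c) by (apply A; rewrite Rabs_left; lra). generalize (Hg s ltac:(lra)). nra. }
 intros t Ht. destruct (W t Ht) as [P1 P2]. split; [lra | split; [lra |]]. intros Hat. split.
 - apply (Str g1 d1 t Cg1 Cd1 D1); [lra | intros; apply W; assumption | intros E; apply B1; lra].
 - apply (Str g2 d2 t Cg2 Cd2 D2); [lra | intros; apply W; assumption | intros E; apply B2; lra].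
Qed.

Lemma barrier (g d : R -> R) a b : a <= b ->
 (forall t, continuous g t) -> (forall t, continuous d t) ->
 (forall t, a < t < b -> is_derive g t (d t)) -> 0 <= g a ->
 (forall t, a <= t <= b -> g t = 0 -> 0 < d t) ->
 forall t, a <= t <= b -> 0 <= g t /\ (a < t -> 0 < g t).
Proof.
 intros Hab Cg Cd D I B t Ht.
 destruct (barrier2 g d g d a b Hab Cg Cg Cd Cd D D I I) with (t := t) as (P1 & _ & P2); auto. split; [lra | lra].
Qed.

Lemma continuous_bounded (g : R -> R) a b : a <= b -> (forall t, continuous g t) ->
 exists m, a <= m <= b /\ forall t, a <= t <= b -> g t <= g m.
Proof.
 intros Hab Hg. destruct (continuity_ab_maj g a b Hab) as (m & Hm & Hr).
 - intros c _. apply continuity_pt_filterlim, Hg.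
 - exists m. split; [lra | pos].
Qed.

(** The time s is the supremum of the times at level at most k: an estimate valid far out can be
    started at the last passage through its threshold. *)
Lemma last_below (g : R -> R) a b k : a <= b -> (forall t, continuous g t) -> k <= g b ->
 (forall t, a <= t <= b -> k <= g t) \/
 exists s, a <= s <= b /\ g s = k /\ forall t, s <= t <= b -> k <= g t.
Proof.
 intros Hab Cg Hk. destruct (classic (forall t, a <= t <= b -> k <= g t)) as [H | H]; [left; exact H | right].
 destruct (completeness (fun t => a <= t <= b /\ g t <= k)) as [S [HS1 HS2]].
 { exists b. intros t [Ht _]. lra. }
 { apply NNPP. intros Hn. apply H. intros t Ht. apply Rnot_lt_le. intros Hlt. apply Hn. exists t. lra. }
 assert (HSb : S <= b) by (apply HS2; intros t [Ht _]; lra). assert (HaS : a <= S).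
 { apply NNPP. intros Hn. apply H. intros t Ht. apply Rnot_lt_le. intros Hlt.
  generalize (HS1 t). intros A. assert (t <= S) by lra. lra. }
 assert (Habove : forall t, S < t <= b -> k <= g t).
 { intros t Ht. apply Rnot_lt_le. intros Hlt. assert (t <= S) by (apply HS1; lra). lra. }
 assert (HgS : g S <= k).
 { apply Rnot_lt_le. intros Hlt. destruct (continuous_pos g S k (Cg S) Hlt) as (d & Hd & A).
  assert (B : S <= S - d); [| lra]. apply HS2. intros t [Ht Hgt]. apply Rnot_lt_le. intros Hl2.
  assert (t <= S) by (apply HS1; lra). assert (k < g t) by (apply A; rewrite Rabs_left1; lra). lra. }
 assert (HgS2 : k <= g S).
 { destruct (Req_dec S b) as [-> | Hne]; [lra |]. apply Rnot_lt_le. intros Hlt.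
  destruct (continuous_pos (fun s => - g s) S (- k)) as (d & Hd & A).
  - apply (continuous_opp (V := R_NormedModule)), Cg.
  - lra.
  - set (t := Rmin b (S + d / 2)). destruct (Rmin_bounds b (S + d / 2)) as [M1 M2].
   fold t in M1, M2. assert (S < t) by (apply Rmin_glb_lt; lra).
   assert (Z := A t ltac:(rewrite Rabs_pos_eq; lra)). assert (Y := Habove t ltac:(lra)). lra. }
 exists S. split; [lra | split; [lra |]].
 intros t Ht. destruct (Req_dec t S) as [-> | Hne]; [lra | apply Habove; lra].
Qed.

(** * Existence of solutions *)

Lemma cvcont_reparam phi (g : R -> R) : cvcont phi -> (forall t, continuous g t) -> cvcont (fun t => phi (g t)).
Proof.
 intros H Hg. apply cvcont_eps. intros t eps He. destruct (proj1 (cvcont_eps phi) H (g t) eps He) as (d & Hd & K).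
 destruct (proj1 (continuous_eps g t) (Hg t) d Hd) as (e & He' & K2).
 exists e. split; [lra |]. intros s Hs. apply K, K2, Hs.
Qed.

Lemma cder_ext_open phi psi a b t v : a < t < b -> (forall s, a < s < b -> phi s = psi s) ->
 cder phi t v -> cder psi t v.
Proof.
 intros Ht E H. apply cder_eps. intros eps He. destruct (proj1 (cder_eps _ _ _) H eps He) as (d & Hd & K).
 exists (Rmin d (Rmin (t - a) (b - t))). split; [pos |].
 intros s Hs. destruct (Rmin_bounds d (Rmin (t - a) (b - t))) as [M1 M2].
 destruct (Rmin_bounds (t - a) (b - t)) as [M3 M4].
 assert (Hs' : Rabs (s - t) < Rmin (t - a) (b - t)) by lra. apply Rabs_lt_between in Hs'.
 rewrite <- !E by lra. apply K. lra.
Qed.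

Lemma cder_prim f t : cvcont f -> cder (fun s => CInt f 0 s) t (f t).
Proof.
 intros H. assert (K : forall g : R -> R, (forall s, continuous g s) -> is_derive (fun s => RInt g 0 s) t (g t)).
 { intros g Hg. apply (is_derive_RInt (V := R_NormedModule) g (fun s => RInt g 0 s) 0); [| apply Hg].
  apply filter_forall. intros s. apply (RInt_correct (V := R_CompleteNormedModule)).
  apply (ex_RInt_continuous (V := R_CompleteNormedModule)). intros x _. apply Hg. }
 split; [exact (K (fun s => Re (f s)) (fun s => proj1 (H s))) | exact (K (fun s => Im (f s)) (fun s => proj2 (H s)))].
Qed.

Lemma cder_cvcont phi v : (forall t, cder phi t (v t)) -> cvcont phi.
Proof.
 intros H t. destruct (H t) as [H1 H2].
 split; apply (ex_derive_continuous (K := R_AbsRing) (V := R_NormedModule)); eexists; eassumption.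
Qed.

Lemma CInt_0 f : CInt f 0 0 = 0%C.
Proof. unfold CInt. rewrite !RInt_point. reflexivity. Qed.

Definition clamp (w t : R) : R := Rmax 0 (Rmin w t).

Lemma clamp_in w t : 0 <= w -> 0 <= clamp w t <= w.
Proof. intros H. unfold clamp, Rmax, Rmin. destruct (Rle_dec w t), (Rle_dec 0 _); lra. Qed.

Lemma clamp_id w t : 0 <= t <= w -> clamp w t = t.
Proof. intros H. unfold clamp, Rmax, Rmin. destruct (Rle_dec w t), (Rle_dec 0 _); lra. Qed.

Lemma Rmax_lip k x y : Rabs (Rmax k x - Rmax k y) <= Rabs (x - y).
Proof.
 unfold Rmax. destruct (Rle_dec k x), (Rle_dec k y); unfold Rabs; repeat destruct Rcase_abs; lra.
Qed.

Lemma Rmin_lip k x y : Rabs (Rmin k x - Rmin k y) <= Rabs (x - y).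
Proof.
 unfold Rmin. destruct (Rle_dec k x), (Rle_dec k y); unfold Rabs; repeat destruct Rcase_abs; lra.
Qed.

Lemma clamp_lip w s t : Rabs (clamp w s - clamp w t) <= Rabs (s - t).
Proof. eapply Rle_trans; [apply Rmax_lip | apply Rmin_lip]. Qed.

Lemma clamp_continuous w t : continuous (clamp w) t.
Proof.
 apply continuous_eps. intros eps He. exists eps. split; [lra |].
 intros s Hs. eapply Rle_lt_trans; [apply clamp_lip | lra].
Qed.

Lemma geometric_small E eps : 0 <= E -> 0 < eps -> exists N, forall k, (N <= k)%nat -> 2 * E / 2 ^ k < eps.
Proof.
 intros HE He. destruct (archimed_cor1 (eps / (2 * E + 1))) as (N & HN & HN0); [pos |].
 exists N. intros k Hk. assert (HN' : 0 < INR N) by (apply lt_0_INR, HN0). assert (A : INR N <= 2 ^ k).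
 { apply Rle_trans with (INR k); [apply le_INR, Hk |].
  clear. induction k as [| k IH]; [simpl; lra |]. rewrite S_INR. simpl.
  assert (1 <= 2 ^ k) by (apply pow_R1_Rle; lra). lra. }
 apply Rle_lt_trans with (2 * E * / INR N).
 - unfold Rdiv. apply Rmult_le_compat_l; [lra |]. apply Rinv_le_contravar; lra.
 - apply Rlt_div_r in HN; [| lra]. assert (0 < / INR N) by pos. lra.
Qed.

Lemma Cauchy_geometric (y : nat -> C) E :
 (forall k, Cmod (y (S k) - y k) <= E / 2 ^ k) ->
 exists l, forall k, Cmod (l - y k) <= 2 * E / 2 ^ k.
Proof.
 intros H. assert (H2 : forall k, 0 < 2 ^ k) by (intros; apply pow_lt; lra). assert (HE : 0 <= E).
 { assert (A := H O). simpl in A. generalize (Cmod_ge_0 (y 1%nat - y 0%nat)). lra. }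
 assert (K : forall p k, Cmod (y (k + p)%nat - y k) <= 2 * E / 2 ^ k - 2 * E / 2 ^ (k + p)).
 { induction p as [| p IH]; intros k.
  - rewrite Nat.add_0_r. rewrite Cmod_sub_diag. lra.
  - eapply Rle_trans; [apply (Cmod_triangle_sub _ (y (k + p)%nat)) |]. replace (k + S p)%nat with (S (k + p)) by lia.
   assert (A := H (k + p)%nat). assert (B := IH k). simpl (2 ^ S (k + p)). assert (P := H2 (k + p)%nat).
   replace (2 * E / (2 * 2 ^ (k + p))) with (E / 2 ^ (k + p)) by (field; lra).
   replace (2 * E / 2 ^ (k + p)) with (E / 2 ^ (k + p) + E / 2 ^ (k + p)) in B by lra. lra. }
 assert (K' : forall k j, (k <= j)%nat -> Cmod (y j - y k) <= 2 * E / 2 ^ k).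
 { intros k j Hkj. replace j with (k + (j - k))%nat by lia. eapply Rle_trans; [apply K |].
  assert (0 <= 2 * E / 2 ^ (k + (j - k))) by (apply Rdiv_le_0_compat; [lra | pos]). lra. }
 assert (G : forall f : C -> R, (forall u v, Rabs (f u - f v) <= Cmod (u - v)) ->
   exists l : R, is_lim_seq (fun k => f (y k)) l).
 { intros f Hf. assert (X : ex_finite_lim_seq (fun k => f (y k))).
  { apply ex_lim_seq_cauchy_corr. intros eps. destruct (geometric_small E eps HE (cond_pos eps)) as [N HN]. exists N.
   assert (T : forall k j, (N <= k)%nat -> (k <= j)%nat -> Rabs (f (y j) - f (y k)) < eps).
   { intros k j Hk Hj. eapply Rle_lt_trans; [apply Hf |]. eapply Rle_lt_trans; [apply K', Hj | apply HN, Hk]. }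
   intros k j Hk Hj. destruct (Nat.le_ge_cases k j).
   - rewrite Rabs_minus_sym. apply T; assumption.
   - apply T; assumption. }
  destruct X as [l Hl]. exists l. exact Hl. }
 destruct (G Re) as [l1 L1]; [intros u v; apply (re_le_Cmod (u - v)%C) |].
 destruct (G Im) as [l2 L2]; [intros u v; apply (Im_le_Cmod (u - v)%C) |].
 exists (l1, l2). intros k. apply Rnot_lt_le. intros Hlt. set (eps := (Cmod ((l1, l2) - y k) - 2 * E / 2 ^ k) / 2).
 assert (He : 0 < eps) by (unfold eps; lra). apply is_lim_seq_spec in L1. apply is_lim_seq_spec in L2.
 assert (He2 : 0 < eps / 2) by lra.
 destruct (L1 (mkposreal _ He2)) as [N1 A1]. destruct (L2 (mkposreal _ He2)) as [N2 A2]. simpl in A1, A2.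
 set (j := Nat.max k (Nat.max N1 N2)).
 assert (B1 := A1 j ltac:(unfold j; lia)). assert (B2 := A2 j ltac:(unfold j; lia)).
 assert (B3 := K' k j ltac:(unfold j; lia)). assert (B4 : Cmod ((l1, l2) - y j) < eps).
 { eapply Rle_lt_trans; [apply Cmod_le_Re_Im |]. change (Rabs (l1 - Re (y j)) + Rabs (l2 - Im (y j)) < eps).
  rewrite (Rabs_minus_sym l1), (Rabs_minus_sym l2). lra. }
 assert (B5 := Cmod_triangle_sub (l1, l2) (y j) (y k)). unfold eps in *. lra.
Qed.

(** Differences of iterates are measured with the weight exp(4 L t), which makes a Picard step halve
    them on the whole interval whatever its length; the rate is 4 L because the two components are
    estimated separately. *)
Lemma picard (X : R -> C -> C) L w c : 0 < L -> 0 < w ->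
 (forall t x y, Cmod (X t x - X t y) <= L * Cmod (x - y)) ->
 (forall phi, cvcont phi -> cvcont (fun t => X t (phi t))) ->
 exists phi, cvcont phi /\ phi 0 = c /\ forall t, 0 < t < w -> cder phi t (X t (phi t)).
Proof.
 intros HL Hw Hlip Hcont. set (step := fun (phi : R -> C) (t : R) => (c + CInt (fun s => X s (phi s)) 0 t)%C).
 assert (Dstep : forall phi, cvcont phi -> forall t, cder (step phi) t (X t (phi t))).
 { intros phi Hp t. unfold step. replace (X t (phi t)) with (0 + X t (phi t))%C by ring.
  apply cder_plus; [apply cder_const | apply cder_prim, Hcont, Hp]. }
 assert (Sstep : forall phi, step phi 0 = c) by (intros phi; unfold step; rewrite CInt_0; ring).
 set (y := fix y k := match k with O => fun _ : R => c | S k => step (y k) end). assert (Cy : forall k, cvcont (y k)).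
 { induction k as [| k IH]; [apply cvcont_const |]. apply (cder_cvcont _ _ (Dstep _ IH)). }
 assert (Y0 : forall k, y k 0 = c) by (intros [| k]; [reflexivity | apply Sstep]).
 destruct (continuous_bounded (fun t => Cmod (y 1%nat t - y 0%nat t)) 0 w ltac:(lra)) as (m & _ & Hm).
 { intros t. apply continuous_Cmod, cvcont_minus; apply Cy. }
 set (B := Cmod (y 1%nat m - y 0%nat m)) in Hm. assert (HB : 0 <= B) by apply Cmod_ge_0.
 assert (E4 : forall s : R, 0 <= s -> 1 <= exp (4 * L * s)).
 { intros s Hs. rewrite <- exp_0. destruct (Req_dec s 0) as [-> | Hne].
  - right. f_equal. ring.
  - left. apply exp_increasing. nra. }
 assert (H2 : forall k, 0 < 2 ^ k) by (intros; apply pow_lt; lra).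
 assert (K : forall k t, 0 <= t <= w -> Cmod (y (S k) t - y k t) <= B / 2 ^ k * exp (4 * L * t)).
 { induction k as [| k IH]; intros t Ht.
  - simpl (2 ^ 0). eapply Rle_trans; [apply (Hm t Ht) |]. generalize (E4 t ltac:(lra)). intros. nra.
  - assert (A := cder_compare (fun t => y (S (S k)) t - y (S k) t)%C
     (fun t => X t (y (S k) t) - X t (y k t))%C
     (fun t => B / 2 ^ k / 4 * exp (4 * L * t)) (fun t => B / 2 ^ k / 4 * (4 * L * exp (4 * L * t))) 0 t).
   assert (A' : Cmod (y (S (S k)) t - y (S k) t - (y (S (S k)) 0 - y (S k) 0))
     <= 2 * (B / 2 ^ k / 4 * exp (4 * L * t) - B / 2 ^ k / 4 * exp (4 * L * 0))).
   { apply A; clear A.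
    - lra.
    - apply cvcont_minus; apply Cy.
    - intros x Hx. apply cder_minus; apply Dstep, Cy.
    - intros x Hx. auto_derive; [exact I | ring].
    - intros x. apply (ex_derive_continuous (fun t => B / 2 ^ k / 4 * exp (4 * L * t))). auto_derive. exact I.
    - intros x Hx. eapply Rle_trans; [apply Hlip |].
     assert (Z := IH x ltac:(lra)). apply Rmult_le_compat_l with (r := L) in Z; [| lra].
     eapply Rle_trans; [exact Z |]. right. field. generalize (H2 k); lra. }
   rewrite !Y0 in A'. replace (y (S (S k)) t - y (S k) t - (c - c))%C with (y (S (S k)) t - y (S k) t)%C in A' by ring.
   eapply Rle_trans; [exact A' |]. simpl (2 ^ S k). rewrite Rmult_0_r, exp_0.
   assert (0 <= B / 2 ^ k) by (apply Rdiv_le_0_compat; [lra | pos]).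
   replace (B / (2 * 2 ^ k) * exp (4 * L * t)) with (B / 2 ^ k / 2 * exp (4 * L * t)) by (field; generalize (H2 k); lra).
   lra. }
 set (E := B * exp (4 * L * w)).
 (* The limit is taken along [clamp w t], so that the solution is defined and continuous on the
    whole line, constant outside the time interval. *)
 assert (Hlim : forall t, exists l, forall k, Cmod (l - y k (clamp w t)) <= 2 * E / 2 ^ k).
 { intros t. apply Cauchy_geometric. intros k. assert (Hc := clamp_in w t ltac:(lra)).
  eapply Rle_trans; [apply K, Hc |].
  replace (E / 2 ^ k) with (B / 2 ^ k * exp (4 * L * w)) by (unfold E; field; generalize (H2 k); lra).
  apply Rmult_le_compat_l; [apply Rdiv_le_0_compat; [lra | pos] |].
  destruct (Req_dec (clamp w t) w) as [-> | Hne]; [lra |]. left. apply exp_increasing. nra. }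
 assert (HE : 0 <= E) by (apply Rmult_le_pos; [lra | left; apply exp_pos]).
 set (phi := fun t => proj1_sig (constructive_indefinite_description _ (Hlim t))).
 assert (Hphi : forall t k, Cmod (phi t - y k (clamp w t)) <= 2 * E / 2 ^ k).
 { intros t. unfold phi. destruct (constructive_indefinite_description _ (Hlim t)) as [l Hl]. exact Hl. }
 assert (Small : forall eps, 0 < eps -> exists k, 2 * E / 2 ^ k < eps).
 { intros eps He. destruct (geometric_small E eps HE He) as [N HN]. exists N. apply HN, Nat.le_refl. }
 assert (Cphi : cvcont phi).
 { apply cvcont_eps. intros t eps He. destruct (Small (eps / 3) ltac:(lra)) as [k Hk].
  destruct (proj1 (cvcont_eps _) (cvcont_reparam (y k) (clamp w) (Cy k) (clamp_continuous w)) t (eps / 3) ltac:(lra)) as (d & Hd & A).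
  exists d. split; [lra |]. intros s Hs. eapply Rle_lt_trans; [apply (Cmod_triangle_sub _ (y k (clamp w s))) |].
  assert (A2 := Cmod_triangle_sub (y k (clamp w s)) (y k (clamp w t)) (phi t)).
  assert (A3 := Hphi s k). assert (A4 := Hphi t k). rewrite Cmod_sub_sym in A4. assert (A5 := A s Hs). lra. }
 assert (Fix : forall t, 0 <= t <= w -> phi t = step phi t).
 { intros t Ht. assert (Z : Cmod (phi t - step phi t) <= 0).
  { apply Rnot_lt_le. intros Hpos. set (Q := 1 + 2 * L * w). assert (HQ : 1 <= Q) by (unfold Q; nra).
   destruct (Small (Cmod (phi t - step phi t) / Q)) as [k Hk]; [pos |].
   assert (A1 := Hphi t (S k)). rewrite clamp_id in A1 by exact Ht.
   assert (A2 := cder_compare (fun t => y (S k) t - step phi t)%C (fun t => X t (y k t) - X t (phi t))%C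
    (fun t => L * (2 * E / 2 ^ k) * t) (fun t => L * (2 * E / 2 ^ k)) 0 t).
   assert (A3 : Cmod (y (S k) t - step phi t - (y (S k) 0 - step phi 0))
    <= 2 * (L * (2 * E / 2 ^ k) * t - L * (2 * E / 2 ^ k) * 0)).
   { apply A2; clear A2.
    - lra.
    - apply cvcont_minus; [apply Cy | apply (cder_cvcont _ _ (Dstep _ Cphi))].
    - intros x Hx. apply cder_minus; apply Dstep; [apply Cy | pos].
    - intros x Hx. auto_derive; [exact I | ring].
    - intros x. apply (ex_derive_continuous (fun t => L * (2 * E / 2 ^ k) * t)). auto_derive. exact I.
    - intros x Hx. eapply Rle_trans; [apply Hlip |]. apply Rmult_le_compat_l; [lra |].
     rewrite Cmod_sub_sym. assert (A4 := Hphi x k). rewrite clamp_id in A4 by lra. exact A4. }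
   rewrite Y0, Sstep in A3.
   replace (y (S k) t - step phi t - (c - c))%C with (y (S k) t - step phi t)%C in A3 by ring.
   assert (A5 := Cmod_triangle_sub (phi t) (y (S k) t) (step phi t)). assert (P := H2 k). simpl (2 ^ S k) in A1.
   replace (2 * E / (2 * 2 ^ k)) with (2 * E / 2 ^ k / 2) in A1 by (field; lra).
   assert (P2 : 0 <= 2 * E / 2 ^ k) by (apply Rdiv_le_0_compat; lra). apply Rlt_div_r in Hk; [| lra].
   assert (L * (2 * E / 2 ^ k) * t <= L * (2 * E / 2 ^ k) * w) by (apply Rmult_le_compat_l; nra).
   unfold Q in Hk. nra. }
  assert (E0 : (phi t - step phi t)%C = 0%C) by (apply Cmod_eq_0; generalize (Cmod_ge_0 (phi t - step phi t)); lra).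
  replace (phi t) with ((phi t - step phi t) + step phi t)%C by ring. rewrite E0. ring. }
 exists phi. split; [pos |]. split; [rewrite Fix by lra; apply Sstep |].
 intros t Ht. apply (cder_ext_open (step phi) phi 0 w); [lra | | apply Dstep, Cphi].
 intros s Hs. symmetry. apply Fix. lra.
Qed.

(** * Polynomial fields *)

(** The leading coefficient is an ordinary coefficient [A n], so that the time reversed and the
    reflected fields have the same shape. *)
Fixpoint Fld (A : nat -> R -> R) (n : nat) (t : R) (z : C) : C :=
 match n with
 | O => RtoC (A O t)
 | S k => (Fld A k t z + RtoC (A (S k) t) * z ^ S k)%C
 end.

(** The divided difference (x^k - y^k) / (x - y) as a polynomial, which makes sense on the diagonal
    too. *)
Fixpoint pdiff (x y : C) (k : nat) : C :=
 match k with O => 0%C | S k => (x * pdiff x y k + y ^ k)%C end.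

Lemma pdiff_spec x y k : (x ^ k - y ^ k = (x - y) * pdiff x y k)%C.
Proof.
 induction k as [| k IH]; [simpl; ring |]. simpl.
 replace (x * x ^ k - y * y ^ k)%C with (x * (x ^ k - y ^ k) + (x - y) * y ^ k)%C by ring. rewrite IH. ring.
Qed.

(** The divided difference of the field in z; on the diagonal it is the derivative, the coefficient
    of the variational equation. *)
Fixpoint Fdel (A : nat -> R -> R) (n : nat) (t : R) (x y : C) : C :=
 match n with
 | O => 0%C
 | S k => (Fdel A k t x y + RtoC (A (S k) t) * pdiff x y (S k))%C
 end.

Lemma Fdel_spec A n t x y : (Fld A n t x - Fld A n t y = (x - y) * Fdel A n t x y)%C.
Proof.
 induction n as [| n IH]; [simpl; ring |]. cbn [Fld Fdel].
 replace (Fld A n t x + RtoC (A (S n) t) * x ^ S n - (Fld A n t y + RtoC (A (S n) t) * y ^ S n))%C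
  with ((Fld A n t x - Fld A n t y) + RtoC (A (S n) t) * (x ^ S n - y ^ S n))%C by ring.
 rewrite IH, pdiff_spec. ring.
Qed.

(** Coefficients live on the whole line; clamping time makes those of the equation bounded there. *)
Definition good_sys (n : nat) (A : nat -> R -> R) : Prop :=
 (forall i t, (i <= n)%nat -> continuous (A i) t) /\
 exists B, 0 <= B /\ forall i t, (i <= n)%nat -> Rabs (A i t) <= B.

Lemma good_sys_S n A : good_sys (S n) A -> good_sys n A.
Proof.
 intros [H1 (B & HB & H2)]. split; [intros; apply H1; lia |]. exists B. split; [lra | intros; apply H2; lia].
Qed.

Lemma pdiff_bound M x y k : Cmod x <= M -> Cmod y <= M -> Cmod (pdiff x y k) <= INR k * M ^ (k - 1).
Proof.
 intros Hx Hy. induction k as [| k IH]; [simpl; rewrite Cmod_0; lra |]. cbn [pdiff].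
 eapply Rle_trans; [apply Cmod_triangle |]. rewrite Cmod_mult, Cmod_pow, S_INR. replace (S k - 1)%nat with k by lia.
 assert (A : Cmod y ^ k <= M ^ k) by (apply pow_incr; split; [pos | lra]).
 assert (B := Rmult_le_compat _ _ _ _ (Cmod_ge_0 x) (Cmod_ge_0 _) Hx IH). destruct k as [| k]; [simpl in *; lra |].
 replace (S k - 1)%nat with k in B by lia. simpl (M ^ S k) in *. lra.
Qed.

Lemma pdiff_lip M k : 0 <= M -> exists L, 0 <= L /\ forall x x' y,
 Cmod x <= M -> Cmod x' <= M -> Cmod y <= M -> Cmod (pdiff x y k - pdiff x' y k) <= L * Cmod (x - x').
Proof.
 intros HM. induction k as [| k (L & HL & H)].
 - exists 0. split; [lra |]. intros. simpl. rewrite Cmod_sub_diag. lra.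
 - exists (M * L + INR k * M ^ (k - 1)). split.
  { assert (0 <= M ^ (k - 1)) by pos. generalize (pos_INR k). intros. nra. }
  intros x x' y Hx Hx' Hy. cbn [pdiff]. replace (x * pdiff x y k + y ^ k - (x' * pdiff x' y k + y ^ k))%C
   with (x * (pdiff x y k - pdiff x' y k) + (x - x') * pdiff x' y k)%C by ring.
  eapply Rle_trans; [apply Cmod_triangle |]. rewrite !Cmod_mult.
  assert (A := H x x' y Hx Hx' Hy). assert (B := pdiff_bound M x' y k Hx' Hy).
  assert (T1 := Rmult_le_compat _ _ _ _ (Cmod_ge_0 x) (Cmod_ge_0 _) Hx A).
  assert (T2 := Rmult_le_compat_l _ _ _ (Cmod_ge_0 (x - x')) B). lra.
Qed.

Lemma Fdel_bound n A M : good_sys n A -> 0 <= M -> exists L, 0 < L /\ forall t x y,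
 Cmod x <= M -> Cmod y <= M -> Cmod (Fdel A n t x y) <= L.
Proof.
 intros HA HM. induction n as [| n IH].
 - exists 1. split; [lra |]. intros. simpl. rewrite Cmod_0. lra.
 - destruct IH as (L & HL & H); [apply good_sys_S, HA |]. destruct HA as [_ (B & HB & HA)].
  assert (HP : 0 <= INR (S n) * M ^ (S n - 1)) by (apply Rmult_le_pos; [apply pos_INR | pos]).
  exists (L + B * (INR (S n) * M ^ (S n - 1))). split; [nra |]. intros t x y Hx Hy. cbn [Fdel].
  eapply Rle_trans; [apply Cmod_triangle |]. rewrite Cmod_mult, Cmod_R.
  apply Rplus_le_compat; [apply H; assumption |].
  apply Rmult_le_compat; [pos | pos | apply HA; lia | apply pdiff_bound; assumption].
Qed.

Lemma Fdel_lip n A M : good_sys n A -> 0 <= M -> exists L, 0 < L /\ forall t x x' y,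
 Cmod x <= M -> Cmod x' <= M -> Cmod y <= M ->
 Cmod (Fdel A n t x y - Fdel A n t x' y) <= L * Cmod (x - x').
Proof.
 intros HA HM. induction n as [| n IH].
 - exists 1. split; [lra |]. intros. simpl. rewrite Cmod_sub_diag. generalize (Cmod_ge_0 (x - x')). lra.
 - destruct IH as (L & HL & H); [apply good_sys_S, HA |]. destruct HA as [_ (B & HB & HA)].
  destruct (pdiff_lip M (S n) HM) as (L2 & HL2 & H2). exists (L + B * L2). split; [nra |].
  intros t x x' y Hx Hx' Hy. cbn [Fdel].
  replace (Fdel A n t x y + RtoC (A (S n) t) * pdiff x y (S n) - (Fdel A n t x' y + RtoC (A (S n) t) * pdiff x' y (S n)))%C
   with ((Fdel A n t x y - Fdel A n t x' y) + RtoC (A (S n) t) * (pdiff x y (S n) - pdiff x' y (S n)))%C by ring.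
  eapply Rle_trans; [apply Cmod_triangle |]. rewrite Cmod_mult, Cmod_R. assert (T1 := H t x x' y Hx Hx' Hy).
  assert (T2 := Rmult_le_compat _ _ _ _ (Rabs_pos _) (Cmod_ge_0 _) (HA (S n) t (Nat.le_refl _)) (H2 x x' y Hx Hx' Hy)).
  lra.
Qed.

Lemma Fld_cvcont n A phi : good_sys n A -> cvcont phi -> cvcont (fun t => Fld A n t (phi t)).
Proof.
 intros HA Hp. induction n as [| n IH].
 - apply cvcont_RtoC. intros t. apply HA. lia.
 - cbn [Fld]. apply cvcont_plus; [apply IH, good_sys_S, HA |].
  apply cvcont_mult; [| apply cvcont_pow, Hp]. apply cvcont_RtoC. intros t. apply HA. lia.
Qed.

Lemma pdiff_cvcont f g k : cvcont f -> cvcont g -> cvcont (fun t => pdiff (f t) (g t) k).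
Proof.
 intros Hf Hg. induction k as [| k IH]; [exact (cvcont_const 0%C) |]. cbn [pdiff].
 apply cvcont_plus; [apply cvcont_mult; assumption | apply cvcont_pow, Hg].
Qed.

Lemma Fdel_cvcont n A f g : good_sys n A -> cvcont f -> cvcont g -> cvcont (fun t => Fdel A n t (f t) (g t)).
Proof.
 intros HA Hf Hg. induction n as [| n IH]; [exact (cvcont_const 0%C) |]. cbn [Fdel].
 apply cvcont_plus; [apply IH, good_sys_S, HA |]. apply cvcont_mult; [| apply (pdiff_cvcont f g (S n)); assumption].
 apply cvcont_RtoC. intros t. apply HA. lia.
Qed.

Lemma Cconj_RtoC x : Cconj (RtoC x) = RtoC x.
Proof. apply C_eq; unfold Re, Im; simpl; ring. Qed.

Lemma Fld_conj A n t z : Fld A n t (Cconj z) = Cconj (Fld A n t z).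
Proof.
 induction n as [| n IH]; [simpl Fld; symmetry; apply Cconj_RtoC |]. cbn [Fld].
 rewrite Cplus_conj, Cmult_conj, Cconj_RtoC, Cpow_conj, IH. reflexivity.
Qed.

(** * Truncation and the flow *)

(* Clamping both coordinates makes the polynomial field globally Lipschitz
   without changing it on the disc of radius [M]. *)
Definition cl (M x : R) : R := Rmax (- M) (Rmin M x).
Definition box (M : R) (z : C) : C := (cl M (Re z), cl M (Im z)).

Lemma cl_lip M x y : Rabs (cl M x - cl M y) <= Rabs (x - y).
Proof. eapply Rle_trans; [apply Rmax_lip | apply Rmin_lip]. Qed.

Lemma cl_bound M x : 0 <= M -> Rabs (cl M x) <= M.
Proof.
 intros H. apply Rabs_le. unfold cl, Rmax, Rmin. destruct (Rle_dec M x); destruct Rle_dec; lra.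
Qed.

Lemma cl_id M x : Rabs x <= M -> cl M x = x.
Proof.
 intros H. apply Rabs_le_between in H. unfold cl, Rmax, Rmin. destruct (Rle_dec M x); destruct Rle_dec; lra.
Qed.

Lemma box_lip M x y : Cmod (box M x - box M y) <= Cmod (x - y).
Proof.
 apply Rsqr_incr_0_var; [| pos]. unfold Rsqr. rewrite !Cmod2_Re_Im.
 apply Rplus_le_compat; apply Rsqr_le_abs_1; [apply (cl_lip M (Re x) (Re y)) | apply (cl_lip M (Im x) (Im y))].
Qed.

Lemma box_bound M x : 0 <= M -> Cmod (box M x) <= 2 * M.
Proof.
 intros H. eapply Rle_trans; [apply Cmod_le_Re_Im |]. change (Rabs (cl M (Re x)) + Rabs (cl M (Im x)) <= 2 * M).
 generalize (cl_bound M (Re x) H) (cl_bound M (Im x) H). lra.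
Qed.

Lemma box_id M x : Cmod x <= M -> box M x = x.
Proof.
 intros H. apply C_eq; apply cl_id; [generalize (re_le_Cmod x) | generalize (Im_le_Cmod x)]; lra.
Qed.

Lemma box_conj M x : 0 <= M -> box M (Cconj x) = Cconj (box M x).
Proof.
 intros HM. apply C_eq; [reflexivity |]. change (cl M (- Im x) = - cl M (Im x)). unfold cl, Rmax, Rmin.
 destruct (Rle_dec M (Im x)), (Rle_dec M (- Im x)); repeat destruct Rle_dec; lra.
Qed.

Lemma box_cvcont M phi : cvcont phi -> cvcont (fun t => box M (phi t)).
Proof.
 intros H. apply (cvcont_comp (box M) phi H). intros t eps He. exists eps. split; [lra |].
 intros z Hz. eapply Rle_lt_trans; [apply box_lip | lra].
Qed.

Section Flow.
Variables (n : nat) (A : nat -> R -> R) (w : R).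
Hypothesis HA : good_sys n A.
Hypothesis Hw : 0 < w.

Definition sol (tau : R) (phi : R -> C) : Prop :=
 cvcont phi /\ forall t, 0 < t < tau -> cder phi t (Fld A n t (phi t)).

Lemma trunc_lip M : 0 <= M -> exists L, 0 < L /\ forall t x y,
 Cmod (Fld A n t (box M x) - Fld A n t (box M y)) <= L * Cmod (x - y).
Proof.
 intros HM. destruct (Fdel_bound n A (2 * M) HA ltac:(lra)) as (L & HL & H).
 exists L. split; [lra |]. intros t x y. rewrite Fdel_spec, Cmod_mult, Rmult_comm.
 apply Rmult_le_compat; [pos | pos | apply H; apply box_bound, HM | apply box_lip].
Qed.

Definition tsol (M : R) (c : C) (phi : R -> C) : Prop :=
 cvcont phi /\ phi 0 = c /\ forall t, 0 < t < w -> cder phi t (Fld A n t (box M (phi t))).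

Lemma tsol_exists M c : 0 <= M -> exists phi, tsol M c phi.
Proof.
 intros HM. destruct (trunc_lip M HM) as (L & HL & H). apply (picard (fun t z => Fld A n t (box M z)) L w c HL Hw H).
 intros phi Hp. apply (Fld_cvcont n A (fun t => box M (phi t))); [pos | apply box_cvcont, Hp].
Qed.

(** The truncated flow is defined for every start and every time up to [w], so that domain questions
    become bounds: as long as it stays in the disc of radius [M] it is the true solution. *)
Definition Phi (M : R) (c : C) : R -> C :=
 epsilon (inhabits (fun _ => c)) (tsol M c).

Lemma Phi_tsol M c : 0 <= M -> tsol M c (Phi M c).
Proof. intros HM. unfold Phi. apply epsilon_spec, tsol_exists, HM. Qed.

Lemma Phi_lip M : 0 <= M -> exists Q, 0 < Q /\ forall x y t, 0 <= t <= w ->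
 Cmod (Phi M x t - Phi M y t) <= Q * Cmod (x - y).
Proof.
 intros HM. destruct (trunc_lip M HM) as (L & HL & H). exists (exp ((2 * L + 1) * w)). split; [pos |].
 intros x y t Ht. destruct (Phi_tsol M x HM) as (C1 & I1 & D1). destruct (Phi_tsol M y HM) as (C2 & I2 & D2).
 assert (G := gronwall_curves (Phi M x) (Phi M y) (fun t => Fld A n t (box M (Phi M x t)))
   (fun t => Fld A n t (box M (Phi M y t))) 0 t L 0 ltac:(lra) ltac:(lra) ltac:(lra) C1 C2
   (fun s Hs => D1 s ltac:(lra)) (fun s Hs => D2 s ltac:(lra))).
 assert (G' := G ltac:(intros s _; generalize (H s (Phi M x s) (Phi M y s)); lra)).
 unfold sqdist in G'. rewrite I1, I2 in G'.
 assert (E1 : exp ((2 * L + 1) * (t - 0)) <= exp ((2 * L + 1) * w) * exp ((2 * L + 1) * w)).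
 { rewrite <- exp_plus.
  destruct (Rle_lt_or_eq_dec ((2 * L + 1) * (t - 0)) ((2 * L + 1) * w + (2 * L + 1) * w)) as [Hlt | E]; [nra | |].
  - left. apply exp_increasing, Hlt.
  - nra. }
 assert (Hp := exp_pos ((2 * L + 1) * w)). apply Rsqr_incr_0_var; [| pos]. unfold Rsqr.
 generalize (Cmod_ge_0 (x - y)). intros P. assert (0 <= Cmod (x - y) * Cmod (x - y)) by nra.
 assert (Cmod (x - y) * Cmod (x - y) * exp ((2 * L + 1) * (t - 0))
  <= Cmod (x - y) * Cmod (x - y) * (exp ((2 * L + 1) * w) * exp ((2 * L + 1) * w))) by nra.
 nra.
Qed.

Lemma tsol_unique M phi psi tau : 0 <= M -> 0 <= tau -> cvcont phi -> cvcont psi -> phi 0 = psi 0 ->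
 (forall t, 0 < t < tau -> cder phi t (Fld A n t (box M (phi t)))) ->
 (forall t, 0 < t < tau -> cder psi t (Fld A n t (box M (psi t)))) ->
 forall t, 0 <= t <= tau -> phi t = psi t.
Proof.
 intros HM Htau C1 C2 E D1 D2 t Ht. destruct (trunc_lip M HM) as (L & HL & H).
 assert (G := gronwall_curves phi psi (fun t => Fld A n t (box M (phi t)))
   (fun t => Fld A n t (box M (psi t))) 0 t L 0 ltac:(lra) ltac:(lra) ltac:(lra) C1 C2
   (fun s Hs => D1 s ltac:(lra)) (fun s Hs => D2 s ltac:(lra))).
 assert (G' := G ltac:(intros s _; generalize (H s (phi s) (psi s)); lra)).
 unfold sqdist in G'. rewrite E in G'. replace (psi 0 - psi 0)%C with (RtoC 0) in G' by ring. rewrite Cmod_0 in G'.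
 assert (E0 : (phi t - psi t)%C = 0%C).
 { apply Cmod_eq_0. generalize (Cmod_ge_0 (phi t - psi t)). nra. }
 replace (phi t) with ((phi t - psi t) + psi t)%C by ring. rewrite E0. ring.
Qed.

Lemma Phi_sol M c tau : 0 <= M -> tau <= w -> (forall t, 0 <= t <= tau -> Cmod (Phi M c t) <= M) ->
 sol tau (Phi M c).
Proof.
 intros HM Htau H. destruct (Phi_tsol M c HM) as (C1 & I1 & D1). split; [pos |].
 intros t Ht. assert (D := D1 t ltac:(lra)). rewrite box_id in D by (apply H; lra). exact D.
Qed.

Lemma sol_Phi M phi tau : 0 <= M -> 0 <= tau <= w -> sol tau phi ->
 (forall t, 0 <= t <= tau -> Cmod (phi t) <= M) ->
 forall t, 0 <= t <= tau -> phi t = Phi M (phi 0) t.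
Proof.
 intros HM Htau [C1 D1] H. destruct (Phi_tsol M (phi 0) HM) as (C2 & I2 & D2).
 apply (tsol_unique M); try assumption; try lra.
 - symmetry. exact I2.
 - intros t Ht. rewrite box_id by (apply H; lra). apply D1, Ht.
 - intros t Ht. apply D2. lra.
Qed.

Lemma Phi_0 M c : 0 <= M -> Phi M c 0 = c.
Proof. intros HM. apply (Phi_tsol M c HM). Qed.

Lemma Phi_cvcont M c : 0 <= M -> cvcont (Phi M c).
Proof. intros HM. apply (Phi_tsol M c HM). Qed.

(** The gap between M' and M closes the circle: while the truncated solution stays within M it is a
    true solution, the hypothesis then yields the better bound M', and continuity prevents it from
    reaching M. *)
Lemma Phi_apriori M M' c : 0 <= M -> M' < M -> Cmod c <= M' ->
 (forall tau, 0 <= tau <= w -> sol tau (Phi M c) ->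
   (forall t, 0 <= t <= tau -> Cmod (Phi M c t) <= M) -> Cmod (Phi M c tau) <= M') ->
 forall t, 0 <= t <= w -> Cmod (Phi M c t) <= M'.
Proof.
 intros HM HM' Hc H. assert (C1 := Phi_cvcont M c HM). assert (K : forall t, 0 <= t <= w -> Cmod (Phi M c t) <= M).
 { apply (real_ind 0 w (fun t => Cmod (Phi M c t) <= M)).
  - rewrite Phi_0; lra.
  - intros t Ht Hall.
   assert (Z : Cmod (Phi M c t) <= M') by (apply H; [lra | apply Phi_sol; [lra | lra | pos] | pos]).
   destruct (proj1 (cvcont_eps _) C1 t (M - M') ltac:(lra)) as (d & Hd & Y). exists d. split; [lra |].
   intros s Hs _. assert (Y' := Y s ltac:(rewrite Rabs_pos_eq; lra)).
   generalize (Cmod_reverse (Phi M c s) (Phi M c t)). lra.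
  - intros t Ht Hall. apply Rnot_lt_le. intros Hlt.
   destruct (continuous_pos (fun s => Cmod (Phi M c s)) t M (continuous_Cmod _ t C1) Hlt) as (d & Hd & Y).
   set (s := Rmax 0 (t - d / 2)). destruct (Rmax_bounds 0 (t - d / 2)) as [M1 M2].
   fold s in M1, M2. assert (Hs : s < t) by (apply Rmax_lub_lt; lra).
   assert (Z := Y s ltac:(rewrite Rabs_left; lra)). generalize (Hall s ltac:(lra)). lra. }
 intros t Ht. apply H; [lra | |].
 - apply Phi_sol; [lra | lra |]. intros s Hs. apply K. lra.
 - intros s Hs. apply K. lra.
Qed.

Lemma Phi_strict_near M c : 0 <= M -> (forall t, 0 <= t <= w -> Cmod (Phi M c t) < M) ->
 exists r, 0 < r /\ forall z, Cmod (z - c) < r -> forall t, 0 <= t <= w -> Cmod (Phi M z t) < M.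
Proof.
 intros HM H. destruct (Phi_lip M HM) as (Q & HQ & L).
 destruct (continuous_bounded (fun t => Cmod (Phi M c t)) 0 w ltac:(lra)) as (m & Hm & Hmax).
 { intros t. apply continuous_Cmod, Phi_cvcont, HM. }
 assert (A1 := H m Hm). set (g := M - Cmod (Phi M c m)). assert (Hg : 0 < g) by (unfold g; lra).
 exists (g / Q). split; [pos |]. intros z Hz t Ht. assert (B := L z c t Ht). assert (B2 := Hmax t Ht). simpl in B2.
 assert (Q * Cmod (z - c) < g).
 { apply Rmult_lt_compat_l with (r := Q) in Hz; [| lra]. replace (Q * (g / Q)) with g in Hz by (field; lra). exact Hz. }
 generalize (Cmod_reverse (Phi M z t) (Phi M c t)). unfold g in *. lra.
Qed.

(** The remainder Phi y - Phi x - (y - x) E x, with [E x] the solution of the variational equation,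
    vanishes at time 0 and satisfies a linear inequality whose forcing is quadratic in y - x;
    Gronwall gives the uniform quadratic bound. *)
Lemma hol_Phi M c : 0 <= M -> (forall t, 0 <= t <= w -> Cmod (Phi M c t) < M) ->
 hol (fun z => Phi M z w) c.
Proof.
 intros HM Hc. destruct (Phi_strict_near M c HM Hc) as (r & Hr & Hn). destruct (Phi_lip M HM) as (Q & HQ & HL).
 destruct (Fdel_bound n A (2 * M) HA ltac:(lra)) as (L & HLp & HB).
 destruct (Fdel_lip n A (2 * M) HA ltac:(lra)) as (L2 & HL2 & HB2).
 (* the variational equation along the solution from [x] *)
 assert (HE : forall x, exists E, cvcont E /\ E 0 = 1%C /\ forall t, 0 < t < w ->
   cder E t (Fdel A n t (box M (Phi M x t)) (box M (Phi M x t)) * E t)%C).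
 { intros x. apply (picard (fun t e => Fdel A n t (box M (Phi M x t)) (box M (Phi M x t)) * e)%C L w 1%C HLp Hw).
  - intros t e e'.
   replace (Fdel A n t (box M (Phi M x t)) (box M (Phi M x t)) * e - Fdel A n t (box M (Phi M x t)) (box M (Phi M x t)) * e')%C
    with (Fdel A n t (box M (Phi M x t)) (box M (Phi M x t)) * (e - e'))%C by ring.
   rewrite Cmod_mult. apply Rmult_le_compat_r; [pos | apply HB; apply box_bound, HM].
  - intros e He. apply (cvcont_mult (fun t => Fdel A n t (box M (Phi M x t)) (box M (Phi M x t)))); [| pos].
   apply (Fdel_cvcont n A (fun t => box M (Phi M x t)) (fun t => box M (Phi M x t))); [pos | |];
    apply box_cvcont, Phi_cvcont, HM. }
 set (E := fun x => proj1_sig (constructive_indefinite_description _ (HE x))).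
 assert (HE' : forall x, cvcont (E x) /\ E x 0 = 1%C /\ forall t, 0 < t < w ->
   cder (E x) t (Fdel A n t (box M (Phi M x t)) (box M (Phi M x t)) * E x t)%C).
 { intros x. unfold E. destruct (constructive_indefinite_description _ (HE x)) as [e He]. exact He. }
 set (G := w * exp ((2 * L + 1) * w)). assert (Hp := exp_pos ((2 * L + 1) * w)).
 assert (HG : 0 <= G) by (unfold G; nra). exists (fun x => E x w), r, (L2 * Q * Q * (1 + G)). repeat split; [lra | |].
 { pos. }
 intros x y Hx Hy. destruct (HE' x) as (CE & IE & DE).
 destruct (Phi_tsol M x HM) as (Cx & Ix & Dx). destruct (Phi_tsol M y HM) as (Cy & Iy & Dy).
 set (h := Cmod (y - x)). assert (Hh : 0 <= h) by apply Cmod_ge_0.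
 set (e := fun t => (Phi M y t - Phi M x t - (y - x) * E x t)%C). assert (Ce : cvcont e).
 { apply cvcont_minus; [apply cvcont_minus; assumption | apply cvcont_mult; [apply cvcont_const | pos]]. }
 set (q := L2 * Q * Q * (h * h)). assert (Hq : 0 <= q) by (unfold q; repeat apply Rmult_le_pos; lra).
 assert (K := gronwall_curves e (fun _ => 0%C)
  (fun t => Fld A n t (box M (Phi M y t)) - Fld A n t (box M (Phi M x t))
    - (0 * E x t + (y - x) * (Fdel A n t (box M (Phi M x t)) (box M (Phi M x t)) * E x t)))%C (fun _ => 0%C)
  0 w L q ltac:(lra) ltac:(lra) Hq Ce (cvcont_const _)).
 assert (K1 : sqdist e (fun _ => 0%C) w <= (sqdist e (fun _ => 0%C) 0 + q * q * (w - 0)) * exp ((2 * L + 1) * (w - 0))).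
 { apply K; clear K.
  - intros t Ht. apply cder_minus; [apply cder_minus; [apply Dy, Ht | apply Dx, Ht] |].
   apply (cder_mult (fun _ => (y - x)%C) (E x)); [apply cder_const | apply DE, Ht].
  - intros t Ht. apply cder_const.
  - intros t Ht. assert (Bx : box M (Phi M x t) = Phi M x t) by (apply box_id; left; apply Hn; [lra | lra]).
   assert (By : box M (Phi M y t) = Phi M y t) by (apply box_id; left; apply Hn; [lra | lra]).
   rewrite Bx, By. rewrite Fdel_spec. set (px := Phi M x t) in *. set (py := Phi M y t) in *.
   replace ((py - px) * Fdel A n t py px - (0 * E x t + (y - x) * (Fdel A n t px px * E x t)) - 0)%C
    with (Fdel A n t px px * (e t - 0) + (Fdel A n t py px - Fdel A n t px px) * (py - px))%C
    by (unfold e; fold px py; ring).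
   eapply Rle_trans; [apply Cmod_triangle |]. rewrite !Cmod_mult.
   assert (Mx : Cmod px <= 2 * M) by (rewrite <- Bx; apply box_bound, HM).
   assert (My : Cmod py <= 2 * M) by (rewrite <- By; apply box_bound, HM).
   assert (T1 := HB t px px Mx Mx). assert (T2 := HB2 t py px px My Mx Mx).
   assert (T3 := HL y x t ltac:(lra)). fold px py h in T3.
   generalize (Cmod_ge_0 (e t - 0)) (Cmod_ge_0 (py - px)). intros P1 P2.
   assert (Cmod (Fdel A n t px px) * Cmod (e t - 0) <= L * Cmod (e t - 0)) by nra.
   assert (T4 : Cmod (Fdel A n t py px - Fdel A n t px px) * Cmod (py - px) <= (L2 * (Q * h)) * (Q * h)).
   { apply Rmult_le_compat; [pos | lra | | lra]. eapply Rle_trans; [exact T2 |]. apply Rmult_le_compat_l; lra. }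
   unfold q. nra. }
 unfold sqdist in K1. unfold e at 3 4 in K1. rewrite Iy, Ix, IE in K1.
 replace (y - x - (y - x) * 1 - 0)%C with (RtoC 0) in K1 by ring. rewrite Cmod_0 in K1.
 replace (e w - 0)%C with (e w) in K1 by ring. fold h. change (Cmod (e w) <= L2 * Q * Q * (1 + G) * (h * h)).
 replace (L2 * Q * Q * (1 + G) * (h * h)) with (q * (1 + G)) by (unfold q; ring).
 apply Rsqr_incr_0_var; [| pos]. unfold Rsqr. replace (w - 0) with w in K1 by ring.
 replace ((0 * 0 + q * q * w) * exp ((2 * L + 1) * w)) with (q * q * G) in K1 by (unfold G; ring).
 assert (0 <= q * q) by nra. nra.
Qed.

End Flow.

(** * Sectors *)

(* [side th z] is positive on the left of the oriented line spanned by [el th]. *)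
Definition side (th : R) (z : C) : R := Im z * cos th - Re z * sin th.

(** For an opening below pi the two half planes cut out the closed angular sector. Sides are linear
    in z, hence easy to differentiate along a solution, unlike the angle. *)
Definition sector (lo hi : R) (z : C) : Prop := 0 <= side lo z /\ side hi z <= 0.

Definition polar (rho th : R) : C := (RtoC rho * el th)%C.

Lemma Re_polar rho th : Re (polar rho th) = rho * cos th.
Proof. unfold Re, polar; simpl. ring. Qed.

Lemma Im_polar rho th : Im (polar rho th) = rho * sin th.
Proof. unfold Im, polar; simpl. ring. Qed.

Lemma Cmod_polar rho th : 0 <= rho -> Cmod (polar rho th) = rho.
Proof. intros H. unfold polar. rewrite Cmod_mult, Cmod_el, Cmod_R, Rabs_pos_eq; lra. Qed.

Lemma polar_pow rho th k : (polar rho th ^ k)%C = polar (rho ^ k) (INR k * th).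
Proof. unfold polar. rewrite Cpow_mult_l, el_pow, RtoC_pow. reflexivity. Qed.

Lemma polar_conj rho th : Cconj (polar rho th) = polar rho (- th).
Proof.
 apply C_eq; [change (Re (polar rho th) = Re (polar rho (- th))) | change (- Im (polar rho th) = Im (polar rho (- th)))];
 rewrite ?Re_polar, ?Im_polar, ?cos_neg, ?sin_neg; ring.
Qed.

Lemma polar_mult a b x y : (polar a x * polar b y)%C = polar (a * b) (x + y).
Proof. unfold polar. rewrite el_plus, RtoC_mult. ring. Qed.

Lemma polar_inv rho th : rho <> 0 -> (/ polar rho th)%C = polar (/ rho) (- th).
Proof.
 intros H. assert (Hp : polar rho th <> 0%C).
 { unfold polar. apply Cmult_neq_0; [intros E; apply RtoC_inj in E; lra | apply el_neq_0]. }
 assert (E : (polar rho th * polar (/ rho) (- th))%C = 1%C).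
 { rewrite polar_mult, Rinv_r by exact H. replace (th + - th) with 0 by ring. unfold polar. rewrite el_0. ring. }
 transitivity (/ polar rho th * (polar rho th * polar (/ rho) (- th)))%C; [rewrite E; ring | field; exact Hp].
Qed.

Lemma side_polar th rho x : side th (polar rho x) = rho * sin (x - th).
Proof. unfold side. rewrite Re_polar, Im_polar, sin_minus. ring. Qed.

Lemma side_plus th x y : side th (x + y)%C = side th x + side th y.
Proof. unfold side, Re, Im; simpl. ring. Qed.

Lemma side_minus th x y : side th (x - y)%C = side th x - side th y.
Proof. unfold side, Re, Im; simpl. ring. Qed.

Lemma side_scal th k x : side th (RtoC k * x)%C = k * side th x.
Proof. unfold side, Re, Im; simpl. ring. Qed.

Lemma side_le_Cmod th x : Rabs (side th x) <= Cmod x.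
Proof.
 assert (A := Re_Im_Cauchy_Schwarz x (- sin th, cos th)). replace (Cmod (- sin th, cos th)) with 1 in A.
 - unfold side. simpl in A. replace (Im x * cos th - Re x * sin th) with (Re x * - sin th + Im x * cos th) by ring. lra.
 - symmetry. replace (- sin th, cos th) with (Ci * el th)%C by (apply C_eq; simpl; ring).
  rewrite Cmod_mult, Cmod_Ci, Cmod_el. ring.
Qed.

Lemma half_plane_polar lo (z : C) : z <> 0%C -> 0 <= side lo z ->
 exists b, 0 <= b <= PI /\ z = polar (Cmod z) (lo + b).
Proof.
 intros Hz Hs. set (rho := Cmod z). assert (Hr : 0 < rho) by (apply Cmod_gt_0, Hz).
 set (x := (Re z * cos lo + Im z * sin lo) / rho). set (y := side lo z / rho). assert (Exy : x * x + y * y = 1).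
 { unfold x, y, side. assert (A := Cmod2_Re_Im z). fold rho in A. assert (B := sin2_cos2 lo). unfold Rsqr in B.
  replace 1 with ((Re z * Re z + Im z * Im z) * (sin lo * sin lo + cos lo * cos lo) / (rho * rho))
   by (rewrite B, <- A; field; lra).
  field. lra. }
 assert (Hy : 0 <= y) by (apply Rdiv_le_0_compat; lra). assert (Hx : -1 <= x <= 1) by nra.
 exists (acos x). split; [apply acos_bound |]. assert (Ec : cos (acos x) = x) by (apply cos_acos, Hx).
 assert (Es : sin (acos x) = y).
 { rewrite sin_acos by exact Hx. replace (1 - Rsqr x) with (Rsqr y) by (unfold Rsqr; lra). apply sqrt_Rsqr, Hy. }
 assert (B := sin2_cos2 lo). unfold Rsqr in B. apply C_eq.
 - rewrite Re_polar, cos_plus, Ec, Es. unfold x, y, side.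
  replace (rho * (cos lo * ((Re z * cos lo + Im z * sin lo) / rho) - sin lo * ((Im z * cos lo - Re z * sin lo) / rho)))
   with (Re z * (sin lo * sin lo + cos lo * cos lo)) by (field; lra). rewrite B. ring.
 - rewrite Im_polar, sin_plus, Ec, Es. unfold x, y, side.
  replace (rho * (sin lo * ((Re z * cos lo + Im z * sin lo) / rho) + cos lo * ((Im z * cos lo - Re z * sin lo) / rho)))
   with (Im z * (sin lo * sin lo + cos lo * cos lo)) by (field; lra). rewrite B. ring.
Qed.

Lemma sector_polar lo hi (z : C) : 0 < hi - lo < PI -> z <> 0%C -> sector lo hi z ->
 exists th, lo <= th <= hi /\ z = polar (Cmod z) th.
Proof.
 intros Hw Hz [H1 H2]. destruct (half_plane_polar lo z Hz H1) as (b & Hb & E).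
 assert (Hr : 0 < Cmod z) by (apply Cmod_gt_0, Hz). exists (lo + b). split; [| exact E]. rewrite E, side_polar in H2.
 replace (lo + b - hi) with (b - (hi - lo)) in H2 by ring.
 assert (b <= hi - lo); [| lra]. apply Rnot_lt_le. intros Hlt.
 assert (0 < sin (b - (hi - lo))) by (apply sin_gt_0; lra). nra.
Qed.

Lemma polar_in_sector lo hi rho th : 0 < hi - lo < PI -> 0 <= rho -> lo <= th <= hi ->
 sector lo hi (polar rho th).
Proof.
 intros Hw Hr Hth. split; rewrite side_polar.
 - assert (0 <= sin (th - lo)) by (apply sin_ge_0; lra). nra.
 - assert (0 <= sin (hi - th)) by (apply sin_ge_0; lra).
  replace (th - hi) with (- (hi - th)) by ring. rewrite sin_neg. nra.
Qed.

Lemma side_zero lo hi e (z : C) : 0 < hi - lo < PI -> lo <= e <= hi -> sector lo hi z -> side e z = 0 ->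
 z = polar (Cmod z) e.
Proof.
 intros Hw He Hs H0. destruct (Ceq_dec z 0%C) as [-> | Hz]; [rewrite Cmod_0; unfold polar; ring |].
 destruct (sector_polar lo hi z Hw Hz Hs) as (th & Hth & E). rewrite E, side_polar in H0.
 assert (Hr : 0 < Cmod z) by (apply Cmod_gt_0, Hz).
 destruct (Rtotal_order th e) as [Hlt | [<- | Hlt]]; [| exact E |]; exfalso.
 - assert (0 < sin (e - th)) by (apply sin_gt_0; lra).
  replace (th - e) with (- (e - th)) in H0 by ring. rewrite sin_neg in H0. nra.
 - assert (0 < sin (th - e)) by (apply sin_gt_0; lra). nra.
Qed.

Lemma side_lo_zero lo hi (z : C) : 0 < hi - lo < PI -> sector lo hi z -> side lo z = 0 -> z = polar (Cmod z) lo.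
Proof. intros Hw. apply side_zero; lra. Qed.

Lemma side_hi_zero lo hi (z : C) : 0 < hi - lo < PI -> sector lo hi z -> side hi z = 0 -> z = polar (Cmod z) hi.
Proof. intros Hw. apply side_zero; lra. Qed.

Lemma sector_strict_polar lo hi (z : C) th : 0 < hi - lo < PI -> 0 < side lo z -> side hi z < 0 ->
 z = polar (Cmod z) th -> lo <= th <= hi -> lo < th < hi.
Proof.
 intros Hw H1 H2 E Hth. rewrite E, side_polar in H1. rewrite E, side_polar in H2. split; apply Rnot_le_lt; intros H.
 - replace (th - lo) with 0 in H1 by lra. rewrite sin_0 in H1. lra.
 - replace (th - hi) with 0 in H2 by lra. rewrite sin_0 in H2. lra.
Qed.

(** * Invariant regions *)

Lemma cder_pow phi t v k : cder phi t v ->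
 cder (fun s => phi s ^ S k)%C t (RtoC (INR (S k)) * phi t ^ k * v)%C.
Proof.
 intros H. induction k as [| k IH].
 - simpl. apply cder_ext with phi; [intros s; ring |]. replace (1 * 1 * v)%C with v by ring. exact H.
 - rewrite (S_INR (S k)), RtoC_plus. replace ((RtoC (INR (S k)) + 1) * phi t ^ S k * v)%C
   with (v * phi t ^ S k + phi t * (RtoC (INR (S k)) * phi t ^ k * v))%C by (simpl Cpow; ring).
  apply (cder_mult phi (fun s => phi s ^ S k)%C); assumption.
Qed.

Lemma cder_inv phi t v : cder phi t v -> phi t <> 0%C ->
 cder (fun s => / phi s)%C t (- (/ phi t * / phi t) * v)%C.
Proof.
 intros H Hne. destruct (hol_with_inv (phi t) Hne) as (r & M & Hh).
 apply (cder_comp (fun z => / z)%C (fun z => - (/ z * / z))%C (phi t) r M phi t v Hh); [| exact H].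
 rewrite Cmod_sub_diag. apply Hh.
Qed.

Lemma is_derive_side th phi t v : cder phi t v -> is_derive (fun s => side th (phi s)) t (side th v).
Proof.
 intros [H1 H2]. unfold side. eapply is_derive_eq.
 - exact (is_derive_Rminus _ _ _ _ _ (is_derive_Rmult _ _ _ _ _ H2 (is_derive_const (cos th) t))
                   (is_derive_Rmult _ _ _ _ _ H1 (is_derive_const (sin th) t))).
 - unfold zero; simpl. ring.
Qed.

Lemma continuous_side th phi t : cvcont phi -> continuous (fun s => side th (phi s)) t.
Proof.
 intros H. destruct (H t) as [H1 H2]. unfold side.
 apply (continuous_minus (V := R_NormedModule) (fun s => Im (phi s) * cos th) (fun s => Re (phi s) * sin th));
 [apply (continuous_mult (K := R_AbsRing) (fun s => Im (phi s)) (fun _ => cos th))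
 |apply (continuous_mult (K := R_AbsRing) (fun s => Re (phi s)) (fun _ => sin th))];
 try assumption; apply continuous_const.
Qed.

(** The real scalar product; for v the velocity at z it is half the derivative of |z|^2. *)
Definition radial (v z : C) : R := Re z * Re v + Im z * Im v.

Lemma is_derive_Cmod2 phi t v : cder phi t v ->
 is_derive (fun s => Cmod (phi s) * Cmod (phi s)) t (2 * radial v (phi t)).
Proof.
 intros [H1 H2]. apply is_derive_ext with (fun s => Re (phi s) * Re (phi s) + Im (phi s) * Im (phi s)).
 - intros s. symmetry. apply Cmod2_Re_Im.
 - eapply is_derive_eq.
  + exact (is_derive_Rplus _ _ _ _ _ (is_derive_Rmult _ _ _ _ _ H1 H1) (is_derive_Rmult _ _ _ _ _ H2 H2)).
  + unfold radial. cbv beta. ring.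
Qed.

Lemma continuous_radial f phi t : cvcont f -> cvcont phi -> continuous (fun s => radial (f s) (phi s)) t.
Proof.
 intros Hf Hp. destruct (Hf t), (Hp t). unfold radial.
 apply (continuous_plus (V := R_NormedModule) (fun s => Re (phi s) * Re (f s)) (fun s => Im (phi s) * Im (f s)));
 [apply (continuous_mult (K := R_AbsRing) (fun s => Re (phi s)) (fun s => Re (f s)))
 |apply (continuous_mult (K := R_AbsRing) (fun s => Im (phi s)) (fun s => Im (f s)))]; assumption.
Qed.

Section Dynamics.
Variables (n : nat) (A : nat -> R -> R) (w : R).
Hypothesis HA : good_sys n A.

Let F := Fld A n.

Definition ray_in (r lo hi : R) : Prop := forall t rho, 0 <= t <= w -> r <= rho ->
 0 < side lo (F t (polar rho lo)) /\ side hi (F t (polar rho hi)) < 0.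

Definition circ_out (r : R) : Prop := forall t z, 0 <= t <= w -> Cmod z = r -> 0 < radial (F t z) z.
Definition circ_in (r : R) : Prop := forall t z, 0 <= t <= w -> Cmod z = r -> radial (F t z) z < 0.

(** With an opening below pi, a point of the sector where one side vanishes lies on the
    corresponding ray, where the field is known; staying beyond radius r keeps the vertex away. *)
Lemma sector_inv r lo hi tau phi a b : 0 < r -> 0 < hi - lo < PI -> ray_in r lo hi ->
 sol n A tau phi -> tau <= w -> 0 <= a <= b -> b <= tau ->
 (forall t, a <= t <= b -> r <= Cmod (phi t)) -> sector lo hi (phi a) ->
 forall t, a <= t <= b -> sector lo hi (phi t) /\ (a < t -> 0 < side lo (phi t) /\ side hi (phi t) < 0).
Proof.
 intros Hr Hw Hray [Cp Dp] Htau Hab Hb Hout [S1 S2] t Ht.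
 assert (CF : cvcont (fun t => F t (phi t))) by (apply Fld_cvcont; assumption).
 assert (Cop : forall g : R -> R, (forall t, continuous g t) -> forall t, continuous (fun s => - g s) t).
 { intros g Hg s. apply (continuous_opp (V := R_NormedModule)), Hg. }
 destruct (barrier2 (fun t => side lo (phi t)) (fun t => side lo (F t (phi t)))
  (fun t => - side hi (phi t)) (fun t => - side hi (F t (phi t))) a b) with (t := t) as (P1 & P2 & P3); try lra.
 - intros s. apply continuous_side, Cp.
 - apply Cop. intros s. apply continuous_side, Cp.
 - intros s. apply (continuous_side lo (fun t => F t (phi t))), CF.
 - apply (Cop (fun t => side hi (F t (phi t)))). intros s. apply (continuous_side hi (fun t => F t (phi t))), CF.
 - intros s Hs. apply is_derive_side, Dp. lra.
 - intros s Hs. apply (is_derive_opp (V := R_NormedModule) (fun t => side hi (phi t))). apply is_derive_side, Dp. lra.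
 - intros s Hs E G. assert (Hsec : sector lo hi (phi s)) by (split; lra).
  assert (E2 := side_lo_zero lo hi _ Hw Hsec E). rewrite E2. apply (Hray s (Cmod (phi s))); [lra | apply Hout, Hs].
 - intros s Hs E G. assert (Hsec : sector lo hi (phi s)) by (split; lra).
  assert (E2 := side_hi_zero lo hi _ Hw Hsec ltac:(lra)). rewrite E2.
  destruct (Hray s (Cmod (phi s)) ltac:(lra) (Hout s Hs)) as [_ Z]. lra.
 - split; [split; lra |]. intros Hat. destruct (P3 Hat). lra.
Qed.

(** The sign of [e] selects the direction, so that inward and outward circles share one barrier
    argument. *)
Lemma circ_inv e r tau phi a b : e <> 0 -> 0 < r ->
 (forall t z, 0 <= t <= w -> Cmod z = r -> 0 < e * radial (F t z) z) -> sol n A tau phi -> tau <= w ->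
 0 <= a <= b -> b <= tau -> 0 <= e * (Cmod (phi a) * Cmod (phi a) - r * r) -> forall t, a <= t <= b ->
 0 <= e * (Cmod (phi t) * Cmod (phi t) - r * r) /\ (a < t -> 0 < e * (Cmod (phi t) * Cmod (phi t) - r * r)).
Proof.
 intros He Hr Hc [Cp Dp] Htau Hab Hb Ha t Ht.
 assert (CF : cvcont (fun t => F t (phi t))) by (apply Fld_cvcont; assumption).
 apply (barrier (fun t => e * (Cmod (phi t) * Cmod (phi t) - r * r)) (fun t => e * (2 * radial (F t (phi t)) (phi t))) a b);
  try lra.
 - intros s. apply (continuous_scal_r (V := R_NormedModule) e (fun t => Cmod (phi t) * Cmod (phi t) - r * r)).
  apply (continuous_minus (V := R_NormedModule) (fun t => Cmod (phi t) * Cmod (phi t)) (fun _ => r * r)); [| apply continuous_const].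
  apply (continuous_mult (K := R_AbsRing)); apply continuous_Cmod, Cp.
 - intros s. apply (continuous_scal_r (V := R_NormedModule) e (fun t => 2 * radial (F t (phi t)) (phi t))).
  apply (continuous_scal_r (V := R_NormedModule) 2 (fun t => radial (F t (phi t)) (phi t))).
  apply (continuous_radial (fun t => F t (phi t)) phi); assumption.
 - intros s Hs. eapply is_derive_eq.
  + exact (is_derive_Rmult _ _ _ _ _ (is_derive_const e s)
    (is_derive_Rminus _ _ _ _ _ (is_derive_Cmod2 phi s _ (Dp s ltac:(lra))) (is_derive_const (r * r) s))).
  + unfold zero; simpl. unfold F. ring.
 - intros s Hs E. apply Rmult_integral in E. assert (Z : Cmod (phi s) = r).
  { generalize (Cmod_ge_0 (phi s)). destruct E as [E | E]; [lra | nra]. }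
  generalize (Hc s (phi s) ltac:(lra) Z). lra.
Qed.

Lemma circ_out_inv r tau phi a b : 0 < r -> circ_out r -> sol n A tau phi -> tau <= w ->
 0 <= a <= b -> b <= tau -> r <= Cmod (phi a) ->
 forall t, a <= t <= b -> r <= Cmod (phi t) /\ (a < t -> r < Cmod (phi t)).
Proof.
 intros Hr Hc Hs Htau Hab Hb Ha t Ht.
 destruct (circ_inv 1 r tau phi a b ltac:(lra) Hr) with (t := t) as [P1 P2]; try assumption; [| nra |].
 - intros u z Hu Hz. generalize (Hc u z Hu Hz). lra.
 - generalize (Cmod_ge_0 (phi t)). intros Hp. split; [nra |]. intros Hat. specialize (P2 Hat). nra.
Qed.

Lemma circ_in_inv r tau phi a b : 0 < r -> circ_in r -> sol n A tau phi -> tau <= w ->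
 0 <= a <= b -> b <= tau -> Cmod (phi a) <= r ->
 forall t, a <= t <= b -> Cmod (phi t) <= r /\ (a < t -> Cmod (phi t) < r).
Proof.
 intros Hr Hc Hs Htau Hab Hb Ha t Ht.
 destruct (circ_inv (-1) r tau phi a b ltac:(lra) Hr) with (t := t) as [P1 P2]; try assumption.
 - intros u z Hu Hz. generalize (Hc u z Hu Hz). lra.
 - generalize (Cmod_ge_0 (phi a)). nra.
 - nra.
Qed.

End Dynamics.

(** * Solutions far from the origin *)

Lemma Fld_growth A N t z B : (forall i, (i <= N)%nat -> Rabs (A i t) <= B) -> 1 <= Cmod z ->
 Cmod (Fld A N t z) <= INR (S N) * B * Cmod z ^ N.
Proof.
 intros HB Hz. induction N as [| N IH].
 - simpl. rewrite Cmod_R. generalize (HB 0%nat (Nat.le_refl _)). lra.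
 - cbn [Fld]. eapply Rle_trans; [apply Cmod_triangle |]. rewrite Cmod_mult, Cmod_R, Cmod_pow.
  assert (H1 := IH (fun i Hi => HB i (Nat.le_trans _ _ _ Hi (Nat.le_succ_diag_r _)))).
  assert (H2 := HB (S N) (Nat.le_refl _)). assert (P := pow_lt (Cmod z) N ltac:(lra)).
  assert (HB0 : 0 <= B) by (generalize (Rabs_pos (A (S N) t)); lra).
  assert (Q : INR (S N) * B * Cmod z ^ N <= INR (S N) * B * Cmod z ^ S N).
  { apply Rmult_le_compat_l; [apply Rmult_le_pos; [apply pos_INR | lra] |]. simpl. nra. }
  assert (Q2 : Rabs (A (S N) t) * Cmod z ^ S N <= B * Cmod z ^ S N).
  { apply Rmult_le_compat_r; [pos | lra]. }
  rewrite (S_INR (S N)). nra.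
Qed.

Definition clampab (a b t : R) : R := a + clamp (b - a) (t - a).

Lemma clampab_in a b t : a <= b -> a <= clampab a b t <= b.
Proof. intros H. unfold clampab. generalize (clamp_in (b - a) (t - a)). lra. Qed.

Lemma clampab_id a b t : a <= t <= b -> clampab a b t = t.
Proof. intros H. unfold clampab. rewrite clamp_id; lra. Qed.

Lemma clampab_continuous a b t : continuous (clampab a b) t.
Proof.
 apply continuous_eps. intros eps He. exists eps. split; [lra |]. intros s Hs. unfold clampab.
 replace (a + clamp (b - a) (s - a) - (a + clamp (b - a) (t - a)))
  with (clamp (b - a) (s - a) - clamp (b - a) (t - a)) by ring.
 eapply Rle_lt_trans; [apply clamp_lip |]. replace (s - a - (t - a)) with (s - t) by ring. exact Hs.
Qed.

(** A vector outside a cone around the positive axis cannot be cancelled by subtracting a positive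
    number: the hypothesis gives k (|v|^2 + T^2) <= |v - T|^2. *)
Lemma margin_dist (v : C) k T : 0 < k <= 1 -> Re v <= (1 - k) * Cmod v -> 0 <= T ->
 k * Cmod v <= Cmod (v - T) /\ k * T <= Cmod (v - T).
Proof.
 intros Hk Hv HT. assert (E : Cmod (v - T) * Cmod (v - T) = Cmod v * Cmod v - 2 * T * Re v + T * T).
 { rewrite !Cmod2_Re_Im. unfold Re, Im; simpl. ring. }
 assert (Hq := Cmod_ge_0 (v - T)). assert (E1 : k * (Cmod v * Cmod v + T * T) <= Cmod (v - T) * Cmod (v - T)).
 { rewrite E. assert (T * Re v <= T * ((1 - k) * Cmod v)) by nra.
  assert (0 <= (1 - k) * ((Cmod v - T) * (Cmod v - T))) by (apply Rmult_le_pos; [lra | apply Rle_0_sqr]). nra. }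
 split; apply Rsqr_incr_0_var; try exact Hq; unfold Rsqr.
 - nra.
 - nra.
Qed.

Lemma pow_le_reg (x y : R) k : 0 <= x -> 0 <= y -> x ^ S k <= y ^ S k -> x <= y.
Proof.
 intros Hx Hy H. apply Rnot_lt_le. intros Hlt. assert (A : y ^ S k < x ^ S k); [| lra].
 clear H. induction k as [| k IH]; [lra |]. simpl in *. assert (0 <= y * y ^ k) by pos. nra.
Qed.

Section Far.
Variables (N : nat) (A : nat -> R -> R) (w sg : R).
Hypothesis HA : good_sys (S N) A.
Hypothesis Hlead : forall t, A (S N) t = sg.
Hypothesis Hsg : sg * sg = 1.
Hypothesis HN : (1 <= N)%nat.

Definition uu (z : C) : C := (RtoC sg * / z ^ N)%C.

Lemma Cmod_sg : Rabs sg = 1.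
Proof. clear - Hsg. assert (sg = 1 \/ sg = -1) as [-> | ->] by nra; unfold Rabs; destruct Rcase_abs; lra. Qed.

Lemma Cmod_uu (z : C) : z <> 0%C -> Cmod (uu z) = / Cmod z ^ N.
Proof.
 intros H. unfold uu. rewrite Cmod_mult, Cmod_inv, Cmod_pow, Cmod_R, Cmod_sg by (apply Cpow_nz, H). ring.
Qed.

(* In the coordinate [u = sg / z^N] the field is close to the constant [-N] near infinity. *)
Lemma u_drift eps : 0 < eps -> exists X0, 1 <= X0 /\ forall tau phi a b X,
 X0 <= X -> sol (S N) A tau phi -> 0 <= a <= b -> b <= tau ->
 (forall t, a <= t <= b -> X <= Cmod (phi t)) ->
 Cmod (uu (phi b) - uu (phi a) + RtoC (INR N * (b - a))) <= eps * (INR N * (b - a)).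
Proof.
 (* Relative to the leading term the lower ones are at most (N + 1) B / |z|, which beyond [X0] is
    below eps / 2; the remaining factor 2 is lost in [cder_compare]. *)
 intros He. destruct (proj2 HA) as (B & HB & HBA). set (X0 := 1 + 2 * (INR (S N) * B) / eps).
 assert (HQ : 0 <= INR (S N) * B) by (apply Rmult_le_pos; [apply pos_INR | lra]).
 assert (HX0 : 0 <= 2 * (INR (S N) * B) / eps) by (apply Rdiv_le_0_compat; lra). exists X0. split; [unfold X0; lra |].
 intros tau phi a b X HX [Cp Dp] Hab Hb Hout. assert (HNr : 1 <= INR N) by (apply (le_INR 1), HN).
 assert (Hne : forall t, a <= t <= b -> phi t <> 0%C).
 { intros t Ht. apply Cmod_gt_0. generalize (Hout t Ht). unfold X0 in HX. lra. }
 set (g := fun t => (uu (phi (clampab a b t)) + RtoC (INR N * t))%C). assert (Cg : cvcont g).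
 { apply cvcont_plus.
  - apply (cvcont_comp uu (fun t => phi (clampab a b t))).
   + apply cvcont_reparam; [pos | apply clampab_continuous].
   + intros t. apply hol_ccont. unfold uu. apply hol_mult; [apply hol_const |].
    apply (hol_inv (fun z => z ^ N)%C); [apply (hol_pow (fun z => z)), hol_id |]. apply Cpow_nz, Hne, clampab_in. lra.
  - apply cvcont_RtoC. intros t. apply (continuous_scal_r (V := R_NormedModule) (INR N) (fun t => t)), continuous_id. }
 destruct (Nat.lt_exists_pred 0 N HN) as (N' & EN & _). assert (D := cder_compare g
  (fun t => sg * (- (/ phi t ^ N * / phi t ^ N) * (RtoC (INR N) * phi t ^ N' * Fld A (S N) t (phi t))) + RtoC (INR N))%C
  (fun t => eps / 2 * INR N * t) (fun t => eps / 2 * INR N) a b ltac:(lra) Cg).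
 assert (D1 : Cmod (g b - g a) <= 2 * (eps / 2 * INR N * b - eps / 2 * INR N * a)).
 { apply D; clear D.
  - intros t Ht. apply (cder_ext_open (fun t => sg * / phi t ^ N + RtoC (INR N) * t)%C g a b); [lra | |].
   + intros s Hs. unfold g, uu. rewrite clampab_id by lra. rewrite RtoC_mult. reflexivity.
   + apply cder_plus.
    * replace (RtoC sg * (- (/ phi t ^ N * / phi t ^ N) * (RtoC (INR N) * phi t ^ N' * Fld A (S N) t (phi t))))%C
      with (0 * / phi t ^ N + sg * (- (/ phi t ^ N * / phi t ^ N) * (RtoC (INR N) * phi t ^ N' * Fld A (S N) t (phi t))))%C by ring.
     apply (cder_mult (fun _ => sg) (fun t => / phi t ^ N)%C); [apply cder_const |].
     apply (cder_inv (fun t => phi t ^ N)%C); [| apply Cpow_nz, Hne; lra].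
     rewrite EN. apply cder_pow. rewrite <- EN. apply Dp. lra.
    * assert (Q := cder_mult _ _ _ _ _ (cder_const (RtoC (INR N)) t) (cder_id t)).
     cbv beta in Q. replace (0 * t + RtoC (INR N) * 1)%C with (RtoC (INR N)) in Q by ring. exact Q.
  - intros x _. auto_derive; [exact I | ring].
  - intros x. apply (ex_derive_continuous (fun t => eps / 2 * INR N * t)). auto_derive. exact I.
  - intros t Ht. assert (Hz := Hne t ltac:(lra)). assert (HX1 := Hout t ltac:(lra)). set (z := phi t) in *.
   assert (Hz1 : 1 <= Cmod z) by (unfold X0 in HX; lra). cbn [Fld]. rewrite Hlead.
   replace (RtoC sg * (- (/ z ^ N * / z ^ N) * (RtoC (INR N) * z ^ N' * (Fld A N t z + sg * z ^ S N))) + RtoC (INR N))%C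
    with (- (RtoC (INR N * sg) * (/ z ^ N * / z) * Fld A N t z))%C.
   2:{ rewrite EN at 3 4 6 8. rewrite RtoC_mult. simpl Cpow.
     transitivity (RtoC (INR N) * (1 - RtoC (sg * sg)) - (RtoC (INR N) * sg * (/ z ^ N * / z) * Fld A N t z))%C.
     - rewrite Hsg. rewrite EN. simpl Cpow. ring.
     - rewrite RtoC_mult, EN. simpl Cpow. field. split; [apply Cpow_nz |]; exact Hz. }
   rewrite Cmod_opp, !Cmod_mult, !Cmod_inv, Cmod_pow, Cmod_R, Rabs_mult, Cmod_sg, (Rabs_pos_eq (INR N))
    by (first [exact Hz | apply Cpow_nz, Hz | lra]).
   assert (G := Fld_growth A N t z B (fun i Hi => HBA i t ltac:(lia)) Hz1).
   assert (P := pow_lt (Cmod z) N ltac:(lra)). assert (Pz : 0 < Cmod z) by lra.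
   apply Rle_trans with (INR N * 1 * (/ Cmod z ^ N * / Cmod z) * (INR (S N) * B * Cmod z ^ N)).
   + apply Rmult_le_compat_l; [| exact G].
    apply Rmult_le_pos; [lra |]. apply Rmult_le_pos; left; apply Rinv_0_lt_compat; assumption.
   + replace (INR N * 1 * (/ Cmod z ^ N * / Cmod z) * (INR (S N) * B * Cmod z ^ N))
     with (INR N * ((INR (S N) * B) * / Cmod z)) by (field; lra).
    replace (eps / 2 * INR N) with (INR N * (eps / 2)) by ring. apply Rmult_le_compat_l; [lra |].
    apply Rmult_le_reg_r with (Cmod z); [lra |]. rewrite Rmult_assoc, Rinv_l, Rmult_1_r by lra.
    assert (X0 <= Cmod z) by lra. apply Rle_trans with (eps / 2 * X0); [| nra]. unfold X0. field_simplify; lra. }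
 unfold g in D1. rewrite !clampab_id in D1 by lra. replace (uu (phi b) - uu (phi a) + RtoC (INR N * (b - a)))%C
  with (uu (phi b) + RtoC (INR N * b) - (uu (phi a) + RtoC (INR N * a)))%C.
 - lra.
 - replace (INR N * (b - a)) with (INR N * b - INR N * a) by ring. rewrite RtoC_minus. ring.
Qed.

(** Escape means u = 0, and u drifts in the direction -1, so only a u close to the positive half
    line can get there. The margin keeps u outside a cone around that half line. *)
Definition margin (k : R) (z : C) : Prop := Re (uu z) <= (1 - k) * Cmod (uu z).

(** With drift error at most k T / 2, the vector u at time b has size at least k |u(a)| / 2 and at
    least k T / 2. The second bound does not involve the start: solutions come down from infinity in
    finite time. *)
Lemma margin_drift k : 0 < k <= 1 -> exists X0, 1 <= X0 /\ forall tau phi a b,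
 sol (S N) A tau phi -> 0 <= a <= b -> b <= tau ->
 (forall t, a <= t <= b -> X0 <= Cmod (phi t)) -> margin k (phi a) ->
 Cmod (phi b) <= 2 / k * Cmod (phi a) /\ Cmod (phi b) ^ N * (k / 2 * (INR N * (b - a))) <= 1.
Proof.
 intros Hk. destruct (u_drift (k / 2) ltac:(lra)) as (X0 & HX0 & H). exists X0. split; [lra |].
 intros tau phi a b Hs Hab Hb Hout Hm. assert (D := H tau phi a b X0 (Rle_refl _) Hs Hab Hb Hout).
 assert (HNr : 1 <= INR N) by (apply (le_INR 1), HN).
 set (T := INR N * (b - a)) in *. assert (HT : 0 <= T) by (unfold T; nra).
 destruct (margin_dist (uu (phi a)) k T Hk Hm HT) as [M1 M2].
 assert (Pa : 1 <= Cmod (phi a)) by (generalize (Hout a ltac:(lra)); lra).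
 assert (Pb : 1 <= Cmod (phi b)) by (generalize (Hout b ltac:(lra)); lra).
 assert (Za : phi a <> 0%C) by (apply Cmod_gt_0; lra). assert (Zb : phi b <> 0%C) by (apply Cmod_gt_0; lra).
 assert (R1 : Cmod (uu (phi a) - T) <= Cmod (uu (phi b)) + k / 2 * T).
 { replace (uu (phi a) - T)%C with (uu (phi b) - (uu (phi b) - uu (phi a) + T))%C by ring.
  eapply Rle_trans; [apply Cmod_triangle_minus |]. lra. }
 rewrite !Cmod_uu in * by assumption.
 assert (Qa := pow_lt (Cmod (phi a)) N ltac:(lra)). assert (Qb := pow_lt (Cmod (phi b)) N ltac:(lra)).
 assert (R2 : k / 2 * T <= / Cmod (phi b) ^ N) by lra.
 assert (R3 : k / 2 * / Cmod (phi a) ^ N <= / Cmod (phi b) ^ N) by lra. split.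
 - destruct (Nat.lt_exists_pred 0 N HN) as (N' & EN & _). rewrite EN in Qa, Qb, R2, R3.
  apply (pow_le_reg _ _ N'); [lra | |].
  + apply Rmult_le_pos; [| lra]. apply Rdiv_le_0_compat; lra.
  + rewrite Rpow_mult_distr. apply Rle_trans with (2 / k * Cmod (phi a) ^ S N').
   * apply Rmult_le_reg_r with (k / 2 * / Cmod (phi a) ^ S N').
    { pos. }
    apply Rle_trans with (Cmod (phi b) ^ S N' * / Cmod (phi b) ^ S N').
    -- nra.
    -- right. field. repeat split; lra.
   * apply Rmult_le_compat_r; [lra |]. assert (1 <= 2 / k).
    { apply Rle_div_r; lra. }
    simpl. assert (1 <= (2 / k) ^ N') by (apply pow_R1_Rle; lra). nra.
 - apply Rmult_le_compat_l with (r := Cmod (phi b) ^ N) in R2; [| lra]. rewrite Rinv_r in R2 by lra. exact R2.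
Qed.

(** The drift estimate is started at the last passage through modulus [X0], or at time a if the
    solution is beyond it throughout. In the former case the bound is a multiple of [X0]; in the
    latter the whole time b - a is available for coming down. *)
Lemma margin_bound k : 0 < k <= 1 -> exists X0, 1 <= X0 /\ forall tau phi a b,
 sol (S N) A tau phi -> 0 <= a <= b -> b <= tau ->
 (forall t, a <= t <= b -> X0 <= Cmod (phi t) -> margin k (phi t)) ->
 Cmod (phi b) <= 2 / k * Rmax (Cmod (phi a)) X0 /\
 (Cmod (phi b) <= 2 / k * X0 \/ Cmod (phi b) ^ N * (k / 2 * (INR N * (b - a))) <= 1).
Proof.
 intros Hk. destruct (margin_drift k Hk) as (X0 & HX0 & H). exists X0. split; [lra |].
 intros tau phi a b Hs Hab Hb Hm. assert (K1 : 1 <= 2 / k).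
 { apply Rle_div_r; lra. }
 assert (K2 : X0 <= 2 / k * X0) by nra. destruct (Rmax_bounds (Cmod (phi a)) X0) as [K3 K4].
 assert (K5 : 2 / k * X0 <= 2 / k * Rmax (Cmod (phi a)) X0) by nra.
 assert (K6 : 2 / k * Cmod (phi a) <= 2 / k * Rmax (Cmod (phi a)) X0) by nra.
 destruct (Rle_dec X0 (Cmod (phi b))) as [Hle | Hle]; [| lra].
 destruct (last_below (fun t => Cmod (phi t)) a b X0 ltac:(lra)
   (fun t => continuous_Cmod phi t (proj1 Hs)) Hle) as [Hall | (s & Hs1 & Es & Hall)].
 - destruct (H tau phi a b Hs Hab Hb Hall (Hm a ltac:(lra) (Hall a ltac:(lra)))) as [R1 R2]. split; [lra | lra].
 - destruct (H tau phi s b Hs ltac:(lra) Hb Hall (Hm s ltac:(lra) ltac:(lra))) as [R1 R2].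
  rewrite Es in R1. split; [lra | lra].
Qed.

End Far.

(** * Counting periodic solutions *)

(** The time [w] map is kept as a relation, since a solution may fail to exist up to time [w]. *)
Definition Fl (n : nat) (A : nat -> R -> R) (w : R) (c d : C) : Prop :=
 exists phi, sol n A w phi /\ phi 0 = c /\ phi w = d.

Definition zm (n : nat) (A : nat -> R -> R) (w : R) (c : C) (k : nat) : Prop :=
 exists (r : R) (h : C -> C), 0 < r /\ h c <> RtoC 0 /\
  forall z, Cmod (z - c) < r -> Fl n A w z (z + (z - c) ^ k * h z)%C /\ hol h z.

(** Multiplicities refer to full neighbourhoods in the plane and [D] only selects points, so that
    counts over several regions add up. The condition 1 <= k matters because [zm] with k = 0 holds
    at points where the displacement does not vanish. *)
Definition counted (n : nat) (A : nat -> R -> R) (w : R) (D : C -> Prop) (N : nat) : Prop :=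
 exists ps : list (C * nat), NoDup (map fst ps) /\
  (forall c k, List.In (c, k) ps -> D c /\ (1 <= k)%nat /\ zm n A w c k) /\
  (forall c, D c -> Fl n A w c c -> List.In c (map fst ps)) /\
  fold_right Nat.add 0%nat (map snd ps) = N.

Section Count.
Variables (n : nat) (A : nat -> R -> R) (w : R).
Hypothesis HA : good_sys n A.
Hypothesis Hw : 0 < w.

Lemma sol_bounded phi : sol n A w phi -> exists M, 0 <= M /\ forall t, 0 <= t <= w -> Cmod (phi t) <= M.
Proof.
 intros [Cp _]. destruct (continuous_bounded (fun t => Cmod (phi t)) 0 w ltac:(lra)) as (m & _ & Hm).
 - intros t. apply continuous_Cmod, Cp.
 - exists (Cmod (phi m)). split; [pos | pos].
Qed.

Lemma Fl_Phi M c : 0 <= M -> (forall t, 0 <= t <= w -> Cmod (Phi n A w M c t) <= M) ->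
 Fl n A w c (Phi n A w M c w).
Proof.
 intros HM H. exists (Phi n A w M c). split; [| split; [| reflexivity]].
 - apply Phi_sol; try assumption. lra.
 - apply Phi_0; assumption.
Qed.

Lemma Fl_eq_Phi M c phi : 0 <= M -> sol n A w phi -> phi 0 = c ->
 (forall t, 0 <= t <= w -> Cmod (phi t) <= M) -> phi w = Phi n A w M c w.
Proof.
 intros HM Hs <- Hb. apply (sol_Phi n A w HA Hw M phi w); try assumption; lra.
Qed.

Lemma sol_unique phi psi : sol n A w phi -> sol n A w psi -> phi 0 = psi 0 ->
 forall t, 0 <= t <= w -> phi t = psi t.
Proof.
 intros H1 H2 E t Ht.
 destruct (sol_bounded phi H1) as (M1 & HM1 & B1). destruct (sol_bounded psi H2) as (M2 & HM2 & B2).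
 destruct (Rmax_bounds M1 M2) as [L1 L2].
 rewrite (sol_Phi n A w HA Hw (Rmax M1 M2) phi w), (sol_Phi n A w HA Hw (Rmax M1 M2) psi w); try assumption; try lra.
 - rewrite E. reflexivity.
 - intros s Hs. generalize (B2 s Hs). lra.
 - intros s Hs. generalize (B1 s Hs). lra.
Qed.

Lemma Fl_fun c d d' : Fl n A w c d -> Fl n A w c d' -> d = d'.
Proof.
 intros (phi & H1 & I1 & <-) (psi & H2 & I2 & <-). apply sol_unique; try assumption; [congruence | lra].
Qed.

Lemma zm_intro M a k h rho : 0 <= M -> (forall t, 0 <= t <= w -> Cmod (Phi n A w M a t) < M) ->
 hol h a -> h a <> 0%C -> 0 < rho ->
 (forall z, Cmod (z - a) < rho -> (Phi n A w M z w - z = (z - a) ^ k * h z)%C) -> zm n A w a k.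
Proof.
 intros HM Hb Hh H0 Hrho E. destruct (Phi_strict_near n A w HA Hw M a HM Hb) as (r1 & Hr1 & B1).
 destruct (hol_near h a Hh) as (r2 & Hr2 & B2). exists (Rmin rho (Rmin r1 r2)), h. split; [pos |]. split; [pos |].
 intros z Hz. destruct (Rmin_bounds rho (Rmin r1 r2)) as [M1 M2]. destruct (Rmin_bounds r1 r2) as [M3 M4].
 split; [| apply B2; lra]. rewrite <- E by lra. replace (z + (Phi n A w M z w - z))%C with (Phi n A w M z w) by ring.
 apply Fl_Phi; [lra |]. intros t Ht. left. apply B1; [lra | lra].
Qed.

Lemma zm_Fl c k : (1 <= k)%nat -> zm n A w c k -> Fl n A w c c.
Proof.
 intros Hk (r & h & Hr & _ & H). destruct (H c) as [F _].
 - rewrite Cmod_sub_diag. exact Hr.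
 - replace (c + (c - c) ^ k * h c)%C with c in F; [exact F |]. destruct k as [| k]; [lia |]. simpl. ring.
Qed.

Lemma counted_single (D : C -> Prop) a k : (1 <= k)%nat -> D a -> zm n A w a k ->
 (forall c, D c -> Fl n A w c c -> c = a) -> counted n A w D k.
Proof.
 intros Hk Da Hz Hu. exists ((a, k) :: nil). split; [| split; [| split]].
 - apply NoDup_cons; [intros [] | apply NoDup_nil].
 - intros c j [E | []]. injection E as <- <-. repeat split; assumption.
 - intros c Dc Hc. left. symmetry. apply Hu; assumption.
 - simpl. lia.
Qed.

Lemma counted_none (D : C -> Prop) : (forall c, D c -> ~ Fl n A w c c) -> counted n A w D 0.
Proof.
 intros H. exists nil. split; [apply NoDup_nil | split; [| split; [| reflexivity]]].
 - intros c k [].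
 - pos.
Qed.

(** Only periodic starts in the overlap are forbidden, so closed regions may share a boundary that
    carries none. *)
Lemma counted_union (D1 D2 : C -> Prop) N1 N2 :
 counted n A w D1 N1 -> counted n A w D2 N2 ->
 (forall c, D1 c -> D2 c -> ~ Fl n A w c c) ->
 counted n A w (fun z => D1 z \/ D2 z) (N1 + N2).
Proof.
 intros (p1 & U1 & Z1 & I1 & S1) (p2 & U2 & Z2 & I2 & S2) Hd.
 exists (p1 ++ p2). rewrite !map_app. split; [| split; [| split]].
 - apply NoDup_app; try assumption. intros c H1 H2. apply in_map_iff in H1. apply in_map_iff in H2.
  destruct H1 as ((c1 & k1) & E1 & H1). destruct H2 as ((c2 & k2) & E2 & H2). simpl in *. subst c1 c2.
  destruct (Z1 _ _ H1) as (A1 & K1 & Y1). destruct (Z2 _ _ H2) as (A2 & K2 & Y2).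
  apply (Hd c A1 A2). apply (zm_Fl c k1); assumption.
 - intros c k H. apply in_app_or in H.
  destruct H as [H | H]; [destruct (Z1 _ _ H) as (X & Y) | destruct (Z2 _ _ H) as (X & Y)]; split; auto.
 - intros c [Dc | Dc] Hc; apply in_or_app; [left; apply I1 | right; apply I2]; assumption.
 - rewrite fold_right_app, S2, <- S1. clear. induction (map snd p1) as [| x l IH]; simpl; [lia |]. rewrite IH. lia.
Qed.

Lemma counted_ext (D1 D2 : C -> Prop) N : (forall c, Fl n A w c c -> (D1 c <-> D2 c)) ->
 counted n A w D1 N -> counted n A w D2 N.
Proof.
 intros H (p & U & Z & I & S). exists p. split; [exact U | split; [| split; [| exact S]]].
 - intros c k Hi. destruct (Z c k Hi) as (X & Y & V). split; [| split; assumption].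
  apply H; [apply (zm_Fl c k); assumption | exact X].
 - intros c Dc Hc. apply I; [apply H |]; assumption.
Qed.

End Count.

(** * Zero counting by comparison on the boundary *)

Lemma off_ray_div (u v : C) : 0 < Re u -> 0 < Re v -> off_ray (u / v)%C.
Proof.
 intros Hu Hv. assert (Hv0 : v <> 0%C) by (intros ->; simpl in Hv; lra).
 destruct (Req_dec (Im (u / v)) 0) as [E | E]; [left | right; exact E].
 assert (Eu : u = (u / v * v)%C) by (field; exact Hv0). assert (R1 : Re u = Re (u / v) * Re v - Im (u / v) * Im v).
 { rewrite Eu at 1. reflexivity. }
 rewrite E in R1. nra.
Qed.

Lemma off_ray_Im (u : C) k : Im u <> 0 -> k <> 0 -> off_ray (u / k)%C.
Proof.
 intros Hu Hk. right. replace (Im (u / k)) with (Im u / k); [| unfold Im, Cdiv, Cinv; simpl; field; exact Hk].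
 intros E. apply Hu. apply (f_equal (Rmult k)) in E. rewrite Rmult_0_r in E.
 replace (Im u) with (k * (Im u / k)) by (field; exact Hk). exact E.
Qed.

Lemma gcont_of_hol K g : (forall z, K z -> hol g z) -> gcont_on K g.
Proof.
 intros H z eps Kz He. destruct (hol_ccont g z (H z Kz) eps He) as (d & Hd & A).
 exists d. split; [lra | intros y _; apply A].
Qed.

(* [Z] collects the zeros common to the displacement [Z * q] and to the comparison function [Z * E]. *)
Lemma no_further_zero (K : C -> Prop) (Z q V E : C -> C) : ccompact K ->
 (forall z, K z -> hol q z /\ hol V z /\ hol E z) -> (forall z, K z -> E z <> 0%C) ->
 (forall z, K z -> (Z z <> 0%C /\ off_ray (Z z * q z * V z / (Z z * E z))) \/ inner K z) ->
 forall z, K z -> q z <> 0%C.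
Proof.
 intros HK Hh HE Hb z Kz Eq. apply (ray_lemma K (fun z => q z * V z / E z)%C HK) with z; [| | pos |].
 - apply gcont_of_hol. intros y Ky. destruct (Hh y Ky) as (H1 & H2 & H3).
  apply hol_div; [apply hol_mult | | apply HE]; assumption.
 - intros y Ky. destruct (Hb y Ky) as [[HZ Ho] | Hi].
  + left. replace (q y * V y / E y)%C with (Z y * q y * V y / (Z y * E y))%C; [pos |].
   field. split; [apply HE, Ky | pos].
  + right. split; [| pos]. destruct (Hh y Ky) as (H1 & H2 & H3).
   apply hol_div; [apply hol_mult | | apply HE]; assumption.
 - rewrite Eq. unfold Cdiv. ring.
Qed.

(** Writing the displacement as (z - a) q, the comparison function (z - a) E has the same factor and
    E has no zero, so q has none either. The factor V converts the displacement to another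
    coordinate, for instance to a difference of values of [W]. *)
Lemma simple_zero n A w M (K : C -> Prop) a (V E : C -> C) : good_sys n A -> 0 < w -> 0 <= M -> ccompact K ->
 (forall z t, K z -> 0 <= t <= w -> Cmod (Phi n A w M z t) < M) -> K a -> Phi n A w M a w = a ->
 (forall z, K z -> hol V z /\ hol E z) -> (forall z, K z -> E z <> 0%C) ->
 (forall z, K z ->
  (z <> a /\ off_ray ((Phi n A w M z w - z) * V z / ((z - a) * E z))%C) \/ inner K z) ->
 zm n A w a 1 /\ forall c, K c -> Phi n A w M c w = c -> c = a.
Proof.
 intros HA Hw HM HK Hb Ka Fa Hh HE Hbd. set (f := fun z => Phi n A w M z w) in *.
 assert (Hf : forall z, K z -> hol f z).
 { intros z Kz. apply (hol_Phi n A w HA Hw M z HM). intros t Ht. apply Hb; assumption. }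
 destruct (fix_slope f a (Hf a Ka) Fa) as (q & E1 & H1). assert (N : forall z, K z -> q z <> 0%C).
 { apply (no_further_zero K (fun z => z - a)%C q V E HK); [| pos |].
  - intros z Kz. split; [apply H1, Hf, Kz | apply Hh, Kz].
  - intros z Kz. destruct (Hbd z Kz) as [[B1 B2] | Hi]; [left | right; exact Hi].
   rewrite <- E1. split; [apply Csub_neq_0, B1 | pos]. }
 split.
 - apply (zm_intro n A w HA Hw M a 1 q 1); [lra | intros t Ht; apply Hb; assumption | apply H1, Hf, Ka | apply N, Ka | lra |].
  intros z _. change (f z - z = (z - a) ^ 1 * q z)%C. rewrite E1. simpl. ring.
 - intros c Kc Fc. assert (Eq := E1 c). change (f c = c) in Fc. rewrite Fc in Eq.
  replace (c - c)%C with (RtoC 0) in Eq by ring. symmetry in Eq. destruct (Ceq_dec c a) as [E0 | Hne]; [pos |].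
  destruct (Cmult_neq_0 (c - a) (q c) (Csub_neq_0 _ _ Hne) (N c Kc) Eq).
Qed.

(** The roles are exchanged here: if N had no zero, E / N would be holomorphic with the boundary
    behaviour of [ray_lemma] and yet vanish at a. *)
Lemma zero_exists (K : C -> Prop) (N E : C -> C) a : ccompact K ->
 (forall z, K z -> hol N z /\ hol E z) -> K a -> E a = 0%C ->
 (forall z, K z -> off_ray (E z / N z)%C \/ inner K z) ->
 exists z, K z /\ N z = 0%C.
Proof.
 intros HK Hh Ka Ea Hb. apply NNPP. intros Hn.
 assert (HN : forall z, K z -> N z <> 0%C) by (intros z Kz E0; apply Hn; exists z; split; assumption).
 apply (ray_lemma K (fun z => E z / N z)%C HK) with a; [| | pos |].
 - apply gcont_of_hol. intros y Ky. destruct (Hh y Ky). apply hol_div; [| | apply HN]; assumption.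
 - intros y Ky. destruct (Hb y Ky) as [Ho | Hi]; [left; exact Ho | right].
  split; [| pos]. destruct (Hh y Ky). apply hol_div; [| | apply HN]; assumption.
 - rewrite Ea. unfold Cdiv. ring.
Qed.

Lemma off_ray_inv (u : C) : u <> 0%C -> off_ray u -> off_ray (/ u)%C.
Proof.
 intros Hu Ho. assert (P : 0 < Re u * Re u + Im u * Im u).
 { rewrite <- Cmod2_Re_Im. apply Cmod_gt_0 in Hu. nra. }
 unfold off_ray in *. unfold Cinv, Re, Im in *; simpl in *. destruct Ho as [Ho | Ho]; [left | right].
 - pos.
 - intros E. apply Ho. apply (f_equal (Rmult (fst u * (fst u * 1) + snd u * (snd u * 1)))) in E.
  field_simplify in E; lra.
Qed.

Lemma ccompact_inter_closed (K1 K2 : C -> Prop) : ccompact K1 ->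
 (forall z, ~ K2 z -> exists d, 0 < d /\ forall y, Cmod (y - z) < d -> ~ K2 y) ->
 ccompact (fun z => K1 z /\ K2 z).
Proof.
 intros H1 H2. apply ccompact_sub; [pos |]. intros z _ Hz. destruct (H2 z Hz) as (d & Hd & H).
 exists d. split; [lra |]. intros y _. apply H.
Qed.

Lemma ccompact_disc Y : ccompact (fun z => Cmod z <= Y).
Proof.
 split; [exists Y; intros; assumption |]. intros z Hz. apply Rnot_le_lt in Hz.
 exists (Cmod z - Y). split; [lra |]. intros y Hy. generalize (Cmod_reverse z y). rewrite (Cmod_sub_sym z y). lra.
Qed.

Lemma closed_outside r z : ~ r <= Cmod z -> exists d, 0 < d /\ forall y, Cmod (y - z) < d -> ~ r <= Cmod y.
Proof.
 intros Hz. apply Rnot_le_lt in Hz. exists (r - Cmod z). split; [lra |]. intros y Hy.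
 generalize (Cmod_reverse y z). lra.
Qed.

Lemma closed_sector lo hi z : ~ sector lo hi z -> exists d, 0 < d /\ forall y, Cmod (y - z) < d -> ~ sector lo hi y.
Proof.
 intros Hz. unfold sector in *. assert (S : forall th y, Rabs (side th y - side th z) <= Cmod (y - z)).
 { intros th y. rewrite <- side_minus. apply side_le_Cmod. }
 destruct (Rle_dec 0 (side lo z)) as [H1 | H1].
 - destruct (Rle_dec (side hi z) 0) as [H2 | H2]; [lra |].
  exists (side hi z). split; [lra |]. intros y Hy [_ H]. assert (A := S hi y). apply Rabs_le_between in A. lra.
 - exists (- side lo z). split; [lra |]. intros y Hy [H _]. assert (A := S lo y). apply Rabs_le_between in A. lra.
Qed.

(** * The disc *)

Lemma Re_one_minus (u z : C) : Cmod u < Cmod z -> 0 < Re (1 - u / z)%C.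
Proof.
 intros Hu. assert (Hz : 0 < Cmod z) by (generalize (Cmod_ge_0 u); lra).
 assert (Hz0 : z <> 0%C) by (apply Cmod_gt_0, Hz). assert (B : Cmod (u / z) < 1).
 { rewrite Cmod_div by exact Hz0. apply Rmult_lt_reg_r with (Cmod z); [lra |].
  unfold Rdiv. rewrite Rmult_assoc, Rinv_l; lra. }
 assert (B2 := re_le_Cmod (u / z)%C). apply Rabs_le_between in B2. change (0 < 1 - Re (u / z)%C). lra.
Qed.

Lemma off_ray_side th (u z : C) : 0 < Cmod z -> z = polar (Cmod z) th -> side th u <> 0 -> off_ray (1 - u / z)%C.
Proof.
 intros Hz E Hne. right. change (0 - Im (u / z)%C <> 0). assert (Ei : Im (u / z)%C = side th u * / Cmod z).
 { rewrite E at 1. unfold Cdiv. rewrite polar_inv by lra.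
  change (Re u * Im (polar (/ Cmod z) (- th)) + Im u * Re (polar (/ Cmod z) (- th)) = side th u * / Cmod z).
  rewrite Re_polar, Im_polar, sin_neg, cos_neg. unfold side. ring. }
 rewrite Ei. assert (0 < / Cmod z) by pos. intros E0. apply Hne. apply Rmult_eq_reg_r with (/ Cmod z); lra.
Qed.

Section Disc.
Variables (n : nat) (A : nat -> R -> R) (w r : R).
Hypothesis HA : good_sys n A.
Hypothesis Hw : 0 < w.
Hypothesis Hr : 0 < r.
Hypothesis Hin : circ_in n A w r.

Lemma disc_bound c t : Cmod c <= r -> 0 <= t <= w ->
 Cmod (Phi n A w (r + 1) c t) <= r /\ (0 < t -> Cmod (Phi n A w (r + 1) c t) < r).
Proof.
 intros Hc Ht. assert (HM : 0 <= r + 1) by lra.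
 assert (B : forall t, 0 <= t <= w -> Cmod (Phi n A w (r + 1) c t) <= r).
 { apply (Phi_apriori n A w HA Hw (r + 1) r c); try lra.
  intros tau Htau Hs _. apply (circ_in_inv n A w HA r tau _ 0 tau Hr Hin Hs); try lra.
  rewrite Phi_0 by assumption. exact Hc. }
 split; [apply B, Ht |]. intros Hpos. apply (circ_in_inv n A w HA r w (Phi n A w (r + 1) c) 0 w Hr Hin); try lra.
 - apply Phi_sol; try assumption; try lra. intros s Hs. generalize (B s Hs). lra.
 - rewrite Phi_0 by assumption. exact Hc.
Qed.

(** On the circle |f| < |z|, so 1 - f / z has positive real part. Comparison with -z produces a
    fixed point a, and a second comparison, with 1 - a / z in the denominator, shows that it is
    simple and alone. *)
Lemma disc_count : counted n A w (fun z => Cmod z <= r) 1.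
Proof.
 set (f := fun z => Phi n A w (r + 1) z w). set (q := fun z => (f z - z)%C). assert (HM : 0 <= r + 1) by lra.
 assert (Hf : forall z, Cmod z <= r -> hol f z).
 { intros z Hz. apply (hol_Phi n A w HA Hw (r + 1) z HM). intros t Ht. generalize (disc_bound z t Hz Ht). lra. }
 assert (Hq : forall z, Cmod z <= r -> hol q z).
 { intros z Hz. apply hol_minus; [apply Hf, Hz | apply hol_id]. }
 assert (Ff : forall z, Cmod z <= r -> Cmod (f z) < r).
 { intros z Hz. apply (disc_bound z w Hz); lra. }
 assert (Re1 : forall x z : C, Cmod z = r -> Cmod x < r -> 0 < Re (1 - x / z)%C)
  by (intros x z Hz Hx; apply Re_one_minus; lra).
 assert (Inn : forall z, Cmod z < r -> inner (fun z => Cmod z <= r) z).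
 { intros z Hz. exists (r - Cmod z). split; [lra |]. intros y Hy. generalize (Cmod_reverse y z). lra. }
 destruct (zero_exists (fun z => Cmod z <= r) q (fun z => - z)%C 0%C) as (a & Ka & Ea).
 - apply ccompact_disc.
 - intros z Hz. split; [apply Hq, Hz | apply hol_opp, hol_id].
 - rewrite Cmod_0. lra.
 - ring.
 - intros z Hz. destruct (Req_dec (Cmod z) r) as [Er | Er]; [left | right; apply Inn; lra].
  assert (Hz0 : z <> 0%C) by (apply Cmod_gt_0; lra). assert (H1 := Re1 (f z) z Er (Ff z Hz)).
  replace (- z / q z)%C with (1 / (1 - f z / z))%C.
  + apply off_ray_div; [simpl; lra | lra].
  + assert (Hne : (1 - f z / z)%C <> 0%C) by (intros E0; rewrite E0 in H1; simpl in H1; lra).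
   assert (Hq0 : q z <> 0%C).
   { intros E0. apply Hne. unfold q in E0. replace (1 - f z / z)%C with (- (f z - z) / z)%C by (field; exact Hz0).
    rewrite E0. unfold Cdiv. ring. }
   unfold q in *. replace (1 - f z / z)%C with ((z - f z) / z)%C by (field; exact Hz0).
   field. repeat split; try assumption. intros E0. apply Hq0.
   replace (f z - z)%C with (- (z - f z))%C by ring. rewrite E0. ring.
 - assert (Haf : f a = a).
  { unfold q in Ea. replace (f a) with ((f a - a) + a)%C by ring. rewrite Ea. ring. }
  assert (Ha : Cmod a < r) by (rewrite <- Haf; apply Ff, Ka).
  destruct (simple_zero n A w (r + 1) (fun z => Cmod z <= r) a (fun _ => RtoC (-1)) (fun _ => 1%C)) as [Z1 Z2]; try assumption.
  + apply ccompact_disc.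
  + intros z t Hz Ht. generalize (disc_bound z t Hz Ht). lra.
  + intros z _. split; apply hol_const.
  + intros z _ E0. apply RtoC_inj in E0. lra.
  + intros z Hz. destruct (Req_dec (Cmod z) r) as [Er | Er]; [left | right; apply Inn; lra].
   assert (Hz0 : z <> 0%C) by (apply Cmod_gt_0; lra).
   assert (Hza : z <> a) by (intros ->; lra). split; [pos |]. apply Csub_neq_0 in Hza.
   replace ((Phi n A w (r + 1) z w - z) * RtoC (-1) / ((z - a) * 1))%C with ((1 - f z / z) / (1 - a / z))%C.
   * apply off_ray_div; apply Re1; try assumption. apply Ff, Hz.
   * replace (RtoC (-1)) with (- (1))%C by (rewrite <- RtoC_opp; reflexivity).
    replace (1 - a / z)%C with ((z - a) / z)%C by (field; exact Hz0). unfold f. field. split; assumption.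
  + apply (counted_single n A w _ a 1); [lia | lra | pos |]. intros c Hc (phi & Hs & I0 & I1). apply Z2; [lra |].
   rewrite <- (Fl_eq_Phi n A w HA Hw (r + 1) c phi HM Hs I0); [pos |].
   intros t Ht. generalize (circ_in_inv n A w HA r w phi 0 w Hr Hin Hs ltac:(lra) ltac:(lra) ltac:(lra)
    ltac:(rewrite I0; exact Hc) t Ht). lra.
Qed.

End Disc.

(** * The comparison function *)

Lemma pow_le_reg1 (x y : R) k : (1 <= k)%nat -> 0 <= x -> 0 <= y -> x ^ k <= y ^ k -> x <= y.
Proof. intros Hk. destruct k as [| k]; [lia |]. apply pow_le_reg. Qed.

Lemma pow_ge_self x k : (1 <= k)%nat -> 1 <= x -> x <= x ^ k.
Proof.
 intros Hk H. destruct k as [| k]; [lia |]. simpl. assert (1 <= x ^ k) by (apply pow_R1_Rle; lra). nra.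
Qed.

(* [W] maps a sector of opening [PI / m] outside the disc of radius [R2 ^ (1 / (2 m))]
   conformally onto a half plane; it is real on the boundary. *)
Definition W (kap R2 : R) (m : nat) (z : C) : C := (RtoC kap * (z ^ m + R2 * / z ^ m))%C.

(** The divided difference of [W]. That it has no zero expresses both injectivity and a nonvanishing
    derivative. *)
Definition DW (kap R2 : R) (m : nat) (x y : C) : C :=
 (RtoC kap * pdiff x y m * (1 - R2 * / (x ^ m * y ^ m)))%C.

Lemma DW_spec kap R2 m (x y : C) : x <> 0%C -> y <> 0%C ->
 (W kap R2 m x - W kap R2 m y = (x - y) * DW kap R2 m x y)%C.
Proof.
 intros Hx Hy. unfold W, DW. assert (Px := Cpow_nz x m Hx). assert (Py := Cpow_nz y m Hy).
 transitivity (RtoC kap * ((x ^ m - y ^ m) * (1 - R2 * / (x ^ m * y ^ m))))%C.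
 - field. split; assumption.
 - rewrite pdiff_spec. ring.
Qed.

Lemma hol_pdiff f g m c : hol f c -> hol g c -> hol (fun z => pdiff (f z) (g z) m) c.
Proof.
 intros Hf Hg. induction m as [| m IH]; [apply (hol_const 0%C) |]. cbn [pdiff].
 apply hol_plus; [apply hol_mult; assumption | apply hol_pow, Hg].
Qed.

Lemma hol_W kap R2 m f c : hol f c -> f c <> 0%C -> hol (fun z => W kap R2 m (f z)) c.
Proof.
 intros Hf H0. unfold W. apply hol_mult; [apply hol_const |].
 apply hol_plus; [apply hol_pow, Hf |]. apply hol_mult; [apply hol_const |].
 apply (hol_inv (fun z => f z ^ m)%C); [apply hol_pow, Hf | apply Cpow_nz, H0].
Qed.

Lemma hol_DW kap R2 m f g c : hol f c -> hol g c -> f c <> 0%C -> g c <> 0%C ->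
 hol (fun z => DW kap R2 m (f z) (g z)) c.
Proof.
 intros Hf Hg H0 H1. unfold DW. apply hol_mult.
 - apply hol_mult; [apply hol_const | apply hol_pdiff; assumption].
 - apply hol_minus; [apply hol_const |]. apply hol_mult; [apply hol_const |].
  apply (hol_inv (fun z => f z ^ m * g z ^ m)%C).
  + apply hol_mult; apply hol_pow; assumption.
  + apply Cmult_neq_0; apply Cpow_nz; assumption.
Qed.

(** [W] is the Joukowski map applied to z^m. The sign [kap] is e^(i m lo), real because the ray lo
    is one where z^m is real, and it makes the angle count from that ray. *)
Lemma W_polar kap R2 m rho lo b : kap * kap = 1 -> el (INR m * lo) = kap -> 0 < rho ->
 W kap R2 m (polar rho (lo + b)) = (polar (rho ^ m) (INR m * b) + polar (R2 * / rho ^ m) (- (INR m * b)))%C.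
Proof.
 intros Hk He Hr. unfold W. rewrite polar_pow, polar_inv by (apply pow_nonzero; lra).
 replace (INR m * (lo + b)) with (INR m * lo + INR m * b) by ring. unfold polar. rewrite el_plus, He.
 replace (- (INR m * lo + INR m * b)) with (- (INR m * lo) + - (INR m * b)) by ring. rewrite el_plus.
 assert (E : el (- (INR m * lo)) = kap).
 { transitivity (RtoC (kap * kap) * el (- (INR m * lo)))%C; [rewrite Hk; ring |].
  rewrite RtoC_mult, <- He at 1. rewrite <- Cmult_assoc, (Cmult_comm kap). rewrite Cmult_assoc, el_opp. ring. }
 rewrite E, RtoC_mult.
 transitivity (RtoC (kap * kap) * (RtoC (rho ^ m) * el (INR m * b) + R2 * RtoC (/ rho ^ m) * el (- (INR m * b))))%C.
 - rewrite RtoC_mult. ring.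
 - rewrite Hk. ring.
Qed.

Lemma Im_W_polar kap R2 m rho lo b : kap * kap = 1 -> el (INR m * lo) = kap -> 0 < rho ->
 Im (W kap R2 m (polar rho (lo + b))) = (rho ^ m - R2 * / rho ^ m) * sin (INR m * b).
Proof.
 intros Hk He Hr. rewrite W_polar by assumption.
 change (Im (polar (rho ^ m) (INR m * b)) + Im (polar (R2 * / rho ^ m) (- (INR m * b)))
     = (rho ^ m - R2 * / rho ^ m) * sin (INR m * b)).
 rewrite !Im_polar, sin_neg. ring.
Qed.

Lemma Re_W_polar kap R2 m rho lo b : kap * kap = 1 -> el (INR m * lo) = kap -> 0 < rho ->
 Re (W kap R2 m (polar rho (lo + b))) = (rho ^ m + R2 * / rho ^ m) * cos (INR m * b).
Proof.
 intros Hk He Hr. rewrite W_polar by assumption.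
 change (Re (polar (rho ^ m) (INR m * b)) + Re (polar (R2 * / rho ^ m) (- (INR m * b)))
     = (rho ^ m + R2 * / rho ^ m) * cos (INR m * b)).
 rewrite !Re_polar, cos_neg. ring.
Qed.

Lemma el_inj x y : el x = el y -> Rabs (x - y) < 2 * PI -> x = y.
Proof.
 intros E H. assert (E1 : el (x - y) = 1%C).
 { unfold Rminus. rewrite el_plus, E. apply el_opp. }
 apply (f_equal Re) in E1. change (cos (x - y) = 1) in E1.
 replace (x - y) with (2 * ((x - y) / 2)) in E1 by field. rewrite cos_2a_sin in E1.
 assert (S : sin ((x - y) / 2) = 0) by nra. apply Rabs_lt_between in H.
 destruct (Rtotal_order ((x - y) / 2) 0) as [Hl | [Hl | Hl]]; [| lra |]; exfalso.
 - assert (0 < sin (- ((x - y) / 2))) by (apply sin_gt_0; lra). rewrite sin_neg in *. lra.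
 - assert (0 < sin ((x - y) / 2)) by (apply sin_gt_0; lra). lra.
Qed.

Lemma pow_inj_pos x y k : 0 < x -> 0 < y -> x ^ S k = y ^ S k -> x = y.
Proof. intros Hx Hy E. apply Rle_antisym; apply (pow_le_reg _ _ k); lra. Qed.

Lemma polar_pow_inj m rho th rho' th' : (1 <= m)%nat -> 0 < rho -> 0 < rho' ->
 Rabs (INR m * (th - th')) < 2 * PI ->
 (polar rho th ^ m = polar rho' th' ^ m)%C -> polar rho th = polar rho' th'.
Proof.
 intros Hm Hr Hr' Hd E. rewrite !polar_pow in E. assert (Er : rho ^ m = rho' ^ m).
 { apply (f_equal Cmod) in E. rewrite !Cmod_polar in E by pos. exact E. }
 destruct m as [| k]; [lia |]. assert (Err : rho = rho') by (apply (pow_inj_pos _ _ k); assumption). subst rho'.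
 assert (P := pow_lt rho (S k) Hr). assert (Ee : el (INR (S k) * th) = el (INR (S k) * th')).
 { unfold polar in E. apply (f_equal (Cmult (/ RtoC (rho ^ S k)))) in E.
  rewrite !Cmult_assoc, !Cinv_l, !Cmult_1_l in E by (intros E0; apply RtoC_inj in E0; lra). exact E. }
 apply el_inj in Ee.
 - f_equal. apply Rmult_eq_reg_l with (INR (S k)); [lra |]. apply not_0_INR. lia.
 - replace (INR (S k) * th - INR (S k) * th') with (INR (S k) * (th - th')) by ring. exact Hd.
Qed.

Lemma pdiff_diag x k : pdiff x x (S k) = (RtoC (INR (S k)) * x ^ k)%C.
Proof.
 induction k as [| k IH].
 - simpl. ring.
 - change (pdiff x x (S (S k))) with (x * pdiff x x (S k) + x ^ S k)%C.
  rewrite IH, (S_INR (S k)), RtoC_plus. simpl Cpow. ring.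
Qed.

(** The m-th power is injective for angles less than 2 pi / m apart, and the other factor vanishes
    only where x^m y^m = r^(2 m), which |x| |y| > r^2 excludes. *)
Lemma DW_neq_0 kap r m rho th rho' th' : kap * kap = 1 -> (1 <= m)%nat -> 0 < r -> 0 < rho -> 0 < rho' ->
 r * r < rho * rho' -> Rabs (INR m * (th - th')) < 2 * PI ->
 DW kap (r ^ m * r ^ m) m (polar rho th) (polar rho' th') <> 0%C.
Proof.
 intros Hk Hm Hr H1 H2 H3 Hd. unfold DW.
 assert (N1 : polar rho th <> 0%C) by (apply Cmod_gt_0; rewrite Cmod_polar; lra).
 assert (N2 : polar rho' th' <> 0%C) by (apply Cmod_gt_0; rewrite Cmod_polar; lra).
 apply Cmult_neq_0; [apply Cmult_neq_0 |].
 - intros E. apply RtoC_inj in E. rewrite E in Hk. lra.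
 - destruct (Ceq_dec (polar rho th) (polar rho' th')) as [E | Hne].
  + rewrite E. destruct m as [| k]; [lia |]. rewrite pdiff_diag.
   apply Cmult_neq_0; [| apply Cpow_nz, N2]. intros E0. apply RtoC_inj in E0.
   generalize (pos_INR k). rewrite S_INR in E0. lra.
  + intros E. apply Hne. apply (polar_pow_inj m); try assumption.
   assert (S := pdiff_spec (polar rho th) (polar rho' th') m). rewrite E in S.
   replace (polar rho th ^ m)%C with ((polar rho th ^ m - polar rho' th' ^ m) + polar rho' th' ^ m)%C by ring.
   rewrite S. ring.
 - assert (P1 := Cpow_nz _ m N1). assert (P2 := Cpow_nz _ m N2).
  assert (B : Cmod (RtoC (r ^ m * r ^ m) * / (polar rho th ^ m * polar rho' th' ^ m)) < 1).
  { rewrite Cmod_mult, Cmod_inv, Cmod_mult, !Cmod_pow, !Cmod_polar, Cmod_R by (try (apply Cmult_neq_0; assumption); lra).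
   assert (Q : 0 < r ^ m) by pos. rewrite Rabs_pos_eq by nra. rewrite <- !Rpow_mult_distr.
   assert (Q2 : (r * r) ^ m < (rho * rho') ^ m).
   { apply Rnot_le_lt. intros Hle. destruct m as [| k]; [lia |]. apply pow_le_reg in Hle; nra. }
   assert (Q3 : 0 < (rho * rho') ^ m) by pos. apply Rmult_lt_reg_r with ((rho * rho') ^ m); [lra |].
   rewrite Rmult_assoc, Rinv_l; lra. }
  intros E. replace (RtoC (r ^ m * r ^ m) * / (polar rho th ^ m * polar rho' th' ^ m))%C
   with (1 - (1 - RtoC (r ^ m * r ^ m) * / (polar rho th ^ m * polar rho' th' ^ m)))%C in B by ring.
  rewrite E in B. replace (1 - 0)%C with (RtoC 1) in B by ring. rewrite Cmod_1 in B. lra.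
Qed.

(* On a large circle [p - b] is nearly [-b]; a negative quotient would make [b] nearly
   real positive and force [Im p] to have the sign of [- Im b]. *)
Lemma far_off_ray P s1 s2 : 0 <= P -> exists Y0, 0 < Y0 /\ forall p b : C,
 Cmod p <= P -> 0 < Im p -> 0 <= Im b -> Y0 <= Cmod b ->
 (b * b - RtoC s1 * b + RtoC s2)%C <> 0%C /\
 off_ray ((p - b) / (b * b - RtoC s1 * b + RtoC s2))%C.
Proof.
 intros HP. set (Y0 := 1 + 4 * P + 10 * (Rabs s1 + 2 * Rabs s2)).
 assert (A1 := Rabs_pos s1). assert (A2 := Rabs_pos s2).
 exists Y0. split; [unfold Y0; lra |]. intros p b Hp Hip Hib Hb. assert (Hb1 : 1 <= Cmod b) by (unfold Y0 in Hb; lra).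
 assert (Hb0 : b <> 0%C) by (apply Cmod_gt_0; lra). set (V := (b - s1 + s2 / b)%C).
 assert (EQ : (b * b - s1 * b + s2 = b * V)%C) by (unfold V; field; exact Hb0).
 assert (Hs2b : Cmod (RtoC s2 / b) <= Rabs s2).
 { rewrite Cmod_div, Cmod_R by exact Hb0. apply Rmult_le_reg_r with (Cmod b); [lra |].
  unfold Rdiv. rewrite Rmult_assoc, Rinv_l by lra. nra. }
 assert (HV : Cmod b / 2 <= Cmod V).
 { assert (B1 := Cmod_reverse b (RtoC s1 - s2 / b)).
  replace (b - (RtoC s1 - s2 / b))%C with V in B1 by (unfold V; ring).
  assert (B2 := Cmod_triangle_minus s1 (RtoC s2 / b)). rewrite Cmod_R in B2. unfold Y0 in Hb. lra. }
 assert (HV0 : V <> 0%C) by (apply Cmod_gt_0; lra).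
 assert (HQ : (b * b - s1 * b + s2)%C <> 0%C) by (rewrite EQ; apply Cmult_neq_0; assumption). split; [pos |].
 set (g := ((p - b) / (b * b - s1 * b + s2))%C). destruct (Req_dec (Im g) 0) as [Eg | Eg]; [| right; exact Eg].
 left. apply Rnot_le_lt. intros Hle. set (x := - Re g). assert (Hx : 0 <= x) by (unfold x; lra).
 assert (Egx : g = RtoC (- x)) by (apply C_eq; [unfold x; simpl; ring | pos]).
 (* If the quotient is -x then Im p = Im b (1 - x (2 Re b - s1)), so Im p > 0 forces x (2 Re b - s1)
    < 1. But p is small against b, so x V is close to 1 and x Re b nearly 1 as well. The terms of
    [Y0] make the errors too small to reconcile the two. *)
 assert (Ep : p = (b - x * (b * b - s1 * b + s2))%C).
 { replace p with (b + g * (b * b - s1 * b + s2))%C by (unfold g; field; exact HQ). rewrite Egx, RtoC_opp. ring. }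
 assert (EI : Im p = Im b * (1 - x * (2 * Re b - s1))).
 { rewrite Ep. unfold Re, Im; simpl. ring. }
 assert (Hlt : x * (2 * Re b - s1) < 1) by nra.
 assert (Epb : (p / b = 1 - x * V)%C) by (rewrite Ep; unfold V; field; exact Hb0).
 assert (Hpb : Cmod (p / b) <= 1 / 4).
 { rewrite Cmod_div by exact Hb0. apply Rmult_le_reg_r with (Cmod b); [lra |].
  unfold Rdiv. rewrite Rmult_assoc, Rinv_l by lra. unfold Y0 in Hb. lra. }
 assert (HxV : x * Cmod V <= 5 / 4).
 { replace (x * Cmod V) with (Cmod (RtoC x * V)) by (rewrite Cmod_mult, Cmod_R, Rabs_pos_eq; lra).
  replace (RtoC x * V)%C with (1 - p / b)%C by (rewrite Epb; ring).
  eapply Rle_trans; [apply Cmod_triangle_minus |]. rewrite Cmod_1. lra. }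
 assert (Hxb : x * Cmod b <= 5 / 2) by nra. assert (HR : 3 / 4 <= x * Re V).
 { assert (B := re_le_Cmod (p / b)). apply Rabs_le_between in B.
  replace (x * Re V) with (1 - Re (p / b)); [lra |]. rewrite Epb. unfold Re, Im; simpl. ring. }
 assert (ERV : Re V = Re b - s1 + Re (RtoC s2 / b)) by reflexivity.
 assert (B3 := re_le_Cmod (RtoC s2 / b)). apply Rabs_le_between in B3.
 assert (Hxs : x * (Rabs s1 + 2 * Rabs s2) <= 1 / 4).
 { assert (x * (10 * (Rabs s1 + 2 * Rabs s2)) <= x * Cmod b) by (apply Rmult_le_compat_l; unfold Y0 in Hb; lra). lra. }
 assert (B4 := Rle_abs s1). assert (B5 := Rle_abs (- s1)). rewrite Rabs_Ropp in B5.
 assert (x * (- s1) <= x * Rabs s1) by nra. assert (x * Re (RtoC s2 / b) <= x * Rabs s2) by nra.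
 rewrite ERV in HR. nra.
Qed.

(** * Sectors away from the real axis *)

Section Interior.
Variables (m : nat) (A : nat -> R -> R) (w sg r lo k kap : R).
Let n := S (S m).
Let al := PI / INR m.
Let hi := lo + al.
Hypothesis HA : good_sys n A.
Hypothesis Hlead : forall t, A n t = sg.
Hypothesis Hsg : sg * sg = 1.
Hypothesis Hw : 0 < w.
Hypothesis Hm : (3 <= m)%nat.
Hypothesis Hr : 0 < r.
Hypothesis Hray : ray_in n A w r lo hi.
Hypothesis Hk : 0 < k <= 1.
Hypothesis Hmarg : forall th, lo <= th <= hi -> sg * cos (INR (S m) * th) <= 1 - k.
Hypothesis Hkap : kap * kap = 1.
Hypothesis Hlo : el (INR m * lo) = kap.

Lemma INRm : 3 <= INR m.
Proof. generalize (le_INR 3 m Hm). simpl. lra. Qed.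

Lemma al_bounds : 0 < al <= PI / 3 /\ INR m * al = PI.
Proof.
 assert (H := INRm). assert (Hp := PI_RGT_0). unfold al. split; [split |].
 - pos.
 - unfold Rdiv. apply Rmult_le_compat_l; [lra |]. apply Rinv_le_contravar; lra.
 - field. lra.
Qed.

Lemma hi_lo : 0 < hi - lo < PI.
Proof. destruct al_bounds as [H _]. unfold hi. lra. Qed.

Lemma sector_angle (z : C) : z <> 0%C -> sector lo hi z ->
 exists b, 0 <= b <= al /\ z = polar (Cmod z) (lo + b).
Proof.
 intros Hz Hs. destruct (sector_polar lo hi z hi_lo Hz Hs) as (th & Hth & E).
 exists (th - lo). split; [unfold hi in Hth; lra |]. rewrite E at 1. f_equal. ring.
Qed.

Lemma sector_angle_strict (z : C) : z <> 0%C -> 0 < side lo z -> side hi z < 0 ->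
 exists b, 0 < b < al /\ z = polar (Cmod z) (lo + b).
Proof.
 intros Hz H1 H2. destruct (sector_polar lo hi z hi_lo Hz) as (th & Hth & E); [split; lra |].
 assert (B := sector_strict_polar lo hi z th hi_lo H1 H2 E Hth).
 exists (th - lo). split; [unfold hi in B; lra |]. rewrite E at 1. f_equal. ring.
Qed.

Lemma margin_in_sector (z : C) : z <> 0%C -> sector lo hi z -> margin (S m) sg k z.
Proof.
 intros Hz Hs. destruct (sector_polar lo hi z hi_lo Hz Hs) as (th & Hth & E).
 assert (Hp : 0 < Cmod z) by (apply Cmod_gt_0, Hz).
 unfold margin. rewrite (Cmod_uu (S m) sg Hsg) by assumption. rewrite E at 1. unfold uu.
 assert (P := pow_lt (Cmod z) (S m) Hp). rewrite polar_pow, polar_inv by lra.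
 replace (Re (RtoC sg * polar (/ Cmod z ^ S m) (- (INR (S m) * th))))
  with (sg * cos (INR (S m) * th) * / Cmod z ^ S m).
 - apply Rmult_le_compat_r; [pos | apply Hmarg, Hth].
 - unfold Re, polar; simpl. rewrite cos_neg. ring.
Qed.

(** In such a sector the margin holds throughout, so no solution escapes, and [P] bounds the end
    points independently of the start. *)
Lemma interior_bounds : exists X0 P, 1 <= X0 /\ 0 < P /\ forall tau phi,
 sol n A tau phi -> 0 <= tau <= w -> (forall t, 0 <= t <= tau -> phi t <> 0%C /\ sector lo hi (phi t)) ->
 Cmod (phi tau) <= 2 / k * Rmax (Cmod (phi 0)) X0 /\ (tau = w -> Cmod (phi tau) <= P).
Proof.
 destruct (margin_bound (S m) A sg HA Hlead Hsg ltac:(lia) k Hk) as (X0 & HX0 & H).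
 assert (HN : 1 <= INR (S m)) by (apply (le_INR 1); lia).
 set (e := k / 2 * (INR (S m) * w)). assert (He : 0 < e) by (unfold e; repeat apply Rmult_lt_0_compat; lra).
 exists X0, (2 / k * X0 + 1 + / e). assert (Hie := Rinv_0_lt_compat e He). assert (HkX : 0 < 2 / k * X0) by pos.
 split; [lra |]. split; [lra |]. intros tau phi Hs Htau Hin.
 destruct (H tau phi 0 tau Hs ltac:(lra) ltac:(lra)) as [B1 B2].
 { intros t Ht _. apply margin_in_sector; apply Hin, Ht. }
 split; [lra |]. intros ->. destruct B2 as [B2 | B2]; [lra |]. rewrite Rminus_0_r in B2. fold e in B2.
 destruct (Rle_dec (Cmod (phi w)) 1) as [H1 | H1]; [lra |]. assert (Q : Cmod (phi w) <= Cmod (phi w) ^ S m).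
 { simpl. assert (1 <= Cmod (phi w) ^ m) by (apply pow_R1_Rle; lra). nra. }
 assert (Q2 : Cmod (phi w) ^ S m <= / e).
 { apply Rmult_le_reg_r with e; [lra |]. rewrite Rinv_l; lra. }
 lra.
Qed.

Definition Kset (Y : R) (z : C) : Prop := (Cmod z <= Y /\ r <= Cmod z) /\ sector lo hi z.

Lemma Kset_compact Y : ccompact (Kset Y).
Proof.
 apply ccompact_inter_closed; [| apply closed_sector].
 apply ccompact_inter_closed; [apply ccompact_disc | apply closed_outside].
Qed.

Lemma Kset_inner Y z : r < Cmod z < Y -> 0 < side lo z -> side hi z < 0 -> inner (Kset Y) z.
Proof.
 intros Hz H1 H2. set (d := Rmin (Rmin (Cmod z - r) (Y - Cmod z)) (Rmin (side lo z) (- side hi z))).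
 destruct (Rmin_bounds (Rmin (Cmod z - r) (Y - Cmod z)) (Rmin (side lo z) (- side hi z))) as [M1 M2].
 destruct (Rmin_bounds (Cmod z - r) (Y - Cmod z)) as [M3 M4].
 destruct (Rmin_bounds (side lo z) (- side hi z)) as [M5 M6]. fold d in M1, M2.
 exists d. split; [unfold d; repeat apply Rmin_pos; lra |]. intros y Hy.
 assert (S : forall th, Rabs (side th y - side th z) <= Cmod (y - z)).
 { intros th. rewrite <- side_minus. apply side_le_Cmod. }
 assert (S1 := S lo). assert (S2 := S hi). apply Rabs_le_between in S1. apply Rabs_le_between in S2.
 assert (R1 := Rabs_Cmod_sub y z). apply Rabs_le_between in R1. split; [split | split]; lra.
Qed.

(** * Sectors away from the axis, repelling disc *)

Section Repelling.
Hypothesis Hout : circ_out n A w r.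

Lemma out_stays tau phi : sol n A tau phi -> 0 <= tau <= w -> r <= Cmod (phi 0) -> sector lo hi (phi 0) ->
 forall t, 0 <= t <= tau -> r <= Cmod (phi t) /\ sector lo hi (phi t) /\
  (0 < t -> r < Cmod (phi t) /\ 0 < side lo (phi t) /\ side hi (phi t) < 0).
Proof.
 intros Hs Htau H0 H1 t Ht.
 assert (C1 := circ_out_inv n A w HA r tau phi 0 tau Hr Hout Hs ltac:(lra) ltac:(lra) ltac:(lra) H0).
 assert (C2 := sector_inv n A w HA r lo hi tau phi 0 tau Hr hi_lo Hray Hs ltac:(lra) ltac:(lra) ltac:(lra)
   (fun s Hs => proj1 (C1 s Hs)) H1 t Ht).
 destruct (C1 t Ht) as [D1 D2]. destruct C2 as [D3 D4]. split; [lra | split; [pos |]]. intros Hp. split; [lra | lra].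
Qed.

Lemma Kset_flow Y : 0 <= Y ->
 (forall tau phi, sol n A tau phi -> 0 <= tau <= w -> Kset Y (phi 0) -> Cmod (phi tau) <= 2 / k * Y) ->
 (forall z, Kset Y z -> sol n A w (Phi n A w (2 / k * Y + 1) z) /\ Phi n A w (2 / k * Y + 1) z 0 = z /\
  forall t, 0 <= t <= w -> Cmod (Phi n A w (2 / k * Y + 1) z t) < 2 / k * Y + 1) /\
 (forall c d, Kset Y c -> Fl n A w c d -> d = Phi n A w (2 / k * Y + 1) c w).
Proof.
 intros HY Hbd. assert (Hk2 : 1 <= 2 / k) by (apply Rle_div_r; lra). assert (HkY : Y <= 2 / k * Y) by nra.
 set (M := 2 / k * Y + 1). assert (HM : 0 <= M) by (unfold M; lra). split.
 - intros z Kz. assert (E0 := Phi_0 n A w HA Hw M z HM).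
  assert (Hall : forall t, 0 <= t <= w -> Cmod (Phi n A w M z t) <= 2 / k * Y).
  { apply (Phi_apriori n A w HA Hw M (2 / k * Y) z HM); try (unfold M; lra).
   - destruct Kz as [[K1 _] _]. lra.
   - intros tau Htau Hs _. apply (Hbd tau _ Hs Htau). rewrite E0. exact Kz. }
  assert (Hlt : forall t, 0 <= t <= w -> Cmod (Phi n A w M z t) < M) by (intros t Ht; generalize (Hall t Ht); unfold M; lra).
  split; [| split; assumption]. apply Phi_sol; try assumption; [lra |]. intros t Ht. left. apply Hlt, Ht.
 - intros c d Kc (phi & Hs & I0 & <-). apply (Fl_eq_Phi n A w HA Hw M c phi HM Hs I0).
  intros t Ht. assert (Hst : sol n A t phi) by (destruct Hs as [Cp Dp]; split; [pos | intros s Hs'; apply Dp; lra]).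
  assert (B := Hbd t phi Hst Ht ltac:(rewrite I0; exact Kc)). unfold M. lra.
Qed.

(** The bound [P] is chosen before [Y]: however far out the outer arc is placed, end points stay in
    one fixed bounded set. *)
Lemma interior_flow : exists X0 P, 1 <= X0 /\ 0 < P /\ forall Y, X0 <= Y ->
 (forall z t, Kset Y z -> 0 <= t <= w -> Cmod (Phi n A w (2 / k * Y + 1) z t) < 2 / k * Y + 1) /\
 (forall z, Kset Y z -> let f := Phi n A w (2 / k * Y + 1) z w in
   Cmod f <= P /\ r < Cmod f /\ 0 < side lo f /\ side hi f < 0) /\
 (forall c d, r <= Cmod c -> sector lo hi c -> Fl n A w c d -> Cmod d <= P /\
   (Cmod c <= Y -> d = Phi n A w (2 / k * Y + 1) c w)).
Proof.
 destruct interior_bounds as (X0 & P & HX0 & HP & HB). exists X0, P. split; [lra | split; [lra |]]. intros Y HY.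
 assert (Hk2 : 1 <= 2 / k) by (apply Rle_div_r; lra).
 assert (Hbd : forall tau phi, sol n A tau phi -> 0 <= tau <= w -> Kset Y (phi 0) ->
   Cmod (phi tau) <= 2 / k * Y /\ (tau = w -> Cmod (phi tau) <= P)).
 { intros tau phi Hs Htau [[Hz1 Hz2] Hz3]. destruct (HB tau phi Hs Htau) as [B1 B2].
  - intros t Ht. destruct (out_stays tau phi Hs Htau Hz2 Hz3 t Ht) as (D1 & D2 & _).
   split; [apply Cmod_gt_0; lra | pos].
  - split; [| lra]. eapply Rle_trans; [exact B1 |]. apply Rmult_le_compat_l; [lra |]. apply Rmax_lub; assumption. }
 destruct (Kset_flow Y ltac:(lra) (fun tau phi S T K => proj1 (Hbd tau phi S T K))) as [HF1 HF2].
 split; [intros z t Kz Ht; apply HF1; assumption | split].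
 - intros z Kz f. destruct (HF1 z Kz) as (Hs & E0 & _). assert (K0 := Kz). rewrite <- E0 in K0.
  destruct (Hbd w _ Hs ltac:(lra) K0) as [_ B]. split; [apply B; reflexivity |].
  destruct K0 as [[_ K1] K2]. apply (out_stays w _ Hs ltac:(lra) K1 K2 w); lra.
 - intros c d Hc1 Hc2 HF. split; [| intros HcY; apply HF2; [split; [split |] |]; assumption].
  destruct HF as (phi & Hs & I0 & I1). rewrite <- I0 in Hc1, Hc2.
  rewrite <- I1. apply (HB w phi Hs ltac:(lra)); [| lra].
  intros t Ht. destruct (out_stays w phi Hs ltac:(lra) Hc1 Hc2 t Ht) as (D1 & D2 & _).
  split; [apply Cmod_gt_0; lra | pos].
Qed.

Lemma real_quadratic_pos (x : R) (a : C) : 0 < Im a ->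
 exists y, 0 < y /\ ((RtoC x - a) * (RtoC x - Cconj a))%C = y.
Proof.
 intros Ha. exists ((x - Re a) * (x - Re a) + Im a * Im a). split.
 { generalize (Rle_0_sqr (x - Re a)) (Rmult_lt_0_compat _ _ Ha Ha). unfold Rsqr. lra. }
 apply C_eq; unfold Re, Im, Cconj; simpl; ring.
Qed.

Let R2 := r ^ m * r ^ m.
Let Wf := W kap R2 m.

Lemma Im_W_strict (z : C) : r < Cmod z -> 0 < side lo z -> side hi z < 0 -> 0 < Im (Wf z).
Proof.
 intros Hz H1 H2. assert (Hz0 : z <> 0%C) by (apply Cmod_gt_0; lra).
 destruct (sector_angle_strict z Hz0 H1 H2) as (b & Hb & E). rewrite E.
 unfold Wf. rewrite Im_W_polar by (assumption || lra). destruct al_bounds as [Ha Em]. assert (Hm3 := INRm).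
 assert (S : 0 < sin (INR m * b)) by (apply sin_gt_0; nra). assert (Q : r ^ m < Cmod z ^ m).
 { apply Rnot_le_lt. intros Hle. apply pow_le_reg1 in Hle; [lra | lia | lra | lra]. }
 assert (P := pow_lt r m Hr). apply Rmult_lt_0_compat; [| exact S]. assert (R2 * / Cmod z ^ m < Cmod z ^ m); [| lra].
 apply Rmult_lt_reg_r with (Cmod z ^ m); [lra |]. rewrite Rmult_assoc, Rinv_l by lra. unfold R2. nra.
Qed.

Lemma Im_W_boundary (z : C) : r <= Cmod z -> sector lo hi z ->
 0 <= Im (Wf z) /\ (Cmod z = r \/ side lo z = 0 \/ side hi z = 0 -> Im (Wf z) = 0).
Proof.
 intros Hz Hs. assert (Hz0 : z <> 0%C) by (apply Cmod_gt_0; lra). destruct al_bounds as [Ha Em]. assert (Hm3 := INRm).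
 assert (P := pow_lt r m Hr). destruct (sector_angle z Hz0 Hs) as (b & Hb & E).
 assert (EI : Im (Wf z) = (Cmod z ^ m - R2 * / Cmod z ^ m) * sin (INR m * b)).
 { rewrite E at 1. unfold Wf. rewrite Im_W_polar by (assumption || lra). reflexivity. }
 split.
 - rewrite EI. assert (S : 0 <= sin (INR m * b)) by (apply sin_ge_0; nra).
  assert (Q : r ^ m <= Cmod z ^ m) by (apply pow_incr; lra). apply Rmult_le_pos; [| exact S].
  assert (R2 * / Cmod z ^ m <= Cmod z ^ m); [| lra].
  apply Rmult_le_reg_r with (Cmod z ^ m); [lra |]. rewrite Rmult_assoc, Rinv_l by lra. unfold R2. nra.
 - intros [Er | [E0 | E0]].
  + rewrite EI, Er. unfold R2. replace (r ^ m - r ^ m * r ^ m * / r ^ m) with 0 by (field; lra). ring.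
  + apply (side_lo_zero lo hi z hi_lo Hs) in E0. assert (Q := Im_W_polar kap R2 m (Cmod z) lo 0 Hkap Hlo ltac:(lra)).
   rewrite Rplus_0_r, <- E0, Rmult_0_r, sin_0, Rmult_0_r in Q. exact Q.
  + apply (side_hi_zero lo hi z hi_lo Hs) in E0. assert (Q := Im_W_polar kap R2 m (Cmod z) lo al Hkap Hlo ltac:(lra)).
   fold hi in Q. rewrite <- E0, Em, sin_PI, Rmult_0_r in Q. exact Q.
Qed.

Lemma Cmod_W_lower (z : C) : r <= Cmod z -> Cmod z ^ m - r ^ m <= Cmod (Wf z).
Proof.
 intros Hz. assert (Hz0 : z <> 0%C) by (apply Cmod_gt_0; lra). assert (P := pow_lt r m Hr).
 assert (Hk1 : Rabs kap = 1).
 { assert (kap = 1 \/ kap = -1) as [-> | ->] by nra; unfold Rabs; destruct Rcase_abs; lra. }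
 unfold Wf, W. rewrite Cmod_mult, Cmod_R, Hk1, Rmult_1_l. assert (B := Cmod_reverse (z ^ m) (- (RtoC R2 * / z ^ m))).
 replace (z ^ m - - (RtoC R2 * / z ^ m))%C with (z ^ m + R2 * / z ^ m)%C in B by ring.
 rewrite Cmod_opp, Cmod_mult, Cmod_inv, Cmod_pow, Cmod_R in B by (apply Cpow_nz, Hz0).
 assert (Q : r ^ m <= Cmod z ^ m) by (apply pow_incr; lra). unfold R2 in *. rewrite Rabs_pos_eq in B by nra.
 assert (r ^ m * r ^ m * / Cmod z ^ m <= r ^ m).
 { apply Rmult_le_reg_r with (Cmod z ^ m); [lra |]. rewrite Rmult_assoc, Rinv_l by lra. nra. }
 lra.
Qed.

Lemma W_bounded P : exists P', 0 <= P' /\ forall z : C, r <= Cmod z -> Cmod z <= P -> Cmod (Wf z) <= P'.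
Proof.
 assert (Hk1 : Rabs kap = 1).
 { assert (kap = 1 \/ kap = -1) as [-> | ->] by nra; unfold Rabs; destruct Rcase_abs; lra. }
 exists (Rabs P ^ m + r ^ m). assert (Pr := pow_lt r m Hr). assert (PP : 0 <= Rabs P ^ m) by pos.
 split; [lra |]. intros z H1 H2. assert (Hz0 : z <> 0%C) by (apply Cmod_gt_0; lra).
 unfold Wf, W. rewrite Cmod_mult, Cmod_R, Hk1, Rmult_1_l. eapply Rle_trans; [apply Cmod_triangle |].
 rewrite Cmod_mult, Cmod_inv, Cmod_pow, Cmod_R by (apply Cpow_nz, Hz0). unfold R2. rewrite Rabs_pos_eq by nra.
 assert (Q : r ^ m <= Cmod z ^ m) by (apply pow_incr; lra). assert (Q2 : Cmod z ^ m <= Rabs P ^ m).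
 { apply pow_incr. split; [lra |]. generalize (Rle_abs P). lra. }
 apply Rplus_le_compat; [lra |].
 apply Rmult_le_reg_r with (Cmod z ^ m); [lra |]. rewrite Rmult_assoc, Rinv_l by lra. nra.
Qed.

(** On the sides and the inner circle W z is real. There a factor W z - a alone would be nonreal,
    but its product with W z - conj a is positive, and the numerator has imaginary part Im W p > 0.
    The added root lies in the lower half plane, outside the image of the sector. The outer arc is
    [far_off_ray]. *)
Lemma interior_boundary (a : C) P : 0 < Im a -> 0 < P -> exists Y0, 1 <= Y0 /\ forall Y z p,
 Y0 <= Y -> Kset Y z -> Cmod p <= P -> r < Cmod p -> 0 < side lo p -> side hi p < 0 ->
 (((Wf z - a) * (Wf z - Cconj a))%C <> 0%C /\
  off_ray ((Wf p - Wf z) / ((Wf z - a) * (Wf z - Cconj a)))%C) \/ inner (Kset Y) z.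
Proof.
 intros Ha HP. destruct (W_bounded P) as (P' & HP' & HW).
 destruct (far_off_ray P' (2 * Re a) (Re a * Re a + Im a * Im a) HP') as (Y1 & HY1 & Hfar).
 assert (Pr := pow_lt r m Hr).
 exists (1 + Y1 + r ^ m). split; [lra |]. intros Y z p HY [[Kz1 Kz2] Kz3] Hp1 Hp2 Hp3 Hp4.
 assert (Hip := Im_W_strict p Hp2 Hp3 Hp4). destruct (Im_W_boundary z Kz2 Kz3) as [Hiz Hbz].
 assert (Case : (Cmod z = r \/ side lo z = 0 \/ side hi z = 0) \/ Cmod z = Y \/
         (r < Cmod z < Y /\ 0 < side lo z /\ side hi z < 0)).
 { destruct Kz3. destruct (Req_dec (Cmod z) r); [tauto |]. destruct (Req_dec (side lo z) 0); [tauto |].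
  destruct (Req_dec (side hi z) 0); [tauto |]. destruct (Req_dec (Cmod z) Y); [tauto |]. right. right. lra. }
 destruct Case as [Hb | [HzY | (H1 & H2 & H3)]]; [left | left | right; apply Kset_inner; assumption].
 - assert (Ez : Wf z = RtoC (Re (Wf z))) by (apply C_eq; [reflexivity | apply Hbz, Hb]).
  destruct (real_quadratic_pos (Re (Wf z)) a Ha) as (y & Hy & Ey). rewrite <- Ez in Ey. rewrite Ey. split.
  + intros E. apply RtoC_inj in E. lra.
  + apply off_ray_Im; [| lra]. change (Im (Wf p) - Im (Wf z) <> 0). rewrite (Hbz Hb). lra.
 - assert (B := Cmod_W_lower z Kz2). assert (Q : Cmod z <= Cmod z ^ m) by (apply pow_ge_self; [lia | lra]).
  destruct (Hfar (Wf p) (Wf z)) as [F1 F2]; try lra.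
  + apply HW; lra.
  + assert (EQ : ((Wf z - a) * (Wf z - Cconj a) = Wf z * Wf z - RtoC (2 * Re a) * Wf z + RtoC (Re a * Re a + Im a * Im a))%C).
   { apply C_eq; unfold Re, Im, Cconj; simpl; ring. }
   rewrite EQ. split; assumption.
Qed.

(** Comparison with an arbitrary interior point yields a fixed point a; comparison with a itself
    then yields simplicity and uniqueness. [Y] is enlarged so that every fixed point of the
    unbounded sector, having modulus at most [P], is seen. *)
Lemma sector_count_repelling : counted n A w (fun z => r <= Cmod z /\ sector lo hi z) 1.
Proof.
 destruct interior_flow as (X0 & P & HX0 & HP & Hflow). destruct al_bounds as [Hal Em]. assert (Hm3 := INRm).
 assert (Hk2 : 1 <= 2 / k) by (apply Rle_div_r; lra). set (fY := fun Y z => Phi n A w (2 / k * Y + 1) z w).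
 assert (Hdw : forall x z : C, r <= Cmod z -> sector lo hi z -> r < Cmod x -> sector lo hi x ->
   DW kap R2 m x z <> 0%C /\ DW kap R2 m z x <> 0%C).
 { intros x z Hz1 Hz2 Hx1 Hx2.
  assert (Hz0 : z <> 0%C) by (apply Cmod_gt_0; lra). assert (Hx0 : x <> 0%C) by (apply Cmod_gt_0; lra).
  destruct (sector_angle z Hz0 Hz2) as (b & Hb & Ez). destruct (sector_angle x Hx0 Hx2) as (c & Hc & Ex).
  rewrite Ez, Ex. unfold R2. split; apply DW_neq_0; try assumption; try lia; try lra; try nra; apply Rabs_def1; nra. }
 assert (Kne : forall Y z, Kset Y z -> z <> 0%C).
 { intros Y z [[_ K2] _]. apply Cmod_gt_0. lra. }
 assert (Hhol : forall Y z, X0 <= Y -> Kset Y z -> hol (fY Y) z).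
 { intros Y z HY Kz. apply (hol_Phi n A w HA Hw (2 / k * Y + 1) z); [nra |].
  intros t Ht. apply (proj1 (Hflow Y HY) z t Kz Ht). }
 assert (Hfne : forall Y z, X0 <= Y -> Kset Y z -> fY Y z <> 0%C).
 { intros Y z HY Kz. destruct (proj1 (proj2 (Hflow Y HY)) z Kz) as (_ & H & _). apply Cmod_gt_0. unfold fY. lra. }
 assert (Hex : exists a, r < Cmod a /\ 0 < side lo a /\ side hi a < 0 /\ Fl n A w a a).
 (* Any point strictly inside would do; this one lies on the bisector. *)
 { set (a0 := polar (2 * r) (lo + al / 2)). assert (Ha0 : Cmod a0 = 2 * r) by (apply Cmod_polar; lra).
  assert (S1 : 0 < side lo a0).
  { unfold a0. rewrite side_polar. replace (lo + al / 2 - lo) with (al / 2) by ring.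
   apply Rmult_lt_0_compat; [lra | apply sin_gt_0; lra]. }
  assert (S2 : side hi a0 < 0).
  { unfold a0. rewrite side_polar. unfold hi. replace (lo + al / 2 - (lo + al)) with (- (al / 2)) by field.
   rewrite sin_neg. assert (0 < sin (al / 2)) by (apply sin_gt_0; lra). nra. }
  assert (Hia := Im_W_strict a0 ltac:(lra) S1 S2). destruct (interior_boundary (Wf a0) P Hia HP) as (Y0 & HY0 & Hbd).
  set (Y := Rmax Y0 (Rmax X0 (2 * r))). destruct (Rmax_bounds Y0 (Rmax X0 (2 * r))) as [Y1 Y2].
  destruct (Rmax_bounds X0 (2 * r)) as [Y3 Y4]. fold Y in Y1, Y2. assert (HY : X0 <= Y) by lra.
  destruct (zero_exists (Kset Y) (fun z => Wf (fY Y z) - Wf z)%C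
   (fun z => (Wf z - Wf a0) * (Wf z - Cconj (Wf a0)))%C a0) as (a & Ka & Ea).
  - apply Kset_compact.
  - intros z Kz. assert (hW : hol Wf z) by (apply (hol_W kap R2 m (fun z => z)); [apply hol_id | apply (Kne Y), Kz]).
   split.
   + apply hol_minus; [| pos]. apply (hol_W kap R2 m (fY Y)); [apply Hhol | apply Hfne]; assumption.
   + apply hol_mult; apply hol_minus; (exact hW || apply hol_const).
  - split; [lra | split; lra].
  - ring.
  - intros z Kz. destruct (proj1 (proj2 (Hflow Y HY)) z Kz) as (F1 & F2 & F3 & F4).
   destruct (Hbd Y z (fY Y z) Y1 Kz F1 F2 F3 F4) as [[N1 N2] | Hi]; [left | right; exact Hi].
   assert (N3 : (Wf (fY Y z) - Wf z)%C <> 0%C).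
   { intros E. rewrite E in N2. destruct N2 as [N2 | N2]; apply N2 || revert N2;
     unfold Cdiv; rewrite Cmult_0_l; simpl; lra. }
   replace ((Wf z - Wf a0) * (Wf z - Cconj (Wf a0)) / (Wf (fY Y z) - Wf z))%C
    with (/ ((Wf (fY Y z) - Wf z) / ((Wf z - Wf a0) * (Wf z - Cconj (Wf a0)))))%C.
   + apply off_ray_inv; [| pos]. apply Cmult_neq_0; [pos |].
    intros E. apply N1. apply (f_equal (Cmult ((Wf z - Wf a0) * (Wf z - Cconj (Wf a0)))%C)) in E.
    rewrite Cinv_r in E by exact N1. rewrite Cmult_0_r in E. apply RtoC_inj in E. lra.
   + field. repeat split; try exact N3; intros E; apply N1; rewrite E; ring.
  - destruct (proj1 (proj2 (Hflow Y HY)) a Ka) as (F1 & F2 & F3 & F4). fold (fY Y a) in F1, F2, F3, F4.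
   assert (Efa : fY Y a = a).
   { unfold Wf in Ea. rewrite DW_spec in Ea by (apply Hfne + apply (Kne Y); assumption). destruct Ka as [[K1 K2] K3].
    destruct (Hdw (fY Y a) a K2 K3 F2 ltac:(split; lra)) as [D _].
    destruct (Ceq_dec (fY Y a) a) as [E | Hne]; [exact E |]. destruct (Cmult_neq_0 _ _ (Csub_neq_0 _ _ Hne) D Ea). }
   rewrite Efa in F1, F2, F3, F4. exists a. repeat split; try assumption.
   rewrite <- Efa at 2. apply Fl_Phi; try assumption; [nra |].
   intros t Ht. left. apply (proj1 (Hflow Y HY) a t Ka Ht). }
 destruct Hex as (a & Ha1 & Ha2 & Ha3 & HaF). assert (Hia := Im_W_strict a Ha1 Ha2 Ha3).
 destruct (interior_boundary (Wf a) P Hia HP) as (Y0 & HY0 & Hbd). set (Y := Rmax Y0 (Rmax X0 (Rmax P (Cmod a)))).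
 destruct (Rmax_bounds Y0 (Rmax X0 (Rmax P (Cmod a)))) as [Y1 Y2].
 destruct (Rmax_bounds X0 (Rmax P (Cmod a))) as [Y3 Y4].
 destruct (Rmax_bounds P (Cmod a)) as [Y5 Y6]. fold Y in Y1, Y2. assert (HY : X0 <= Y) by lra.
 assert (Ka : Kset Y a) by (split; [lra | split; lra]). assert (Ane : a <> 0%C) by (apply (Kne Y), Ka).
 (* With these factors (f z - z) V = W (f z) - W z, and (z - a) E is the quadratic (W z - W a) (W z
    - conj (W a)). *)
 destruct (simple_zero n A w (2 / k * Y + 1) (Kset Y) a (fun z => DW kap R2 m (fY Y z) z)
  (fun z => DW kap R2 m z a * (Wf z - Cconj (Wf a)))%C) as [Z1 Z2]; try assumption.
 - nra.
 - apply Kset_compact.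
 - intros z t Kz Ht. apply (proj1 (Hflow Y HY) z t Kz Ht).
 - symmetry. apply (proj2 (proj2 (Hflow Y HY)) a a); [lra | split; lra | pos | lra].
 - intros z Kz. split.
  + apply (hol_DW kap R2 m (fY Y) (fun z => z)); [apply Hhol | apply hol_id | apply Hfne | apply (Kne Y)]; assumption.
  + apply hol_mult.
   * apply (hol_DW kap R2 m (fun z => z) (fun _ => a)); [apply hol_id | apply hol_const | apply (Kne Y), Kz | pos].
   * apply hol_minus; [| apply hol_const]. apply (hol_W kap R2 m (fun z => z)); [apply hol_id | apply (Kne Y), Kz].
 - intros z [[Kz1 Kz2] Kz3]. apply Cmult_neq_0.
  + apply (Hdw a z Kz2 Kz3 Ha1). split; lra.
  + intros E. apply (f_equal Im) in E. change (Im (Wf z) - - Im (Wf a) = 0) in E.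
   destruct (Im_W_boundary z Kz2 Kz3) as [B _]. lra.
 - intros z Kz. destruct (proj1 (proj2 (Hflow Y HY)) z Kz) as (F1 & F2 & F3 & F4).
  destruct (Hbd Y z (fY Y z) Y1 Kz F1 F2 F3 F4) as [[B1 B2] | Hi]; [left | right; exact Hi].
  split; [intros ->; apply B1; ring |].
  assert (S1 := DW_spec kap R2 m (fY Y z) z (Hfne Y z HY Kz) (Kne Y z Kz)). fold Wf in S1.
  assert (S2 := DW_spec kap R2 m z a (Kne Y z Kz) Ane). fold Wf in S2.
  rewrite S1, S2 in B2. rewrite Cmult_assoc. exact B2.
 - apply (counted_single n A w _ a 1); [lia | split; [lra | split; lra] | pos |].
  intros c [Hc1 Hc2] Hc. destruct (proj2 (proj2 (Hflow Y HY)) c c Hc1 Hc2 Hc) as [B1 B2].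
  apply Z2; [split; [lra | pos] |]. symmetry. apply B2. lra.
Qed.

End Repelling.

(** * Sectors away from the axis, attracting disc *)

Section Attracting.
Hypothesis Hin : circ_in n A w r.

(** The entry time s is strictly before tau, so that in the first case the solution is strictly
    inside the disc at time tau. *)
Lemma in_stays tau phi : sol n A tau phi -> 0 <= tau <= w -> r <= Cmod (phi 0) -> sector lo hi (phi 0) ->
 (exists s, 0 <= s < tau /\ Cmod (phi s) <= r) \/
 (forall t, 0 <= t <= tau -> r <= Cmod (phi t) /\ sector lo hi (phi t) /\
   (0 < t -> 0 < side lo (phi t) /\ side hi (phi t) < 0)).
Proof.
 intros Hs Htau H0 H1.
 destruct (classic (exists s, 0 <= s < tau /\ Cmod (phi s) <= r)) as [He | He]; [left; exact He | right].
 assert (Hge : forall t, 0 <= t <= tau -> r <= Cmod (phi t)).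
 { intros t Ht. destruct (Req_dec t 0) as [-> | Ht0]; [lra |]. apply Rnot_lt_le. intros Hlt.
  destruct (continuous_pos (fun s => - Cmod (phi s)) t (- r)) as (d & Hd & B).
  - apply (continuous_opp (V := R_NormedModule)), continuous_Cmod, Hs.
  - lra.
  - set (s := Rmax 0 (t - d / 2)). destruct (Rmax_bounds 0 (t - d / 2)) as [M1 M2].
   fold s in M1, M2. assert (s < t) by (apply Rmax_lub_lt; lra).
   apply He. exists s. assert (Z := B s ltac:(rewrite Rabs_left; lra)). lra. }
 intros t Ht. split; [apply Hge, Ht |].
 apply (sector_inv n A w HA r lo hi tau phi 0 tau Hr hi_lo Hray Hs ltac:(lra) ltac:(lra) ltac:(lra) Hge H1 t Ht).
Qed.

(** The comparison function -z has no zero in the region. On the boundary 1 - f / z is off the half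
    line: |f| < |z| if the disc was entered and on the outer arc, while on the two rays f lies
    strictly to one side. *)
Lemma sector_count_attracting : counted n A w (fun z => r <= Cmod z /\ sector lo hi z) 0.
Proof.
 destruct interior_bounds as (X0 & P & HX0 & HP & HB). assert (Hk2 : 1 <= 2 / k) by (apply Rle_div_r; lra).
 assert (Hend : forall tau phi, sol n A tau phi -> 0 <= tau <= w -> r <= Cmod (phi 0) -> sector lo hi (phi 0) ->
  (Cmod (phi tau) < r \/
   (r <= Cmod (phi tau) /\ r < Cmod (phi 0) + (w - tau) /\ (0 < tau -> 0 < side lo (phi tau) /\ side hi (phi tau) < 0) /\
   Cmod (phi tau) <= 2 / k * Rmax (Cmod (phi 0)) X0 /\ (tau = w -> Cmod (phi tau) <= P))) \/ tau < w).
 { intros tau phi Hs Htau H0 H1. destruct (Req_dec tau w) as [-> | Hne]; [left | lra].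
  destruct (in_stays w phi Hs Htau H0 H1) as [(s & Hs1 & Hs2) | Hall].
  - left. apply (circ_in_inv n A w HA r w phi s w Hr Hin Hs); lra.
  - right. destruct (Hall w ltac:(lra)) as (D1 & D2 & D3). destruct (HB w phi Hs Htau) as [B1 B2].
   { intros t Ht. destruct (Hall t Ht) as (E1 & E2 & _). split; [apply Cmod_gt_0; lra | pos]. }
   repeat split; try assumption; try (apply D3; assumption).
   rewrite Rminus_diag, Rplus_0_r. apply Rnot_le_lt. intros Hle.
   assert (Z := circ_in_inv n A w HA r w phi 0 w Hr Hin Hs ltac:(lra) ltac:(lra) ltac:(lra) Hle w ltac:(lra)). lra. }
 apply (counted_none n A w). intros c [Hc1 Hc2] Hc. set (Y := Rmax (Cmod c + 1) (Rmax X0 (Rmax (P + 1) (r + 1)))).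
 destruct (Rmax_bounds (Cmod c + 1) (Rmax X0 (Rmax (P + 1) (r + 1)))) as [Y1 Y2].
 destruct (Rmax_bounds X0 (Rmax (P + 1) (r + 1))) as [Y3 Y4].
 destruct (Rmax_bounds (P + 1) (r + 1)) as [Y5 Y6]. fold Y in Y1, Y2. assert (HkY : Y <= 2 / k * Y) by nra.
 assert (Hbd : forall tau phi, sol n A tau phi -> 0 <= tau <= w -> Kset Y (phi 0) -> Cmod (phi tau) <= 2 / k * Y).
 { intros tau phi Hs Htau [[K1 K2] K3]. destruct (in_stays tau phi Hs Htau K2 K3) as [(s & Hs1 & Hs2) | Hall].
  - assert (Z := circ_in_inv n A w HA r tau phi s tau Hr Hin Hs ltac:(lra) ltac:(lra) ltac:(lra) Hs2 tau ltac:(lra)). lra.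
  - destruct (HB tau phi Hs Htau) as [B1 _].
   { intros t Ht. destruct (Hall t Ht) as (E1 & E2 & _). split; [apply Cmod_gt_0; lra | pos]. }
   eapply Rle_trans; [exact B1 |]. apply Rmult_le_compat_l; [lra |]. apply Rmax_lub; lra. }
 destruct (Kset_flow Y ltac:(lra) Hbd) as [HF1 HF2].
 set (M := 2 / k * Y + 1) in *. assert (HM : 0 <= M) by (unfold M; lra). set (f := fun z => Phi n A w M z w).
 assert (Hf : forall z, Kset Y z -> hol f z).
 { intros z Kz. apply (hol_Phi n A w HA Hw M z HM). apply HF1, Kz. }
 assert (Hfin : forall z, Kset Y z -> Cmod (f z) < r \/
   (r < Cmod z /\ Cmod (f z) <= P /\ 0 < side lo (f z) /\ side hi (f z) < 0)).
 { intros z Kz. destruct (HF1 z Kz) as (Hs & E0 & _). destruct Kz as [[K1 K2] K3].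
  destruct (Hend w _ Hs ltac:(lra)) as [[E | (E1 & E2 & E3 & E4 & E5)] | E]; try lra;
   try (rewrite Phi_0 by assumption; assumption).
  - left. exact E.
  - right. rewrite Phi_0 in E2 by assumption. unfold f. split; [lra | lra]. }
 assert (Hnz : forall z, Kset Y z -> (f z - z)%C <> 0%C).
 { apply (no_further_zero (Kset Y) (fun _ => 1%C) (fun z => f z - z)%C (fun _ => RtoC (-1)) (fun z => z)).
  - apply Kset_compact.
  - intros z Kz. split; [apply hol_minus; [apply Hf, Kz | apply hol_id] | split; [apply hol_const | apply hol_id]].
  - intros z [[_ K2] _]. apply Cmod_gt_0. lra.
  - intros z Kz. assert (Kz' := Kz). destruct Kz' as [[K1 K2] [K3 K4]].
   assert (Hz0 : z <> 0%C) by (apply Cmod_gt_0; lra).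
   assert (Eg : (1 * (f z - z) * RtoC (-1) / (1 * z))%C = (1 - f z / z)%C).
   { replace (RtoC (-1)) with (- (1))%C by (rewrite <- RtoC_opp; reflexivity). field. exact Hz0. }
   assert (H10 : RtoC 1 <> RtoC 0) by (intros E; apply RtoC_inj in E; lra).
   assert (Hsmall : Cmod (f z) < Cmod z -> off_ray (1 - f z / z)%C).
   { intros Hlt. left. apply Re_one_minus, Hlt. }
   rewrite Eg. assert (Hray2 : forall th, z = polar (Cmod z) th -> side th (f z) <> 0 -> off_ray (1 - f z / z)%C).
   { intros th E Hne. apply (off_ray_side th); [lra | exact E | lra]. }
   destruct (Hfin z Kz) as [F | (F1 & F2 & F3 & F4)]; [left; split; [pos | apply Hsmall; lra] |].
   destruct (Req_dec (side lo z) 0) as [E | E].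
   { left. split; [pos |]. apply (side_lo_zero lo hi z hi_lo ltac:(split; assumption)) in E.
    apply (Hray2 lo E). lra. }
   destruct (Req_dec (side hi z) 0) as [E2 | E2].
   { left. split; [pos |]. apply (side_hi_zero lo hi z hi_lo ltac:(split; assumption)) in E2.
    apply (Hray2 hi E2). lra. }
   destruct (Req_dec (Cmod z) Y) as [E3 | E3].
   { left. split; [pos |]. apply Hsmall. lra. }
   right. apply Kset_inner; lra. }
 assert (Kc : Kset Y c) by (split; [lra | pos]). apply (Hnz c Kc). unfold f. rewrite <- (HF2 c c Kc Hc). ring.
Qed.

End Attracting.

End Interior.

(** * Symmetry with respect to the real axis *)

Lemma cder_conj phi t v : cder phi t v -> cder (fun s => Cconj (phi s)) t (Cconj v).
Proof.
 intros [H1 H2]. split; [pos |]. exact (is_derive_opp (V := R_NormedModule) (fun s => Im (phi s)) t (Im v) H2).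
Qed.

Lemma cvcont_conj phi : cvcont phi -> cvcont (fun s => Cconj (phi s)).
Proof.
 intros H t. destruct (H t) as [H1 H2]. split; [pos |].
 exact (continuous_opp (V := R_NormedModule) (fun s => Im (phi s)) t H2).
Qed.

Lemma Phi_conj n A w M z t : good_sys n A -> 0 < w -> 0 <= M -> 0 <= t <= w ->
 Phi n A w M (Cconj z) t = Cconj (Phi n A w M z t).
Proof.
 intros HA Hw HM Ht. destruct (Phi_tsol n A w HA Hw M z HM) as (C1 & I1 & D1).
 destruct (Phi_tsol n A w HA Hw M (Cconj z) HM) as (C2 & I2 & D2).
 apply (tsol_unique n A HA M (Phi n A w M (Cconj z)) (fun s => Cconj (Phi n A w M z s)) w);
  try assumption; try lra.
 - apply cvcont_conj, C1.
 - rewrite I1, I2. reflexivity.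
 - intros s Hs. rewrite box_conj, Fld_conj by exact HM. apply cder_conj, D1, Hs.
Qed.

Lemma conj_real (z : C) : Im z = 0 -> Cconj z = z.
Proof. intros H. apply C_eq; [reflexivity |]. change (- Im z = Im z). lra. Qed.

Lemma Cmod_sub_conj (z : C) : Cmod (z - Cconj z) = 2 * Rabs (Im z).
Proof.
 replace (z - Cconj z)%C with (RtoC (2 * Im z) * Ci)%C by (apply C_eq; unfold Re, Im, Cconj; simpl; ring).
 rewrite Cmod_mult, Cmod_Ci, Cmod_R, Rabs_mult, (Rabs_pos_eq 2) by lra. ring.
Qed.

Lemma IVT_cont (g : R -> R) a b : a <= b -> (forall t, continuous g t) -> g a <= 0 <= g b ->
 exists c, a <= c <= b /\ g c = 0.
Proof.
 intros Hab Hg [H1 H2]. destruct (IVT_gen g a b 0) as (c & Hc & E).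
 - intros x. apply continuity_pt_filterlim, Hg.
 - rewrite Rmin_left, Rmax_right; lra.
 - exists c. rewrite Rmin_left, Rmax_right in Hc by lra. split; assumption.
Qed.

Lemma sol_conj n A tau phi t : sol n A tau phi -> 0 < t < tau ->
 cder (fun s => Cconj (phi s)) t (Fld A n t (Cconj (phi t))).
Proof. intros [_ Dp] Ht. rewrite Fld_conj. apply cder_conj, Dp, Ht. Qed.

Lemma im_zero n A tau phi : good_sys n A -> 0 <= tau -> sol n A tau phi ->
 Im (phi 0) = 0 -> forall t, 0 <= t <= tau -> Im (phi t) = 0.
Proof.
 intros HA Htau Hs H0 t Ht. assert (Cp := proj1 Hs).
 destruct (continuous_bounded (fun t => Cmod (phi t)) 0 tau ltac:(lra)) as (m & _ & Hm).
 { intros u. apply continuous_Cmod, Cp. }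
 set (M := Cmod (phi m)) in Hm. assert (HM : 0 <= M) by apply Cmod_ge_0. assert (E : phi t = Cconj (phi t)).
 { apply (tsol_unique n A HA M phi (fun s => Cconj (phi s)) tau); try assumption; try lra.
  - apply cvcont_conj, Cp.
  - symmetry. apply conj_real, H0.
  - intros s Hs'. rewrite box_id by (apply Hm; lra). apply (proj2 Hs), Hs'.
  - intros s Hs'. rewrite box_id by (rewrite Cmod_conj; apply Hm; lra). apply (sol_conj n A tau phi s Hs Hs'). }
 apply (f_equal Im) in E. change (Im (phi t) = - Im (phi t)) in E. lra.
Qed.

(* [Im phi] is half the distance from [phi] to its conjugate, which is another solution. *)
Lemma im_lower n A M : good_sys n A -> 0 <= M -> exists L, 0 < L /\ forall tau phi a b,
 sol n A tau phi -> 0 <= a <= b -> b <= tau -> (forall t, a <= t <= b -> Cmod (phi t) <= M) ->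
 0 < Im (phi a) -> Im (phi a) * exp (- L * (b - a)) <= Im (phi b).
Proof.
 intros HA HM. destruct (Fdel_bound n A M HA HM) as (L & HL & HB). exists L. split; [lra |].
 intros tau phi a b Hs Hab Hb Hbd H0. assert (Cp := proj1 Hs). assert (Cc := cvcont_conj phi Cp).
 assert (Habs : forall t, a <= t <= b -> Im (phi a) * exp (- L * (t - a)) <= Rabs (Im (phi t))).
 { intros t Ht. assert (G := gronwall_curves_lower phi (fun s => Cconj (phi s)) (fun t => Fld A n t (phi t))
   (fun t => Fld A n t (Cconj (phi t))) a t L ltac:(lra) ltac:(lra) Cp Cc
   (fun s Hs' => proj2 Hs s ltac:(lra)) (fun s Hs' => sol_conj n A tau phi s Hs ltac:(lra))).
  assert (GB : forall s, a < s < t ->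
   Cmod (Fld A n s (phi s) - Fld A n s (Cconj (phi s))) <= L * Cmod (phi s - Cconj (phi s))).
  { intros s Hs'. rewrite Fdel_spec, Cmod_mult, Rmult_comm. apply Rmult_le_compat_r;
   [apply Cmod_ge_0 | apply HB; rewrite ?Cmod_conj; apply Hbd; lra]. }
  assert (G' := G GB). unfold sqdist in G'. rewrite !Cmod_sub_conj, (Rabs_pos_eq (Im (phi a))) in G' by lra.
  apply Rsqr_incr_0_var; [| pos]. unfold Rsqr.
  replace (- (2 * L) * (t - a)) with (- L * (t - a) + - L * (t - a)) in G' by ring. rewrite exp_plus in G'. nra. }
 destruct (Rle_dec 0 (Im (phi b))) as [Hp | Hn].
 { assert (B := Habs b ltac:(lra)). rewrite (Rabs_pos_eq (Im (phi b))) in B by lra. exact B. }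
 exfalso. destruct (IVT_cont (fun s => - Im (phi s)) a b) as (x & Hx & Ex); try lra.
 - intros s. apply (continuous_opp (V := R_NormedModule) (fun s => Im (phi s))), Cp.
 - assert (B2 := Habs x ltac:(lra)). replace (Im (phi x)) with 0 in B2 by lra. rewrite Rabs_R0 in B2.
  assert (Ex2 := exp_pos (- L * (x - a))). nra.
Qed.

Lemma im_sign n A tau phi : good_sys n A -> 0 <= tau -> sol n A tau phi ->
 (0 <= Im (phi 0) -> forall t, 0 <= t <= tau -> 0 <= Im (phi t)) /\
 (0 < Im (phi 0) -> forall t, 0 <= t <= tau -> 0 < Im (phi t)).
Proof.
 intros HA Htau Hs. assert (HP : 0 < Im (phi 0) -> forall t, 0 <= t <= tau -> 0 < Im (phi t)).
 { intros H0 t Ht. destruct (continuous_bounded (fun t => Cmod (phi t)) 0 tau ltac:(lra)) as (m & _ & Hm).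
  { intros u. apply continuous_Cmod, Hs. }
  destruct (im_lower n A (Cmod (phi m)) HA (Cmod_ge_0 _)) as (L & _ & B).
  eapply Rlt_le_trans; [| apply (B tau phi 0 t Hs); try lra; intros u Hu; apply Hm; lra].
  apply Rmult_lt_0_compat; [lra | pos]. }
 split; [| pos]. intros [H0 | H0] t Ht; [left; apply HP; assumption |].
 right. symmetry. apply (im_zero n A tau phi); try assumption. lra.
Qed.

(** A negative quotient would put u in the thin cone around the negative axis opposite to e; both a
    sufficiently steep positive imaginary part and a positive real part exclude this. *)
Lemma off_ray_strip (u e : C) k : 0 < k -> 0 < Re e -> Rabs (Im e) < k * Re e ->
 (0 < Im u /\ k * Cmod u <= Im u) \/ 0 < Re u -> off_ray (u / e)%C.
Proof.
 intros Hk He Hi Hu. assert (Hne : e <> 0%C) by (intros E; rewrite E in He; simpl in He; lra).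
 set (v := (u / e)%C). assert (Eu : u = (v * e)%C) by (unfold v; field; exact Hne). clearbody v.
 destruct (Req_dec (Im v) 0) as [Hv | Hv]; [| right; exact Hv]. left. apply Rnot_le_lt. intros Hle.
 assert (ER : Re u = Re v * Re e) by (rewrite Eu; unfold Re, Im in *; simpl; rewrite Hv; ring).
 assert (EI : Im u = Re v * Im e) by (rewrite Eu; unfold Re, Im in *; simpl; rewrite Hv; ring).
 destruct Hu as [[H1 H2] | H]; [| nra]. assert (Hv0 : Re v < 0) by (destruct Hle as [Hle | Hle]; [lra | nra]).
 assert (B := re_le_Cmod u). rewrite ER, Rabs_left in B by nra. assert (B2 : Im u <= - Re v * Rabs (Im e)).
 { rewrite EI. generalize (Rle_abs (- Im e)). rewrite Rabs_Ropp. nra. }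
 assert (- Re v * Rabs (Im e) < - Re v * (k * Re e)) by nra. nra.
Qed.

(** Compactness: a property valid near each real point x >= a is valid on the bounded part of a thin
    strip around that half line. *)
Lemma thin_strip (Good : C -> Prop) a Y :
 (forall x, a <= x -> exists d, 0 < d /\ forall y, Cmod (y - x) < d -> Good y) ->
 exists d, 0 < d /\ forall y, Cmod y <= Y -> a <= Re y -> Rabs (Im y) < d -> Good y.
Proof.
 intros H. destruct (box_uniform Y (fun y d => a <= Re y -> Rabs (Im y) < d -> Good y)) as (d & Hd & B).
 - intros y d d' Q Hd' Ha Hi. apply Q; lra.
 - intros z. destruct (Req_dec (Im z) 0) as [Hz | Hz].
  + destruct (Rle_dec a (Re z)) as [Ha | Ha].
   * destruct (H (Re z) Ha) as (d & Hd & G). exists d, 1. split; [lra | split; [lra |]].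
    intros y Hy _ _. apply G. replace (RtoC (Re z)) with z; [lra |]. apply C_eq; [reflexivity | pos].
   * exists (a - Re z), 1. split; [lra | split; [lra |]]. intros y Hy Hay _. assert (B := Re_sub_le y z).
    apply Rabs_le_between in B. lra.
  + assert (Hp : 0 < Rabs (Im z)) by (apply Rabs_pos_lt, Hz).
   exists (Rabs (Im z) / 2), (Rabs (Im z) / 2). split; [lra | split; [lra |]]. intros y Hy _ Hi.
   assert (B := Im_sub_le y z).
   exfalso. assert (B2 := Rabs_triang_inv (Im z) (Im y)). rewrite (Rabs_minus_sym (Im z)) in B2. lra.
 - exists d. split; [lra |]. intros y Hy. apply B, Hy.
Qed.

Lemma W_conj kap R2 m (z : C) : W kap R2 m (Cconj z) = Cconj (W kap R2 m z).
Proof.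
 unfold W. rewrite Cmult_conj, Cplus_conj, Cmult_conj, !Cconj_RtoC, <- Cpow_conj.
 assert (E : Cconj (/ z ^ m) = (/ Cconj (z ^ m))%C); [| rewrite E; reflexivity].
 destruct (Ceq_dec (z ^ m)%C 0%C) as [-> | H]; [| apply Cinv_conj, H].
 apply C_eq; unfold Cinv, Cconj, Re, Im, RtoC; simpl; unfold Rdiv; ring.
Qed.

Lemma off_ray_scale (u : C) y : 0 < y -> off_ray u -> off_ray (u / y)%C.
Proof.
 intros Hy Hu. assert (Hi : 0 < / y) by pos.
 assert (E : (u / y)%C = (RtoC (/ y) * u)%C) by (unfold Cdiv; rewrite RtoC_inv by lra; apply Cmult_comm).
 rewrite E. destruct Hu as [Hu | Hu].
 - left. replace (Re (RtoC (/ y) * u)%C) with (/ y * Re u) by (unfold Re; simpl; ring). apply Rmult_lt_0_compat; assumption.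
 - right. replace (Im (RtoC (/ y) * u)%C) with (/ y * Im u) by (unfold Im; simpl; ring).
  apply Rmult_integral_contrapositive_currified; lra.
Qed.

Lemma Phi_raise n A w M c t : good_sys n A -> 0 < w -> 0 <= M ->
 (forall t, 0 <= t <= w -> Cmod (Phi n A w M c t) <= M) -> 0 <= t <= w ->
 Phi n A w M c t = Phi n A w (M + 1) c t.
Proof.
 intros HA Hw HM Hb Ht. rewrite <- (Phi_0 n A w HA Hw M c HM) at 2.
 apply (sol_Phi n A w HA Hw (M + 1) (Phi n A w M c) w); try lra.
 - apply Phi_sol; try assumption; lra.
 - intros u Hu. generalize (Hb u Hu). lra.
Qed.

Lemma off_ray_neq_0 (v : C) : off_ray v -> v <> 0%C.
Proof. intros H E. rewrite E in H. destruct H as [H | H]; [simpl in H; lra | apply H; reflexivity]. Qed.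

Lemma off_ray_swap (N E : C) : E <> 0%C -> off_ray (N / E)%C -> off_ray (E / N)%C.
Proof.
 intros HE H. assert (Hv := off_ray_neq_0 _ H).
 assert (HN : N <> 0%C) by (intros Q; apply Hv; rewrite Q; unfold Cdiv; ring).
 replace (E / N)%C with (/ (N / E))%C by (field; split; assumption). apply off_ray_inv; assumption.
Qed.

Lemma ccont_punctured f g c d : ccont_at f c -> ccont_at g c -> 0 < d ->
 (forall z, Cmod (z - c) < d -> z <> c -> f z = g z) -> f c = g c.
Proof.
 intros Hf Hg Hd H. destruct (Ceq_dec (f c) (g c)) as [E | Hne]; [exact E | exfalso].
 assert (He : 0 < Cmod (f c - g c)) by (apply Cmod_gt_0, Csub_neq_0, Hne).
 destruct (Hf (Cmod (f c - g c) / 2) ltac:(lra)) as (d1 & Hd1 & B1).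
 destruct (Hg (Cmod (f c - g c) / 2) ltac:(lra)) as (d2 & Hd2 & B2).
 set (e := Rmin d (Rmin d1 d2)). destruct (Rmin_bounds d (Rmin d1 d2)) as [M1 M2].
 destruct (Rmin_bounds d1 d2) as [M3 M4]. fold e in M1, M2.
 assert (He0 : 0 < e) by (repeat apply Rmin_pos; assumption). set (z := (c + RtoC (e / 2))%C).
 assert (Ez : (z - c)%C = RtoC (e / 2)) by (unfold z; ring).
 assert (Cz : Cmod (z - c) = e / 2) by (rewrite Ez, Cmod_R, Rabs_pos_eq; lra).
 assert (Hzc : z <> c) by (intros Q; rewrite Q in Cz; replace (c - c)%C with (RtoC 0) in Cz by ring; rewrite Cmod_0 in Cz; lra).
 assert (D1 := B1 z ltac:(lra)). assert (D2 := B2 z ltac:(lra)). rewrite <- (H z ltac:(lra) Hzc) in D2.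
 assert (V := Cmod_triangle_sub (f c) (f z) (g c)). rewrite (Cmod_sub_sym (f c) (f z)) in V. lra.
Qed.

Lemma sin_between x0 x1 u : 0 < x0 <= PI / 2 -> 0 < x1 <= PI / 2 -> x0 <= u <= PI - x1 ->
 Rmin (sin x0) (sin x1) <= sin u.
Proof.
 intros H0 H1 Hu. destruct (Rmin_bounds (sin x0) (sin x1)) as [M1 M2]. destruct (Rle_dec u (PI / 2)) as [H | H].
 - assert (sin x0 <= sin u) by (apply sin_incr_1; lra). lra.
 - rewrite <- (sin_PI_x u). assert (sin x1 <= sin (PI - u)) by (apply sin_incr_1; lra). lra.
Qed.

(** * The sectors around the real axis *)

Lemma side_Fld_S A t rho th k : side th (Fld A (S k) t (polar rho th)) =
 side th (Fld A k t (polar rho th)) + A (S k) t * (rho ^ S k * sin (INR k * th)).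
Proof.
 cbn [Fld]. rewrite side_plus, side_scal, polar_pow, side_polar.
 replace (INR (S k) * th - th) with (INR k * th) by (rewrite S_INR; ring). reflexivity.
Qed.

(** This is the induction on the degree common to two estimates of the component across a ray, its
    size for small angles and its Lipschitz dependence on the angle. The square of k + 1 crudely
    bounds the sum of the indices. *)
Lemma weighted_sum_bound (a s u : nat -> R) B rho e k : (forall i, (i <= k)%nat -> Rabs (a i) <= B) ->
 0 <= B -> 0 <= rho -> 0 <= e -> Rabs (u O) <= B * e -> (forall i, u (S i) = u i + a (S i) * (rho ^ S i * s i)) ->
 (forall i, Rabs (s i) <= INR i * e) -> Rabs (u k) <= INR (S k) * INR (S k) * B * Rmax 1 rho ^ k * e.
Proof.
 intros HB HB0 Hrho He H0 HS Hs. destruct (Rmax_bounds 1 rho) as [R1 R2]. set (R := Rmax 1 rho) in *.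
 induction k as [| k IH]; [simpl; lra |].
 assert (IH' := IH (fun i Hi => HB i (Nat.le_trans _ _ _ Hi (Nat.le_succ_diag_r _)))).
 rewrite HS. eapply Rle_trans; [apply Rabs_triang |]. rewrite !Rabs_mult.
 assert (P : 0 < R ^ k) by pos. assert (K0 := pos_INR k).
 assert (Q2 : rho ^ S k <= R ^ S k) by (apply pow_incr; lra). rewrite (Rabs_pos_eq (rho ^ S k)) by pos.
 assert (T1 : Rabs (a (S k)) * (rho ^ S k * Rabs (s k)) <= B * (R ^ S k * (INR k * e))).
 { apply Rmult_le_compat; [pos | pos | apply HB; lia |]. apply Rmult_le_compat; [pos | pos | lra | apply Hs]. }
 assert (Z : 0 <= B * R ^ S k * e) by pos. assert (T2 : B * R ^ k * e <= B * R ^ S k * e).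
 { apply Rmult_le_compat_r; [lra |]. apply Rmult_le_compat_l; [lra |]. simpl. nra. }
 apply (Rmult_le_compat_l (INR (S k) * INR (S k))) in T2; [| nra]. rewrite (S_INR (S k)), (S_INR k) in *. nra.
Qed.

Section RightSector.
Variables (m : nat) (A : nat -> R -> R) (w r : R).
Let n := S (S m).
Let al := PI / INR m.
Hypothesis HA : good_sys n A.
Hypothesis Hlead : forall t, A n t = 1.
Hypothesis Hw : 0 < w.
Hypothesis Hm : (3 <= m)%nat.
Hypothesis Hr : 0 < r.
Local Notation sol := (sol n A).
Local Notation Phi := (Phi n A w).
Local Notation Fl := (Fl n A w).
Local Notation zm := (zm n A w).
Local Notation counted := (counted n A w).

Definition T (z : C) : Prop := sector (- al) al z.

Lemma e_al : 0 < al <= PI / 3 /\ INR m * al = PI.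
Proof. apply (al_bounds m Hm). Qed.

Lemma T_width : 0 < al - - al < PI.
Proof. destruct e_al as [H _]. lra. Qed.

Lemma T_polar (z : C) : z <> 0%C -> T z -> exists th, - al <= th <= al /\ z = polar (Cmod z) th.
Proof. intros Hz HT. exact (sector_polar (- al) al z T_width Hz HT). Qed.

Lemma T_upper_polar (z : C) : z <> 0%C -> T z -> 0 <= Im z ->
 exists th, 0 <= th <= al /\ z = polar (Cmod z) th.
Proof.
 intros Hz HT Hi. destruct (T_polar z Hz HT) as (th & Hth & E). exists th. split; [| exact E].
 split; [| lra]. apply Rnot_lt_le. intros Hlt. assert (Hp : 0 < Cmod z) by (apply Cmod_gt_0, Hz).
 rewrite E, Im_polar in Hi. destruct e_al as [Ha _].
 assert (0 < sin (- th)) by (apply sin_gt_0; lra). rewrite sin_neg in *. nra.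
Qed.

Lemma cos_half th : - al <= th <= al -> 1 / 2 <= cos th.
Proof.
 intros H. destruct e_al as [Ha _]. rewrite <- cos_PI3. destruct (Rle_dec 0 th) as [Hp | Hn].
 - apply cos_decr_1; lra.
 - rewrite <- (cos_neg th). apply cos_decr_1; lra.
Qed.

Lemma Re_T (z : C) : T z -> Cmod z / 2 <= Re z.
Proof.
 intros HT. destruct (Ceq_dec z 0%C) as [-> | Hz]; [rewrite Cmod_0; simpl; lra |].
 destruct (T_polar z Hz HT) as (th & Hth & E). rewrite E at 2. rewrite Re_polar.
 generalize (cos_half th Hth) (Cmod_ge_0 z). nra.
Qed.

Lemma sin_mult_bound k x : 0 <= sin x -> Rabs (sin (INR k * x)) <= INR k * sin x.
Proof.
 intros Hx. induction k as [| k IH].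
 - simpl. rewrite Rmult_0_l, sin_0, Rabs_R0. lra.
 - rewrite S_INR, Rmult_plus_distr_r, Rmult_1_l, sin_plus.
  eapply Rle_trans; [apply Rabs_triang |]. rewrite !Rabs_mult.
  assert (C1 := COS_bound x). assert (C2 := COS_bound (INR k * x)).
  assert (B1 : Rabs (cos x) <= 1) by (apply Rabs_le; lra).
  assert (B2 : Rabs (cos (INR k * x)) <= 1) by (apply Rabs_le; lra). rewrite (Rabs_pos_eq (sin x)) by exact Hx.
  assert (Rabs (sin (INR k * x)) * Rabs (cos x) <= INR k * sin x * 1)
   by (apply Rmult_le_compat; try apply Rabs_pos; assumption).
  assert (Rabs (cos (INR k * x)) * sin x <= 1 * sin x) by nra. lra.
Qed.

(** Real coefficients make the field tangent to the real axis; this is the quantitative form, with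
    the component across the ray of order sin th. *)
Lemma side_Fld_bound k B t rho th : (forall i, (i <= k)%nat -> Rabs (A i t) <= B) -> 0 <= B -> 0 <= rho ->
 0 <= sin th -> Rabs (side th (Fld A k t (polar rho th))) <= INR (S k) * INR (S k) * B * Rmax 1 rho ^ k * sin th.
Proof.
 intros HB HB0 Hrho Hs.
 apply (weighted_sum_bound (fun i => A i t) (fun i => sin (INR i * th)) (fun k => side th (Fld A k t (polar rho th))));
  try assumption.
 - simpl. replace (side th (RtoC (A 0%nat t))) with (- (A 0%nat t) * sin th) by (unfold side, Re, Im; simpl; ring).
  rewrite Rabs_mult, Rabs_Ropp, (Rabs_pos_eq (sin th)) by exact Hs. apply Rmult_le_compat_r; [lra | apply HB; lia].
 - intros i. apply side_Fld_S.
 - intros i. apply sin_mult_bound, Hs.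
Qed.

(** The angle at which z^(-(m+1)) becomes purely imaginary. Below it the leading term of the field
    turns solutions away from the real axis. *)
Definition thstar : R := PI / (2 * INR (S m)).

Lemma thstar_bounds : 0 < thstar /\ thstar < al /\ INR (S m) * thstar = PI / 2 /\ thstar < PI / 2.
Proof.
 assert (Hm3 := INRm m Hm). assert (Hp := PI_RGT_0). unfold thstar, al. rewrite S_INR.
 split; [pos |]. split; [| split; [field; lra |]].
 - unfold Rdiv. apply Rmult_lt_compat_l; [lra |]. apply Rinv_lt_contravar; nra.
 - unfold Rdiv. apply Rmult_lt_compat_l; [lra |]. apply Rinv_lt_contravar; nra.
Qed.

(* Small angles cannot shrink faster than exponentially, even near infinity where the
   leading term pushes away from the real axis. *)
Lemma side_lower : exists Q, 0 < Q /\ forall t rho th, r <= rho -> 0 <= th <= thstar ->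
 - (Q * (rho * sin th)) <= side th (Fld A n t (polar rho th)).
Proof.
 destruct (proj2 HA) as (B & HB & HBA). set (N := S m). set (q := INR (S N) * INR (S N) * B).
 assert (Hq : 0 <= q) by (unfold q; repeat apply Rmult_le_pos; try apply pos_INR; exact HB).
 assert (Hqn : 0 <= q ^ S N) by pos. exists ((q + q ^ S N + 1) / r). split; [pos |].
 intros t rho th Hrho Hth. destruct thstar_bounds as (S1 & S2 & S3 & S4).
 assert (Hs : 0 <= sin th) by (apply sin_ge_0; lra).
 assert (HF := side_Fld_bound N B t rho th (fun i Hi => HBA i t ltac:(unfold n, N in *; lia)) HB ltac:(lra) Hs).
 fold q in HF. apply Rabs_le_between in HF.
 unfold n. fold N. cbn [Fld]. rewrite side_plus, side_scal, polar_pow, side_polar.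
 replace (A (S N) t) with 1 by (symmetry; apply Hlead).
 replace (INR (S N) * th - th) with (INR N * th) by (rewrite S_INR; ring).
 assert (HNr : 1 <= INR N) by (generalize (le_INR 1 N ltac:(unfold N; lia)); simpl; lra).
 assert (Hle : sin th <= sin (INR N * th)).
 { assert (INR N * th <= PI / 2).
  { rewrite <- S3. fold N. apply Rmult_le_compat_l; lra. }
  apply sin_incr_1; try lra; nra. }
 assert (P : 0 <= rho ^ S N) by pos. assert (L1 : rho ^ S N * sin th <= rho ^ S N * sin (INR N * th)) by nra.
 assert (L2 : - (q + q ^ S N) <= rho ^ S N - q * Rmax 1 rho ^ N).
 { unfold Rmax. destruct (Rle_dec 1 rho) as [H1 | H1].
  - change (rho ^ S N) with (rho * rho ^ N). change (q ^ S N) with (q * q ^ N) in *.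
   assert (P2 : 0 <= rho ^ N) by pos. destruct (Rle_dec q rho) as [H2 | H2].
   + nra.
   + assert (rho ^ N <= q ^ N) by (apply pow_incr; lra). assert (q * rho ^ N <= q * q ^ N) by nra.
    assert (0 <= rho * rho ^ N) by pos. lra.
  - rewrite pow1. lra. }
 assert (L3 : q + q ^ S N <= (q + q ^ S N + 1) / r * rho).
 { apply Rle_trans with ((q + q ^ S N + 1) / r * r); [field_simplify; lra |].
  apply Rmult_le_compat_l; [| lra]. apply Rdiv_le_0_compat; lra. }
 assert (L4 : - ((q + q ^ S N + 1) / r * rho) * sin th <= (rho ^ S N - q * Rmax 1 rho ^ N) * sin th)
  by nra.
 lra.
Qed.

Definition taustar : R := tan thstar.

Lemma taustar_pos : 0 < taustar.
Proof. destruct thstar_bounds as (S1 & S2 & S3 & S4). apply tan_gt_0; lra. Qed.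

(** The barrier is a line through the origin whose slope decays exponentially. When it is touched
    the angle is at most [thstar], and [side_lower] applies; the rate is 2 Q since |z| <= 2 Re z in
    the sector, and the extra 1 makes the inequality strict. *)
Lemma cone_decay : exists Q, 0 < Q /\ forall tau phi a b lam,
 sol tau phi -> 0 <= a <= b -> b <= tau ->
 (forall t, a <= t <= b -> r <= Cmod (phi t) /\ T (phi t)) ->
 0 < lam <= taustar -> lam * Re (phi a) <= Im (phi a) ->
 lam * exp (- Q * (b - a)) * Re (phi b) <= Im (phi b).
Proof.
 destruct side_lower as (Q & HQ & HS). exists (2 * Q + 1). split; [lra |].
 intros tau phi a b lam [Cp Dp] Hab Hb Hin Hlam Ha. set (l := fun t => lam * exp (- (2 * Q + 1) * (t - a))).
 set (dl := fun t => lam * (- (2 * Q + 1) * exp (- (2 * Q + 1) * (t - a)))).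
 assert (Dl : forall t, is_derive l t (dl t)).
 { intros t. unfold l, dl. auto_derive; [exact I | unfold Rminus; ring]. }
 assert (Cl : forall t, continuous l t).
 { intros t. apply (ex_derive_continuous l). exists (dl t). apply Dl. }
 assert (Cdl : forall t, continuous dl t).
 { intros t. apply (ex_derive_continuous dl). unfold dl. auto_derive. exact I. }
 assert (CF := Fld_cvcont n A phi HA Cp).
 assert (Cm : forall f g : R -> R, (forall t, continuous f t) -> (forall t, continuous g t) -> forall t, continuous (fun s => f s * g s) t).
 { intros f g Hf Hg t. apply (continuous_mult (K := R_AbsRing)); [apply Hf | apply Hg]. }
 assert (Cs : forall f g : R -> R, (forall t, continuous f t) -> (forall t, continuous g t) -> forall t, continuous (fun s => f s - g s) t).
 { intros f g Hf Hg t. apply (continuous_minus (V := R_NormedModule)); [apply Hf | apply Hg]. }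
 assert (CRe := fun t => proj1 (Cp t)). assert (CIm := fun t => proj2 (Cp t)).
 assert (CFRe := fun t => proj1 (CF t)). assert (CFIm := fun t => proj2 (CF t)).
 destruct (barrier (fun t => Im (phi t) - l t * Re (phi t))
  (fun t => Im (Fld A n t (phi t)) - l t * Re (Fld A n t (phi t)) - dl t * Re (phi t)) a b) with (t := b) as [P _]; try lra.
 - apply Cs; [pos |]. apply Cm; assumption.
 - apply (Cs (fun t => Im (Fld A n t (phi t)) - l t * Re (Fld A n t (phi t))) (fun t => dl t * Re (phi t))).
  + apply (Cs (fun t => Im (Fld A n t (phi t))) (fun t => l t * Re (Fld A n t (phi t)))); [pos |].
   apply (Cm l (fun t => Re (Fld A n t (phi t)))); assumption.
  + apply Cm; assumption.
 - intros t Ht. destruct (Dp t ltac:(lra)) as [D1 D2]. eapply is_derive_eq.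
  + exact (is_derive_Rminus _ _ _ _ _ D2 (is_derive_Rmult _ _ _ _ _ (Dl t) D1)).
  + lra.
 - unfold l. replace (a - a) with 0 by ring. rewrite Rmult_0_r, exp_0. lra.
 - intros t Ht E. destruct (Hin t Ht) as [Hr1 HT]. assert (Hz : phi t <> 0%C) by (apply Cmod_gt_0; lra).
  assert (HRe := Re_T _ HT). assert (HRep : 0 < Re (phi t)) by lra. assert (Ep := exp_pos (- (2 * Q + 1) * (t - a))).
  assert (Hlp : 0 < l t) by (apply Rmult_lt_0_compat; lra). assert (Hl1 : l t <= taustar).
  { unfold l. assert (exp (- (2 * Q + 1) * (t - a)) <= 1).
   { apply Rle_trans with (exp 0); [| rewrite exp_0; lra]. destruct (Req_dec t a) as [-> | Hne].
    - right. f_equal. ring.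
    - left. apply exp_increasing. assert (a < t) by lra. assert (0 < (2 * Q + 1) * (t - a)) by pos. lra. }
   apply Rle_trans with (lam * 1); [nra |]; lra. }
  assert (EIm : Im (phi t) = l t * Re (phi t)) by lra. assert (Hi0 : 0 <= Im (phi t)) by nra.
  destruct (T_upper_polar _ Hz HT Hi0) as (th & Hth & Ep2).
  set (rho := Cmod (phi t)) in *. assert (Hrho : 0 < rho) by lra.
  assert (Hcos := cos_half th ltac:(destruct e_al; lra)). rewrite Ep2, Re_polar, Im_polar in EIm.
  assert (Esin : sin th = l t * cos th) by nra. destruct thstar_bounds as (S1 & S2 & S3 & S4).
  assert (Hth2 : th <= thstar).
  { apply Rnot_lt_le. intros Hlt. assert (tan thstar < tan th).
   { apply tan_increasing; destruct e_al; lra. }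
   assert (Et : tan th = l t) by (unfold tan; rewrite Esin; field; lra). unfold taustar in Hl1. lra. }
  assert (B := HS t rho th Hr1 ltac:(lra)). rewrite <- Ep2 in B. unfold side in B. rewrite Esin in B.
  set (F := Fld A n t (phi t)) in *. assert (B2 : - (Q * (rho * l t)) <= Im F - l t * Re F) by nra.
  assert (Edl : dl t = - (2 * Q + 1) * l t) by (unfold dl, l; ring). rewrite Edl.
  assert (rho * l t <= 2 * (Re (phi t)) * l t) by nra. assert (0 < l t * Re (phi t)) by nra. nra.
 - unfold l in P. lra.
Qed.

Lemma cone_angle (z : C) lam : z <> 0%C -> T z -> 0 < lam -> lam * Re z <= Im z ->
 exists th, atan lam <= th <= al /\ z = polar (Cmod z) th.
Proof.
 intros Hz HT Hl Hc. assert (HR := Re_T z HT). assert (Hp : 0 < Cmod z) by (apply Cmod_gt_0, Hz).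
 destruct (T_upper_polar z Hz HT ltac:(nra)) as (th & Hth & E). exists th. split; [| exact E].
 split; [| lra]. assert (Hcos := cos_half th ltac:(destruct e_al; lra)). rewrite E, Re_polar, Im_polar in Hc.
 assert (Ht : lam <= tan th).
 { unfold tan. apply Rmult_le_reg_r with (cos th); [lra |]. unfold Rdiv. rewrite Rmult_assoc, Rinv_l by lra. nra. }
 destruct e_al as [Ha _]. rewrite <- (atan_tan th) by lra.
 destruct Ht as [Ht | <-]; [left; apply atan_increasing, Ht | lra].
Qed.

(** On the cone the angle of z^(m+1) lies between a positive [x0] and pi + pi / 3, so its cosine is
    at most cos [x0] < 1. *)
Lemma cone_margin lam : 0 < lam -> exists k, 0 < k <= 1 /\
 forall z : C, z <> 0%C -> T z -> lam * Re z <= Im z -> margin (S m) 1 k z.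
Proof.
 intros Hl. set (x0 := Rmin (INR (S m) * atan lam) (PI / 2)).
 assert (Hm3 := INRm m Hm). assert (Hpi := PI_RGT_0). destruct e_al as [Ha Em].
 assert (HNr : 1 <= INR (S m)) by (rewrite S_INR; lra).
 assert (Hat : 0 < atan lam) by (rewrite <- atan_0; apply atan_increasing, Hl).
 assert (Hx0 : 0 < x0) by (apply Rmin_pos; [nra | lra]).
 destruct (Rmin_bounds (INR (S m) * atan lam) (PI / 2)) as [Hx0l Hx0r]. fold x0 in Hx0l, Hx0r.
 assert (Hc1 : cos x0 < 1) by (rewrite <- cos_0; apply cos_decreasing_1; lra).
 assert (Hc0 : 0 <= cos x0) by (apply cos_ge_0; lra). exists (1 - cos x0). split; [lra |].
 intros z Hz HT Hc. destruct (cone_angle z lam Hz HT Hl Hc) as (th & Hth & E).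
 assert (Hp : 0 < Cmod z) by (apply Cmod_gt_0, Hz). assert (P := pow_lt (Cmod z) (S m) Hp).
 unfold margin. rewrite (Cmod_uu (S m) 1) by (lra || assumption). rewrite E at 1. unfold uu.
 rewrite polar_pow, polar_inv by lra. replace (Re (1 * polar (/ Cmod z ^ S m) (- (INR (S m) * th))))
  with (cos (INR (S m) * th) * / Cmod z ^ S m) by (unfold Re, polar; simpl; rewrite cos_neg; ring).
 apply Rmult_le_compat_r; [pos |]. replace (1 - (1 - cos x0)) with (cos x0) by ring.
 assert (Hx : x0 <= INR (S m) * th) by nra. assert (Hx2 : INR (S m) * th <= PI + PI / 3).
 { rewrite S_INR. assert (INR m * th <= INR m * al) by nra. lra. }
 destruct (Rle_dec (INR (S m) * th) PI) as [H1 | H1].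
 - apply cos_decr_1; lra.
 - assert (cos (INR (S m) * th) <= 0); [| lra]. apply cos_le_0; lra.
Qed.

(** A slope reached at time a survives up to a fixed factor until time [w], so one margin constant
    serves all later times: once off the axis, a solution cannot escape any more. *)
Lemma cone_bound lam : 0 < lam <= taustar -> exists X0 Q, 1 <= X0 /\ 1 <= Q /\ forall tau phi a b,
 sol tau phi -> 0 <= a <= b -> b <= tau -> tau <= w ->
 (forall t, a <= t <= b -> r <= Cmod (phi t) /\ T (phi t)) -> lam * Re (phi a) <= Im (phi a) ->
 Cmod (phi b) <= Q * Rmax (Cmod (phi a)) X0 /\
 (Cmod (phi b) <= Q * X0 \/ Cmod (phi b) * (b - a) <= Q).
Proof.
 intros Hlam. destruct cone_decay as (Qd & HQd & Hdec). set (l1 := lam * exp (- Qd * w)).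
 assert (Ee := exp_pos (- Qd * w)). assert (Hl1 : 0 < l1) by (apply Rmult_lt_0_compat; lra).
 destruct (cone_margin l1 Hl1) as (k & Hk & Hmar).
 assert (HN : 1 <= INR (S m)) by (generalize (le_INR 1 (S m) ltac:(lia)); simpl; lra).
 destruct (margin_bound (S m) A 1 HA Hlead ltac:(lra) ltac:(lia) k Hk) as (X0 & HX0 & H). assert (Hk2 : 1 <= 2 / k).
 { apply Rle_div_r; lra. }
 exists X0, (2 / k). split; [lra | split; [lra |]]. intros tau phi a b Hs Hab Hb Htau Hin Ha.
 destruct (H tau phi a b Hs Hab Hb) as [B1 B2].
 { intros t Ht _. destruct (Hin t Ht) as [R1 R2]. assert (Hz : phi t <> 0%C) by (apply Cmod_gt_0; lra).
  apply Hmar; [pos | pos |].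
  assert (D := Hdec tau phi a t lam Hs ltac:(lra) ltac:(lra) (fun s Hs' => Hin s ltac:(lra)) Hlam Ha).
  assert (E : exp (- Qd * w) <= exp (- Qd * (t - a))).
  { destruct (Rle_lt_or_eq_dec (- Qd * w) (- Qd * (t - a))) as [Hlt | E]; [nra | |].
   - left. apply exp_increasing, Hlt.
   - rewrite E. right. reflexivity. }
  assert (HR := Re_T _ R2). assert (l1 <= lam * exp (- Qd * (t - a))) by (apply Rmult_le_compat_l; lra).
  assert (0 <= Re (phi t)) by lra. nra. }
 split; [lra |]. destruct B2 as [B2 | B2]; [lra |]. destruct (Rle_dec (Cmod (phi b)) 1) as [H1 | H1].
 - nra.
 - right. assert (Q : Cmod (phi b) <= Cmod (phi b) ^ S m) by (apply pow_ge_self; [lia | lra]).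
  assert (Q2 : k / 2 * (Cmod (phi b) * (b - a)) <= 1).
  { eapply Rle_trans; [| exact B2]. replace (Cmod (phi b) ^ S m * (k / 2 * (INR (S m) * (b - a))))
    with (k / 2 * ((Cmod (phi b) ^ S m * INR (S m)) * (b - a))) by ring.
   apply Rmult_le_compat_l; [lra |]. apply Rmult_le_compat_r; [lra |]. nra. }
  apply Rmult_le_reg_l with (k / 2); [lra |]. replace (k / 2 * (2 / k)) with 1 by (field; lra). exact Q2.
Qed.

Lemma cone_of_uu (z : C) : z <> 0%C -> T z -> 0 <= Im z -> Re (uu (S m) 1 z) <= 0 -> taustar * Re z <= Im z.
Proof.
 intros Hz HT Hi Hu. destruct (T_upper_polar z Hz HT Hi) as (th & Hth & E).
 assert (Hp : 0 < Cmod z) by (apply Cmod_gt_0, Hz). assert (P := pow_lt (Cmod z) (S m) Hp).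
 destruct thstar_bounds as (S1 & S2 & S3 & S4). destruct e_al as [Ha Em]. assert (HN : 1 <= INR (S m)) by nra.
 assert (Hcos := cos_half th ltac:(lra)). assert (Hu2 : cos (INR (S m) * th) * / Cmod z ^ S m <= 0).
 { rewrite E in Hu at 1. unfold uu in Hu. rewrite polar_pow, polar_inv in Hu by lra.
  replace (Re (1 * polar (/ Cmod z ^ S m) (- (INR (S m) * th))))
   with (cos (INR (S m) * th) * / Cmod z ^ S m) in Hu by (unfold Re, polar; simpl; rewrite cos_neg; ring). exact Hu. }
 assert (Hi0 : 0 < / Cmod z ^ S m) by pos. assert (Hth2 : thstar <= th).
 { apply Rnot_lt_le. intros Hlt. assert (0 < cos (INR (S m) * th)); [| nra]. apply cos_gt_0; nra. }
 rewrite E, Re_polar, Im_polar. unfold taustar. assert (Ht : tan thstar <= tan th).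
 { destruct Hth2 as [Hlt | <-]; [left; apply tan_increasing; lra | lra]. }
 assert (Et : sin th = tan th * cos th) by (unfold tan; field; lra).
 rewrite Et. assert (tan thstar * cos th <= tan th * cos th) by nra. nra.
Qed.

(** Far out in the upper half of the sector u starts small and drifts left, so in a very short time
    Re u becomes nonpositive, which means that the slope [taustar] has been reached. The only
    alternative is that time runs out first, with the solution still far out. *)
Lemma excursion : exists X0, 1 <= X0 /\ forall tau phi a b X,
 X0 <= X -> sol tau phi -> 0 <= a <= b -> b <= tau ->
 (forall t, a <= t <= b -> r <= Cmod (phi t) /\ T (phi t) /\ 0 <= Im (phi t)) -> X <= Cmod (phi a) ->
 (exists s, a <= s <= b /\ s <= a + 2 / X /\ taustar * Re (phi s) <= Im (phi s)) \/
 (X / 4 <= Cmod (phi b) /\ b < a + 2 / X).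
Proof.
 assert (HN : 1 <= INR (S m)) by (generalize (le_INR 1 (S m) ltac:(lia)); simpl; lra).
 destruct (u_drift (S m) A 1 HA Hlead ltac:(lra) ltac:(lia) (1 / 2) ltac:(lra)) as (X1 & HX1 & HD).
 exists (5 * X1). split; [lra |]. intros tau phi a b X HX Hs Hab Hb Hin HXa.
 set (N := S m) in *. assert (HXp : 0 < X) by lra. assert (HXN : 0 < X ^ N) by pos.
 set (e := Rmin b (a + 2 / (INR N * X ^ N))).
 destruct (Rmin_bounds b (a + 2 / (INR N * X ^ N))) as [E1 E2]. fold e in E1, E2.
 (* Over a time 2 / (N X^N) the drift moves u by 2 / X^N with error at most half of that, while
    |u(a)| <= 1 / X^N; this just brings Re u below 0. Along the way |u| <= 4 / X^N, hence the
    modulus X / 4. *)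
 assert (Hd : 0 < 2 / (INR N * X ^ N)) by pos. assert (Hae : a <= e) by (apply Rmin_glb; lra).
 assert (Hna : phi a <> 0%C) by (apply Cmod_gt_0; lra). assert (Hua : Cmod (uu N 1 (phi a)) <= / X ^ N).
 { rewrite (Cmod_uu N 1) by (lra || assumption). apply Rinv_le_contravar; [lra |]. apply pow_incr. lra. }
 (* while [phi] is beyond [X1] on [[a, t]] it is in fact beyond [X / 4] *)
 assert (Step : forall t, a <= t <= e -> (forall s, a <= s <= t -> X1 <= Cmod (phi s)) ->
   Cmod (uu N 1 (phi t) - uu N 1 (phi a) + RtoC (INR N * (t - a))) <= 1 / 2 * (INR N * (t - a)) /\ X / 4 <= Cmod (phi t)).
 { intros t Ht Hall. assert (D := HD tau phi a t X1 (Rle_refl _) Hs ltac:(lra) ltac:(lra) Hall). split; [exact D |].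
  assert (HT : INR N * (t - a) <= 2 * / X ^ N).
  { apply Rle_trans with (INR N * (2 / (INR N * X ^ N))); [nra |]. right. field. lra. }
  assert (HT0 : 0 <= INR N * (t - a)) by pos.
  assert (Hnt : phi t <> 0%C) by (apply Cmod_gt_0; generalize (Hall t ltac:(lra)); lra).
  assert (U : Cmod (uu N 1 (phi t)) <= 4 * / X ^ N).
  { replace (uu N 1 (phi t)) with ((uu N 1 (phi t) - uu N 1 (phi a) + RtoC (INR N * (t - a))) + (uu N 1 (phi a) - RtoC (INR N * (t - a))))%C by ring.
   eapply Rle_trans; [apply Cmod_triangle |].
   assert (Z := Cmod_triangle_minus (uu N 1 (phi a)) (RtoC (INR N * (t - a)))). rewrite Cmod_R, Rabs_pos_eq in Z by exact HT0. lra. }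
  rewrite (Cmod_uu N 1) in U by (lra || assumption).
  assert (Pt : 0 < Cmod (phi t)) by (apply Cmod_gt_0, Hnt). assert (PtN := pow_lt _ N Pt).
  apply (pow_le_reg _ _ m); [lra | lra |]. fold N.
  replace (X / 4) with (X * / 4) by reflexivity. rewrite Rpow_mult_distr. assert (Q4 : (/ 4) ^ N <= / 4).
  { unfold N. simpl. assert (0 < (/ 4) ^ m) by pos.
   assert ((/ 4) ^ m <= 1) by (rewrite <- (pow1 m); apply pow_incr; lra). lra. }
  apply Rle_trans with (X ^ N * / 4); [nra |]. apply Rmult_le_reg_r with (/ Cmod (phi t) ^ N); [pos |].
  rewrite Rinv_r by lra. apply Rle_trans with (X ^ N * / 4 * (4 * / X ^ N)); [nra |]. right. field. lra. }
 assert (Hfar : forall t, a <= t <= e -> X1 <= Cmod (phi t)).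
 { apply (real_ind a e (fun t => X1 <= Cmod (phi t))).
  - lra.
  - intros t Ht Hall. destruct (Step t ltac:(lra) Hall) as [_ B].
   destruct (continuous_pos (fun s => Cmod (phi s)) t X1 (continuous_Cmod _ _ (proj1 Hs)) ltac:(lra)) as (d & Hd' & K).
   exists d. split; [lra |]. intros s Hs' _. left. apply K. rewrite Rabs_pos_eq; lra.
  - intros t Ht Hall. apply Rnot_lt_le. intros Hlt.
   destruct (continuous_pos (fun s => - Cmod (phi s)) t (- X1)) as (d & Hd' & K).
   + apply (continuous_opp (V := R_NormedModule)), continuous_Cmod, Hs.
   + lra.
   + set (s := Rmax a (t - d / 2)). destruct (Rmax_bounds a (t - d / 2)) as [M1 M2].
    fold s in M1, M2. assert (s < t) by (apply Rmax_lub_lt; lra).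
    assert (Z := K s ltac:(rewrite Rabs_left; lra)). assert (Y := Hall s ltac:(lra)). lra. }
 destruct (Step e ltac:(lra) Hfar) as [D B]. assert (H2X : 2 / (INR N * X ^ N) <= 2 / X).
 { unfold Rdiv. apply Rmult_le_compat_l; [lra |]. apply Rinv_le_contravar; [lra |].
  assert (X <= X ^ N) by (apply pow_ge_self; [lia | lra]). nra. }
 destruct (Rlt_dec b (a + 2 / (INR N * X ^ N))) as [Hlt | Hge].
 - right. assert (Ee : e = b) by (apply Rmin_left; lra). rewrite Ee in B. split; [exact B | lra].
 - left. assert (Ee : e = a + 2 / (INR N * X ^ N)) by (apply Rmin_right; lra).
  exists e. split; [lra | split; [lra |]]. destruct (Hin e ltac:(lra)) as (I1 & I2 & I3).
  apply cone_of_uu; [apply Cmod_gt_0; lra | pos | lra |].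
  assert (R := re_le_Cmod (uu N 1 (phi e) - uu N 1 (phi a) + RtoC (INR N * (e - a)))%C). apply Rabs_le_between in R.
  replace (Re (uu N 1 (phi e) - uu N 1 (phi a) + RtoC (INR N * (e - a)))%C)
   with (Re (uu N 1 (phi e)) - Re (uu N 1 (phi a)) + INR N * (e - a)) in R by (unfold Re; simpl; ring).
  assert (R2 := re_le_Cmod (uu N 1 (phi a))). apply Rabs_le_between in R2.
  assert (ET : INR N * (e - a) = 2 * / X ^ N) by (rewrite Ee; field; lra). fold N. lra.
Qed.

Hypothesis Hray : ray_in n A w r (- al) al.

Definition Rg (z : C) : Prop := r <= Cmod z /\ T z.

(** A common description of the repelling and the attracting disc: a solution follows the region up
    to a time b, and if this is not the end it is in the disc from then on. *)
Definition stays : Prop := forall tau phi, sol tau phi -> 0 <= tau <= w -> Rg (phi 0) ->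
 exists b, 0 <= b <= tau /\ (forall t, 0 <= t <= b -> Rg (phi t)) /\
  (b = tau \/ (b < tau /\ Cmod (phi b) = r /\ forall t, b <= t <= tau -> Cmod (phi t) <= r)).

Lemma region_strict tau phi : sol tau phi -> 0 <= tau <= w -> T (phi 0) ->
 (forall t, 0 <= t <= tau -> r <= Cmod (phi t)) -> forall t, 0 <= t <= tau ->
 Rg (phi t) /\ (0 < t -> 0 < side (- al) (phi t) /\ side al (phi t) < 0).
Proof.
 intros Hs Htau H0 H t Ht.
 destruct (sector_inv n A w HA r (- al) al tau phi 0 tau Hr T_width Hray Hs ltac:(lra) ltac:(lra) ltac:(lra) H H0 t Ht) as [I1 I2].
 split; [split; [apply H, Ht | pos] | lra].
Qed.

Lemma stays_out : circ_out n A w r -> stays.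
Proof.
 intros Hout tau phi Hs Htau [H1 H2]. exists tau. split; [lra | split; [| lra]].
 intros t Ht. apply (region_strict tau phi Hs Htau H2); [| lra].
 intros s Hs'. apply (circ_out_inv n A w HA r tau phi 0 tau Hr Hout Hs); lra.
Qed.

Lemma stays_in : circ_in n A w r -> stays.
Proof.
 intros Hin tau phi Hs Htau [H1 H2].
 destruct (classic (exists t, 0 <= t <= tau /\ Cmod (phi t) < r)) as [(t1 & Ht1 & Hlt) | He].
 (* Time is run backwards from t1, so the last passage at level r is the first entry into the
    disc. *)
 - destruct (last_below (fun u => Cmod (phi (t1 - u))) 0 t1 r) as [B | (s & Hs1 & Hs2 & Hs3)].
  + lra.
  + intros t. apply (continuous_comp (fun u => t1 - u) (fun s => Cmod (phi s))).
   * apply (continuous_minus (V := R_NormedModule)); [apply continuous_const | apply continuous_id].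
   * apply continuous_Cmod, Hs.
  + replace (t1 - t1) with 0 by ring. exact H1.
  + assert (B0 := B 0 ltac:(lra)). cbv beta in B0. rewrite Rminus_0_r in B0. lra.
  + cbv beta in Hs2. exists (t1 - s). split; [lra |]. split.
   * intros t Ht. assert (Hst : sol (t1 - s) phi) by (destruct Hs as [C1 D1]; split; [pos | intros; apply D1; lra]).
    apply (region_strict (t1 - s) phi Hst ltac:(lra) H2); [| lra].
    intros u Hu. replace u with (t1 - (t1 - u)) by ring. apply Hs3. lra.
   * right. split; [| split; [lra |]].
    -- destruct (Req_dec s 0) as [-> | Hne]; [rewrite Rminus_0_r in Hs2; lra | lra].
    -- intros t Ht. apply (circ_in_inv n A w HA r tau phi (t1 - s) tau Hr Hin Hs); lra.
 - exists tau. split; [lra | split; [| lra]]. intros t Ht. apply (region_strict tau phi Hs Htau H2); [| lra].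
  intros s Hs'. apply Rnot_lt_le. intros Hlt. apply He. exists s. lra.
Qed.

(** End points definitely above the real axis: at slope at least l in the region, or at height at
    least k in the disc. *)
Definition turned (l k : R) (f : C) : Prop := (Rg f /\ l * Re f <= Im f) \/ (Cmod f <= r /\ k <= Im f).

(** * Orbits from the right sector that reach a large modulus *)

Section Stays.
Hypothesis Hst : stays.

(** The constant l is [taustar] after its decay over time [w]; k is what remains of the height l r /
    2 at the entry into the disc. The bound P is claimed only if the cone is reached in the first
    half of the time, since coming down from infinity takes the other half. *)
Lemma turned_of_cone : exists l k P, 0 < l /\ 0 < k /\ 0 < P /\ forall phi s b,
 sol w phi -> 0 <= s <= b -> b <= w -> (forall t, 0 <= t <= b -> Rg (phi t)) ->
 (b = w \/ (b < w /\ Cmod (phi b) = r /\ forall t, b <= t <= w -> Cmod (phi t) <= r)) ->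
 taustar * Re (phi s) <= Im (phi s) ->
 turned l k (phi w) /\ (s <= w / 2 -> Cmod (phi w) <= P).
Proof.
 assert (Htau := taustar_pos). destruct cone_decay as (Q & HQ & Hdec).
 destruct (cone_bound taustar ltac:(lra)) as (X0 & Qb & HX0 & HQb & Hbd).
 destruct (im_lower n A r HA ltac:(lra)) as (L & HL & Him). set (l := taustar * exp (- Q * w)).
 assert (Hl : 0 < l) by (apply Rmult_lt_0_compat; [lra | pos]). set (k := l * (r / 2) * exp (- L * w)).
 assert (Hk : 0 < k) by (apply Rmult_lt_0_compat; [pos | pos]). assert (HQX : 0 < Qb * X0) by pos.
 assert (HQw : 0 < 2 * Qb / w) by pos.
 exists l, k, (Qb * X0 + 2 * Qb / w + r). split; [lra | split; [lra | split; [lra |]]].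
 intros phi s b Hs Hsb Hb Hreg Hend Hc. assert (Hexp : forall K x, 0 < K -> x <= w -> exp (- K * w) <= exp (- K * x)).
 { intros K x HK [Hx | ->]; [left; apply exp_increasing; nra | lra]. }
 assert (Dec : l * Re (phi b) <= Im (phi b)).
 { assert (D := Hdec w phi s b taustar Hs ltac:(lra) Hb (fun t Ht => Hreg t ltac:(lra)) ltac:(lra) Hc).
  assert (HR := Re_T _ (proj2 (Hreg b ltac:(lra)))). generalize (Cmod_ge_0 (phi b)). intros H0.
  assert (E := Hexp Q (b - s) HQ ltac:(lra)).
  assert (l <= taustar * exp (- Q * (b - s))) by (apply Rmult_le_compat_l; lra). nra. }
 destruct Hend as [-> | (Hlt & Er & Hin)].
 - split; [left; split; [apply Hreg; lra | lra] |]. intros Hs2.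
  destruct (Hbd w phi s w Hs ltac:(lra) ltac:(lra) ltac:(lra) (fun t Ht => Hreg t ltac:(lra)) Hc) as [_ [B | B]]; [lra |].
  assert (Cmod (phi w) * (w / 2) <= Qb) by nra. assert (Cmod (phi w) <= 2 * Qb / w).
  { apply Rmult_le_reg_r with (w / 2); [lra |]. replace (2 * Qb / w * (w / 2)) with Qb by (field; lra). assumption. }
  lra.
 - assert (HR := Re_T _ (proj2 (Hreg b ltac:(lra)))). rewrite Er in HR.
  assert (Hib : l * (r / 2) <= Im (phi b)) by nra. assert (Hp : 0 < l * (r / 2)) by pos.
  assert (I := Him w phi b w Hs ltac:(lra) ltac:(lra) Hin ltac:(lra)).
  split; [right; split; [apply Hin; lra |] | intros _; generalize (Hin w ltac:(lra)); lra].
  eapply Rle_trans; [| exact I]. assert (E := Hexp L (w - b) HL ltac:(lra)).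
  unfold k. apply Rmult_le_compat; try lra. left. apply exp_pos.
Qed.

(** An orbit that gets as far as X has either turned by the end, or is caught by the end of time in
    the middle of its excursion, far out at slope below [taustar]. Starting far out, at t = 0,
    leaves time to turn and to come down. *)
Lemma turning : exists l k P X0, 0 < l /\ 0 < k /\ 0 < P /\ 1 <= X0 /\ forall phi X t,
 sol w phi -> Rg (phi 0) -> 0 <= Im (phi 0) -> X0 <= X -> 0 <= t <= w -> X <= Cmod (phi t) ->
 (turned l k (phi w) /\ (t = 0 -> Cmod (phi w) <= P)) \/
 (0 < t /\ Rg (phi w) /\ X / 4 <= Cmod (phi w) /\ Im (phi w) < taustar * Re (phi w)).
Proof.
 destruct turned_of_cone as (l & k & P & Hl & Hk & HP & Hturn). destruct excursion as (X1 & HX1 & Hexc).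
 assert (H4w : 0 < 4 / w) by pos.
 (* The term 4 / w makes the excursion shorter than w / 2; the term 4 r keeps X / 4 above r, so that
    an unfinished excursion is outside the disc. *)
 exists l, k, P, (X1 + 4 * r + 4 / w). split; [lra | split; [lra | split; [lra | split; [lra |]]]].
 intros phi X t Hs H0 Hi HX Ht HXt. assert (HX2 : 2 / X <= w / 2).
 { apply Rmult_le_reg_r with (2 * X); [lra |]. replace (2 / X * (2 * X)) with 4 by (field; lra).
  apply Rmult_le_reg_r with (/ w); [lra |].
  replace (w / 2 * (2 * X) * / w) with X by (field; lra). unfold Rdiv in *. lra. }
 destruct (Hst w phi Hs ltac:(lra) H0) as (b & Hb & Hreg & Hend). assert (Htb : t <= b).
 { apply Rnot_lt_le. intros Hlt. destruct Hend as [-> | (_ & _ & Hin)]; [lra |].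
  assert (Z := Hin t ltac:(lra)). lra. }
 assert (Hpos := proj1 (im_sign n A w phi HA ltac:(lra) Hs) Hi).
 destruct (Hexc w phi t b X ltac:(lra) Hs ltac:(lra) ltac:(lra)) as [(s & Hs1 & Hs2 & Hs3) | [E1 E2]].
 - intros u Hu. destruct (Hreg u ltac:(lra)) as [R1 R2]. split; [lra | split; [pos | apply Hpos; lra]].
 - lra.
 - left. destruct (Hturn phi s b Hs ltac:(lra) ltac:(lra) Hreg Hend Hs3) as [D1 D2].
  split; [pos |]. intros E. apply D2. lra.
 - destruct Hend as [-> | (_ & Er & _)]; [| lra]. assert (Ht0 : 0 < t) by lra.
  destruct (Rle_dec (taustar * Re (phi w)) (Im (phi w))) as [Hc | Hc].
  + left. destruct (Hturn phi w w Hs ltac:(lra) ltac:(lra) Hreg ltac:(left; reflexivity) Hc) as [D1 _].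
   split; [pos | lra].
  + right. split; [lra | split; [apply Hreg; lra | lra]].
Qed.

(** A start of slope at least eps and modulus at most Y has an orbit bounded by [cone_bound], so
    only starts close to the axis reach beyond X1. *)
Lemma thin_start eps Y : 0 < eps -> exists X1, 0 < X1 /\ forall phi t,
 sol w phi -> Rg (phi 0) -> 0 <= t <= w -> Cmod (phi 0) <= Y -> X1 <= Cmod (phi t) ->
 Im (phi 0) < eps * Re (phi 0).
Proof.
 intros He. assert (Htau := taustar_pos). set (lam := Rmin eps taustar).
 destruct (Rmin_bounds eps taustar) as [L1 L2]. fold lam in L1, L2.
 assert (Hlam : 0 < lam) by (apply Rmin_pos; assumption).
 destruct (cone_bound lam ltac:(lra)) as (X0 & Qb & HX0 & HQb & Hbd). destruct (Rmax_bounds Y X0) as [M1 M2].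
 assert (HQ : 0 < Qb * Rmax Y X0) by pos.
 exists (Qb * Rmax Y X0 + r + 1). split; [lra |]. intros phi t Hs H0 Ht HY HX. apply Rnot_le_lt. intros Hc.
 destruct (Hst w phi Hs ltac:(lra) H0) as (b & Hb & Hreg & Hend). assert (Htb : t <= b).
 { apply Rnot_lt_le. intros Hlt. destruct Hend as [-> | (_ & _ & Hin)]; [lra |].
  assert (Z := Hin t ltac:(lra)). lra. }
 assert (HR := Re_T _ (proj2 H0)). assert (G := Cmod_ge_0 (phi 0)).
 destruct (Hbd w phi 0 t Hs ltac:(lra) ltac:(lra) ltac:(lra) (fun u Hu => Hreg u ltac:(lra)) ltac:(nra)) as [B _].
 assert (Rmax (Cmod (phi 0)) X0 <= Rmax Y X0) by (apply Rmax_lub; lra).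
 assert (Qb * Rmax (Cmod (phi 0)) X0 <= Qb * Rmax Y X0) by nra. lra.
Qed.

(** Orbits from the real segment stay below M - 1, so by Lipschitz dependence those from its
    neighbourhood stay below M. A start close to the axis whose orbit reaches M must therefore lie
    to the right of the segment by a fixed amount. *)
Lemma near_segment a M : r <= a -> 1 <= M ->
 (forall x t, r <= x <= a -> 0 <= t <= w -> Cmod (Phi M x t) <= M - 1) ->
 exists d eps, 0 < d /\ 0 < eps /\ forall phi t, sol w phi -> Rg (phi 0) -> 0 <= t <= w ->
  M <= Cmod (phi t) -> 0 <= Im (phi 0) < eps * Re (phi 0) -> a + d <= Re (phi 0).
Proof.
 intros Ha HM Hseg. destruct (Phi_lip n A w HA Hw M ltac:(lra)) as (Q & HQ & Hlip).
 assert (Hd0 : 0 < / (8 * Q)) by pos. set (d := / (8 * Q)) in *. assert (He0 : 0 < d / (a + d)) by pos.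
 exists d, (d / (a + d)). split; [lra | split; [lra |]].
 intros phi t Hs [H0 H0'] Ht HMt [Hi1 Hi2]. apply Rnot_lt_le. intros Hlt. set (z := phi 0) in *.
 assert (HR := Re_T _ H0'). assert (Hi3 : Im z < d).
 { apply Rlt_le_trans with (d / (a + d) * (a + d)); [| right; field; lra].
  eapply Rlt_trans; [exact Hi2 |]. apply Rmult_lt_compat_l; lra. }
 assert (HRz : r - d < Re z).
 { assert (B := Cmod_le_Re_Im z). rewrite (Rabs_pos_eq (Re z)), (Rabs_pos_eq (Im z)) in B by lra. lra. }
 (* The nearest point of the segment to Re z. Its left end causes no trouble: |z| >= r and a small
    imaginary part give Re z > r - d. *)
 set (x := Rmax r (Rmin a (Re z))). assert (Hx : r <= x <= a /\ Rabs (Re z - x) <= d).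
 { unfold x, Rmax, Rmin. destruct (Rle_dec a (Re z)); destruct (Rle_dec r _); (split; [lra | apply Rabs_le; lra]). }
 assert (Hzx : Cmod (z - x) <= 2 * d).
 { assert (B := Cmod_le_Re_Im (z - x)%C).
  change (Re (z - x)%C) with (Re z - x) in B. change (Im (z - x)%C) with (Im z - 0) in B.
  rewrite (Rabs_pos_eq (Im z - 0)) in B by lra. lra. }
 assert (Hz : forall u, 0 <= u <= w -> Cmod (Phi M z u) <= M - 3 / 4).
 { intros u Hu. assert (L := Hlip z x u Hu). assert (Q * Cmod (z - x) <= / 4).
  { apply Rle_trans with (Q * (2 * d)); [nra |]. unfold d. right. field. lra. }
  assert (B := Hseg x u (proj1 Hx) Hu). assert (B2 := Cmod_reverse (Phi M z u) (Phi M x u)). lra. }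
 assert (E : phi t = Phi M z t).
 { apply (sol_unique n A w HA Hw phi (Phi M z) Hs); [| | lra].
  - apply Phi_sol; try assumption; try lra. intros u Hu. generalize (Hz u Hu). lra.
  - rewrite (Phi_0 n A w HA Hw M z ltac:(lra)). reflexivity. }
 rewrite E in HMt. generalize (Hz t Ht). lra.
Qed.

(** This treats the boundary created by truncating at orbit size X. Such starts lie close to the
    axis and beyond a, where E is almost positive and b almost real. A turned end point gives p a
    definite positive argument; an end point caught far out near the axis gives p a real part
    exceeding that of b. The functions are left open because the attracting case uses the identity
    and the repelling case [W1]. *)
Lemma end_boundary (p b E : C -> C) (G : C -> Prop) a :
 (forall l k, 0 < l -> 0 < k -> exists kap, 0 < kap /\ forall f, turned l k f -> G f -> kap * (1 + Cmod (p f)) <= Im (p f)) ->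
 (forall B, exists X2, forall f, Rg f -> 0 <= Im f < taustar * Re f -> X2 <= Cmod f -> B < Re (p f)) ->
 (forall x, a <= x -> ccont_at E x /\ ccont_at b x /\
   Im (E x) = 0 /\ 0 < Re (E x) /\ Im (b x) = 0) ->
 (forall Y, exists B, 0 <= B /\ forall z, Rg z -> Cmod z <= Y -> Cmod (b z) <= B) ->
 (exists M eps, 0 < eps /\ forall phi t, sol w phi -> Rg (phi 0) -> 0 <= t <= w ->
  M <= Cmod (phi t) -> 0 <= Im (phi 0) < eps * Re (phi 0) -> a <= Re (phi 0) /\ G (phi w)) ->
 forall Y, exists X1, forall phi t, sol w phi -> Rg (phi 0) -> 0 <= Im (phi 0) -> Cmod (phi 0) <= Y ->
  0 <= t <= w -> X1 <= Cmod (phi t) ->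
  E (phi 0) <> 0%C /\ off_ray ((p (phi w) - b (phi 0)) / E (phi 0))%C.
Proof.
 intros H1 H2 H3 H4 (M & eps & Heps & HM) Y. destruct turning as (l & k & P & X0 & Hl & Hk & HP & HX0 & Hturn).
 destruct (H1 l k Hl Hk) as (kap & Hkap & HK). destruct (H4 Y) as (B & HB & HBb). destruct (H2 B) as (X2 & HX2).
 (* Since |b| <= B, passing from p to p - b costs at most half of the steepness [kap]. *)
 set (k' := kap / (2 * (1 + B))). assert (Hk' : 0 < k') by (apply Rdiv_lt_0_compat; lra).
 assert (Ek' : k' * (1 + B) = kap / 2) by (unfold k'; field; lra).
 destruct (thin_strip (fun y => 0 < Re (E y) /\ Rabs (Im (E y)) < k' * Re (E y) /\ Rabs (Im (b y)) < kap / 2) a Y)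
  as (d & Hd & HG).
 { intros x Hx. destruct (H3 x Hx) as (C1 & C2 & E1 & E2 & E3). set (e := Re (E x)) in *.
  set (eta := k' * e / (2 * (1 + k'))). assert (Heta : 0 < eta) by (apply Rdiv_lt_0_compat; [pos | lra]).
  assert (Ee : eta * (1 + k') = k' * e / 2) by (unfold eta; field; lra).
  destruct (C1 eta Heta) as (d1 & Hd1 & B1). destruct (C2 (kap / 2) ltac:(lra)) as (d2 & Hd2 & B2).
  destruct (Rmin_bounds d1 d2) as [M1 M2]. exists (Rmin d1 d2). split; [pos |]. intros y Hy.
  assert (D1 := B1 y ltac:(lra)). assert (D2 := B2 y ltac:(lra)).
  assert (R1 := Re_sub_le (E y) (E x)). assert (R2 := Im_sub_le (E y) (E x)). assert (R3 := Im_sub_le (b y) (b x)).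
  fold e in R1. rewrite E1, Rminus_0_r in R2. rewrite E3, Rminus_0_r in R3.
  apply Rabs_le_between in R1. assert (e - eta < Re (E y)) by lra. assert (eta < e) by nra. split; [lra | nra]. }
 assert (Hd0 : 0 < d / (1 + Rabs Y)) by (apply Rdiv_lt_0_compat; generalize (Rabs_pos Y); lra).
 set (eps1 := Rmin eps (d / (1 + Rabs Y))).
 destruct (Rmin_bounds eps (d / (1 + Rabs Y))) as [M1 M2]. fold eps1 in M1, M2.
 assert (He1 : 0 < eps1) by (apply Rmin_pos; assumption). destruct (thin_start eps1 Y He1) as (X1 & HX1 & Hthin).
 set (X := Rmax X0 (Rmax X1 (Rmax M (4 * X2)))). destruct (Rmax_bounds X0 (Rmax X1 (Rmax M (4 * X2)))) as [N1 N2].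
 destruct (Rmax_bounds X1 (Rmax M (4 * X2))) as [N3 N4].
 destruct (Rmax_bounds M (4 * X2)) as [N5 N6]. fold X in N1, N2. exists X. intros phi t Hs H0 Hi HY Ht HX.
 assert (Hth := Hthin phi t Hs H0 Ht HY ltac:(lra)).
 set (z := phi 0) in *. assert (HR := Re_T z (proj2 H0)). assert (Hz0 := proj1 H0).
 assert (HRY : Re z <= Y) by (generalize (re_le_Cmod z) (Rle_abs (Re z)); lra). assert (Haz : a <= Re z /\ G (phi w)).
 { apply (HM phi t Hs H0 Ht); [lra |]. fold z. split; [lra |].
  apply Rlt_le_trans with (eps1 * Re z); [lra |]. apply Rmult_le_compat_r; lra. }
 destruct Haz as [Haz HGf]. destruct (HG z HY Haz) as (G1 & G2 & G3).
 { rewrite Rabs_pos_eq by exact Hi. eapply Rlt_le_trans; [exact Hth |].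
  apply Rle_trans with (d / (1 + Rabs Y) * (1 + Rabs Y)); [| right; field; generalize (Rabs_pos Y); lra].
  apply Rmult_le_compat; try lra. generalize (Rle_abs Y). lra. }
 split; [intros E0; rewrite E0 in G1; simpl in G1; lra |]. assert (HbB := HBb z H0 HY).
 apply (off_ray_strip _ _ k'); try assumption.
 destruct (Hturn phi X t Hs H0 Hi ltac:(lra) Ht HX) as [[Htu _] | (_ & R1 & R2 & R3)].
 - left. assert (K := HK _ Htu HGf). set (q := p (phi w)) in *.
  apply Rabs_def2 in G3. change (Im (q - b z)%C) with (Im q - Im (b z)).
  assert (B1 := Cmod_triangle_minus q (b z)). assert (Q0 := Cmod_ge_0 q).
  assert (Z : k' * Cmod (q - b z) <= kap / 2 * (1 + Cmod q)).
  { rewrite <- Ek'. apply Rle_trans with (k' * (Cmod q + B)); [apply Rmult_le_compat_l; lra |].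
   rewrite Rmult_assoc. apply Rmult_le_compat_l; [lra |]. nra. }
  nra.
 - right. change (0 < Re (p (phi w)) - Re (b z)).
  assert (I0 := proj1 (im_sign n A w phi HA ltac:(lra) Hs) Hi w ltac:(lra)).
  assert (B1 := HX2 (phi w) R1 ltac:(lra) ltac:(lra)).
  assert (B2 := re_le_Cmod (b z)). apply Rabs_le_between in B2. lra.
Qed.

(** Starts in the truncated sector whose whole orbit stays within X. The flow is truncated at X + 1,
    so it is genuine and holomorphic on the boundary of this set as well. *)
Definition KE (X Y : R) (z : C) : Prop := (Cmod z <= Y /\ Rg z) /\
 forall t, 0 <= t <= w -> Cmod (Phi (X + 1) z t) <= X.

Lemma KE_compact X Y : 0 <= X -> ccompact (KE X Y).
Proof.
 intros HX. apply ccompact_inter_closed.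
 - apply (ccompact_inter_closed (fun z => Cmod z <= Y)); [apply ccompact_disc |].
  intros z Hz. apply not_and_or in Hz. destruct Hz as [Hz | Hz].
  + destruct (closed_outside r z Hz) as (d & Hd & B). exists d. split; [lra |]. intros y Hy [Q _]. apply (B y Hy Q).
  + destruct (closed_sector (- al) al z Hz) as (d & Hd & B). exists d. split; [lra |]. intros y Hy [_ Q]. apply (B y Hy Q).
 - intros z Hz. apply not_all_ex_not in Hz. destruct Hz as (t & Hz). apply imply_to_and in Hz.
  destruct Hz as [Ht Hz]. destruct (Phi_lip n A w HA Hw (X + 1) ltac:(lra)) as (Q & HQ & L).
  set (e := Cmod (Phi (X + 1) z t) - X). assert (He : 0 < e) by (unfold e; lra).
  exists (e / Q). split; [pos |]. intros y Hy HK. assert (B := L z y t Ht). assert (B2 := HK t Ht).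
  rewrite (Cmod_sub_sym z y) in B. apply Rlt_div_r in Hy; [| lra].
  assert (B4 := Cmod_reverse (Phi (X + 1) z t) (Phi (X + 1) y t)). unfold e in Hy. lra.
Qed.

Lemma KE_sol X Y z : 0 <= X -> KE X Y z ->
 sol w (Phi (X + 1) z) /\ Phi (X + 1) z 0 = z /\ hol (fun z => Phi (X + 1) z w) z.
Proof.
 intros HX [_ K]. split; [| split].
 - apply Phi_sol; try assumption; try lra. intros t Ht. generalize (K t Ht). lra.
 - apply Phi_0; try assumption. lra.
 - apply hol_Phi; try assumption; try lra. intros t Ht. generalize (K t Ht). lra.
Qed.

Lemma KE_intro X Y phi : 0 <= X -> sol w phi -> Rg (phi 0) -> Cmod (phi 0) <= Y ->
 (forall t, 0 <= t <= w -> Cmod (phi t) <= X) ->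
 KE X Y (phi 0) /\ forall t, 0 <= t <= w -> phi t = Phi (X + 1) (phi 0) t.
Proof.
 intros HX Hs H0 HY Hb. assert (E : forall t, 0 <= t <= w -> phi t = Phi (X + 1) (phi 0) t).
 { apply (sol_Phi n A w HA Hw (X + 1) phi w); try assumption; try lra. intros t Ht. generalize (Hb t Ht). lra. }
 split; [| exact E]. split; [split; assumption |]. intros t Ht. rewrite <- E by exact Ht. apply Hb, Ht.
Qed.

Lemma T_side_conj th (z : C) : side th (Cconj z) = - side (- th) z.
Proof. unfold side. rewrite cos_neg, sin_neg. unfold Re, Im, Cconj. simpl. ring. Qed.

Lemma T_conj (z : C) : T z -> T (Cconj z).
Proof. intros [H1 H2]. split; rewrite T_side_conj, ?Ropp_involutive; lra. Qed.

Lemma KE_conj X Y z : 0 <= X -> KE X Y z -> KE X Y (Cconj z).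
Proof.
 intros HX [[K1 [K2 K3]] K4]. split; [split; [| split] |].
 - rewrite Cmod_conj. exact K1.
 - rewrite Cmod_conj. exact K2.
 - apply T_conj, K3.
 - intros t Ht. rewrite Phi_conj by (assumption || lra). rewrite Cmod_conj. apply K4, Ht.
Qed.

Lemma KE_cases X Y z : 0 <= X -> KE X Y z ->
 inner (KE X Y) z \/ Cmod z = r \/ Cmod z = Y \/ side (- al) z = 0 \/ side al z = 0 \/
 exists t, 0 <= t <= w /\ Cmod (Phi (X + 1) z t) = X.
Proof.
 intros HX [[K1 [K2 [K3 K3']]] K4]. destruct (Req_dec (Cmod z) r) as [E1 | E1]; [auto |].
 destruct (Req_dec (Cmod z) Y) as [E2 | E2]; [auto |]. destruct (Req_dec (side (- al) z) 0) as [E3 | E3]; [auto |].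
 destruct (Req_dec (side al z) 0) as [E4 | E4]; [auto 6 |].
 destruct (classic (exists t, 0 <= t <= w /\ Cmod (Phi (X + 1) z t) = X)) as [E5 | E5]; [auto 6 |]. left.
 destruct (continuous_bounded (fun t => Cmod (Phi (X + 1) z t)) 0 w ltac:(lra)) as (t0 & Ht0 & Hmax).
 { intros t. apply continuous_Cmod, Phi_cvcont; try assumption. lra. }
 assert (Hlt : Cmod (Phi (X + 1) z t0) < X).
 { destruct (K4 t0 Ht0) as [H | H]; [exact H |]. exfalso. apply E5. exists t0. split; assumption. }
 destruct (Phi_lip n A w HA Hw (X + 1) ltac:(lra)) as (Q & HQ & L).
 set (e := X - Cmod (Phi (X + 1) z t0)). assert (He : 0 < e) by (unfold e; lra). assert (HeQ : 0 < e / Q) by pos.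
 set (d := Rmin (Rmin (Cmod z - r) (Y - Cmod z)) (Rmin (Rmin (side (- al) z) (- side al z)) (e / Q))).
 assert (Hd : d <= Cmod z - r /\ d <= Y - Cmod z /\ d <= side (- al) z /\ d <= - side al z /\ d <= e / Q).
 { destruct (Rmin_bounds (Rmin (Cmod z - r) (Y - Cmod z)) (Rmin (Rmin (side (- al) z) (- side al z)) (e / Q))) as [Q1 Q2].
  destruct (Rmin_bounds (Cmod z - r) (Y - Cmod z)) as [Q3 Q4].
  destruct (Rmin_bounds (Rmin (side (- al) z) (- side al z)) (e / Q)) as [Q5 Q6].
  destruct (Rmin_bounds (side (- al) z) (- side al z)) as [Q7 Q8]. fold d in Q1, Q2. lra. }
 assert (Hdp : 0 < d) by (unfold d; repeat apply Rmin_pos; lra). clearbody d. destruct Hd as (D1 & D2 & D3 & D4 & D5).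
 exists d. split; [lra |]. intros y Hy. assert (B1 := Rabs_Cmod_sub y z). apply Rabs_le_between in B1.
 assert (B3 := side_le_Cmod (- al) (y - z)%C). assert (B4 := side_le_Cmod al (y - z)%C).
 rewrite side_minus in B3, B4. apply Rabs_le_between in B3. apply Rabs_le_between in B4.
 split; [split; [lra | split; [lra | split; lra]] |].
 intros t Ht. assert (B5 := L y z t Ht). assert (B6 := Cmod_reverse (Phi (X + 1) y t) (Phi (X + 1) z t)).
 assert (B7 := Hmax t Ht). cbv beta in B7.
 apply Rle_div_r in D5; [| lra]. assert (Q * Cmod (y - z) < e); [nra | unfold e in *; lra].
Qed.

Lemma off_ray_conj v : off_ray v -> off_ray (Cconj v).
Proof. intros [H | H]; [left; exact H | right]. change (- Im v <> 0). lra. Qed.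

(** All data commute with conjugation, so it suffices to look at starts in the upper half, where the
    sign of the imaginary part is preserved by the flow. *)
Lemma boundary_symmetric (p b E : C -> C) X Y : 0 <= X ->
 (forall z, p (Cconj z) = Cconj (p z)) -> (forall z, b (Cconj z) = Cconj (b z)) ->
 (forall z, E (Cconj z) = Cconj (E z)) ->
 let good z := inner (KE X Y) z \/
  (E z <> 0%C /\ off_ray ((p (Phi (X + 1) z w) - b z) / E z)%C) in
 (forall z, KE X Y z -> 0 <= Im z -> good z) -> forall z, KE X Y z -> good z.
Proof.
 intros HX Hp Hb HE good H z Kz. destruct (Rle_dec 0 (Im z)) as [Hi | Hi]; [apply H; assumption |].
 destruct (H (Cconj z) (KE_conj X Y z HX Kz)) as [(d & Hd & In) | [N1 N2]].
 - change (0 <= - Im z). lra.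
 - left. exists d. split; [lra |]. intros y Hy. rewrite <- (Cconj_conj y).
  apply KE_conj; [lra |]. apply In. rewrite <- Cminus_conj, Cmod_conj. exact Hy.
 - right. rewrite HE, Hb, Phi_conj, Hp in * by (assumption || lra).
  assert (N3 : E z <> 0%C) by (intros E0; apply N1; rewrite E0; apply C_eq; simpl; ring). split; [pos |].
  rewrite <- Cminus_conj, <- Cdiv_conj in N2 by exact N3. apply off_ray_conj in N2. rewrite Cconj_conj in N2. exact N2.
Qed.

End Stays.

Lemma Rg_real x : r <= x -> Rg x /\ 0 < side (- al) x /\ side al x < 0.
Proof.
 intros Hx. destruct e_al as [Ha _]. assert (Hp := PI_RGT_0). assert (S : 0 < sin al) by (apply sin_gt_0; lra).
 assert (S1 : 0 < side (- al) x).
 { unfold side, Re, Im. simpl. rewrite sin_neg. nra. }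
 assert (S2 : side al x < 0) by (unfold side, Re, Im; simpl; nra).
 split; [split; [rewrite Cmod_R, Rabs_pos_eq; lra | split; lra] | lra].
Qed.

Lemma not_turned_real l k f : 0 < l -> 0 < k -> turned l k f -> Im f <> 0.
Proof.
 intros Hl Hk [[[H1 H2] H3] | [_ H]] E; [| lra]. assert (HR := Re_T f H2). nra.
Qed.

(** * The comparison function in the right sector *)

Local Notation DW1 := (DW 1 (r ^ m * r ^ m) m).
(** The right sector has twice the opening of the others, and [W1] maps its part outside the disc
    conformally onto the plane slit along (-oo, 2 r^m]: the circle covers the segment up to 2 r^m
    twice, and each side covers the rest. *)
Definition W1 : C -> C := W 1 (r ^ m * r ^ m) m.
Definition w1 (x : R) : R := x ^ m + r ^ m * r ^ m * / x ^ m.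

Lemma el_mult_0 : el (INR m * 0) = RtoC 1.
Proof. rewrite Rmult_0_r. apply el_0. Qed.

Lemma W1_polar rho th : 0 < rho ->
 Re (W1 (polar rho th)) = w1 rho * cos (INR m * th) /\
 Im (W1 (polar rho th)) = (rho ^ m - (r ^ m * r ^ m) * / rho ^ m) * sin (INR m * th).
Proof.
 intros H. assert (E := el_mult_0).
 replace th with (0 + th) at 1 3 by ring. split; [apply Re_W_polar | apply Im_W_polar]; try assumption; lra.
Qed.

Lemma W1_real x : x <> 0 -> W1 x = RtoC (w1 x).
Proof.
 intros Hx. assert (P := pow_nonzero x m Hx). unfold W1, W, w1. rewrite <- RtoC_pow, <- RtoC_inv by exact P.
 rewrite <- !RtoC_mult, <- RtoC_plus, <- RtoC_mult. f_equal. ring.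
Qed.

Lemma w1_incr x y : r <= x < y -> w1 x < w1 y.
Proof.
 intros [H1 H2]. unfold w1. assert (Px : 0 < x ^ m) by pos. assert (Py : 0 < y ^ m) by pos.
 assert (Pr : 0 < r ^ m) by pos. assert (L1 : r ^ m <= x ^ m) by (apply pow_incr; lra).
 assert (L2 : x ^ m < y ^ m) by (apply Rnot_le_lt; intros Hle; apply (pow_le_reg1 y x m) in Hle; lra || lia).
 assert (E : y ^ m + r ^ m * r ^ m * / y ^ m - (x ^ m + r ^ m * r ^ m * / x ^ m)
   = (y ^ m - x ^ m) * (x ^ m * y ^ m - r ^ m * r ^ m) * / (x ^ m * y ^ m)) by (field; lra).
 assert (0 < (y ^ m - x ^ m) * (x ^ m * y ^ m - r ^ m * r ^ m) * / (x ^ m * y ^ m)); [| lra].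
 apply Rmult_lt_0_compat; [apply Rmult_lt_0_compat; [lra | nra] | pos].
Qed.

Lemma w1_r : w1 r = 2 * r ^ m.
Proof. unfold w1. assert (0 < r ^ m) by pos. field. lra. Qed.

Lemma w1_ge x : 0 < x -> x ^ m <= w1 x.
Proof.
 intros Hx. unfold w1. assert (0 < r ^ m) by pos. assert (0 < x ^ m) by pos. assert (0 < / x ^ m) by pos.
 assert (0 <= r ^ m * r ^ m * / x ^ m) by pos. lra.
Qed.

Lemma not_zero (z : C) : r <= Cmod z -> z <> 0%C.
Proof. intros H. apply Cmod_gt_0. lra. Qed.

Lemma W1_edge (z : C) : Rg z -> 0 <= Im z -> Cmod z = r \/ side al z = 0 ->
 Im (W1 z) = 0 /\ Re (W1 z) <= 2 * r ^ m.
Proof.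
 intros [H1 H2] Hi He. assert (Pr : 0 < r ^ m) by pos. destruct e_al as [Ha Em]. destruct He as [He | He].
 - destruct (T_upper_polar z (not_zero z H1) H2 Hi) as (th & Hth & E).
  rewrite He in E. rewrite E. destruct (W1_polar r th Hr) as [E1 E2]. rewrite E1, E2, w1_r.
  split; [field; lra |]. generalize (COS_bound (INR m * th)). nra.
 - assert (E := side_hi_zero (- al) al z T_width H2 He). rewrite E.
  destruct (W1_polar (Cmod z) al ltac:(lra)) as [E1 E2]. rewrite E1, E2, Em, sin_PI, cos_PI.
  split; [ring |]. assert (B := w1_ge (Cmod z) ltac:(lra)). assert (0 < Cmod z ^ m) by pos. lra.
Qed.

Lemma hol_W1 z : r <= Cmod z -> hol W1 z.
Proof. intros H. apply (hol_W 1 (r ^ m * r ^ m) m (fun z => z)); [apply hol_id | apply not_zero, H]. Qed.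

(** The two bounding rays, and conjugate points of the circle, have equal images, so one of the two
    points has to be strictly inside. *)
Lemma DW1_neq_0 (x y : C) : Rg x -> Rg y -> r < Cmod x -> 0 < side (- al) x -> side al x < 0 ->
 DW1 x y <> 0%C /\ DW1 y x <> 0%C.
Proof.
 intros [X1 X2] [Y1 Y2] H S1 S2. destruct e_al as [Ha Em]. assert (Hp := PI_RGT_0).
 destruct (T_polar x (not_zero x X1) X2) as (t1 & H1 & E1). destruct (T_polar y (not_zero y Y1) Y2) as (t2 & H2 & E2).
 assert (H3 := sector_strict_polar (- al) al x t1 T_width S1 S2 E1 H1). rewrite E1, E2.
 split; apply DW_neq_0; try lra; try lia; try nra; apply Rabs_def1; nra.
Qed.

(** If the quotient were -c, then f = z g with g = 1 - c (W1 z - a). As f is small against z, so is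
    g, hence c (W1 z - a) is close to 1 and in particular m th <= pi / 2. There the argument of W1 z
    exceeds that of z so much that cos th Im g outweighs sin th Re g, and Im f <= 0. *)
Lemma far_attracting a P : 0 < a -> 0 < P -> exists Y1, r < Y1 /\ forall z f : C, T z -> 0 <= Im z -> Y1 <= Cmod z ->
 Cmod f <= P -> 0 < Im f ->
 (z * (W1 z - a))%C <> 0%C /\ off_ray ((f - z) / (z * (W1 z - a)))%C.
Proof.
 intros Ha HP. exists (4 * P + 2 * r + r ^ m + a + 1). assert (Pr : 0 < r ^ m) by pos.
 split; [lra |]. intros z f HT Hi HY Hf Hif. set (rho := Cmod z) in *.
 assert (Hz0 : z <> 0%C) by (apply not_zero; fold rho; lra). destruct e_al as [Hal Em]. assert (Hm3 := INRm m Hm).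
 destruct (T_upper_polar z Hz0 HT Hi) as (th & Hth & E). fold rho in E.
 destruct (W1_polar rho th ltac:(lra)) as [E1 E2]. rewrite <- E in E1, E2.
 assert (Hrho : rho <= rho ^ m) by (apply pow_ge_self; [lia | lra]). assert (Prho : 2 * r ^ m <= rho ^ m).
 { apply Rle_trans with ((2 * r) ^ m); [| apply pow_incr; lra]. rewrite Rpow_mult_distr.
  apply Rmult_le_compat_r; [lra |]. apply pow_ge_self; [lia | lra]. }
 assert (Hq : (r ^ m * r ^ m) * / rho ^ m <= rho ^ m / 4).
 { apply Rmult_le_reg_r with (rho ^ m); [lra |]. rewrite Rmult_assoc, Rinv_l by lra. nra. }
 assert (Hq0 : 0 <= (r ^ m * r ^ m) * / rho ^ m) by pos. set (D := (W1 z - a)%C).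
 assert (EDi : Im D = (rho ^ m - (r ^ m * r ^ m) * / rho ^ m) * sin (INR m * th)) by (rewrite <- E2; unfold D, Im; simpl; ring).
 assert (EDr : Re D = w1 rho * cos (INR m * th) - a) by (rewrite <- E1; unfold D, Re; simpl; ring).
 assert (HD : D <> 0%C).
 { intros E0. rewrite E0 in EDi, EDr. unfold Re, Im in EDi, EDr. simpl in EDi, EDr.
  assert (Hs : sin (INR m * th) = 0) by nra.
  assert (Hc := sin2_cos2 (INR m * th)). unfold Rsqr in Hc. rewrite Hs in Hc. assert (Bw := w1_ge rho ltac:(lra)).
  destruct (Rmult_integral (cos (INR m * th) - 1) (cos (INR m * th) + 1) ltac:(lra)) as [Hc1 | Hc1];
   [replace (cos (INR m * th)) with 1 in EDr by lra | replace (cos (INR m * th)) with (-1) in EDr by lra]; lra. }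
 split; [apply Cmult_neq_0; assumption |].
 set (v := ((f - z) / (z * D))%C). assert (Ev : f = (z * (1 + v * D))%C) by (unfold v; field; split; assumption).
 clearbody v. apply NNPP. intros Hoff. apply not_or_and in Hoff. destruct Hoff as [O1 O2].
 apply Rnot_lt_le in O1. apply NNPP in O2. set (c := - Re v).
 assert (Ev2 : v = RtoC (- c)) by (unfold c; rewrite Ropp_involutive; apply C_eq; [reflexivity | pos]).
 set (g := (1 + v * D)%C) in *. assert (Eg1 : Re g = 1 - c * Re D) by (unfold g; rewrite Ev2; unfold Re; simpl; ring).
 assert (Eg2 : Im g = - c * Im D) by (unfold g; rewrite Ev2; unfold Im; simpl; ring). assert (Hg : Cmod g <= 1 / 4).
 { apply Rmult_le_reg_l with rho; [lra |]. apply Rle_trans with (Cmod f); [rewrite Ev, Cmod_mult; fold rho; lra | lra]. }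
 assert (Hgr := re_le_Cmod g). apply Rabs_le_between in Hgr.
 assert (Hif2 : Im f = rho * (sin th * Re g + cos th * Im g)).
 { rewrite Ev, E. unfold polar, el, Re, Im. simpl. ring. }
 clearbody g. assert (Hc : 0 <= c) by (unfold c; lra). clearbody c. assert (HcD : 3 / 4 <= c * Re D) by lra.
 assert (HDp : 0 < Re D) by nra. assert (HS : 0 < w1 rho) by (generalize (w1_ge rho ltac:(lra)); lra).
 assert (Hcos : 0 < cos (INR m * th)) by nra. assert (Hmth : 0 <= INR m * th <= PI).
 { split; [pos |]. rewrite <- Em. apply Rmult_le_compat_l; lra. }
 assert (Hmth2 : INR m * th <= PI / 2).
 { apply Rnot_lt_le. intros Hlt. assert (cos (INR m * th) < 0); [| lra]. apply cos_lt_0; lra. }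
 assert (Hth2 : th <= INR m * th) by nra. assert (S1 : sin th <= sin (INR m * th)) by (apply sin_incr_1; lra).
 assert (S0 : 0 <= sin th) by (apply sin_ge_0; lra).
 assert (C1 : cos (INR m * th) <= cos th) by (apply cos_decr_1; lra).
 assert (K1 : c * Re D <= c * (w1 rho * cos (INR m * th))) by (apply Rmult_le_compat_l; lra).
 assert (K2 : w1 rho / 2 * sin (INR m * th) <= Im D).
 { rewrite EDi. apply Rmult_le_compat_r; [lra |]. unfold w1. lra. }
 assert (K3 : c * (w1 rho / 2 * sin (INR m * th)) <= c * Im D) by (apply Rmult_le_compat_l; assumption).
 assert (K4 : c * w1 rho / 2 * cos (INR m * th) * sin th <= cos th * (c * Im D)).
 { apply Rle_trans with (cos th * (c * (w1 rho / 2 * sin (INR m * th)))).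
  - replace (cos th * (c * (w1 rho / 2 * sin (INR m * th)))) with (c * w1 rho / 2 * (cos th * sin (INR m * th))) by field.
   rewrite Rmult_assoc. apply Rmult_le_compat_l; [apply Rmult_le_pos; [pos |]; lra |]. apply Rmult_le_compat; lra.
  - apply Rmult_le_compat_l; lra. }
 assert (K5 : 3 / 8 * sin th <= c * w1 rho / 2 * cos (INR m * th) * sin th) by (apply Rmult_le_compat_r; lra).
 assert (K6 : sin th * Re g <= sin th * (1 / 4)) by (apply Rmult_le_compat_l; lra).
 assert (sin th * Re g + cos th * Im g <= 0) by (rewrite Eg2; lra). nra.
Qed.

(** * Right sector, attracting disc *)

Section Attracting.
Hypothesis Hin : circ_in n A w r.

(** The intermediate value theorem is not directly applicable, since real solutions may escape.
    Instead x is moved to the right from r: without a fixed point, boundedness of the orbit and f x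
    < x would persist up to Y, but a real start that far out would have to turn away from the axis.
    This also bounds all orbits from the segment up to a, as [near_segment] requires. *)
Lemma end_in_zero : exists a X, r < a /\ 1 <= X /\
 (forall x t, r <= x <= a -> 0 <= t <= w -> Cmod (Phi (X + 1) x t) <= X) /\
 Phi (X + 1) a w = a.
Proof.
 assert (Hst := stays_in Hin). destruct (turning Hst) as (l & k & P & X0 & Hl & Hk & HP & HX0 & Hturn).
 (* An orbit reaching M without turning ends beyond M / 4 > Y, which is incompatible with an end
    point to the left of its start. *)
 set (Y := X0 + r). set (M := 4 * Y + X0 + 1). assert (HM : 0 <= M) by (unfold M, Y; lra). apply NNPP. intros Hno.
 assert (Hreal : forall x, Im (RtoC x) = 0) by reflexivity.
 assert (Hphi : forall x, r <= x -> (forall t, 0 <= t <= w -> Cmod (Phi M x t) <= M) ->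
   sol w (Phi M x) /\ Phi M x 0 = x /\ Im (Phi M x w) = 0).
 { intros x Hx Hb. assert (Hs : sol w (Phi M x)) by (apply Phi_sol; try assumption; lra).
  assert (E0 := Phi_0 n A w HA Hw M x HM). split; [pos | split; [pos |]].
  apply (im_zero n A w (Phi M x) HA); try lra; [pos | rewrite E0; reflexivity]. }
 destruct (Phi_lip n A w HA Hw M HM) as (Q & HQ & Hlip).
 assert (HP' : forall x, r <= x <= Y -> (forall t, 0 <= t <= w -> Cmod (Phi M x t) < M) /\
   Re (Phi M x w) < x).
 { apply (real_ind r Y (fun x => (forall t, 0 <= t <= w -> Cmod (Phi M x t) < M) /\
   Re (Phi M x w) < x)).
  - assert (Cr : Cmod r = r) by (rewrite Cmod_R, Rabs_pos_eq; lra).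
   assert (Hb : forall t, 0 <= t <= w -> Cmod (Phi M r t) <= r).
   { apply (Phi_apriori n A w HA Hw M r r HM); [unfold M, Y; lra | lra |]. intros tau Htau Hs _.
    apply (circ_in_inv n A w HA r tau (Phi M r) 0 tau Hr Hin Hs); try lra. rewrite Phi_0 by assumption. lra. }
   split; [intros t Ht; generalize (Hb t Ht); unfold M, Y; lra |].
   destruct (Hphi r ltac:(lra)) as (Hs & E0 & _); [intros t Ht; generalize (Hb t Ht); unfold M, Y; lra |].
   assert (B : Cmod (Phi M r w) < r).
   { apply (circ_in_inv n A w HA r w (Phi M r) 0 w Hr Hin Hs); try lra. rewrite E0. lra. }
   generalize (re_le_Cmod (Phi M r w)) (Rle_abs (Re (Phi M r w))). lra.
  - intros x Hx Hall. destruct (Hall x ltac:(lra)) as [B1 B2].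
   destruct (Phi_strict_near n A w HA Hw M x HM B1) as (d & Hd & Hnear).
   set (g := x - Re (Phi M x w)). assert (Hg : 0 < g / Q) by (apply Rdiv_lt_0_compat; unfold g; lra).
   destruct (Rmin_bounds d (g / Q)) as [M1 M2]. exists (Rmin d (g / Q)). split; [pos |]. intros s Hs HsY.
   assert (Cs : Cmod (RtoC s - x) = s - x) by (rewrite <- RtoC_minus, Cmod_R, Rabs_pos_eq; lra).
   split; [apply Hnear; lra |]. assert (L := Hlip s x w ltac:(lra)). rewrite Cs in L.
   assert (R := Re_sub_le (Phi M s w) (Phi M x w)). apply Rabs_le_between in R.
   assert (Z : s - x < g / Q) by lra. apply Rlt_div_r in Z; [unfold g in *; lra | lra].
  - intros x Hx Hall. assert (Happ : forall e, 0 < e -> exists s, r <= s < x /\ forall t, 0 <= t <= w ->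
    Cmod (Phi M x t - Phi M s t) <= e).
   { intros e He. assert (HeQ : 0 < e / Q) by pos.
    set (s := Rmax r (x - e / Q)). destruct (Rmax_bounds r (x - e / Q)) as [S1 S2]. fold s in S1, S2.
    assert (Hsx : s < x) by (apply Rmax_lub_lt; lra). exists s. split; [lra |]. intros t Ht.
    eapply Rle_trans; [apply (Hlip x s t Ht) |]. rewrite <- RtoC_minus, Cmod_R, Rabs_pos_eq by lra.
    assert (Z : x - s <= e / Q) by lra. apply Rle_div_r in Z; lra. }
   assert (Hb : forall t, 0 <= t <= w -> Cmod (Phi M x t) <= M).
   { intros t Ht. apply Rnot_lt_le. intros Hlt. destruct (Happ (Cmod (Phi M x t) - M) ltac:(lra)) as (s & Hs & B).
    assert (B1 := proj1 (Hall s ltac:(lra)) t Ht). assert (B2 := B t Ht).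
    assert (V := Cmod_reverse (Phi M x t) (Phi M s t)). lra. }
   assert (Hw2 : Re (Phi M x w) <= x).
   { apply Rnot_lt_le. intros Hlt. destruct (Happ (Re (Phi M x w) - x) ltac:(lra)) as (s & Hs & B).
    assert (B1 := proj2 (Hall s ltac:(lra))). assert (B2 := B w ltac:(lra)).
    assert (V := Re_sub_le (Phi M x w) (Phi M s w)). apply Rabs_le_between in V. lra. }
   destruct (Hphi x ltac:(lra) Hb) as (Hs & E0 & Ei).
   assert (Hstrict : forall t, 0 <= t <= w -> Cmod (Phi M x t) < M).
   { intros t Ht. apply Rnot_le_lt. intros Hge.
    destruct (Hturn _ M t Hs) as [[D _] | (_ & D1 & D2 & _)]; try (unfold M, Y; lra); try assumption.
    - rewrite E0. apply Rg_real; lra || assumption.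
    - rewrite E0, Hreal. lra.
    - apply (not_turned_real _ _ _ Hl Hk D Ei).
    - assert (V := Cmod_le_Re_Im (Phi M x w)). rewrite Ei, Rabs_R0 in V.
     assert (V2 := Re_T _ (proj2 D1)). rewrite (Rabs_pos_eq (Re _)) in V by lra. unfold M, Y in *. lra. }
   split; [pos |]. destruct Hw2 as [Hlt | Heq]; [lra | exfalso].
   apply Hno. exists x, M. split; [lra | split; [unfold M, Y; lra | split]].
   + intros y t Hy Ht. assert (By : forall t, 0 <= t <= w -> Cmod (Phi M y t) <= M).
    { intros u Hu. destruct (Req_dec y x) as [-> | Hne]; [apply Hb, Hu |].
     left. apply (proj1 (Hall y ltac:(lra)) u Hu). }
    rewrite <- Phi_raise; try assumption. apply By, Ht.
   + rewrite <- Phi_raise by (assumption || lra). apply C_eq; [pos | pos]. }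
 destruct (HP' Y ltac:(unfold Y; lra)) as [B1 B2].
 destruct (Hphi Y ltac:(unfold Y; lra)) as (Hs & E0 & Ei); [intros t Ht; left; apply B1, Ht |].
 assert (HY : 0 < Y) by (unfold Y; lra). destruct (Hturn _ Y 0 Hs) as [[D _] | (D & _)]; try lra; try (unfold Y; lra).
 - rewrite E0. apply Rg_real; (assumption || unfold Y; lra).
 - rewrite E0, Hreal. lra.
 - rewrite E0, Cmod_R, Rabs_pos_eq; lra.
 - apply (not_turned_real _ _ _ Hl Hk D Ei).
Qed.

(** On the sides and the circle W1 is at most 2 r^m < w1 a, so the comparison function z (W1 z - w1
    a) is there a negative multiple of z and the quotient becomes 1 - f / z up to a positive factor.
    On the real axis beyond a it is positive, as [end_boundary] requires. *)
Lemma end_in_boundary a M : r < a -> 1 <= M ->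
 (forall x t, r <= x <= a -> 0 <= t <= w -> Cmod (Phi M x t) <= M - 1) ->
 exists Y1, forall Y, Y1 <= Y -> exists X1, forall X, X1 <= X -> 0 <= X -> forall z, KE X Y z ->
  inner (KE X Y) z \/
  ((z * (W1 z - RtoC (w1 a)))%C <> 0%C /\
   off_ray ((Phi (X + 1) z w - z) / (z * (W1 z - RtoC (w1 a))))%C).
Proof.
 intros Ha HM Hseg. assert (Hst := stays_in Hin).
 assert (Hwa : 2 * r ^ m < w1 a) by (rewrite <- w1_r by assumption; apply w1_incr; assumption || lra).
 assert (Pr : 0 < r ^ m) by pos. destruct (turning Hst) as (l & k & P & X0 & Hl & Hk & HP & HX0 & Hturn).
 destruct (far_attracting (w1 a) P ltac:(lra) HP) as (Y1 & HY1 & Hfar).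
 destruct (near_segment a M ltac:(lra) HM Hseg) as (d & eps & Hd & Heps & Hnear).
 set (E := fun z : C => (z * (W1 z - RtoC (w1 a)))%C). exists (Y1 + X0). intros Y HY.
 destruct (end_boundary Hst (fun z => z) (fun z => z) E (fun _ => True) (a + d)) with (Y := Y) as (X1 & Hbd).
 - intros l' k' Hl' Hk'. assert (Hkap : 0 < Rmin (Rmin (l' / 4) (l' * r / 4)) (k' / (1 + r))) by pos.
  destruct (Rmin_bounds (Rmin (l' / 4) (l' * r / 4)) (k' / (1 + r))) as [M1 M2].
  destruct (Rmin_bounds (l' / 4) (l' * r / 4)) as [M3 M4].
  exists (Rmin (Rmin (l' / 4) (l' * r / 4)) (k' / (1 + r))). set (kap := Rmin (Rmin _ _) _) in *. split; [lra |].
  intros f [[[F1 F2] F3] | [F1 F2]] _.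
  + assert (HR := Re_T f F2). nra.
  + apply Rle_trans with k'; [| lra]. apply Rle_trans with (k' / (1 + r) * (1 + r)); [| right; field; lra].
   apply Rmult_le_compat; try lra. generalize (Cmod_ge_0 f). lra.
 - intros B. exists (2 * Rabs B + 1). intros f [F1 F2] _ HB. assert (HR := Re_T f F2). generalize (Rle_abs B). lra.
 - intros x Hx. assert (Hx0 : r <= Cmod x) by (rewrite Cmod_R, Rabs_pos_eq; lra).
  assert (EE : E x = RtoC (x * (w1 x - w1 a))).
  { unfold E. rewrite W1_real by lra. rewrite RtoC_mult, RtoC_minus. reflexivity. }
  assert (Hwx : w1 a < w1 x) by (apply w1_incr; assumption || lra). split; [| split; [| split; [| split]]].
  + apply hol_ccont. apply hol_mult; [apply hol_id | apply hol_minus; [apply hol_W1; assumption | apply hol_const]].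
  + apply hol_ccont, hol_id.
  + rewrite EE. reflexivity.
  + rewrite EE. change (0 < x * (w1 x - w1 a)). apply Rmult_lt_0_compat; lra.
  + reflexivity.
 - intros Y'. exists (Rabs Y'). split; [pos |]. intros z _ Hz. generalize (Rle_abs Y'). lra.
 - exists M, eps. split; [lra |]. intros phi t Hs H0 Ht HMt Hi. split; [apply (Hnear phi t); assumption | exact I].
 - exists X1. intros X HX HX0' z Kz.
  apply (boundary_symmetric (fun z => z) (fun z => z) E X Y HX0'); try (intros; reflexivity); [| | pos].
  { intros y. unfold E, W1. rewrite W_conj, Cmult_conj, Cminus_conj, Cconj_RtoC. reflexivity. }
  clear z Kz. intros z Kz Hi. destruct (KE_sol X Y z HX0' Kz) as (Hs & E0 & _).
  set (phi := Phi (X + 1) z) in *. destruct (proj1 Kz) as [K1 K2]. assert (K3 := proj1 K2).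
  assert (Hz0 : z <> 0%C) by (apply not_zero, K3). assert (Hzp : 0 < Cmod z) by lra.
  destruct e_al as [Hal _]. assert (Hpi := PI_RGT_0).
  assert (Hedge : Cmod z = r \/ side al z = 0 -> off_ray (1 - phi w / z)%C ->
   E z <> 0%C /\ off_ray ((phi w - z) / E z)%C).
  { intros He Ho. destruct (W1_edge z K2 Hi He) as [W2 W3].
   set (y := w1 a - Re (W1 z)). assert (Hy : 0 < y) by (unfold y; lra).
   assert (EW : (W1 z - RtoC (w1 a))%C = (- y)%C).
   { apply C_eq; [change (Re (W1 z) - w1 a = - y); unfold y; ring | change (Im (W1 z) - 0 = - 0); lra]. }
   assert (Hy0 : RtoC y <> 0%C) by (intros Q; apply RtoC_inj in Q; lra). unfold E. rewrite EW. split.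
   - apply Cmult_neq_0; [pos |]. intros Q. apply Hy0. replace (RtoC y) with (- - RtoC y)%C by ring. rewrite Q. ring.
   - replace ((phi w - z) / (z * - y))%C with ((1 - phi w / z) / y)%C.
    + apply off_ray_scale; assumption.
    + field. split; assumption. }
  destruct (Req_dec (Cmod z) r) as [Er | Er].
  { right. apply Hedge; [lra |]. left. apply Re_one_minus. rewrite Er.
   apply (circ_in_inv n A w HA r w phi 0 w Hr Hin Hs); try lra. rewrite E0. lra. }
  destruct (KE_cases X Y z HX0' Kz) as [In | [Ec | [Ec | [Ec | [Ec | (t & Ht & Ec)]]]]].
  + left. exact In.
  + lra.
  + right. assert (HR0 : Rg (phi 0)) by (rewrite E0; exact K2).
   destruct (Hturn phi Y 0 Hs HR0 ltac:(rewrite E0; exact Hi) ltac:(lra) ltac:(lra) ltac:(rewrite E0; lra)) as [[D1 D2] | (D & _)]; [| lra].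
   apply Hfar; try assumption; [exact (proj2 K2) | lra | lra |].
   destruct D1 as [[[D3 D4] D5] | [_ D3]]; [| lra]. assert (HR := Re_T _ D4). nra.
  + exfalso. apply (side_lo_zero (- al) al z T_width (proj2 K2)) in Ec.
   rewrite Ec, Im_polar, sin_neg in Hi. assert (0 < sin al) by (apply sin_gt_0; lra). nra.
  + right. apply Hedge; [lra |].
   destruct (Hst w phi Hs ltac:(lra) ltac:(rewrite E0; exact K2)) as (b & Hb & Hreg & [-> | (Hlt & _ & Hd')]).
   * apply (off_ray_side al); [lra | apply (side_hi_zero (- al) al z T_width (proj2 K2) Ec) |].
    assert (S := region_strict w phi Hs ltac:(lra) ltac:(rewrite E0; exact (proj2 K2))
     (fun t Ht => proj1 (Hreg t Ht)) w ltac:(lra)). lra.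
   * left. apply Re_one_minus. generalize (Hd' w ltac:(lra)). lra.
  + right. rewrite <- E0 at 2 3. rewrite <- E0 at 1. apply (Hbd phi t); try assumption; try (rewrite E0; assumption).
   fold phi in Ec. fold phi in Ec. lra.
Qed.

(** Dividing the comparison function by z - a leaves z [DW1 z a], without zeros, so a is simple and
    alone in every truncated set. *)
Lemma sector_count_end_attracting : counted Rg 1.
Proof.
 destruct end_in_zero as (a & M & Ha & HM & Hseg & Efa).
 destruct (end_in_boundary a (M + 1) Ha ltac:(lra)) as (Y1 & HY1).
 { intros x t Hx Ht. replace (M + 1 - 1) with M by ring. apply Hseg; assumption. }
 destruct (Rg_real a ltac:(lra)) as (Ra & Ra1 & Ra2). assert (Ca : Cmod a = a) by (rewrite Cmod_R, Rabs_pos_eq; lra).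
 assert (Hsa : forall t, 0 <= t <= w -> Cmod (Phi (M + 1) a t) <= M) by (intros t Ht; apply Hseg; lra).
 assert (Core : forall c, Fl c c -> Rg c -> c = a /\ zm a 1).
 { intros c (phi & Hs & I0 & I1) Hc. destruct (sol_bounded n A w Hw phi Hs) as (Mc & HMc & Hbc).
  (* The truncation is chosen after the second periodic start c, large enough to contain the orbits
     of both a and c. *)
  set (Y := Rmax Y1 (Rmax a (Cmod c))). destruct (Rmax_bounds Y1 (Rmax a (Cmod c))) as [L1 L2].
  destruct (Rmax_bounds a (Cmod c)) as [L3 L4]. fold Y in L1, L2. destruct (HY1 Y L1) as (X1 & HX1).
  set (X := Rmax X1 (Rmax M Mc)). destruct (Rmax_bounds X1 (Rmax M Mc)) as [N1 N2].
  destruct (Rmax_bounds M Mc) as [N3 N4]. fold X in N1, N2. assert (HX : 0 <= X) by lra. assert (Hbd := HX1 X N1 HX).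
  assert (Sa : sol w (Phi (M + 1) a)).
  { apply Phi_sol; try assumption; try lra. intros t Ht. generalize (Hsa t Ht). lra. }
  assert (Ia : Phi (M + 1) a 0 = a) by (apply Phi_0; try assumption; lra).
  destruct (KE_intro X Y (Phi (M + 1) a) HX Sa) as [Ka Eqa]; try (rewrite Ia; assumption || lra).
  { intros t Ht. generalize (Hsa t Ht). lra. }
  rewrite Ia in Ka, Eqa. destruct (KE_intro X Y phi HX Hs) as [Kc Eqc]; try (rewrite I0; assumption || lra).
  { intros t Ht. generalize (Hbc t Ht). lra. }
  rewrite I0 in Kc, Eqc. assert (Hz0 : forall z, KE X Y z -> z <> 0%C) by (intros z Kz; apply not_zero, Kz).
  destruct (simple_zero n A w (X + 1) (KE X Y) a (fun _ => 1%C)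
   (fun z => z * DW1 z a)%C) as [Z1 Z2]; try assumption.
  - lra.
  - apply KE_compact; assumption.
  - intros z t Kz Ht. generalize (proj2 Kz t Ht). lra.
  - rewrite <- Eqa by lra. exact Efa.
  - intros z Kz. split; [apply hol_const |].
   apply hol_mult; [apply hol_id |]. apply (hol_DW 1 (r ^ m * r ^ m) m (fun z => z) (fun _ => a));
    [apply hol_id | apply hol_const | apply Hz0, Kz | apply Hz0, Ka].
  - intros z Kz. apply Cmult_neq_0; [apply Hz0, Kz |]. apply (DW1_neq_0 a z Ra (proj2 (proj1 Kz)) ltac:(lra) Ra1 Ra2).
  - intros z Kz. destruct (Hbd z Kz) as [In | [B1 B2]]; [right; exact In | left].
   assert (S := DW_spec 1 (r ^ m * r ^ m) m z a (Hz0 z Kz) (Hz0 _ Ka)).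
   fold (W1 z) in S. fold (W1 a) in S. rewrite (W1_real a) in S by lra.
   rewrite S in B1, B2. split; [intros ->; apply B1; ring |]. rewrite Cmult_1_r. replace ((z - a) * (z * DW1 z a))%C
    with (z * ((z - a) * DW1 z a))%C by ring. exact B2.
  - split; [| pos]. apply Z2; [pos |]. rewrite <- Eqc by lra. exact I1. }
 assert (Fla : Fl a a).
 { rewrite <- Efa at 2. apply Fl_Phi; try assumption; try lra. intros t Ht. generalize (Hsa t Ht). lra. }
 apply (counted_single n A w _ a 1); [lia | pos | apply (Core a); assumption |].
 intros c Hc HF. apply (Core c); assumption.
Qed.

End Attracting.

(** * Right sector, repelling disc *)

Section Repelling.
Variables r2 mu : R.
Hypothesis Hout : circ_out n A w r.
Hypothesis Hr2 : r < r2.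
Hypothesis Hout2 : circ_out n A w r2.
Hypothesis Hmu : 0 < mu < al.
Hypothesis Hray2 : ray_in n A w r (- (al - mu)) (al - mu).

Lemma end_strict tau phi : sol tau phi -> 0 <= tau <= w -> Rg (phi 0) -> forall t, 0 <= t <= tau ->
 Rg (phi t) /\ (0 < t -> r < Cmod (phi t) /\ 0 < side (- al) (phi t) /\ side al (phi t) < 0).
Proof.
 intros Hs Htau [H1 H2] t Ht.
 assert (B := circ_out_inv n A w HA r tau phi 0 tau Hr Hout Hs ltac:(lra) ltac:(lra) ltac:(lra) H1).
 destruct (region_strict tau phi Hs Htau H2 (fun u Hu => proj1 (B u Hu)) t Ht) as [R1 R2].
 split; [pos |]. intros H0. split; [apply (B t Ht), H0 | lra].
Qed.

Lemma W1_upper (z : C) : Rg z -> 0 <= Im z ->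
 0 <= Im (W1 z) /\ (r < Cmod z -> 0 < Im z -> side al z < 0 -> 0 < Im (W1 z)).
Proof.
 intros [H1 H2] Hi. assert (S0 : side 0 z = Im z) by (unfold side; rewrite sin_0, cos_0; ring).
 split; [apply (Im_W_boundary m r 0 1 Hm Hr (Rmult_1_l 1) el_mult_0 z H1) | intros H3 H4 H5; apply (Im_W_strict m r 0 1)];
  try assumption; try ring; try exact el_mult_0; fold al; rewrite ?Rplus_0_l; try lra.
 split; [lra | apply H2].
Qed.

(** Im W1 vanishes on the circle of radius r and on the sides, so being off the real axis is not
    enough. Modulus at least [r2] and angle at most al - mu keep the end point uniformly inside, and
    then Im W1 is comparable to |W1|. *)
Lemma turned_W1 l k : 0 < l -> exists kap, 0 < kap /\ forall f, turned l k f ->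
 r2 <= Cmod f /\ side (al - mu) f <= 0 -> kap * (1 + Cmod (W1 f)) <= Im (W1 f).
Proof.
 intros Hl. destruct e_al as [Ha Em]. assert (Hm3 := INRm m Hm).
 assert (Hat : 0 < atan l) by (rewrite <- atan_0; apply atan_increasing, Hl).
 set (x0 := Rmin (INR m * atan l) (PI / 2)). set (x1 := Rmin (INR m * mu) (PI / 2)).
 destruct (Rmin_bounds (INR m * atan l) (PI / 2)) as [A1 A2]. fold x0 in A1, A2.
 destruct (Rmin_bounds (INR m * mu) (PI / 2)) as [B1 B2]. fold x1 in B1, B2.
 assert (Hx0 : 0 < x0) by (apply Rmin_pos; [pos |]; lra). assert (Hx1 : 0 < x1) by (apply Rmin_pos; [pos |]; lra).
 set (s0 := Rmin (sin x0) (sin x1)). assert (Hs0 : 0 < s0) by (apply Rmin_pos; apply sin_gt_0; lra).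
 assert (Pv : 0 < r ^ m) by pos.
 assert (Pu : r ^ m < r2 ^ m) by (apply Rnot_le_lt; intros Hle; apply (pow_le_reg1 r2 r m) in Hle; lra || lia).
 (* [k1] is the ratio of u - v^2 / u to u + v^2 / u at u = u2, the smallest value that occurs; it
    increases with u. *)
 set (v := r ^ m) in *. set (u2 := r2 ^ m) in *. set (k1 := (u2 * u2 - v * v) / (u2 * u2 + v * v)).
 assert (Hk1 : 0 < k1) by (apply Rdiv_lt_0_compat; nra).
 assert (Ek1 : k1 * (u2 * u2 + v * v) = u2 * u2 - v * v) by (unfold k1; field; nra). assert (Hk1' : k1 < 1) by nra.
 set (kap := k1 * s0 * (u2 / (1 + u2))). assert (Hu2 : 0 < u2 / (1 + u2)) by pos.
 exists kap. split; [apply Rmult_lt_0_compat; [pos |]; assumption |].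
 intros f Hf [F1 F2]. destruct Hf as [[[F3 F4] F5] | [F3 _]]; [| lra].
 destruct (cone_angle f l (not_zero f F3) F4 Hl F5) as (th & Hth & E).
 assert (Hf0 : 0 < Cmod f) by lra. assert (P := pow_lt _ m Hf0). assert (Hth2 : th <= al - mu).
 { apply Rnot_lt_le. intros Hlt. rewrite E, side_polar in F2.
  assert (0 < sin (th - (al - mu))) by (apply sin_gt_0; lra). nra. }
 destruct (W1_polar (Cmod f) th Hf0) as [E1 E2]. rewrite <- E in E1, E2. assert (Hs : s0 <= sin (INR m * th)).
 { apply sin_between; try lra. split; [nra |]. apply Rle_trans with (INR m * (al - mu)); [nra |]. lra. }
 assert (Hu : u2 <= Cmod f ^ m) by (apply pow_incr; lra).
 fold v in E2. unfold w1 in E1. fold v in E1. set (u := Cmod f ^ m) in *.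
 set (S := u + v * v * / u) in *. set (D := u - v * v * / u) in *. assert (Hiu : 0 < / u) by pos.
 assert (HSu : u <= S) by (unfold S; assert (0 <= v * v * / u) by pos; lra). assert (HSD : k1 * S <= D).
 { apply Rmult_le_reg_r with u; [exact P |].
  replace (k1 * S * u) with (k1 * (u * u + v * v)) by (unfold S; field; lra).
  replace (D * u) with (u * u - v * v) by (unfold D; field; lra). assert (u2 * u2 <= u * u) by nra. nra. }
 assert (HW : Cmod (W1 f) <= S).
 { apply Rsqr_incr_0_var; [| lra]. unfold Rsqr. rewrite Cmod2_Re_Im, E1, E2.
  assert (HD : D <= S) by (unfold D, S; assert (0 <= v * v * / u) by pos; lra).
  assert (0 <= D) by nra. assert (D * D <= S * S) by nra. assert (T1 := sin2_cos2 (INR m * th)). unfold Rsqr in T1.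
  assert (T2 : 0 <= sin (INR m * th) * sin (INR m * th)) by apply Rle_0_sqr.
  replace (S * S) with (S * S * (sin (INR m * th) * sin (INR m * th) + cos (INR m * th) * cos (INR m * th))) by (rewrite T1; ring).
  nra. }
 assert (H1S : u2 / (1 + u2) * (1 + S) <= S).
 { apply Rmult_le_reg_r with (1 + u2); [lra |].
  replace (u2 / (1 + u2) * (1 + S) * (1 + u2)) with (u2 * (1 + S)) by (field; lra). nra. }
 apply Rle_trans with (k1 * s0 * S).
 - unfold kap. rewrite Rmult_assoc. apply Rmult_le_compat_l; [pos |].
  eapply Rle_trans; [| exact H1S]. apply Rmult_le_compat_l; lra.
 - rewrite E2. replace (k1 * s0 * S) with (k1 * S * s0) by ring.
  apply Rmult_le_compat; try lra. apply Rmult_le_pos; lra.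
Qed.

(** Below [thstar] the angle m th stays below pi / 2 by a fixed amount, so Re W1 grows with the
    modulus. *)
Lemma flat_W1 B : exists X2, forall f, Rg f -> 0 <= Im f < taustar * Re f -> X2 <= Cmod f -> B < Re (W1 f).
Proof.
 destruct e_al as [Ha Em]. assert (Hm3 := INRm m Hm).
 destruct thstar_bounds as (S1 & S2 & S3 & S4). rewrite S_INR in S3.
 assert (Hc0 : 0 < cos (INR m * thstar)) by (apply cos_gt_0; nra). set (c0 := cos (INR m * thstar)) in *.
 exists ((Rabs B + 1) / c0 + 1). intros f [F1 F2] [F3 F4] HX.
 assert (HB : 0 < (Rabs B + 1) / c0) by (apply Rdiv_lt_0_compat; generalize (Rabs_pos B); lra).
 destruct (T_upper_polar f (not_zero f F1) F2 F3) as (th & Hth & E). assert (Hf0 : 0 < Cmod f) by lra.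
 assert (Hth2 : th <= thstar).
 { apply Rnot_lt_le. intros Hlt. rewrite E, Re_polar, Im_polar in F4.
  assert (Hcos := cos_half th ltac:(fold al; lra)).
  assert (tan thstar < tan th) by (apply tan_increasing; lra). fold taustar in H.
  assert (Et : sin th = tan th * cos th) by (unfold tan; field; lra). rewrite Et in F4.
  assert (0 < Cmod f * cos th) by pos. nra. }
 destruct (W1_polar (Cmod f) th Hf0) as [E1 _]. rewrite <- E in E1. rewrite E1.
 assert (Hc : c0 <= cos (INR m * th)) by (apply cos_decr_1; nra). assert (Hwf := w1_ge (Cmod f) Hf0).
 assert (Cmod f <= Cmod f ^ m) by (apply pow_ge_self; [lia | lra]). assert (K : Rabs B + 1 <= Cmod f * c0).
 { apply Rle_trans with ((Rabs B + 1) / c0 * c0); [right; field; lra | nra]. }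
 assert (Cmod f * c0 <= w1 (Cmod f) * cos (INR m * th)) by nra. generalize (Rle_abs B). lra.
Qed.

Lemma W1_large (Y0 : R) : exists Y1, forall z, Y1 <= Cmod z -> r <= Cmod z -> Y0 <= Cmod (W1 z).
Proof.
 exists (Rabs Y0 + r ^ m + 1). intros z H1 H2.
 assert (B := Cmod_W_lower m r 0 1 Hr ltac:(lra) el_mult_0 z H2). fold (W1 z) in B.
 assert (Pr : 0 < r ^ m) by pos. assert (R0 := Rabs_pos Y0).
 assert (Cmod z <= Cmod z ^ m) by (apply pow_ge_self; [lia | lra]). generalize (Rle_abs Y0). lra.
Qed.

Lemma W1_bounded (P : R) : exists B, 0 <= B /\ forall z, r <= Cmod z -> Cmod z <= P -> Cmod (W1 z) <= B.
Proof.
 apply (W_bounded m r 0 1 Hr ltac:(lra) el_mult_0).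
Qed.

(** A real quadratic in W1, given by the sum and the product of its roots: this covers a conjugate
    pair, two real zeros and a double zero alike. *)
Definition Qd (s1 s2 : R) (z : C) : C := (W1 z * W1 z - s1 * W1 z + s2)%C.

Definition good_at (s1 s2 X Y : R) (z : C) : Prop := inner (KE X Y) z \/
 (Qd s1 s2 z <> 0%C /\ off_ray ((W1 (Phi (X + 1) z w) - W1 z) / Qd s1 s2 z)%C).

Definition far_good (s1 s2 : R) : Prop := exists Y1, forall Y, Y1 <= Y -> exists X1, forall X, X1 <= X -> 0 <= X ->
 forall z, KE X Y z -> good_at s1 s2 X Y z.

(** The quadratic has to be positive only where the boundary makes W1 real: up to 2 r^m for the
    sides and the circle, and on the axis beyond a for starts with very large orbits. *)
Lemma end_out_boundary s1 s2 a :
 (forall y, y <= 2 * r ^ m -> 0 < y * y - s1 * y + s2) -> 0 < a ->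
 (forall x, a <= x -> 0 < w1 x * w1 x - s1 * w1 x + s2) ->
 (exists M eps, 0 < eps /\ forall phi t, sol w phi -> Rg (phi 0) -> 0 <= t <= w ->
  M <= Cmod (phi t) -> 0 <= Im (phi 0) < eps * Re (phi 0) -> a <= Re (phi 0)) ->
 far_good s1 s2.
Proof.
 intros HQ1 Ha HQ2 (M & eps & Heps & Hnear). assert (Hst := stays_out Hout). destruct e_al as [Hal Em].
 destruct (turning Hst) as (l & k & P & X0 & Hl & Hk & HP & HX0 & Hturn).
 destruct (W1_bounded P) as (P' & HP' & HbP). destruct (far_off_ray P' s1 s2 HP') as (Y0 & HY0 & Hfar).
 destruct (W1_large Y0) as (Y1 & HY1). exists (Rmax Y1 X0). intros Y HY. destruct (Rmax_bounds Y1 X0) as [YM1 YM2].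
 assert (Htan : 0 < tan (al - mu)) by (apply tan_gt_0; lra). assert (Hc : 0 < cos (al - mu)) by (apply cos_gt_0; lra).
 assert (Hs : 0 < sin (al - mu)) by (apply sin_gt_0; lra). destruct (end_boundary Hst W1 W1 (Qd s1 s2)
  (fun f => r2 <= Cmod f /\ side (al - mu) f <= 0) a) with (Y := Y) as (X1 & Hbd).
 - intros l' k' Hl' _. apply turned_W1, Hl'.
 - apply flat_W1.
 - intros x Hx. assert (Hx0 : RtoC x <> 0%C) by (intros Q; apply RtoC_inj in Q; lra).
  assert (Hh : hol W1 x) by (apply (hol_W 1 (r ^ m * r ^ m) m (fun z => z)); [apply hol_id | pos]).
  assert (EE : Qd s1 s2 x = RtoC (w1 x * w1 x - s1 * w1 x + s2)).
  { unfold Qd. rewrite W1_real by lra. rewrite RtoC_plus, RtoC_minus, !RtoC_mult. reflexivity. }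
  split; [| split; [| split; [| split]]].
  + apply hol_ccont. apply hol_plus; [apply hol_minus; apply hol_mult; (exact Hh || apply hol_const) | apply hol_const].
  + apply hol_ccont, Hh.
  + rewrite EE. reflexivity.
  + rewrite EE. apply HQ2, Hx.
  + rewrite W1_real by lra. reflexivity.
 - intros Y'. destruct (W1_bounded Y') as (B & HB & H). exists B. split; [lra |]. intros z [Hz _] Hz2. apply H; assumption.
 (* Orbits that pass modulus [r2] end beyond it, and starts of slope below tan(al - mu) stay in the
    narrower invariant sector: these are the conditions [turned_W1] asks of the end point. *)
 - exists (Rmax M r2), (Rmin eps (tan (al - mu))). destruct (Rmax_bounds M r2) as [N1 N2].
  destruct (Rmin_bounds eps (tan (al - mu))) as [N3 N4]. split; [pos |].
  intros phi t Hph H0 Ht HM [Hi1 Hi2]. assert (HR := Re_T _ (proj2 H0)). assert (H00 := proj1 H0).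
  split; [apply (Hnear phi t); try assumption; [lra | nra] |]. split.
  + apply (circ_out_inv n A w HA r2 w phi t w ltac:(lra) Hout2 Hph); lra.
  + assert (Et : tan (al - mu) * cos (al - mu) = sin (al - mu)) by (unfold tan; field; lra).
   apply (sector_inv n A w HA r (- (al - mu)) (al - mu) w phi 0 w Hr) with (t := w); try assumption; try lra.
   * intros u Hu. apply (end_strict w phi Hph ltac:(lra) H0 u Hu).
   * split; unfold side; rewrite ?cos_neg, ?sin_neg.
    -- assert (0 <= Im (phi 0) * cos (al - mu)) by pos. assert (0 <= Re (phi 0) * sin (al - mu)) by pos. lra.
    -- assert (Im (phi 0) * cos (al - mu) <= tan (al - mu) * Re (phi 0) * cos (al - mu)); [| nra].
      apply Rmult_le_compat_r; [lra |]. nra.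
 - exists X1. intros X HX HX0' z Kz. assert (W1c : forall y, W1 (Cconj y) = Cconj (W1 y)) by (intros y; apply W_conj).
  apply (boundary_symmetric W1 W1 (Qd s1 s2) X Y HX0' W1c W1c); [| | pos].
  { intros y. unfold Qd. rewrite W1c, Cplus_conj, Cminus_conj, !Cmult_conj, !Cconj_RtoC. reflexivity. }
  clear z Kz. intros z Kz Hi. destruct (KE_sol X Y z HX0' Kz) as (Hph & E0 & _).
  set (phi := Phi (X + 1) z) in *. destruct (proj1 Kz) as [K1 K2]. assert (K3 := proj1 K2).
  assert (Hzp : 0 < Cmod z) by lra. assert (HR0 : Rg (phi 0)) by (rewrite E0; exact K2).
  destruct (end_strict w phi Hph ltac:(lra) HR0 w ltac:(lra)) as [Rf Sf]. destruct (Sf Hw) as (F1 & F2 & F3).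
  assert (Ipos := proj2 (im_sign n A w phi HA ltac:(lra) Hph)). rewrite E0 in Ipos.
  assert (Wpos : 0 < Im (phi w) -> 0 < Im (W1 (phi w))).
  { intros H. apply W1_upper; try assumption. lra. }
  assert (Hedge : Cmod z = r \/ side al z = 0 ->
   Qd s1 s2 z <> 0%C /\ off_ray ((W1 (phi w) - W1 z) / Qd s1 s2 z)%C).
  { intros He. destruct (W1_edge z K2 Hi He) as [W2 W3].
   set (y := Re (W1 z)) in *. assert (EW : W1 z = y) by (apply C_eq; [reflexivity | pos]).
   assert (EQ : Qd s1 s2 z = RtoC (y * y - s1 * y + s2)).
   { unfold Qd. rewrite EW, RtoC_plus, RtoC_minus, !RtoC_mult. reflexivity. }
   assert (Hq := HQ1 y W3). rewrite EQ, EW. split; [intros Q; apply RtoC_inj in Q; lra |].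
   destruct (Rle_lt_or_eq_dec 0 (Im z) Hi) as [Hi0 | Hi0].
   - apply off_ray_Im; [| lra]. change (Im (W1 (phi w)) - 0 <> 0). assert (B := Wpos (Ipos Hi0 w ltac:(lra))). lra.
   (* A real edge point lies on the circle; its solution stays real and moves outwards, and w1
      increases strictly from 2 r^m. *)
   - apply off_ray_scale; [lra |]. left. change (0 < Re (W1 (phi w)) - y).
    assert (Ef : Im (phi w) = 0) by (apply (im_zero n A w phi HA); try lra; [pos | rewrite E0; lra]).
    assert (Efr : phi w = RtoC (Re (phi w))) by (apply C_eq; [reflexivity | pos]). assert (HRf := Re_T _ (proj2 Rf)).
    assert (HRr : r < Re (phi w)).
    { rewrite Efr, Cmod_R, Rabs_pos_eq in F1; lra. }
    rewrite Efr, W1_real by lra. change (0 < w1 (Re (phi w)) - y).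
    assert (B := w1_incr r (Re (phi w)) ltac:(lra)). rewrite w1_r in B by assumption. lra. }
  destruct (KE_cases X Y z HX0' Kz) as [In | [Ec | [Ec | [Ec | [Ec | (t & Ht & Ec)]]]]].
  + left. exact In.
  + right. apply Hedge. left. exact Ec.
  + right.
   destruct (Hturn phi Y 0 Hph HR0 ltac:(rewrite E0; exact Hi) ltac:(lra) ltac:(lra) ltac:(rewrite E0; lra)) as [[D1 D2] | (D & _)]; [| lra].
   assert (If : 0 < Im (phi w)).
   { destruct D1 as [[[D3 D4] D5] | [_ D3]]; [| lra]. assert (HR := Re_T _ D4). nra. }
   apply Hfar; [apply HbP; [lra | lra] | lra | apply W1_upper; assumption |]. apply HY1; lra.
  + exfalso. apply (side_lo_zero (- al) al z T_width (proj2 K2)) in Ec.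
   rewrite Ec, Im_polar, sin_neg in Hi. assert (0 < sin al) by (apply sin_gt_0; lra). nra.
  + right. apply Hedge. right. exact Ec.
  + right. rewrite <- E0 at 2 3. rewrite <- E0 at 1. apply (Hbd phi t); try assumption; try (rewrite E0; assumption).
   fold phi in Ec. lra.
Qed.

(** Real solutions cannot cross, since by [gronwall_curves_lower] a meeting would force equal
    starts. Those from the left of b are therefore dominated by the one from b. *)
Lemma order_bounded b M psi : sol w psi -> psi 0 = RtoC b -> 0 <= M -> (forall t, 0 <= t <= w -> Cmod (psi t) <= M) ->
 forall x t, r <= x <= b -> 0 <= t <= w -> Cmod (Phi (M + 1) (RtoC x) t) <= M.
Proof.
 intros Hs E0 HM Hb x t Hx Ht. assert (Hpsi : forall t, 0 <= t <= w -> Im (psi t) = 0 /\ r <= Re (psi t)).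
 { intros u Hu. assert (Ei : Im (psi u) = 0) by (apply (im_zero n A w psi HA); try lra; [pos | rewrite E0; reflexivity]).
  split; [lra |].
  destruct (end_strict w psi Hs ltac:(lra) ltac:(rewrite E0; apply Rg_real; assumption || lra) u Hu) as [[R1 R2] _].
  assert (HR := Re_T _ R2). assert (V := Cmod_le_Re_Im (psi u)). rewrite Ei, Rabs_R0, Rabs_pos_eq in V by lra. lra. }
 destruct (Req_dec x b) as [-> | Hne].
 { rewrite <- E0, <- (sol_Phi n A w HA Hw (M + 1) psi w); try assumption; try lra; [apply Hb, Ht |].
  intros u Hu. generalize (Hb u Hu). lra. }
 apply (Phi_apriori n A w HA Hw (M + 1) M x); try lra.
 { assert (B := Hb 0 ltac:(lra)). rewrite E0, Cmod_R, Rabs_pos_eq in B by lra. rewrite Cmod_R, Rabs_pos_eq; lra. }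
 intros tau Htau Hst _. set (phi := Phi (M + 1) x) in *.
 assert (I0 : phi 0 = x) by (apply Phi_0; try assumption; lra).
 assert (Hphi : forall t, 0 <= t <= tau -> Im (phi t) = 0 /\ r <= Re (phi t)).
 { intros u Hu. assert (Ei : Im (phi u) = 0) by (apply (im_zero n A tau phi HA); try lra; [pos | rewrite I0; reflexivity]).
  split; [lra |].
  destruct (end_strict tau phi Hst Htau ltac:(rewrite I0; apply Rg_real; assumption || lra) u Hu) as [[R1 R2] _].
  assert (HR := Re_T _ R2). assert (V := Cmod_le_Re_Im (phi u)). rewrite Ei, Rabs_R0, Rabs_pos_eq in V by lra. lra. }
 assert (Hord : Re (phi tau) <= Re (psi tau)).
 { apply Rnot_lt_le. intros Hlt. destruct (IVT_cont (fun t => Re (phi t) - Re (psi t)) 0 tau) as (c & Hc & Ec).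
  - lra.
  - intros u. exact (continuous_minus (V := R_NormedModule) _ _ u (proj1 (proj1 Hst u)) (proj1 (proj1 Hs u))).
  - rewrite I0, E0. simpl. lra.
  - assert (Ecc : phi c = psi c).
   { apply C_eq; [lra |]. destruct (Hphi c Hc) as [-> _]. destruct (Hpsi c ltac:(lra)) as [-> _]. reflexivity. }
   destruct (continuous_bounded (fun t => Cmod (phi t)) 0 c ltac:(lra)) as (t0 & _ & Hmax).
   { intros u. apply continuous_Cmod, Hst. }
   set (M' := Rmax M (Cmod (phi t0))). destruct (Rmax_bounds M (Cmod (phi t0))) as [N1 N2]. fold M' in N1, N2.
   destruct (Fdel_bound n A M' HA ltac:(lra)) as (L & HL & HB).
   assert (G := gronwall_curves_lower phi psi (fun t => Fld A n t (phi t)) (fun t => Fld A n t (psi t)) 0 c L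
    ltac:(lra) ltac:(lra) (proj1 Hst) (proj1 Hs) (fun u Hu => proj2 Hst u ltac:(lra)) (fun u Hu => proj2 Hs u ltac:(lra))).
   assert (GB : forall u, 0 < u < c -> Cmod (Fld A n u (phi u) - Fld A n u (psi u)) <= L * Cmod (phi u - psi u)).
   { intros u Hu. rewrite Fdel_spec, Cmod_mult, Rmult_comm. apply Rmult_le_compat_r; [pos | apply HB].
    - eapply Rle_trans; [apply (Hmax u); lra | lra].
    - eapply Rle_trans; [apply Hb; lra | lra]. }
   assert (G' := G GB). unfold sqdist in G'. rewrite Ecc, I0, E0 in G'.
   replace (psi c - psi c)%C with (RtoC 0) in G' by ring. rewrite Cmod_0, <- RtoC_minus, Cmod_R in G'.
   assert (Hp : 0 < Rabs (x - b)) by (apply Rabs_pos_lt; lra). assert (He := exp_pos (- (2 * L) * (c - 0))).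
   assert (0 < Rabs (x - b) * Rabs (x - b) * exp (- (2 * L) * (c - 0))) by pos. lra. }
 destruct (Hphi tau ltac:(lra)) as [Ei Hre].
 assert (V := Cmod_le_Re_Im (phi tau)). rewrite Ei, Rabs_R0, Rabs_pos_eq in V by lra.
 assert (V2 := re_le_Cmod (psi tau)). apply Rabs_le_between in V2. generalize (Hb tau Htau). lra.
Qed.

(* [a] is a zero of the displacement of order at least two. *)
Definition dbl (a : C) : Prop := exists X q, 0 <= X /\ (forall t, 0 <= t <= w -> Cmod (Phi (X + 1) a t) <= X) /\
 hol q a /\ q a = 0%C /\ forall z, (Phi (X + 1) z w - z = (z - a) * q z)%C.

Lemma good_set s1 s2 a b : far_good s1 s2 -> Rg a -> Rg b -> Fl a a -> Fl b b ->
 exists X Y, 0 <= X /\ (forall z, KE X Y z -> good_at s1 s2 X Y z) /\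
 (forall c, c = a \/ c = b -> KE X Y c /\ Phi (X + 1) c w = c).
Proof.
 intros (Y1 & HY1) Ra Rb (pa & Sa & A0 & A1) (pb & Sb & B0 & B1).
 destruct (sol_bounded n A w Hw pa Sa) as (Ma & HMa & Ha). destruct (sol_bounded n A w Hw pb Sb) as (Mb & HMb & Hb).
 set (Y := Rmax Y1 (Rmax (Cmod a) (Cmod b))). destruct (Rmax_bounds Y1 (Rmax (Cmod a) (Cmod b))) as [L1 L2].
 destruct (Rmax_bounds (Cmod a) (Cmod b)) as [L3 L4]. fold Y in L1, L2.
 destruct (HY1 Y L1) as (X1 & HX1). set (X := Rmax X1 (Rmax Ma Mb)).
 destruct (Rmax_bounds X1 (Rmax Ma Mb)) as [N1 N2]. destruct (Rmax_bounds Ma Mb) as [N3 N4]. fold X in N1, N2.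
 assert (HX : 0 <= X) by lra. exists X, Y. split; [lra | split; [apply HX1; assumption |]]. intros c [-> | ->].
 - destruct (KE_intro X Y pa HX Sa) as [K E]; try (rewrite A0; assumption || lra).
  { intros t Ht. generalize (Ha t Ht). lra. }
  rewrite A0 in K, E. split; [exact K |]. rewrite <- A1 at 2. symmetry. apply E. lra.
 - destruct (KE_intro X Y pb HX Sb) as [K E]; try (rewrite B0; assumption || lra).
  { intros t Ht. generalize (Hb t Ht). lra. }
  rewrite B0 in K, E. split; [exact K |]. rewrite <- B1 at 2. symmetry. apply E. lra.
Qed.

Lemma KE_facts X Y z : 0 <= X -> KE X Y z -> let f := fun z => Phi (X + 1) z w in
 z <> 0%C /\ f z <> 0%C /\ hol f z /\ hol W1 z /\ hol (fun z => W1 (f z)) z /\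
 hol (fun z => DW1 (f z) z) z /\ Rg (f z) /\
 r < Cmod (f z) /\ 0 < side (- al) (f z) /\ side al (f z) < 0 /\
 (W1 (f z) - W1 z = (f z - z) * DW1 (f z) z)%C /\
 DW1 (f z) z <> 0%C.
Proof.
 intros HX Kz f. destruct (KE_sol X Y z HX Kz) as (Hs & E0 & Hf).
 destruct (proj1 Kz) as [_ K2]. assert (Hz : z <> 0%C) by (apply not_zero, K2).
 destruct (end_strict w _ Hs ltac:(lra) ltac:(rewrite E0; exact K2) w ltac:(lra)) as [R1 R2].
 destruct (R2 Hw) as (R3 & R4 & R5). fold (f z) in R1, R3, R4, R5. assert (Hfz : f z <> 0%C) by (apply not_zero, R1).
 repeat (split; [assumption |]). split; [| split; [| split; [| split; [| split; [| split; [| split; [| split]]]]]]]; try assumption.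
 - apply hol_W1, K2.
 - apply (hol_W 1 (r ^ m * r ^ m) m f); assumption.
 - apply (hol_DW 1 (r ^ m * r ^ m) m f (fun z => z)); try assumption. apply hol_id.
 - apply DW_spec; assumption.
 - apply (DW1_neq_0 (f z) z R1 K2 R3 R4 R5).
Qed.

Lemma fixed_strict a : Rg a -> Fl a a -> r < Cmod a /\ 0 < side (- al) a /\ side al a < 0.
Proof.
 intros Ra (p & S & I0 & I1). rewrite <- I1. apply (end_strict w p S ltac:(lra) ltac:(rewrite I0; exact Ra) w ltac:(lra)), Hw.
Qed.

(** The value of the slope at a does not depend on the truncation. This lets [dbl], stated with its
    own X, be used in any larger truncated set. *)
Lemma slopes_agree X X' a q q' : 0 <= X -> 0 <= X' ->
 (forall t, 0 <= t <= w -> Cmod (Phi (X + 1) a t) <= X) -> (forall t, 0 <= t <= w -> Cmod (Phi (X' + 1) a t) <= X') ->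
 hol q a -> hol q' a -> (forall z, Phi (X + 1) z w - z = (z - a) * q z)%C ->
 (forall z, Phi (X' + 1) z w - z = (z - a) * q' z)%C -> q a = q' a.
Proof.
 intros HX HX' Hb Hb' Hq Hq' E E'.
 destruct (Phi_strict_near n A w HA Hw (X + 1) a ltac:(lra)) as (d & Hd & B); [intros t Ht; generalize (Hb t Ht); lra |].
 destruct (Phi_strict_near n A w HA Hw (X' + 1) a ltac:(lra)) as (d' & Hd' & B'); [intros t Ht; generalize (Hb' t Ht); lra |].
 destruct (Rmin_bounds d d') as [M1 M2].
 apply (ccont_punctured q q' a (Rmin d d')); [apply hol_ccont, Hq | apply hol_ccont, Hq' | pos |]. intros z Hz Hne.
 assert (Ef : Phi (X + 1) z w = Phi (X' + 1) z w).
 { apply (sol_unique n A w HA Hw); [| | rewrite !Phi_0 by (assumption || lra); reflexivity | lra].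
  - apply Phi_sol; try assumption; try lra. intros t Ht. left. apply B; lra.
  - apply Phi_sol; try assumption; try lra. intros t Ht. left. apply B'; lra. }
 assert (Ez := E z). rewrite Ef, E' in Ez. assert (D : ((z - a) * (q z - q' z))%C = 0%C).
 { replace ((z - a) * (q z - q' z))%C with ((z - a) * q z - (z - a) * q' z)%C by ring. rewrite Ez. ring. }
 destruct (Ceq_dec (q z) (q' z)) as [Q | Q]; [exact Q |].
 destruct (Cmult_neq_0 _ _ (Csub_neq_0 _ _ Hne) (Csub_neq_0 _ _ Q) D).
Qed.

(** Given two zeros, possibly equal, the displacement is (z - a) (z - b) q2, and comparison with (W1
    z - W1 a) (W1 z - W1 b) shows that q2 has no zero. For a = b the second factor comes from
    [dbl]. *)
Lemma pair_core a b s1 s2 : far_good s1 s2 -> Rg a -> Rg b -> Fl a a -> Fl b b ->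
 (W1 a + W1 b = s1)%C -> (W1 a * W1 b = s2)%C -> (a = b -> dbl a) ->
 counted Rg 2.
Proof.
 intros Hg Ra Rb Fa Fb Es1 Es2 Hdbl.
 destruct (fixed_strict a Ra Fa) as (Ta1 & Ta2 & Ta3). destruct (fixed_strict b Rb Fb) as (Tb1 & Tb2 & Tb3).
 assert (Core : forall X Y, 0 <= X -> (forall z, KE X Y z -> good_at s1 s2 X Y z) ->
  (forall c, c = a \/ c = b -> KE X Y c /\ Phi (X + 1) c w = c) ->
  exists q2, (forall z, Phi (X + 1) z w - z = (z - a) * ((z - b) * q2 z))%C /\
   forall z, KE X Y z -> hol q2 z /\ q2 z <> 0%C).
 { intros X Y HX Hbd Hab. destruct (Hab a (or_introl eq_refl)) as [Ka Ea]. destruct (Hab b (or_intror eq_refl)) as [Kb Eb].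
  set (f := fun z => Phi (X + 1) z w) in *.
  assert (Hf : forall z, KE X Y z -> hol f z) by (intros z Kz; apply (KE_facts X Y z HX Kz)).
  destruct (fix_slope f a (Hf _ Ka) Ea) as (q1 & E1 & H1). assert (Q1b : q1 b = 0%C).
  { destruct (Ceq_dec a b) as [Eab | Hne].
   - destruct (Hdbl Eab) as (X' & q' & HX' & Hb' & Hq' & Z' & E'). rewrite <- Eab, <- Z'.
    apply (slopes_agree X X' a q1 q' HX HX'); try assumption; [apply Ka | apply H1, Hf, Ka].
   - assert (Eq := E1 b). change (f b = b) in Eb. rewrite Eb in Eq. replace (b - b)%C with (RtoC 0) in Eq by ring. symmetry in Eq.
    destruct (Ceq_dec (q1 b) 0%C) as [Q | Q]; [exact Q |].
    destruct (Cmult_neq_0 (b - a) (q1 b) (Csub_neq_0 _ _ (not_eq_sym Hne)) Q Eq). }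
  destruct (hol_slope q1 b (H1 _ (Hf _ Kb))) as (q2 & E2 & H2).
  assert (E2' : forall z, (f z - z = (z - a) * ((z - b) * q2 z))%C) by (intros z; rewrite E1, (E2 z), Q1b; ring).
  exists q2. split; [pos |]. assert (N : forall z, KE X Y z -> q2 z <> 0%C).
  { apply (no_further_zero (KE X Y) (fun z => (z - a) * (z - b))%C q2 (fun z => DW1 (f z) z)
    (fun z => DW1 z a * DW1 z b)%C).
   - apply KE_compact; assumption.
   - intros z Kz. destruct (KE_facts X Y z HX Kz) as (Z1 & _ & _ & _ & _ & Z2 & _).
    destruct (KE_facts X Y a HX Ka) as (Z3 & _). destruct (KE_facts X Y b HX Kb) as (Z4 & _).
    split; [apply H2, H1, Hf, Kz | split; [pos |]].
    apply hol_mult; [apply (hol_DW 1 (r ^ m * r ^ m) m (fun z => z) (fun _ => a)) | apply (hol_DW 1 (r ^ m * r ^ m) m (fun z => z) (fun _ => b))];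
     try assumption; apply hol_id || apply hol_const.
   - intros z Kz. apply Cmult_neq_0.
    + apply (DW1_neq_0 a z Ra (proj2 (proj1 Kz)) Ta1 Ta2 Ta3).
    + apply (DW1_neq_0 b z Rb (proj2 (proj1 Kz)) Tb1 Tb2 Tb3).
   - intros z Kz. destruct (Hbd z Kz) as [In | [B1 B2]]; [right; exact In | left].
    destruct (KE_facts X Y z HX Kz) as (Z1 & _ & _ & _ & _ & _ & _ & _ & _ & _ & Z2 & _). fold (f z) in B2, Z2.
    destruct (KE_facts X Y a HX Ka) as (Z3 & _). destruct (KE_facts X Y b HX Kb) as (Z4 & _).
    assert (EQ : Qd s1 s2 z = ((z - a) * (z - b) * (DW1 z a * DW1 z b))%C).
    { unfold Qd. rewrite <- Es1, <- Es2.
     assert (S1 := DW_spec 1 (r ^ m * r ^ m) m z a Z1 Z3). assert (S2 := DW_spec 1 (r ^ m * r ^ m) m z b Z1 Z4).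
     fold (W1 z) in S1, S2. fold (W1 a) in S1. fold (W1 b) in S2.
     replace (W1 z * W1 z - (W1 a + W1 b) * W1 z + W1 a * W1 b)%C
      with ((W1 z - W1 a) * (W1 z - W1 b))%C by ring. rewrite S1, S2. ring. }
    rewrite EQ in B1, B2. split.
    + intros Q. apply B1. rewrite Q. ring.
    + replace ((z - a) * (z - b) * q2 z)%C with (f z - z)%C by (rewrite E2'; ring). rewrite <- Z2. exact B2. }
  intros z Kz. split; [apply H2, H1, Hf, Kz | apply N, Kz]. }
 destruct (good_set s1 s2 a b Hg Ra Rb Fa Fb) as (X & Y & HX & Hbd & Hab).
 destruct (Core X Y HX Hbd Hab) as (q2 & E2 & H2). destruct (Hab a (or_introl eq_refl)) as [Ka _]. destruct (Hab b (or_intror eq_refl)) as [Kb _].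
 (* A further periodic start c is excluded by repeating the factorisation in a truncated set that
    contains its orbit as well. *)
 assert (Only : forall c, Rg c -> Fl c c -> c = a \/ c = b).
 { intros c Rc Fc. destruct (Ceq_dec c a) as [E | Na]; [left; exact E |]. destruct (Ceq_dec c b) as [E | Nb]; [right; exact E |].
  exfalso. destruct Hg as (Y1 & HY1).
  destruct (Fa) as (pa & Sa & A0 & A1). destruct Fb as (pb & Sb & B0 & B1). destruct Fc as (pc & Sc & C0 & C1).
  destruct (sol_bounded n A w Hw pa Sa) as (Ma & HMa & Ha). destruct (sol_bounded n A w Hw pb Sb) as (Mb & HMb & Hb).
  destruct (sol_bounded n A w Hw pc Sc) as (Mc & HMc & Hc).
  set (Y' := Rabs Y1 + Cmod a + Cmod b + Cmod c). assert (G3 := Cmod_ge_0 c).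
  assert (G4 := Rabs_pos Y1). assert (G5 := Rle_abs Y1).
  destruct (HY1 Y' ltac:(unfold Y'; lra)) as (X1 & HX1). set (X' := Rabs X1 + Ma + Mb + Mc).
  assert (G6 := Rabs_pos X1). assert (G7 := Rle_abs X1). assert (HX' : 0 <= X') by (unfold X'; lra).
  assert (KK : forall p d M, sol w p -> p 0 = d -> p w = d -> Rg d -> Cmod d <= Y' -> M <= X' ->
   (forall t, 0 <= t <= w -> Cmod (p t) <= M) -> KE X' Y' d /\ Phi (X' + 1) d w = d).
  { intros p d M Sp P0 P1 Rd Hd HM Hp. destruct (KE_intro X' Y' p HX' Sp) as [K E]; try (rewrite P0; assumption).
   { intros t Ht. generalize (Hp t Ht). lra. }
   rewrite P0 in K, E. split; [exact K |]. rewrite <- P1 at 2. symmetry. apply E. lra. }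
  destruct (Core X' Y' HX' (HX1 X' ltac:(unfold X'; lra) HX')) as (q3 & E3 & H3).
  { intros d [-> | ->]; [apply (KK pa a Ma) | apply (KK pb b Mb)]; try assumption; unfold X', Y'; lra. }
  destruct (KK pc c Mc) as [Kc Ec]; try assumption; try (unfold X', Y'; lra).
  assert (Z := E3 c). rewrite Ec in Z. replace (c - c)%C with (RtoC 0) in Z by ring. symmetry in Z.
  revert Z. apply Cmult_neq_0; [apply Csub_neq_0, Na |]. apply Cmult_neq_0; [apply Csub_neq_0, Nb | apply H3, Kc]. }
 assert (Hza : forall t, 0 <= t <= w -> Cmod (Phi (X + 1) a t) < X + 1) by (intros t Ht; generalize (proj2 Ka t Ht); lra).
 assert (Hzb : forall t, 0 <= t <= w -> Cmod (Phi (X + 1) b t) < X + 1) by (intros t Ht; generalize (proj2 Kb t Ht); lra).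
 destruct (Ceq_dec a b) as [Eab | Hne].
 - subst b. apply (counted_single n A w _ a 2); [lia | pos | |].
  + apply (zm_intro n A w HA Hw (X + 1) a 2 q2 1); [lra | pos | apply H2, Ka | apply H2, Ka | lra |].
   intros z _. rewrite E2. simpl. ring.
  + intros c Rc Fc. destruct (Only c Rc Fc); assumption.
 - assert (C1 : counted (fun z => z = a) 1).
  { apply (counted_single n A w _ a 1); [lia | reflexivity | | intros c E _; exact E].
   apply (zm_intro n A w HA Hw (X + 1) a 1 (fun z => (z - b) * q2 z)%C 1); [lra | pos | | | lra |].
   - apply hol_mult; [apply hol_minus; [apply hol_id | apply hol_const] | apply H2, Ka].
   - apply Cmult_neq_0; [apply Csub_neq_0, Hne | apply H2, Ka].
   - intros z _. rewrite E2. simpl. ring. }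
  assert (C2 : counted (fun z => z = b) 1).
  { apply (counted_single n A w _ b 1); [lia | reflexivity | | intros c E _; exact E].
   apply (zm_intro n A w HA Hw (X + 1) b 1 (fun z => (z - a) * q2 z)%C 1); [lra | pos | | | lra |].
   - apply hol_mult; [apply hol_minus; [apply hol_id | apply hol_const] | apply H2, Kb].
   - apply Cmult_neq_0; [apply Csub_neq_0, not_eq_sym, Hne | apply H2, Kb].
   - intros z _. rewrite E2. simpl. ring. }
  apply (counted_ext n A w (fun z => z = a \/ z = b)).
  + intros c Fc. split; [intros [-> | ->]; assumption | intros Rc; apply Only; assumption].
  + apply (counted_union n A w (fun z => z = a) (fun z => z = b) 1 1 C1 C2). intros c -> E. contradiction.
Qed.

Lemma conj_pair_good (A0 : C) : 0 < Im A0 -> far_good (2 * Re A0) (Re A0 * Re A0 + Im A0 * Im A0).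
Proof.
 intros HA0. assert (Hq : forall y, 0 < y * y - 2 * Re A0 * y + (Re A0 * Re A0 + Im A0 * Im A0)).
 { intros y. assert (0 <= (y - Re A0) * (y - Re A0)) by apply Rle_0_sqr. nra. }
 (* The threshold r / 2 holds for every start in the sector, as Re z >= |z| / 2; a conjugate pair
    gives a quadratic positive on the whole real line. *)
 apply (end_out_boundary _ _ (r / 2)); [intros y _; apply Hq | lra | intros x _; apply Hq |].
 exists 0, 1. split; [lra |]. intros phi t _ [H1 H2] _ _ _. assert (HR := Re_T _ H2). lra.
Qed.

(** Between a and b the quadratic is negative, so one must know that starts with very large orbits
    lie beyond b. The solution from b is bounded and dominates the real ones to its left, and
    [near_segment] applies. *)
Lemma real_pair_good a b : Rg (RtoC a) -> Rg (RtoC b) -> r < a <= b -> Fl (RtoC b) (RtoC b) ->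
 far_good (w1 a + w1 b) (w1 a * w1 b).
Proof.
 intros Ra Rb Hab (p & S & I0 & _). destruct (sol_bounded n A w Hw p S) as (M & HM & Hb).
 destruct (near_segment b (M + 1) ltac:(lra) ltac:(lra)) as (d & eps & Hd & Heps & Hnear).
 { intros x t Hx Ht. replace (M + 1 - 1) with M by ring. apply (order_bounded b M p); assumption. }
 assert (Wa := w1_incr r a ltac:(lra)). rewrite w1_r in Wa by assumption. assert (Wab : w1 a <= w1 b).
 { destruct (proj2 Hab) as [H | ->]; [left; apply w1_incr; assumption || lra | lra]. }
 apply (end_out_boundary _ _ (b + d)); [| lra | |].
 - intros y Hy. replace (y * y - (w1 a + w1 b) * y + w1 a * w1 b) with ((w1 a - y) * (w1 b - y)) by ring.
  apply Rmult_lt_0_compat; lra.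
 - intros x Hx. replace (w1 x * w1 x - (w1 a + w1 b) * w1 x + w1 a * w1 b)
   with ((w1 x - w1 a) * (w1 x - w1 b)) by ring.
  assert (Wx := w1_incr b x ltac:(lra)). apply Rmult_lt_0_compat; lra.
 - exists (M + 1), eps. split; [lra |]. intros phi t. apply Hnear.
Qed.

Lemma fixed_of_W X Y z : 0 <= X -> KE X Y z ->
 (W1 (Phi (X + 1) z w) - W1 z)%C = 0%C -> Phi (X + 1) z w = z /\ Fl z z.
Proof.
 intros HX Kz E. destruct (KE_facts X Y z HX Kz) as (_ & _ & _ & _ & _ & _ & _ & _ & _ & _ & Z & D). rewrite Z in E.
 assert (Ef : Phi (X + 1) z w = z).
 { destruct (Ceq_dec (Phi (X + 1) z w) z) as [Q | Q]; [exact Q |].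
  destruct (Cmult_neq_0 _ _ (Csub_neq_0 _ _ Q) D E). }
 split; [pos |]. rewrite <- Ef at 2. apply Fl_Phi; try assumption; try lra.
 intros t Ht. generalize (proj2 Kz t Ht). lra.
Qed.

Lemma hol_Qd s1 s2 z : hol W1 z -> hol (Qd s1 s2) z.
Proof. intros H. apply hol_plus; [apply hol_minus; apply hol_mult; (exact H || apply hol_const) | apply hol_const]. Qed.

Lemma nonreal_bounded z : Rg z -> 0 < Im z -> exists M, forall X t, M <= X -> 0 <= X -> 0 <= t <= w ->
 Cmod (Phi (X + 1) z t) <= X.
Proof.
 intros Rz Hi. assert (Htau := taustar_pos). assert (HR := Re_T z (proj2 Rz)). assert (Hz := proj1 Rz).
 assert (HRz : 0 < Re z) by lra. set (lam := Rmin taustar (Im z / Re z)).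
 destruct (Rmin_bounds taustar (Im z / Re z)) as [L1 L2]. fold lam in L1, L2.
 assert (Hlam : 0 < lam) by (apply Rmin_pos; [lra | pos]).
 destruct (cone_bound lam ltac:(lra)) as (X0 & Q & HX0 & HQ & Hb).
 exists (Q * Rmax (Cmod z) X0 + Cmod z). intros X t HX HX' Ht.
 assert (HQ0 : 0 <= Q * Rmax (Cmod z) X0) by (apply Rmult_le_pos; [lra | generalize (Rmax_r (Cmod z) X0); lra]).
 apply (Phi_apriori n A w HA Hw (X + 1) X z); try lra. intros tau Htau' Hs _.
 assert (E0 : Phi (X + 1) z 0 = z) by (apply Phi_0; try assumption; lra).
 destruct (Hb tau (Phi (X + 1) z) 0 tau Hs) as [B _]; try lra.
 - intros u Hu. apply (end_strict tau _ Hs Htau'); [rewrite E0; exact Rz | lra].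
 - rewrite E0. apply Rle_trans with (Im z / Re z * Re z); [nra | right; field; lra].
 - rewrite E0 in B. generalize (Cmod_ge_0 z). lra.
Qed.

(** The quadratic with root W1 a0 for a nonreal a0 is positive on all real values, so it can be used
    before any periodic start is known. The zero obtained may be real or not. *)
Lemma end_out_zero : exists a, Rg a /\ Fl a a.
Proof.
 destruct e_al as [Ha Em].
 set (a0 := polar (2 * r) (al / 2)). assert (Ca : Cmod a0 = 2 * r) by (apply Cmod_polar; lra).
 assert (Ra : Rg a0) by (split; [lra | apply polar_in_sector; [lra | lra | lra]]).
 assert (Ia : 0 < Im a0) by (unfold a0; rewrite Im_polar; apply Rmult_lt_0_compat; [lra | apply sin_gt_0; lra]).
 assert (Sa : side al a0 < 0).
 { unfold a0. rewrite side_polar. replace (al / 2 - al) with (- (al / 2)) by field. rewrite sin_neg.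
  assert (0 < sin (al / 2)) by (apply sin_gt_0; lra). nra. }
 assert (HW := proj2 (W1_upper a0 Ra ltac:(lra)) ltac:(lra) Ia Sa).
 destruct (conj_pair_good (W1 a0) HW) as (Y1 & HY1).
 set (s1 := 2 * Re (W1 a0)) in *. set (s2 := Re (W1 a0) * Re (W1 a0) + Im (W1 a0) * Im (W1 a0)) in *.
 assert (Q0 : Qd s1 s2 a0 = 0%C).
 { unfold Qd, s1, s2. apply C_eq; unfold Re, Im; simpl; ring. }
 destruct (nonreal_bounded a0 Ra Ia) as (M & HM).
 set (Y := Rmax Y1 (2 * r)). destruct (Rmax_bounds Y1 (2 * r)) as [L1 L2]. fold Y in L1, L2.
 destruct (HY1 Y L1) as (X1 & HX1). set (X := Rmax (Rmax X1 M) 0).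
 destruct (Rmax_bounds (Rmax X1 M) 0) as [N1 HX]. destruct (Rmax_bounds X1 M) as [N2 N3].
 fold X in N1, HX. assert (Hbd := HX1 X ltac:(lra) HX).
 destruct (zero_exists (KE X Y) (fun z => W1 (Phi (X + 1) z w) - W1 z)%C (Qd s1 s2) a0) as (a & Ka & Ea).
 - apply KE_compact; assumption.
 - intros z Kz. destruct (KE_facts X Y z HX Kz) as (_ & _ & _ & Z1 & Z2 & _).
  split; [apply hol_minus; assumption | apply hol_Qd, Z1].
 - split; [split; [lra | pos] |]. intros t Ht. apply HM; try assumption. lra.
 - pos.
 - intros z Kz. destruct (Hbd z Kz) as [In | [B1 B2]]; [right; exact In | left]. apply off_ray_swap; assumption.
 - exists a. split; [apply Ka |]. apply (fixed_of_W X Y a HX Ka Ea).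
Qed.

(** The factor z - a is cancelled both in the displacement and in (W1 z - w1 a)^2. The reduced
    comparison function still vanishes at a, so the reduced displacement has a zero b; if b = a, the
    zero a is at least double. *)
Lemma second_zero a : Rg (RtoC a) -> Fl (RtoC a) (RtoC a) ->
 exists b, Rg b /\ Fl b b /\ (b = RtoC a -> dbl (RtoC a)).
Proof.
 intros Ra Fa. destruct (fixed_strict (RtoC a) Ra Fa) as (Ta1 & Ta2 & Ta3). assert (HRa : r < a).
 { assert (V := Re_T _ (proj2 Ra)). simpl in V. rewrite Cmod_R, Rabs_pos_eq in Ta1; [lra |]. generalize (Cmod_ge_0 a). simpl in *. lra. }
 destruct (good_set _ _ a a (real_pair_good a a Ra Ra ltac:(lra) Fa) Ra Ra Fa Fa) as (X & Y & HX & Hbd & Hab).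
 destruct (Hab _ (or_introl eq_refl)) as [Ka Ea]. set (f := fun z => Phi (X + 1) z w) in *.
 assert (Hf : forall z, KE X Y z -> hol f z) by (intros z Kz; apply (KE_facts X Y z HX Kz)).
 destruct (fix_slope f a (Hf _ Ka) Ea) as (q1 & E1 & H1). assert (Za : RtoC a <> 0%C) by (apply not_zero, Ra).
 destruct (zero_exists (KE X Y) (fun z => q1 z * DW1 (f z) z)%C
  (fun z => (z - a) * (DW1 z a * DW1 z a))%C a) as (b & Kb & Eb).
 - apply KE_compact; assumption.
 - intros z Kz. destruct (KE_facts X Y z HX Kz) as (Z1 & _ & _ & _ & _ & Z2 & _).
  split; [apply hol_mult; [apply H1, Hf, Kz | pos] |].
  apply hol_mult; [apply hol_minus; [apply hol_id | apply hol_const] |].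
  apply hol_mult; apply (hol_DW 1 (r ^ m * r ^ m) m (fun z => z) (fun _ => a)); try assumption; apply hol_id || apply hol_const.
 - pos.
 - ring.
 - intros z Kz. destruct (Hbd z Kz) as [In | [B1 B2]]; [right; exact In | left].
  destruct (KE_facts X Y z HX Kz) as (Z1 & _ & _ & _ & _ & _ & _ & _ & _ & _ & Z2 & _). fold (f z) in B2, Z2.
  assert (S := DW_spec 1 (r ^ m * r ^ m) m z a Z1 Za). fold (W1 z) in S. fold (W1 a) in S.
  rewrite W1_real in S by lra. assert (EQ : Qd (w1 a + w1 a) (w1 a * w1 a) z = ((z - a) *
   ((z - a) * (DW1 z a * DW1 z a)))%C).
  { unfold Qd. rewrite RtoC_plus, RtoC_mult.
   replace (W1 z * W1 z - (RtoC (w1 a) + RtoC (w1 a)) * W1 z + RtoC (w1 a) * RtoC (w1 a))%C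
    with ((W1 z - RtoC (w1 a)) * (W1 z - RtoC (w1 a)))%C by ring. rewrite S. ring. }
  set (D := (DW1 z a * DW1 z a)%C) in *. rewrite EQ in B1, B2. rewrite Z2 in B2. rewrite E1 in B2.
  assert (N1 : (z - a)%C <> 0%C) by (intros Q; apply B1; rewrite Q; ring).
  assert (N2 : ((z - a) * D)%C <> 0%C) by (intros Q; apply B1; rewrite Q; ring). apply off_ray_swap; [pos |].
  replace (q1 z * DW1 (f z) z / ((z - a) * D))%C
   with ((z - a) * q1 z * DW1 (f z) z / ((z - a) * ((z - a) * D)))%C; [pos |].
  assert (N3 : D <> 0%C) by (intros Q; apply N2; rewrite Q; ring). field. split; assumption.
 - assert (Q1b : q1 b = 0%C).
  { destruct (Ceq_dec (q1 b) 0%C) as [Q | Q]; [exact Q |].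
   destruct (KE_facts X Y b HX Kb) as (_ & _ & _ & _ & _ & _ & _ & _ & _ & _ & _ & D). destruct (Cmult_neq_0 _ _ Q D Eb). }
  exists b. split; [apply Kb | split].
  + assert (Efb : f b = b) by (replace (f b) with (f b - b + b)%C by ring; rewrite E1, Q1b; ring).
   rewrite <- Efb at 2. apply Fl_Phi; try assumption; try lra. intros t Ht. generalize (proj2 Kb t Ht). lra.
  + intros ->. exists X, q1. split; [lra | split; [apply Ka | split; [apply H1, Hf, Ka | split; [pos | pos]]]].
Qed.

Lemma Fl_conj a : Fl a a -> Fl (Cconj a) (Cconj a).
Proof.
 intros (p & S & I0 & I1). exists (fun t => Cconj (p t)). rewrite I0, I1. split; [| split; reflexivity].
 split; [apply cvcont_conj, S |]. intros t Ht. apply (sol_conj n A w p t S Ht).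
Qed.

Lemma nonreal_count a : Rg a -> Fl a a -> 0 < Im a -> counted Rg 2.
Proof.
 intros Ra Fa Hi. destruct (fixed_strict a Ra Fa) as (T1 & T2 & T3).
 assert (HW := proj2 (W1_upper a Ra ltac:(lra)) T1 Hi T3). assert (Wc : W1 (Cconj a) = Cconj (W1 a)) by apply W_conj.
 apply (pair_core a (Cconj a) _ _ (conj_pair_good _ HW)); try assumption.
 - split; [rewrite Cmod_conj; apply Ra | apply T_conj, Ra].
 - apply Fl_conj, Fa.
 - rewrite Wc. apply C_eq; unfold Re, Im, Cconj; simpl; ring.
 - rewrite Wc. apply C_eq; unfold Re, Im, Cconj; simpl; ring.
 - intros E. apply (f_equal Im) in E. change (Im a = - Im a) in E. lra.
Qed.

Lemma nonreal_count' a : Rg a -> Fl a a -> Im a <> 0 -> counted Rg 2.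
Proof.
 intros Ra Fa Hi. destruct (Rlt_dec 0 (Im a)) as [H | H]; [apply (nonreal_count a); assumption |].
 apply (nonreal_count (Cconj a)).
 - split; [rewrite Cmod_conj; apply Ra | apply T_conj, Ra].
 - apply Fl_conj, Fa.
 - change (0 < - Im a). lra.
Qed.

(** A nonreal zero brings its conjugate along. Otherwise the zero found and its companion are both
    real, and [real_pair_good] needs them in increasing order. *)
Lemma sector_count_end_repelling : counted Rg 2.
Proof.
 destruct end_out_zero as (a & Ra & Fa).
 destruct (Req_dec (Im a) 0) as [Ia | Ia]; [| apply (nonreal_count' a); assumption].
 assert (Ea : a = RtoC (Re a)) by (apply C_eq; [reflexivity | pos]). rewrite Ea in Ra, Fa.
 destruct (second_zero (Re a) Ra Fa) as (b & Rb & Fb & Hd).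
 destruct (Req_dec (Im b) 0) as [Ib | Ib]; [| apply (nonreal_count' b); assumption].
 assert (Eb : b = RtoC (Re b)) by (apply C_eq; [reflexivity | pos]). rewrite Eb in Rb, Fb, Hd.
 assert (Pos : forall x, Rg (RtoC x) -> Fl (RtoC x) (RtoC x) -> r < x).
 { intros x Rx Fx. destruct (fixed_strict _ Rx Fx) as (T1 & _). assert (V := Re_T _ (proj2 Rx)). simpl in V.
  rewrite Cmod_R, Rabs_pos_eq in T1; [lra |]. generalize (Cmod_ge_0 x). lra. }
 assert (Pa := Pos _ Ra Fa). assert (Pb := Pos _ Rb Fb). destruct (Rle_dec (Re a) (Re b)) as [Hle | Hle].
 - apply (pair_core (RtoC (Re a)) (RtoC (Re b)) _ _ (real_pair_good (Re a) (Re b) Ra Rb ltac:(lra) Fb)); try assumption.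
  + rewrite !W1_real, <- RtoC_plus by lra. reflexivity.
  + rewrite !W1_real, <- RtoC_mult by lra. reflexivity.
  + intros E. apply Hd. symmetry. exact E.
 - apply (pair_core (RtoC (Re b)) (RtoC (Re a)) _ _ (real_pair_good (Re b) (Re a) Rb Ra ltac:(lra) Fa)); try assumption.
  + rewrite !W1_real, <- RtoC_plus by lra. reflexivity.
  + rewrite !W1_real, <- RtoC_mult by lra. reflexivity.
  + intros E. apply RtoC_inj in E. lra.
Qed.

End Repelling.

End RightSector.

(** * Reversal of time and reflection *)

Definition rev_sys (w : R) (A : nat -> R -> R) (i : nat) (t : R) : R := - A i (w - t).
(** The field - F(t, - z), satisfied by the negatives of solutions. *)
Definition refl_sys (A : nat -> R -> R) (i : nat) (t : R) : R := - ((-1) ^ i * A i t).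

Lemma Fld_rev w A n t z : Fld (rev_sys w A) n t z = (- Fld A n (w - t) z)%C.
Proof.
 induction n as [| n IH]; cbn [Fld]; unfold rev_sys in *.
 - apply RtoC_opp.
 - rewrite IH, RtoC_opp. ring.
Qed.

Lemma Fld_refl A n t z : Fld (refl_sys A) n t z = (- Fld A n t (- z))%C.
Proof.
 induction n as [| n IH]; cbn [Fld]; unfold refl_sys in *.
 - simpl. rewrite Rmult_1_l. apply RtoC_opp.
 - rewrite IH. replace (- z)%C with (RtoC (-1) * z)%C by (apply C_eq; unfold Re, Im; simpl; ring).
  rewrite Cpow_mult_l, RtoC_opp, RtoC_mult, <- RtoC_pow. ring.
Qed.

Lemma continuous_rev (f : R -> R) w t : (forall s, continuous f s) -> continuous (fun s => f (w - s)) t.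
Proof.
 intros H. apply (continuous_comp (fun s => w - s) f); [| apply H].
 apply (continuous_minus (V := R_NormedModule)); [apply continuous_const | apply continuous_id].
Qed.

Lemma good_rev w n A : good_sys n A -> good_sys n (rev_sys w A).
Proof.
 intros [H (B & HB & HBA)]. split.
 - intros i t Hi. apply (continuous_opp (V := R_NormedModule)). apply continuous_rev. intros s. apply H, Hi.
 - exists B. split; [lra |]. intros i t Hi. unfold rev_sys. rewrite Rabs_Ropp. apply HBA, Hi.
Qed.

Lemma pow_m1_abs i : Rabs ((-1) ^ i) = 1.
Proof. rewrite <- RPow_abs, Rabs_left by lra. replace (- -1) with 1 by ring. apply pow1. Qed.

Lemma good_refl n A : good_sys n A -> good_sys n (refl_sys A).
Proof.
 intros [H (B & HB & HBA)]. split.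
 - intros i t Hi. apply (continuous_opp (V := R_NormedModule)).
  apply (continuous_mult (K := R_AbsRing)); [apply continuous_const | apply H, Hi].
 - exists B. split; [lra |]. intros i t Hi. unfold refl_sys. rewrite Rabs_Ropp, Rabs_mult, pow_m1_abs, Rmult_1_l. apply HBA, Hi.
Qed.

Lemma cder_rev phi w t v : cder phi (w - t) v -> cder (fun s => phi (w - s)) t (- v)%C.
Proof.
 intros [H1 H2]. assert (D : is_derive (fun s => w - s) t (-1)) by (auto_derive; [exact I | ring]). split.
 - eapply is_derive_eq; [exact (is_derive_comp (fun u => Re (phi u)) (fun s => w - s) t _ _ H1 D) |].
  change (-1 * Re v = - Re v). ring.
 - eapply is_derive_eq; [exact (is_derive_comp (fun u => Im (phi u)) (fun s => w - s) t _ _ H2 D) |].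
  change (-1 * Im v = - Im v). ring.
Qed.

Lemma Fl_rev n A w c d : Fl n A w c d -> Fl n (rev_sys w A) w d c.
Proof.
 intros (phi & [Cp Dp] & I0 & I1). exists (fun t => phi (w - t)). split; [split | split].
 - apply (cvcont_reparam phi (fun t => w - t) Cp). intros t.
  apply (continuous_minus (V := R_NormedModule)); [apply continuous_const | apply continuous_id].
 - intros t Ht. rewrite Fld_rev. apply cder_rev, Dp. lra.
 - rewrite Rminus_0_r. exact I1.
 - rewrite Rminus_diag. exact I0.
Qed.

Lemma rev_rev w A : rev_sys w (rev_sys w A) = A.
Proof.
 apply functional_extensionality. intros i. apply functional_extensionality. intros t.
 unfold rev_sys. rewrite Ropp_involutive. f_equal. ring.
Qed.

Lemma refl_refl A : refl_sys (refl_sys A) = A.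
Proof.
 apply functional_extensionality. intros i. apply functional_extensionality. intros t. unfold refl_sys.
 assert (E : (-1) ^ i * (-1) ^ i = 1) by (rewrite <- Rpow_mult_distr; replace (-1 * -1) with 1 by ring; apply pow1).
 replace (- ((-1) ^ i * - ((-1) ^ i * A i t))) with ((-1) ^ i * (-1) ^ i * A i t) by ring. rewrite E. ring.
Qed.

Lemma Fl_refl n A w c d : Fl n A w c d -> Fl n (refl_sys A) w (- c)%C (- d)%C.
Proof.
 intros (phi & [Cp Dp] & I0 & I1). exists (fun t => - phi t)%C. split; [split | split].
 - intros t. destruct (Cp t) as [H1 H2].
  split; [exact (continuous_opp (V := R_NormedModule) _ _ H1) | exact (continuous_opp (V := R_NormedModule) _ _ H2)].
 - intros t Ht. rewrite Fld_refl. apply cder_opp. replace (- - phi t)%C with (phi t) by ring. apply Dp, Ht.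
 - rewrite I0. reflexivity.
 - rewrite I1. reflexivity.
Qed.

Lemma zm_refl n A w c k : zm n (refl_sys A) w c k -> zm n A w (- c)%C k.
Proof.
 intros (r & h & Hr & Hc & H). assert (Hm1 : forall j, RtoC ((-1) ^ j) <> 0%C).
 { intros j E. apply RtoC_inj in E. assert (B := pow_m1_abs j). rewrite E, Rabs_R0 in B. lra. }
 exists r, (fun z => RtoC (- (-1) ^ k) * h (- z))%C. split; [lra | split].
 - replace (- - c)%C with c by ring. apply Cmult_neq_0; [| pos].
  intros E. apply (Hm1 (S k)). rewrite <- E. f_equal. simpl. ring.
 - intros z Hz. assert (Hz' : Cmod (- z - c) < r).
  { replace (- z - c)%C with (- (z - - c))%C by ring. rewrite Cmod_opp. exact Hz. }
  destruct (H (- z)%C Hz') as [H1 H2]. split.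
  + apply Fl_refl in H1. rewrite refl_refl in H1. replace (- - z)%C with z in H1 by ring.
   replace (z + (z - - c) ^ k * (RtoC (- (-1) ^ k) * h (- z)))%C with (- (- z + (- z - c) ^ k * h (- z)))%C; [pos |].
   replace (- z - c)%C with (RtoC (-1) * (z - - c))%C by (apply C_eq; unfold Re, Im; simpl; ring).
   rewrite Cpow_mult_l, RtoC_opp, <- RtoC_pow. ring.
  + apply hol_mult; [apply hol_const |]. apply (hol_comp (fun z => - z)%C h); [apply hol_opp, hol_id | pos].
Qed.

(* If [G] is the reversed time-[w] map and [F] its inverse, then
   [F y - y = - (F y - c)^k h (F y)], and [F y - c] is [(y - c)] times a nonvanishing slope. *)
Lemma zm_rev n A w c k : good_sys n A -> 0 < w -> (1 <= k)%nat -> zm n (rev_sys w A) w c k -> zm n A w c k.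
Proof.
 intros HA Hw Hk Hz. assert (HF : Fl n A w c c).
 { rewrite <- (rev_rev w A). apply Fl_rev. apply (zm_Fl n _ w c k Hk Hz). }
 destruct Hz as (r & h & Hr & Hc & H). destruct HF as (p & Sp & P0 & P1).
 destruct (sol_bounded n A w Hw p Sp) as (M & HM & Hb).
 assert (Hp : forall t, 0 <= t <= w -> p t = Phi n A w (M + 1) c t).
 { intros t Ht. rewrite <- P0. apply (sol_Phi n A w HA Hw (M + 1) p w); try assumption; try lra.
  intros u Hu. generalize (Hb u Hu). lra. }
 assert (Hs : forall t, 0 <= t <= w -> Cmod (Phi n A w (M + 1) c t) < M + 1).
 { intros t Ht. rewrite <- Hp by exact Ht. generalize (Hb t Ht). lra. }
 set (F := fun y => Phi n A w (M + 1) y w). assert (HhF : hol F c) by (apply hol_Phi; try assumption; lra).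
 assert (Fc : F c = c) by (unfold F; rewrite <- Hp by lra; exact P1).
 destruct (Phi_strict_near n A w HA Hw (M + 1) c ltac:(lra) Hs) as (d1 & Hd1 & B1).
 destruct (hol_ccont F c HhF r Hr) as (d2 & Hd2 & B2). rewrite Fc in B2.
 destruct (hol_slope F c HhF) as (s & Es & Hs'). assert (HsC := Hs' c HhF).
 assert (Es' : forall y, (F y - c = (y - c) * s y)%C) by (intros y; rewrite Es, Fc; ring).
 assert (Hd : 0 < Rmin d1 d2) by pos. destruct (Rmin_bounds d1 d2) as [M1 M2].
 assert (Inv : forall y, Cmod (y - c) < Rmin d1 d2 -> y = (F y + (F y - c) ^ k * h (F y))%C).
 { intros y Hy. assert (FF : Fl n A w y (F y)).
  { apply Fl_Phi; try assumption; try lra. intros t Ht. left. apply B1; lra. }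
  apply Fl_rev in FF. apply (Fl_fun n (rev_sys w A) w (good_rev w n A HA) Hw (F y)); [pos |].
  apply H. apply B2. lra. }
 assert (HhH : hol (fun y => h (F y)) c).
 { apply (hol_comp F h); [pos |]. rewrite Fc. apply H. rewrite Cmod_sub_diag. exact Hr. }
 (* Dividing the identity [Inv] by y - c and letting y tend to c gives a product equal to 1 in which
    s c is a factor. *)
 destruct k as [| j]; [lia |]. assert (Hsc : s c <> 0%C).
 { intros E0. assert (E1 : (s c * (1 + (F c - c) ^ j * h (F c)))%C = 1%C).
  { apply (ccont_punctured (fun y => s y * (1 + (F y - c) ^ j * h (F y)))%C (fun _ => 1%C) c (Rmin d1 d2)).
   - apply hol_ccont, hol_mult; [pos |]. apply hol_plus; [apply hol_const |]. apply hol_mult; [| pos].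
    apply (hol_pow (fun y => F y - c)%C). apply hol_minus; [pos | apply hol_const].
   - apply hol_ccont, hol_const.
   - lra.
   - intros y Hy Hne. assert (I := Inv y Hy).
    assert (E2 : ((y - c) * (s y * (1 + (F y - c) ^ j * h (F y))) = y - c)%C).
    { replace ((y - c) * (s y * (1 + (F y - c) ^ j * h (F y))))%C with ((y - c) * s y * (1 + (F y - c) ^ j * h (F y)))%C by ring.
     rewrite <- Es'. transitivity (F y + (F y - c) ^ S j * h (F y) - c)%C; [simpl; ring | rewrite <- I; reflexivity]. }
    assert (Hyc := Csub_neq_0 _ _ Hne).
    replace (s y * (1 + (F y - c) ^ j * h (F y)))%C with ((y - c) * (s y * (1 + (F y - c) ^ j * h (F y))) / (y - c))%C by (field; exact Hyc).
    rewrite E2. field. exact Hyc. }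
  rewrite E0, Cmult_0_l in E1. apply RtoC_inj in E1. lra. }
 apply (zm_intro n A w HA Hw (M + 1) c (S j) (fun y => - (s y ^ S j * h (F y)))%C (Rmin d1 d2)); try assumption; try lra.
 - apply hol_opp, hol_mult; [apply hol_pow, HsC | pos].
 - intros E. assert (E2 : (s c ^ S j * h (F c))%C = 0%C).
  { replace (s c ^ S j * h (F c))%C with (- - (s c ^ S j * h (F c)))%C by ring. rewrite E. ring. }
  revert E2. apply Cmult_neq_0; [apply Cpow_nz, Hsc | rewrite Fc; exact Hc].
 - intros y Hy. assert (I := Inv y Hy). fold (F y).
  transitivity (F y - (F y + (F y - c) ^ S j * h (F y)))%C; [rewrite <- I; reflexivity |].
  rewrite Es', Cpow_mult_l. ring.
Qed.

Lemma counted_transfer n A A' w (D D' : C -> Prop) (g : C -> C) N :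
 (forall c, g (g c) = c) -> (forall c, D' c -> D (g c)) -> (forall c, D c -> D' (g c)) ->
 (forall c k, (1 <= k)%nat -> zm n A' w c k -> zm n A w (g c) k) ->
 (forall c, Fl n A w c c -> Fl n A' w (g c) (g c)) -> counted n A' w D' N -> counted n A w D N.
Proof.
 intros Hg HD HD' Hz HF (ps & H1 & H2 & H3 & H4). set (ps' := map (fun x => (g (fst x), snd x)) ps).
 assert (E1 : map fst ps' = map g (map fst ps)) by (unfold ps'; rewrite !map_map; reflexivity).
 assert (E2 : map snd ps' = map snd ps) by (unfold ps'; rewrite !map_map; reflexivity).
 exists ps'. rewrite E1, E2. split; [| split; [| split; [| lia]]].
 - apply FinFun.Injective_map_NoDup; [| pos]. intros x y E. rewrite <- (Hg x), <- (Hg y), E. reflexivity.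
 - intros c k Hin. apply in_map_iff in Hin. destruct Hin as ([c' k'] & E & Hin). injection E as <- <-.
  destruct (H2 c' k' Hin) as (I1 & I2 & I3). split; [apply HD, I1 | split; [lia | apply Hz; assumption]].
 - intros c Hc HFc. rewrite <- (Hg c). apply in_map. apply H3; [apply HD', Hc | apply HF, HFc].
Qed.

Lemma counted_rev n A w D N : good_sys n A -> 0 < w -> counted n (rev_sys w A) w D N -> counted n A w D N.
Proof.
 intros HA Hw. apply (counted_transfer n A _ w D D (fun c => c)); try (intros; assumption); try reflexivity.
 - intros c k Hk. apply zm_rev; assumption.
 - intros c. apply Fl_rev.
Qed.

Lemma counted_refl n A w (D : C -> Prop) N : counted n (refl_sys A) w (fun z => D (- z)%C) N -> counted n A w D N.
Proof.
 apply (counted_transfer n A _ w D _ (fun c => - c)%C).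
 - intros c. ring.
 - intros c H. exact H.
 - intros c H. replace (- - c)%C with c by ring. exact H.
 - intros c k _. apply zm_refl.
 - intros c. apply Fl_refl.
Qed.

Lemma sin_lip a b : Rabs (sin a - sin b) <= Rabs (a - b).
Proof.
 assert (H : forall a b, a < b -> Rabs (sin b - sin a) <= Rabs (b - a)).
 { clear. intros a b Hab. destruct (mvt sin cos a b Hab) as (c & _ & E).
  - intros x _. apply is_derive_sin.
  - intros x. apply continuous_sin.
  - rewrite E, Rabs_mult. assert (B : Rabs (cos c) <= 1) by (apply Rabs_le, COS_bound).
   generalize (Rabs_pos (b - a)). nra. }
 destruct (Rtotal_order a b) as [Hlt | [-> | Hlt]].
 - rewrite Rabs_minus_sym, (Rabs_minus_sym a). apply H, Hlt.
 - rewrite !Rminus_diag. lra.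
 - apply H, Hlt.
Qed.

Lemma side_Fld_lip A B t rho k th th' : (forall i, (i <= k)%nat -> Rabs (A i t) <= B) -> 0 <= rho ->
 Rabs (side th (Fld A k t (polar rho th)) - side th' (Fld A k t (polar rho th')))
  <= INR (S k) * INR (S k) * B * Rmax 1 rho ^ k * Rabs (th - th').
Proof.
 intros HB Hrho. apply (weighted_sum_bound (fun i => A i t) (fun i => sin (INR i * th) - sin (INR i * th'))
  (fun k => side th (Fld A k t (polar rho th)) - side th' (Fld A k t (polar rho th')))); try assumption.
 - eapply Rle_trans; [apply Rabs_pos | apply (HB 0%nat); lia].
 - pos.
 - cbn [Fld]. replace (side th (RtoC (A 0%nat t)) - side th' (RtoC (A 0%nat t))) with (- A 0%nat t * (sin th - sin th'))
   by (unfold side, Re, Im; simpl; ring).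
  rewrite Rabs_mult, Rabs_Ropp. apply Rmult_le_compat; try apply Rabs_pos; [apply HB; lia | apply sin_lip].
 - intros i. rewrite !side_Fld_S. ring.
 - intros i. eapply Rle_trans; [apply sin_lip |]. rewrite <- Rmult_minus_distr_l, Rabs_mult, (Rabs_pos_eq (INR i)) by apply pos_INR. lra.
Qed.

Lemma side_conj th (z : C) : side (- th) (Cconj z) = - side th z.
Proof. unfold side. rewrite cos_neg, sin_neg. unfold Re, Im, Cconj. simpl. ring. Qed.

Lemma side_opp th (z : C) : side th (- z)%C = - side th z.
Proof. unfold side, Re, Im. simpl. ring. Qed.

Lemma side_Fld_conj A n t rho th :
 side (- th) (Fld A n t (polar rho (- th))) = - side th (Fld A n t (polar rho th)).
Proof. rewrite <- polar_conj, Fld_conj. apply side_conj. Qed.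

Lemma radial_opp v z : radial (- v)%C z = - radial v z.
Proof. unfold radial, Re, Im. simpl. ring. Qed.

Lemma circ_rev n A w r : (circ_in n A w r -> circ_out n (rev_sys w A) w r) /\ (circ_out n A w r -> circ_in n (rev_sys w A) w r).
Proof.
 split; intros H t z Ht Hz; rewrite Fld_rev, radial_opp; generalize (H (w - t) z ltac:(lra) Hz); lra.
Qed.

Lemma circ_refl n A w r : (circ_in n A w r -> circ_in n (refl_sys A) w r) /\ (circ_out n A w r -> circ_out n (refl_sys A) w r).
Proof.
 assert (E : forall t z, radial (Fld (refl_sys A) n t z) z = radial (Fld A n t (- z)%C) (- z)%C).
 { intros t z. rewrite Fld_refl. unfold radial, Re, Im. simpl. ring. }
 split; intros H t z Ht Hz; rewrite E; apply H; rewrite ?Cmod_opp; assumption.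
Qed.

(** * Sectors by polar angle *)

(** Given by an interval of angles, it keeps its meaning for openings of pi and more, which [sector]
    does not; sectors can thus be glued one after the other. *)
Definition Reg (r a b : R) (z : C) : Prop := r <= Cmod z /\ exists th, a <= th <= b /\ z = polar (Cmod z) th.

Lemma Reg_sector r a b z : 0 < r -> 0 < b - a < PI -> (Reg r a b z <-> r <= Cmod z /\ sector a b z).
Proof.
 intros Hr Hab. split.
 - intros (H & th & Hth & E). split; [exact H |]. rewrite E. apply polar_in_sector; try assumption. lra.
 - intros [H1 H2]. split; [lra |]. apply sector_polar; try assumption. apply Cmod_gt_0. lra.
Qed.

Lemma polar_angle rho th th' : 0 < rho -> polar rho th = polar rho th' -> Rabs (th - th') < 2 * PI -> th = th'.
Proof.
 intros Hr E H. apply el_inj; [| exact H]. unfold polar in E.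
 assert (Hr0 : RtoC rho <> 0%C) by (intros Q; apply RtoC_inj in Q; lra).
 replace (el th) with (RtoC rho * el th / rho)%C by (field; exact Hr0). rewrite E. field. exact Hr0.
Qed.

Definition nofix n A w r th : Prop := forall c, Fl n A w c c -> r <= Cmod c -> c <> polar (Cmod c) th.

Lemma counted_glue n A w r a b c N1 N2 : 0 < r -> a <= b <= c -> c - a < 2 * PI -> nofix n A w r b ->
 counted n A w (Reg r a b) N1 -> counted n A w (Reg r b c) N2 -> counted n A w (Reg r a c) (N1 + N2).
Proof.
 intros Hr Hab Hc Hn H1 H2. apply (counted_ext n A w (fun z => Reg r a b z \/ Reg r b c z)).
 - intros z _. split.
  + intros [(H & th & Hth & E) | (H & th & Hth & E)]; (split; [exact H | exists th; split; [lra | exact E]]).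
  + intros (H & th & Hth & E). destruct (Rle_dec th b); [left | right]; (split; [exact H | exists th; split; [lra | exact E]]).
 - apply counted_union; try assumption. intros z (H & th & Hth & E) (_ & th' & Hth' & E') HF. assert (Q : th = th').
  { apply (polar_angle (Cmod z)); [lra | rewrite <- E; exact E' | apply Rabs_def1; lra]. }
  apply (Hn z HF H). replace b with th by lra. exact E.
Qed.

(** A periodic solution starting outside never visits the open disc: it could not get back if the
    disc attracts, nor get in if it repels. Invariance of the sector then applies over the whole
    period. *)
Lemma fixed_in_sector n A w r lo hi c : good_sys n A -> 0 < w -> 0 < r -> 0 < hi - lo < PI -> ray_in n A w r lo hi ->
 circ_in n A w r \/ circ_out n A w r -> Fl n A w c c -> r <= Cmod c -> sector lo hi c ->
 0 < side lo c /\ side hi c < 0.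
Proof.
 intros HA Hw Hr Hw2 Hray Hcirc (p & S & I0 & I1) Hc HT. assert (Hall : forall t, 0 <= t <= w -> r <= Cmod (p t)).
 { destruct Hcirc as [Hin | Hout].
  - intros t Ht. apply Rnot_lt_le. intros Hlt. destruct (Req_dec t w) as [-> | Hne]; [rewrite I1 in Hlt; lra |].
   assert (B := proj2 (circ_in_inv n A w HA r w p t w Hr Hin S ltac:(lra) ltac:(lra) ltac:(lra) ltac:(lra) w ltac:(lra)) ltac:(lra)).
   rewrite I1 in B. lra.
  - intros t Ht. apply (circ_out_inv n A w HA r w p 0 w Hr Hout S); try lra. rewrite I0. exact Hc. }
 assert (B := proj2 (sector_inv n A w HA r lo hi w p 0 w Hr Hw2 Hray S ltac:(lra) ltac:(lra) ltac:(lra) Hall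
  ltac:(rewrite I0; exact HT) w ltac:(lra)) Hw). rewrite I1 in B. exact B.
Qed.

Lemma cos_sin_nPI j x : cos (x + INR j * PI) = (-1) ^ j * cos x /\ sin (x + INR j * PI) = (-1) ^ j * sin x.
Proof.
 induction j as [| j [IH1 IH2]].
 - simpl. rewrite Rmult_0_l, Rplus_0_r. lra.
 - rewrite S_INR. replace (x + (INR j + 1) * PI) with (x + INR j * PI + PI) by ring.
  rewrite neg_cos, neg_sin, IH1, IH2. simpl. lra.
Qed.

Lemma pow_m1_sq j : (-1) ^ j * (-1) ^ j = 1.
Proof. rewrite <- Rpow_mult_distr. replace (-1 * -1) with 1 by ring. apply pow1. Qed.

Lemma el_mult_PI j : el (INR j * PI) = RtoC ((-1) ^ j).
Proof.
 destruct (cos_sin_nPI j 0) as [E1 E2]. rewrite Rplus_0_l, cos_0, sin_0 in *.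
 apply C_eq; unfold el, Re, Im; simpl; lra.
Qed.

Lemma div2_step x : Nat.div2 (S x) = (Nat.div2 x + if Nat.odd x then 1 else 0)%nat.
Proof.
 destruct (Nat.Even_or_Odd x) as [(q & ->) | (q & ->)].
 - rewrite Nat.div2_succ_double, Nat.div2_double, Nat.odd_mul. simpl. lia.
 - replace (S (2 * q + 1)) with (2 * (q + 1))%nat by lia. rewrite Nat.div2_double.
  replace (2 * q + 1)%nat with (S (2 * q)) by lia. rewrite Nat.div2_succ_double, Nat.odd_succ, Nat.even_mul. simpl. lia.
Qed.

Section Total.
Variables (m : nat) (A : nat -> R -> R) (w r r2 c : R).
Let n := S (S m).
Let al := PI / INR m.
Hypothesis HA : good_sys n A.
Hypothesis Hlead : forall t, A n t = 1.
Hypothesis Hw : 0 < w.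
Hypothesis Hm : (3 <= m)%nat.
Hypothesis Hr : 0 < r.
Hypothesis Hr2 : r < r2.
Hypothesis Hc : 0 < c.

Lemma al_facts : 0 < al <= PI / 3 /\ INR m * al = PI /\ 3 <= INR m /\ 0 < PI.
Proof. destruct (e_al m Hm) as [H1 H2]. split; [pos | split; [pos | nra]]. Qed.

Lemma al_mult : INR (m - 1) * al = PI - al /\ INR (m + 1) * al = PI + al.
Proof. destruct al_facts as (_ & Em & _). rewrite minus_INR, plus_INR by lia. simpl. lra. Qed.

Lemma end_count B : good_sys n B -> (forall t, B n t = 1) ->
 (forall t rho, 0 <= t <= w -> r <= rho -> side al (Fld B n t (polar rho al)) <= - (c * rho ^ n)) ->
 (circ_in n B w r -> counted n B w (Rg m r) 1) /\
 (circ_out n B w r -> circ_out n B w r2 -> counted n B w (Rg m r) 2).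
Proof.
 intros HB HlB Hside. destruct al_facts as (Ha & Em & Hm3 & Hpi). assert (Hray : ray_in n B w r (- al) al).
 { intros t rho Ht Hrho. rewrite side_Fld_conj. assert (P := Hside t rho Ht Hrho).
  assert (0 < c * rho ^ n) by pos. lra. }
 split; [intros Hin; apply (sector_count_end_attracting m B w r); assumption |].
 intros Hout Hout2. destruct (proj2 HB) as (b & Hb & HbB).
 (* For rho >= r this gives max(1, rho)^n <= G^n rho^n, so the Lipschitz constant in the angle
    scales like the lower bound c rho^n on the ray, and a rotation by a small [mu] preserves the
    sign uniformly in rho. *)
 set (G := Rmax 1 (/ r)). destruct (Rmax_bounds 1 (/ r)) as [G1 G2]. fold G in G1, G2.
 set (q := INR (S n) * INR (S n) * b * G ^ n). assert (PG : 0 <= G ^ n) by pos.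
 assert (Hq : 0 <= q) by (unfold q; apply Rmult_le_pos; [| lra]; repeat apply Rmult_le_pos; try apply pos_INR; exact Hb).
 set (mu := Rmin (al / 2) (c / (2 * (q + 1)))). assert (Hmu0 : 0 < mu) by (apply Rmin_pos; [lra | pos]).
 assert (Hmu1 : mu <= al / 2) by apply Rmin_l. assert (Hmu2 : mu <= c / (2 * (q + 1))) by apply Rmin_r.
 assert (Hqmu : q * mu < c).
 { apply Rle_lt_trans with (q * (c / (2 * (q + 1)))); [nra |].
  apply Rmult_lt_reg_r with (2 * (q + 1)); [lra |]. replace (q * (c / (2 * (q + 1))) * (2 * (q + 1))) with (q * c) by (field; lra). nra. }
 assert (Hs : forall t rho, 0 <= t <= w -> r <= rho -> side (al - mu) (Fld B n t (polar rho (al - mu))) < 0).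
 { intros t rho Ht Hrho. assert (P := Hside t rho Ht Hrho).
  assert (L := side_Fld_lip B b t rho n (al - mu) al (fun i Hi => HbB i t Hi) ltac:(lra)).
  replace (al - mu - al) with (- mu) in L by ring. rewrite Rabs_Ropp, (Rabs_pos_eq mu) in L by lra.
  apply Rabs_le_between in L. assert (Prho : 0 < rho ^ n) by pos. assert (RG : Rmax 1 rho ^ n <= G ^ n * rho ^ n).
  { rewrite <- Rpow_mult_distr. apply pow_incr. split; [generalize (Rmax_l 1 rho); lra |].
   apply Rmax_lub; [| nra]. apply Rle_trans with (/ r * rho); [| nra].
   apply Rmult_le_reg_l with r; [lra |]. rewrite <- Rmult_assoc, Rinv_r by lra. lra. }
  assert (L2 : INR (S n) * INR (S n) * b * Rmax 1 rho ^ n * mu <= q * mu * rho ^ n).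
  { unfold q. replace (INR (S n) * INR (S n) * b * G ^ n * mu * rho ^ n) with (INR (S n) * INR (S n) * b * (G ^ n * rho ^ n) * mu) by ring.
   apply Rmult_le_compat_r; [lra |]. apply Rmult_le_compat_l; [| lra].
   repeat apply Rmult_le_pos; try apply pos_INR; exact Hb. }
  assert (q * mu * rho ^ n < c * rho ^ n) by nra. lra. }
 assert (Hray2 : ray_in n B w r (- (al - mu)) (al - mu)).
 { intros t rho Ht Hrho. rewrite side_Fld_conj. assert (P := Hs t rho Ht Hrho). lra. }
 apply (sector_count_end_repelling m B w r) with r2 mu; try assumption. fold al. lra.
Qed.

Lemma Rg_Reg z : Rg m r z <-> Reg r (- al) al z.
Proof. symmetry. apply (Reg_sector r (- al) al z Hr (T_width m Hm)). Qed.

Hypothesis HS : forall t rho k, 0 <= t <= w -> r <= rho -> (1 <= k <= m - 1)%nat ->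
 c * rho ^ n <= (-1) ^ k * side (INR k * al) (Fld A n t (polar rho (INR k * al))).

Lemma interior_count j lo kap : kap * kap = 1 -> el (INR m * lo) = kap ->
 (forall th, lo <= th <= lo + al -> (-1) ^ j * cos (INR (S m) * th) <= cos al) ->
 (forall t rho, 0 <= t <= w -> r <= rho -> 0 < (-1) ^ j * side lo (Fld A n t (polar rho lo)) /\
  (-1) ^ j * side (lo + al) (Fld A n t (polar rho (lo + al))) < 0) ->
 (circ_in n A w r -> counted n A w (Reg r lo (lo + al)) (if Nat.odd j then 1 else 0)%nat) /\
 (circ_out n A w r -> counted n A w (Reg r lo (lo + al)) (if Nat.odd j then 0 else 1)%nat) /\
 (circ_in n A w r \/ circ_out n A w r -> nofix n A w r lo /\ nofix n A w r (lo + al)).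
Proof.
 intros Hkap Hlo Hmarg Hs. destruct al_facts as (Ha & Em & Hm3 & Hpi).
 assert (Hcal : cos al < 1) by (rewrite <- cos_0; apply cos_decreasing_1; lra).
 assert (Hcal0 : 0 <= cos al) by (apply cos_ge_0; lra). assert (Hwid : 0 < lo + al - lo < PI) by lra.
 assert (Key : forall B sg, good_sys n B -> (forall t, B n t = sg) -> sg = (-1) ^ j -> sg * sg = 1 -> ray_in n B w r lo (lo + al) ->
  (circ_in n B w r -> counted n B w (Reg r lo (lo + al)) 0) /\ (circ_out n B w r -> counted n B w (Reg r lo (lo + al)) 1) /\
  (circ_in n B w r \/ circ_out n B w r -> nofix n B w r lo /\ nofix n B w r (lo + al))).
 { intros B sg HB HlB Esg Hsg Hray.
  assert (Hmg : forall th, lo <= th <= lo + PI / INR m -> sg * cos (INR (S m) * th) <= 1 - (1 - cos al)).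
  { intros th Hth. rewrite Esg. replace (1 - (1 - cos al)) with (cos al) by ring. apply Hmarg, Hth. }
  assert (Ext : forall N, counted n B w (fun z => r <= Cmod z /\ sector lo (lo + al) z) N -> counted n B w (Reg r lo (lo + al)) N).
  { intros N. apply counted_ext. intros z _. symmetry. apply Reg_sector; assumption. }
  split; [| split].
  - intros Hin. apply Ext. apply (sector_count_attracting m B w sg r lo (1 - cos al)); try assumption; try lra.
  - intros Hout. apply Ext. apply (sector_count_repelling m B w sg r lo (1 - cos al) kap); try assumption; try lra.
  - intros Hcirc. split; intros z HF Hz E.
   + assert (S := fixed_in_sector n B w r lo (lo + al) z HB Hw Hr Hwid Hray Hcirc HF Hz).
    rewrite E in S. rewrite !side_polar, Rminus_diag, sin_0 in S.
    destruct S as [S _]; [apply polar_in_sector; lra | lra].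
   + assert (S := fixed_in_sector n B w r lo (lo + al) z HB Hw Hr Hwid Hray Hcirc HF Hz).
    rewrite E in S. rewrite !side_polar, Rminus_diag, sin_0 in S.
    destruct S as [_ S]; [apply polar_in_sector; lra | lra]. }
 destruct (Nat.odd j) eqn:Ej.
 - apply Nat.odd_spec in Ej. destruct Ej as (q & Ej).
  assert (Es : (-1) ^ j = -1) by (rewrite Ej, Nat.add_1_r; apply pow_1_odd). rewrite Es in Hs.
  destruct (Key (rev_sys w A) (-1)) as (K1 & K2 & K3).
  + apply good_rev, HA.
  + intros t. unfold rev_sys. rewrite Hlead. reflexivity.
  + lra.
  + ring.
  + intros t rho Ht Hrho. rewrite !Fld_rev, !side_opp. generalize (Hs (w - t) rho ltac:(lra) Hrho). unfold n. lra.
  + assert (C := circ_rev n A w r). split; [| split].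
   * intros H. apply counted_rev; try assumption. apply K2, C, H.
   * intros H. apply counted_rev; try assumption. apply K1, C, H.
   * intros H. destruct K3 as [F1 F2]; [destruct H as [H | H]; [right | left]; apply C, H |].
    split; intros z HF; [apply F1 | apply F2]; apply Fl_rev, HF.
 - assert (Ej' : Nat.even j = true) by (rewrite <- Nat.negb_odd, Ej; reflexivity).
  apply Nat.even_spec in Ej'. destruct Ej' as (q & Ej').
  assert (Es : (-1) ^ j = 1) by (rewrite Ej'; apply pow_1_even). rewrite Es in Hs.
  apply (Key A 1); try assumption; [lra | ring |]. intros t rho Ht Hrho. generalize (Hs t rho Ht Hrho). lra.
Qed.

(** With x = th - j al one has (m + 1) th = m x + th + j pi, where m x is in [0, pi] and th in
    [al, pi - al]. The sum m x + th stays at distance al from the multiples of 2 pi. *)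
Lemma margin_cos j th : (1 <= j <= m - 2)%nat -> INR j * al <= th <= INR j * al + al ->
 (-1) ^ j * cos (INR (S m) * th) <= cos al.
Proof.
 intros Hj Hth. destruct al_facts as (Ha & Em & Hm3 & Hpi). assert (J1 : 1 <= INR j) by (apply (le_INR 1); lia).
 assert (J2 : INR j <= INR m - 2) by (replace (INR m - 2) with (INR (m - 2)) by (rewrite minus_INR by lia; reflexivity); apply le_INR; lia).
 set (x := th - INR j * al). replace (INR (S m) * th) with (INR m * x + th + INR j * PI)
  by (unfold x; rewrite S_INR, <- Em; ring).
 destruct (cos_sin_nPI j (INR m * x + th)) as [E _]. rewrite E, <- Rmult_assoc, pow_m1_sq, Rmult_1_l.
 assert (Hx : 0 <= INR m * x <= PI) by (rewrite <- Em; unfold x; split; [pos | nra]; lra).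
 assert (Hth1 : al <= th) by nra. assert (Hth2 : th <= PI - al) by nra.
 destruct (Rle_dec (INR m * x + th) PI) as [H | H].
 - apply cos_decr_1; lra.
 - replace (cos (INR m * x + th)) with (cos (2 * PI - (INR m * x + th))).
  + apply cos_decr_1; lra.
  + rewrite cos_minus, cos_2PI, sin_2PI. ring.
Qed.
Definition inside_or_out (D : C -> Prop) (N1 N2 : nat) : Prop :=
 (circ_in n A w r -> counted n A w D N1) /\ (circ_out n A w r -> counted n A w D N2).

Lemma upper_count j : (1 <= j <= m - 2)%nat ->
 inside_or_out (Reg r (INR j * al) (INR (S j) * al)) (if Nat.odd j then 1 else 0) (if Nat.odd j then 0 else 1) /\
 (circ_in n A w r \/ circ_out n A w r -> nofix n A w r (INR j * al) /\ nofix n A w r (INR (S j) * al)).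
Proof.
 intros Hj. destruct al_facts as (Ha & Em & Hm3 & Hpi).
 assert (ES : INR (S j) * al = INR j * al + al) by (rewrite S_INR; ring). rewrite ES.
 destruct (interior_count j (INR j * al) ((-1) ^ j)) as (I1 & I2 & I3).
 - apply pow_m1_sq.
 - replace (INR m * (INR j * al)) with (INR j * PI) by nra. apply el_mult_PI.
 - intros th Hth. apply margin_cos; assumption.
 - intros t rho Ht Hrho. assert (P : 0 < c * rho ^ n) by pos.
  assert (H1 := HS t rho j Ht Hrho ltac:(lia)). assert (H2 := HS t rho (S j) Ht Hrho ltac:(lia)).
  rewrite ES in H2. change ((-1) ^ S j) with (-1 * (-1) ^ j) in H2. lra.
 - split; [split; assumption | pos].
Qed.

Lemma lower_count j : (1 <= j <= m - 2)%nat ->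
 inside_or_out (Reg r (- (INR (S j) * al)) (- (INR j * al))) (if Nat.odd j then 1 else 0) (if Nat.odd j then 0 else 1) /\
 (circ_in n A w r \/ circ_out n A w r -> nofix n A w r (- (INR j * al)) /\ nofix n A w r (- (INR (S j) * al))).
Proof.
 intros Hj. destruct al_facts as (Ha & Em & Hm3 & Hpi).
 assert (ES : - (INR j * al) = - (INR (S j) * al) + al) by (rewrite S_INR; ring). rewrite ES.
 destruct (interior_count j (- (INR (S j) * al)) ((-1) ^ S j)) as (I1 & I2 & I3).
 - apply pow_m1_sq.
 - replace (INR m * - (INR (S j) * al)) with (- (INR (S j) * PI)) by nra.
  assert (E := el_mult_PI (S j)). apply (f_equal Cconj) in E. rewrite Cconj_RtoC in E. rewrite <- E.
  apply C_eq; unfold el, Re, Im, Cconj; cbn [fst snd]; [apply cos_neg | apply sin_neg].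
 - intros th Hth. rewrite <- (cos_neg (INR (S m) * th)). replace (- (INR (S m) * th)) with (INR (S m) * - th) by ring.
  apply margin_cos; [lia | lra].
 - rewrite <- ES. intros t rho Ht Hrho. rewrite !side_Fld_conj. assert (P : 0 < c * rho ^ n) by pos.
  assert (H1 := HS t rho j Ht Hrho ltac:(lia)). assert (H2 := HS t rho (S j) Ht Hrho ltac:(lia)).
  change ((-1) ^ S j) with (-1 * (-1) ^ j) in H2. lra.
 - split; [split; assumption |]. intros H. destruct (I3 H) as [F1 F2]. split; assumption.
Qed.

Hypothesis Hcirc : (circ_in n A w r /\ circ_in n A w r2) \/ (circ_out n A w r /\ circ_out n A w r2).

Lemma Hcirc1 : circ_in n A w r \/ circ_out n A w r.
Proof. tauto. Qed.

Lemma ray_nofix k : (1 <= k <= m - 1)%nat -> nofix n A w r (INR k * al) /\ nofix n A w r (- (INR k * al)).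
Proof.
 intros Hk. destruct (Nat.eq_dec k 1) as [-> | Hk1].
 - split; [apply (upper_count 1); [lia | apply Hcirc1] | apply (lower_count 1); [lia | apply Hcirc1]].
 - destruct k as [| j]; [lia |]. split; [apply (upper_count j); [lia | apply Hcirc1] | apply (lower_count j); [lia | apply Hcirc1]].
Qed.

Lemma right_count : inside_or_out (Reg r (- al) al) 1 2.
Proof.
 destruct (end_count A HA Hlead) as [E1 E2].
 - intros t rho Ht Hrho. assert (H := HS t rho 1 Ht Hrho ltac:(lia)). simpl INR in H. rewrite Rmult_1_l in H. simpl in H. simpl. lra.
 - split; intros H; apply (counted_ext n A w (Rg m r)); try (intros z _; apply Rg_Reg); [apply E1, H |].
  apply E2; [exact H |]. destruct Hcirc as [[H1 _] | [_ H2]]; [| pos].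
  exfalso. assert (Cr : Cmod r = r) by (rewrite Cmod_R, Rabs_pos_eq; lra).
  assert (B1 := H 0 r ltac:(lra) Cr). assert (B2 := H1 0 r ltac:(lra) Cr). lra.
Qed.

(* [z -> - z] turns this sector into the right one, with the field reversed when [m] is even. *)
Lemma left_count : inside_or_out (Reg r (INR (m - 1) * al) (INR (m + 1) * al)) (if Nat.odd m then 1 else 2) (if Nat.odd m then 2 else 1).
Proof.
 destruct al_facts as (Ha & Em & Hm3 & Hpi). destruct al_mult as [E1 E2].
 assert (Hpol : forall rho th, polar rho (th + PI) = (- polar rho th)%C).
 { intros rho th. apply C_eq; rewrite ?Re_polar, ?Im_polar.
  - rewrite neg_cos. change (rho * - cos th = - Re (polar rho th)). rewrite Re_polar. ring.
  - rewrite neg_sin. change (rho * - sin th = - Im (polar rho th)). rewrite Im_polar. ring. }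
 assert (Hreg : forall z, Rg m r z <-> Reg r (INR (m - 1) * al) (INR (m + 1) * al) (- z)%C).
 { intros z. rewrite Rg_Reg, E1, E2. unfold Reg. rewrite Cmod_opp. split.
  - intros (H & th & Hth & E). split; [exact H |]. exists (th + PI). split; [lra |]. rewrite Hpol, <- E. reflexivity.
  - intros (H & th & Hth & E). split; [exact H |]. exists (th - PI). split; [lra |].
   replace (polar (Cmod z) (th - PI)) with (- polar (Cmod z) (th - PI + PI))%C by (rewrite Hpol; ring).
   replace (th - PI + PI) with th by ring. rewrite <- E. ring. }
 assert (Hside : forall t rho, side al (Fld (refl_sys A) n t (polar rho al))
   = - side (INR (m - 1) * al) (Fld A n t (polar rho (INR (m - 1) * al)))).
 { intros t rho. rewrite Fld_refl, side_opp, <- Hpol, <- side_Fld_conj, E1.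
  replace (polar rho (- (PI - al))) with (polar rho (al + PI)).
  - replace (- (PI - al)) with (al - PI) by ring. unfold side. rewrite cos_minus, sin_minus, cos_PI, sin_PI. ring.
  - apply C_eq; rewrite ?Re_polar, ?Im_polar; replace (- (PI - al)) with (al - PI) by ring;
    rewrite ?cos_plus, ?sin_plus, ?cos_minus, ?sin_minus, cos_PI, sin_PI; ring. }
 assert (Hlast := fun t rho Ht Hrho => HS t rho (m - 1)%nat Ht Hrho ltac:(lia)).
 assert (Hrefl : forall N, counted n (refl_sys A) w (Rg m r) N -> counted n A w (Reg r (INR (m - 1) * al) (INR (m + 1) * al)) N).
 { intros N H. apply counted_refl. revert H. apply counted_ext. intros z _. apply Hreg. }
 assert (Cr := circ_refl n A w r). assert (Cr2 := circ_refl n A w r2).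
 assert (Dr := circ_rev n (refl_sys A) w r). assert (Dr2 := circ_rev n (refl_sys A) w r2).
 assert (Gr := good_refl n A HA).
 assert (X2 : (circ_in n A w r -> circ_in n A w r2) /\ (circ_out n A w r -> circ_out n A w r2)).
 { assert (Crr : Cmod r = r) by (rewrite Cmod_R, Rabs_pos_eq; lra).
  split; intros H; destruct Hcirc as [[H1 H2] | [H1 H2]]; try assumption; exfalso;
   assert (B1 := H 0 r ltac:(lra) Crr); assert (B2 := H1 0 r ltac:(lra) Crr); lra. }
 destruct (Nat.odd m) eqn:Eo.
 - apply Nat.odd_spec in Eo. destruct Eo as (q & Eq).
  assert (P1 : (-1) ^ (m - 1) = 1) by (replace (m - 1)%nat with (2 * q)%nat by lia; apply pow_1_even).
  assert (P2 : (-1) ^ n = -1) by (unfold n; replace (S (S m)) with (S (2 * (q + 1))) by lia; apply pow_1_odd).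
  destruct (end_count (refl_sys A) Gr) as [F1 F2].
  + intros t. unfold refl_sys. rewrite Hlead, P2. ring.
  + intros t rho Ht Hrho. rewrite Hside. generalize (Hlast t rho Ht Hrho). rewrite P1. lra.
  + split; intros H; apply Hrefl; [apply F1, Cr, H | apply F2; [apply Cr, H | apply Cr2, X2, H]].
 - assert (Eo' : Nat.even m = true) by (rewrite <- Nat.negb_odd, Eo; reflexivity).
  apply Nat.even_spec in Eo'. destruct Eo' as (q & Eq).
  assert (P1 : (-1) ^ (m - 1) = -1) by (replace (m - 1)%nat with (S (2 * (q - 1))) by lia; apply pow_1_odd).
  assert (P2 : (-1) ^ n = 1) by (unfold n; replace (S (S m)) with (2 * (q + 1))%nat by lia; apply pow_1_even).
  destruct (end_count (rev_sys w (refl_sys A)) (good_rev w n _ Gr)) as [F1 F2].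
  + intros t. unfold rev_sys, refl_sys. rewrite Hlead, P2. ring.
  + intros t rho Ht Hrho. rewrite Fld_rev, side_opp, Hside. generalize (Hlast (w - t) rho ltac:(lra) Hrho). rewrite P1. lra.
  + split; intros H; apply Hrefl; apply counted_rev; try assumption.
   * apply F2; [apply Dr, Cr, H | apply Dr2, Cr2, X2, H].
   * apply F1, Dr, Cr, H.
Qed.

(** [S'] holds the partial sums of the sector counts. Starting from the right sector, sectors are
    glued upwards and then downwards, each ray in between carrying no periodic start. *)
Lemma chain_count NT (NJ S' : nat -> nat) : S' 0%nat = 0%nat -> (forall q, S' (S q) = S' q + NJ (S q))%nat ->
 counted n A w (Reg r (- al) al) NT ->
 (forall j, (1 <= j <= m - 2)%nat -> counted n A w (Reg r (INR j * al) (INR (S j) * al)) (NJ j) /\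
   counted n A w (Reg r (- (INR (S j) * al)) (- (INR j * al))) (NJ j)) ->
 counted n A w (Reg r (- (INR (m - 1) * al)) (INR (m - 1) * al)) (NT + 2 * S' (m - 2)%nat).
Proof.
 intros S0 SS HT HJ. destruct al_facts as (Ha & Em & Hm3 & Hpi).
 assert (Hk : forall k, (k <= m - 1)%nat -> INR k * al <= PI - al).
 { intros k Hk. replace (PI - al) with ((INR m - 1) * al) by lra. apply Rmult_le_compat_r; [lra |].
  replace (INR m - 1) with (INR (m - 1)) by (rewrite minus_INR by lia; reflexivity). apply le_INR, Hk. }
 assert (Up : forall q, (q <= m - 2)%nat -> counted n A w (Reg r (- al) (INR (S q) * al)) (NT + S' q)).
 { induction q as [| q IH]; intros Hq.
  - rewrite S0, Nat.add_0_r. simpl INR. rewrite Rmult_1_l. exact HT.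
  - rewrite SS, Nat.add_assoc. apply (counted_glue n A w r (- al) (INR (S q) * al)); try assumption.
   + rewrite (S_INR (S q)), (S_INR q). generalize (pos_INR q). intros. split; nra.
   + generalize (Hk (S (S q)) ltac:(lia)). lra.
   + apply ray_nofix. lia.
   + apply IH. lia.
   + apply HJ. lia. }
 assert (Down : forall q, (q <= m - 2)%nat -> counted n A w (Reg r (- (INR (S q) * al)) (INR (m - 1) * al)) (S' q + (NT + S' (m - 2)%nat))).
 { induction q as [| q IH]; intros Hq.
  - rewrite S0. simpl INR. rewrite Rmult_1_l. replace (m - 1)%nat with (S (m - 2)) by lia. apply Up. lia.
  - rewrite SS. replace (S' q + NJ (S q) + (NT + S' (m - 2)%nat))%nat with (NJ (S q) + (S' q + (NT + S' (m - 2)%nat)))%nat by lia.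
   apply (counted_glue n A w r (- (INR (S (S q)) * al)) (- (INR (S q) * al))); try assumption.
   + rewrite (S_INR (S q)), (S_INR q), minus_INR by lia. generalize (pos_INR q). simpl. intros. split; nra.
   + generalize (Hk (S (S q)) ltac:(lia)) (Hk (m - 1)%nat ltac:(lia)). lra.
   + apply ray_nofix. lia.
   + apply HJ. lia.
   + apply IH. lia. }
 assert (D := Down (m - 2)%nat ltac:(lia)). replace (S (m - 2)) with (m - 1)%nat in D by lia.
 replace (NT + 2 * S' (m - 2)%nat)%nat with (S' (m - 2)%nat + (NT + S' (m - 2)%nat))%nat by lia. exact D.
Qed.

(** The left sector closes the circle; its upper ray is the angle 2 pi - (pi - al) and thus
    coincides with the lowest ray of the chain, so both common rays must be free of periodic
    starts. *)
Lemma outside_count N1 N2 : counted n A w (Reg r (- (INR (m - 1) * al)) (INR (m - 1) * al)) N1 ->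
 counted n A w (Reg r (INR (m - 1) * al) (INR (m + 1) * al)) N2 -> counted n A w (fun z => r <= Cmod z) (N1 + N2).
Proof.
 intros H1 H2. destruct al_facts as (Ha & Em & Hm3 & Hpi). destruct al_mult as [E1 E2].
 destruct (ray_nofix (m - 1) ltac:(lia)) as [F1 F2]. rewrite E1 in *. rewrite E2 in *.
 assert (Hper : forall rho th, polar rho (th + 2 * PI) = polar rho th).
 { intros rho th. apply C_eq; rewrite ?Re_polar, ?Im_polar, ?cos_plus, ?sin_plus, cos_2PI, sin_2PI; ring. }
 apply (counted_ext n A w (fun z => Reg r (- (PI - al)) (PI - al) z \/ Reg r (PI - al) (PI + al) z)).
 - intros z _. split; [intros [[H _] | [H _]]; exact H |]. intros H. assert (Hz : z <> 0%C) by (apply Cmod_gt_0; lra).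
  destruct (Rle_dec 0 (Im z)) as [Hi | Hi].
  + destruct (half_plane_polar 0 z Hz) as (th & Hth & E); [unfold side; rewrite cos_0, sin_0; lra |]. rewrite Rplus_0_l in E.
   destruct (Rle_dec th (PI - al)); [left | right]; (split; [exact H | exists th; split; [lra | exact E]]).
  + assert (Hz' : Cconj z <> 0%C) by (apply Cmod_gt_0; rewrite Cmod_conj; lra).
   destruct (half_plane_polar 0 (Cconj z) Hz') as (th & Hth & E).
   { unfold side. rewrite cos_0, sin_0. change (0 <= - Im z * 1 - Re z * 0). lra. }
   rewrite Rplus_0_l, Cmod_conj in E. apply (f_equal Cconj) in E. rewrite Cconj_conj, polar_conj in E.
   destruct (Rle_dec th (PI - al)); [left | right].
   * split; [exact H | exists (- th); split; [lra | exact E]].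
   * split; [exact H | exists (- th + 2 * PI)]. rewrite Hper. split; [lra | exact E].
 - apply counted_union; try assumption. intros z (H & th & Hth & E) (_ & th' & Hth' & E') HF.
  destruct (Rlt_dec (th' - th) (2 * PI)) as [Hlt | Hge].
  + assert (Q : th = th').
   { apply (polar_angle (Cmod z)); [lra | rewrite <- E; exact E' | apply Rabs_def1; lra]. }
   apply (F1 z HF H). replace (PI - al) with th by lra. exact E.
  + apply (F2 z HF H). replace (- (PI - al)) with th by lra. exact E.
Qed.

Lemma disc_or_rev_count : counted n A w (fun z => Cmod z <= r) 1.
Proof.
 destruct Hcirc as [[H _] | [H _]].
 - apply disc_count; assumption.
 - apply counted_rev; try assumption. apply disc_count; try assumption; [apply good_rev, HA | apply circ_rev, H].
Qed.

(** With an attracting disc the right sector holds 1, the odd sectors on either side 1 each, the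
    left one 1 or 2 for m odd or even: 1 + 2 floor((m - 1) / 2) + (1 or 2) = m + 1. With a repelling
    disc it is 2 + 2 floor((m - 2) / 2) + (2 or 1) = m + 1. The disc adds one. *)
Lemma total_count : counted n A w (fun _ => True) n.
Proof.
 assert (Hout : counted n A w (fun z => r <= Cmod z) (S m)).
 { assert (Em : exists q, (m = 2 * q)%nat /\ Nat.odd m = false \/ (m = 2 * q + 1)%nat /\ Nat.odd m = true).
  { destruct (Nat.Even_or_Odd m) as [(q & E) | (q & E)]; exists q; [left | right]; (split; [exact E |]); rewrite E.
   - rewrite Nat.odd_mul. reflexivity.
   - rewrite Nat.add_1_r, Nat.odd_succ, Nat.even_mul. reflexivity. }
  destruct Em as (q & Em). destruct Hcirc as [[H _] | [H _]].
  - assert (C1 := chain_count 1 (fun j => if Nat.odd j then 1 else 0)%nat (fun q => Nat.div2 (S q)) eq_refl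
    (fun q => div2_step (S q)) (proj1 right_count H)
    (fun j Hj => conj (proj1 (proj1 (upper_count j Hj)) H) (proj1 (proj1 (lower_count j Hj)) H))).
   assert (C2 := outside_count _ _ C1 (proj1 left_count H)). cbv beta in C2.
   replace (S m) with (1 + 2 * Nat.div2 (S (m - 2)) + (if Nat.odd m then 1 else 2))%nat; [pos |].
   destruct Em as [[E ->] | [E ->]]; rewrite E.
   + replace (S (2 * q - 2)) with (S (2 * (q - 1))) by lia. rewrite Nat.div2_succ_double. lia.
   + replace (S (2 * q + 1 - 2)) with (2 * q)%nat by lia. rewrite Nat.div2_double. lia.
  - assert (St : forall q, Nat.div2 (S q) = (Nat.div2 q + if Nat.odd (S q) then 0 else 1)%nat).
   { intros x. rewrite div2_step, Nat.odd_succ, <- Nat.negb_odd. destruct (Nat.odd x); reflexivity. }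
   assert (C1 := chain_count 2 (fun j => if Nat.odd j then 0 else 1)%nat Nat.div2 eq_refl St (proj2 right_count H)
    (fun j Hj => conj (proj2 (proj1 (upper_count j Hj)) H) (proj2 (proj1 (lower_count j Hj)) H))).
   assert (C2 := outside_count _ _ C1 (proj2 left_count H)).
   replace (S m) with (2 + 2 * Nat.div2 (m - 2) + (if Nat.odd m then 2 else 1))%nat; [pos |].
   destruct Em as [[E ->] | [E ->]]; rewrite E.
   + replace (2 * q - 2)%nat with (2 * (q - 1))%nat by lia. rewrite Nat.div2_double. lia.
   + replace (2 * q + 1 - 2)%nat with (S (2 * (q - 1))) by lia. rewrite Nat.div2_succ_double. lia. }
 apply (counted_ext n A w (fun z => Cmod z <= r \/ r <= Cmod z)).
 - intros; lra.
 - change n with (1 + S m)%nat. apply counted_union; [apply disc_or_rev_count | pos |].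
  intros z H1 H2 (p & S & I0 & I1). destruct Hcirc as [[H _] | [H _]].
  + assert (B := proj2 (circ_in_inv n A w HA r w p 0 w Hr H S ltac:(lra) ltac:(lra) ltac:(lra) ltac:(rewrite I0; exact H1) w ltac:(lra)) Hw).
   rewrite I1 in B. lra.
  + assert (B := proj2 (circ_out_inv n A w HA r w p 0 w Hr H S ltac:(lra) ltac:(lra) ltac:(lra) ltac:(rewrite I0; exact H2) w ltac:(lra)) Hw).
   rewrite I1 in B. lra.
Qed.

End Total.

(** * The coefficient bounds *)

Lemma radial_plus u v z : radial (u + v)%C z = radial u z + radial v z.
Proof. unfold radial, Re, Im. simpl. ring. Qed.

Lemma radial_scal k v z : radial (RtoC k * v)%C z = k * radial v z.
Proof. unfold radial, Re, Im. simpl. ring. Qed.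

Lemma radial_bound v z : Rabs (radial v z) <= Cmod v * Cmod z.
Proof. unfold radial. rewrite (Rmult_comm (Cmod v)). apply Re_Im_Cauchy_Schwarz. Qed.

Lemma pow_le_1 x k : 0 <= x <= 1 -> x ^ k <= 1.
Proof. intros H. rewrite <- (pow1 k). apply pow_incr. lra. Qed.

Lemma pow_decr x i k : 0 <= x <= 1 -> (i <= k)%nat -> x ^ k <= x ^ i.
Proof.
 intros Hx Hik. replace k with (i + (k - i))%nat by lia. rewrite pow_add.
 assert (x ^ (k - i) <= 1) by (apply pow_le_1, Hx). assert (0 <= x ^ i) by pos. nra.
Qed.

(* [n = j + 3]; [E] bounds [|A_i| kap^i] for the indices [2 <= i <= n - 1] other than [n - 2]. *)
Section Coefficients.
Variables (A : nat -> R -> R) (t : R) (j : nat) (kap Q p0 E : R).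
Hypothesis Hj : (2 <= j)%nat.
Hypothesis Hkap : 0 < kap.
Hypothesis HQ : 0 <= Q.
Hypothesis HE : 0 <= E.
Hypothesis HA0 : Rabs (A 0%nat t) = p0.
Hypothesis HAmid : forall i, (2 <= i <= S (S j))%nat -> i <> S j -> Rabs (A i t) * kap ^ i <= E.
Hypothesis HAq : A (S j) t = - Q.
Hypothesis HAn : A (S (S (S j))) t = 1.

Lemma coef_pow i x Y : (2 <= i <= S (S j))%nat -> i <> S j -> 0 <= x -> x ^ i <= Y ->
 Rabs (A i t) * (x * kap) ^ i <= E * Y.
Proof.
 intros Hi Hne Hx HY. rewrite Rpow_mult_distr.
 replace (Rabs (A i t) * (x ^ i * kap ^ i)) with (Rabs (A i t) * kap ^ i * x ^ i) by ring.
 apply Rmult_le_compat; [| pos | apply HAmid; assumption | lra]. apply Rmult_le_pos; [pos | pos].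
Qed.

(** The linear term is tangent to the ray, the quadratic one contributes a factor sin th, each later
    one at most 1. Keeping sin th apart is the source of the slack used in [ray_lower]. *)
Lemma side_middle x Y th d : 0 <= x -> (forall i, (2 <= i <= j)%nat -> x ^ i <= Y) -> 0 <= sin th -> (2 + d <= j)%nat ->
 Rabs (side th (Fld A (2 + d) t (polar (x * kap) th)) + A 0%nat t * sin th) <= E * Y * (sin th + INR d).
Proof.
 intros Hx HY Hs. induction d as [| d IH]; intros Hd.
 - cbn [Nat.add Fld]. rewrite !side_plus, !side_scal, !polar_pow, !side_polar.
  replace (INR 1 * th - th) with 0 by (simpl; ring). replace (INR 2 * th - th) with th by (simpl; ring). rewrite sin_0.
  replace (side th (RtoC (A 0%nat t))) with (- A 0%nat t * sin th) by (unfold side, Re, Im; simpl; ring).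
  replace (- A 0%nat t * sin th + A 1%nat t * ((x * kap) ^ 1 * 0) + A 2%nat t * ((x * kap) ^ 2 * sin th) + A 0%nat t * sin th)
   with (A 2%nat t * (x * kap) ^ 2 * sin th) by ring.
  assert (P : 0 <= (x * kap) ^ 2) by pos.
  rewrite !Rabs_mult, (Rabs_pos_eq ((x * kap) ^ 2)), (Rabs_pos_eq (sin th)) by assumption.
  simpl INR. rewrite Rplus_0_r. apply Rmult_le_compat_r; [lra |]. apply coef_pow; try lia; [lra | apply HY; lia].
 - assert (IH' := IH ltac:(lia)). replace (2 + S d)%nat with (S (2 + d)) by lia. set (i := (2 + d)%nat) in *.
  cbn [Fld]. rewrite side_plus, side_scal, polar_pow, side_polar.
  set (u := side th (Fld A i t (polar (x * kap) th))) in *.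
  replace (u + A (S i) t * ((x * kap) ^ S i * sin (INR (S i) * th - th)) + A 0%nat t * sin th)
   with ((u + A 0%nat t * sin th) + A (S i) t * (x * kap) ^ S i * sin (INR (S i) * th - th)) by ring.
  eapply Rle_trans; [apply Rabs_triang |]. rewrite (S_INR i), (S_INR d). assert (P : 0 <= (x * kap) ^ S i) by pos.
  assert (C := coef_pow (S i) x Y ltac:(unfold i; lia) ltac:(unfold i; lia) Hx (HY (S i) ltac:(unfold i; lia))).
  assert (B : Rabs (A (S i) t * (x * kap) ^ S i * sin ((INR i + 1) * th - th)) <= E * Y).
  { rewrite !Rabs_mult, (Rabs_pos_eq ((x * kap) ^ S i)) by exact P.
   assert (B1 : Rabs (sin ((INR i + 1) * th - th)) <= 1) by (apply Rabs_le, SIN_bound).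
   assert (0 <= Rabs (A (S i) t) * (x * kap) ^ S i) by pos. nra. }
  lra.
Qed.

(** On these rays sin((m + 1) th) = (-1)^k sin th and sin((m - 1) th) = - (-1)^k sin th, so the
    leading term and the one with coefficient - Q add up, while the term of degree m + 1 is
    tangent. *)
Lemma side_total x Y th k : 0 <= x -> (forall i, (2 <= i <= j)%nat -> x ^ i <= Y) -> 0 <= sin th -> INR (S j) * th = INR k * PI ->
 sin th * ((x * kap) ^ S (S (S j)) + Q * (x * kap) ^ S j - p0) - E * Y * (sin th + (INR j - 2))
  <= (-1) ^ k * side th (Fld A (S (S (S j))) t (polar (x * kap) th)).
Proof.
 intros Hx HY Hs Hth. assert (B := side_middle x Y th (j - 2) Hx HY Hs ltac:(lia)).
 replace (2 + (j - 2))%nat with j in B by lia. rewrite minus_INR in B by lia. simpl (INR 2) in B.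
 destruct (cos_sin_nPI k 0) as [C1 C2]. rewrite Rplus_0_l, cos_0, sin_0, Rmult_0_r, Rmult_1_r in *.
 cbn [Fld]. rewrite !side_plus, !side_scal, !polar_pow, !side_polar, HAq, HAn. rewrite !S_INR in *.
 replace ((INR j + 1) * th - th) with (INR k * PI - th) by lra.
 replace ((INR j + 1 + 1) * th - th) with (INR k * PI) by lra.
 replace ((INR j + 1 + 1 + 1) * th - th) with (INR k * PI + th) by lra. rewrite sin_minus, sin_plus, C1, C2.
 set (u := side th (Fld A j t (polar (x * kap) th))) in *. set (s := (-1) ^ k) in *.
 assert (Hss : s * s = 1) by apply pow_m1_sq. assert (Hs1 : Rabs s = 1) by apply pow_m1_abs.
 set (X1 := (x * kap) ^ S (S (S j))). set (X2 := (x * kap) ^ S j). set (X3 := (x * kap) ^ S (S j)).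
 replace (s * (u + - Q * (X2 * (0 * cos th - s * sin th)) + A (S (S j)) t * (X3 * 0) + 1 * (X1 * (0 * cos th + s * sin th))))
  with (s * u + s * s * (sin th * (X1 + Q * X2))) by ring.
 rewrite Hss, Rmult_1_l.
 assert (B2 : Rabs (s * (u + A 0%nat t * sin th)) <= E * Y * (sin th + (INR j - (1 + 1)))) by (rewrite Rabs_mult, Hs1, Rmult_1_l; exact B).
 apply Rabs_le_between in B2. assert (B3 : Rabs (s * (A 0%nat t * sin th)) <= p0 * sin th).
 { rewrite !Rabs_mult, Hs1, (Rabs_pos_eq (sin th)) by exact Hs. rewrite HA0. lra. }
 apply Rabs_le_between in B3. lra.
Qed.

Lemma radial_middle x Y (z : C) d : 0 <= x -> Cmod z = x * kap -> (forall i, (2 <= i <= j)%nat -> x ^ i <= Y) -> (1 + d <= j)%nat ->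
 Rabs (radial (Fld A (1 + d) t z) z - A 1%nat t * (Cmod z * Cmod z)) <= Cmod z * (p0 + E * Y * INR d).
Proof.
 intros Hx Hz HY. assert (G := Cmod_ge_0 z). induction d as [| d IH]; intros Hd.
 - cbn [Nat.add Fld]. rewrite radial_plus, radial_scal.
  replace (radial (RtoC (A 0%nat t)) z) with (A 0%nat t * Re z) by (unfold radial, Re, Im; simpl; ring).
  replace (radial (z ^ 1)%C z) with (Cmod z * Cmod z) by (rewrite Cmod2_Re_Im; unfold radial, Re, Im; simpl; ring).
  replace (A 0%nat t * Re z + A 1%nat t * (Cmod z * Cmod z) - A 1%nat t * (Cmod z * Cmod z)) with (A 0%nat t * Re z) by ring.
  rewrite Rabs_mult, HA0. simpl INR. rewrite Rmult_0_r, Rplus_0_r, Rmult_comm.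
  apply Rmult_le_compat_r; [rewrite <- HA0; apply Rabs_pos | apply re_le_Cmod].
 - assert (IH' := IH ltac:(lia)). replace (1 + S d)%nat with (S (1 + d)) by lia. set (i := (1 + d)%nat) in *.
  cbn [Fld]. rewrite radial_plus, radial_scal, S_INR. set (u := radial (Fld A i t z) z) in *.
  replace (u + A (S i) t * radial (z ^ S i)%C z - A 1%nat t * (Cmod z * Cmod z))
   with ((u - A 1%nat t * (Cmod z * Cmod z)) + A (S i) t * radial (z ^ S i)%C z) by ring.
  eapply Rle_trans; [apply Rabs_triang |]. rewrite Rabs_mult.
  assert (C := coef_pow (S i) x Y ltac:(unfold i; lia) ltac:(unfold i; lia) Hx (HY (S i) ltac:(unfold i; lia))).
  rewrite <- Hz in C. assert (B := radial_bound (z ^ S i)%C z). rewrite Cmod_pow in B.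
  assert (Rabs (A (S i) t) * Rabs (radial (z ^ S i)%C z) <= E * Y * Cmod z).
  { apply Rle_trans with (Rabs (A (S i) t) * (Cmod z ^ S i * Cmod z)); [apply Rmult_le_compat_l; [pos | exact B] |].
   rewrite <- Rmult_assoc. apply Rmult_le_compat_r; assumption. }
  lra.
Qed.

(** All terms beyond the linear one have degree at least 2, which for x <= 1 yields the common
    factor x^2. *)
Lemma radial_total x (z : C) : 0 <= x <= 1 -> Cmod z = x * kap ->
 Rabs (radial (Fld A (S (S (S j))) t z) z - A 1%nat t * (Cmod z * Cmod z))
  <= Cmod z * (p0 + x ^ 2 * (E * INR j + (Q * kap ^ S j + kap ^ S (S (S j))))).
Proof.
 intros Hx Hz. assert (G := Cmod_ge_0 z).
 assert (HY : forall i, (2 <= i)%nat -> x ^ i <= x ^ 2) by (intros i Hi; apply pow_decr; assumption).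
 assert (B := radial_middle x (x ^ 2) z (j - 1) ltac:(lra) Hz (fun i Hi => HY i ltac:(lia)) ltac:(lia)).
 replace (1 + (j - 1))%nat with j in B by lia. rewrite minus_INR in B by lia. simpl (INR 1) in B.
 cbn [Fld]. rewrite !radial_plus, !radial_scal, HAq, HAn.
 assert (Bp : forall i, Rabs (radial (z ^ i)%C z) <= (x * kap) ^ i * Cmod z).
 { intros i. eapply Rle_trans; [apply radial_bound |]. rewrite Cmod_pow, Hz. lra. }
 assert (Bq : forall i, (2 <= i)%nat -> (x * kap) ^ i <= x ^ 2 * kap ^ i).
 { intros i Hi. rewrite Rpow_mult_distr. apply Rmult_le_compat_r; [pos | apply HY, Hi]. }
 assert (T1 : Rabs (- Q * radial (z ^ S j)%C z) <= Q * (x ^ 2 * kap ^ S j) * Cmod z).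
 { rewrite Rabs_mult, Rabs_Ropp, (Rabs_pos_eq Q) by exact HQ. rewrite Rmult_assoc. apply Rmult_le_compat_l; [lra |].
  eapply Rle_trans; [apply Bp |]. apply Rmult_le_compat_r; [exact G | apply Bq; lia]. }
 assert (T2 : Rabs (A (S (S j)) t * radial (z ^ S (S j))%C z) <= E * x ^ 2 * Cmod z).
 { rewrite Rabs_mult. apply Rle_trans with (Rabs (A (S (S j)) t) * ((x * kap) ^ S (S j) * Cmod z)); [apply Rmult_le_compat_l; [pos | apply Bp] |].
  rewrite <- Rmult_assoc. apply Rmult_le_compat_r; [exact G |]. apply coef_pow; try lia; [lra | apply HY; lia]. }
 assert (T3 : Rabs (1 * radial (z ^ S (S (S j)))%C z) <= x ^ 2 * kap ^ S (S (S j)) * Cmod z).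
 { rewrite Rmult_1_l. eapply Rle_trans; [apply Bp |]. apply Rmult_le_compat_r; [exact G | apply Bq; lia]. }
 set (a := radial (Fld A j t z) z - A 1%nat t * (Cmod z * Cmod z)) in *.
 set (b1 := - Q * radial (z ^ S j)%C z) in *. set (b2 := A (S (S j)) t * radial (z ^ S (S j))%C z) in *.
 set (b3 := 1 * radial (z ^ S (S (S j)))%C z) in *.
 replace (radial (Fld A j t z) z + b1 + b2 + b3 - A 1%nat t * (Cmod z * Cmod z)) with (a + b1 + b2 + b3) by (unfold a; ring).
 assert (V1 := Rabs_triang (a + b1 + b2) b3). assert (V2 := Rabs_triang (a + b1) b2). assert (V3 := Rabs_triang a b1). lra.
Qed.

(* The slack: on the rays [sin th >= s] with [s < 1], and the [i = 2] term carries the factor [sin th]. *)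
Variables (s p lam c : R).
Let M := kap ^ S (S (S j)) + kap ^ S j * Q.
Hypothesis Hs : 0 < s < 1.
Hypothesis Hp : 0 <= p < 1.
Hypothesis HM : p0 <= p * kap ^ S (S (S j)).
Hypothesis EE : E = (M - p0) * s / (INR j - 1).
Hypothesis Hlam : p < lam < 1.
Hypothesis Hc1 : c <= s.
Hypothesis Hc2 : c <= (1 - p) * (s * (1 - s) / (INR j - 1)) - (1 - lam ^ S (S (S j))).
Hypothesis Hc : 0 < c.

Lemma M_facts : kap ^ S (S (S j)) <= M /\ 0 < kap ^ S (S (S j)) /\ 2 <= INR j /\ 0 <= p0 /\ p0 <= p * M /\ p0 < M.
Proof.
 assert (K1 : 0 < kap ^ S (S (S j))) by pos. assert (K2 : 0 < kap ^ S j) by pos.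
 assert (J : 2 <= INR j) by (apply (le_INR 2), Hj). assert (P0 : 0 <= p0) by (rewrite <- HA0; apply Rabs_pos).
 assert (HM1 : kap ^ S (S (S j)) <= M) by (unfold M; assert (0 <= kap ^ S j * Q) by pos; lra).
 assert (p0 <= p * M) by nra. repeat split; try assumption. nra.
Qed.

Lemma ray_lower x th k : lam <= x -> s <= sin th -> INR (S j) * th = INR k * PI ->
 c * (x * kap) ^ S (S (S j)) <= (-1) ^ k * side th (Fld A (S (S (S j))) t (polar (x * kap) th)).
Proof.
 intros Hx Hsin Hth. destruct M_facts as (F1 & F2 & F3 & F4 & F5 & F6). assert (S1 := SIN_bound th).
 set (S := sin th) in *. set (K := kap ^ Datatypes.S (Datatypes.S (Datatypes.S j))) in *.
 set (c0 := s * (1 - s) / (INR j - 1)) in *. assert (Hc0 : 0 < c0) by (apply Rdiv_lt_0_compat; [pos |]; lra).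
 assert (Key : (M - p0) * c0 <= S * (M - p0) - E * (S + (INR j - 2))).
 { rewrite EE. apply Rmult_le_reg_r with (INR j - 1); [lra |].
  replace ((M - p0) * c0 * (INR j - 1)) with ((M - p0) * (s * (1 - s))) by (unfold c0; field; lra).
  replace ((S * (M - p0) - (M - p0) * s / (INR j - 1) * (S + (INR j - 2))) * (INR j - 1))
   with ((M - p0) * (S * (INR j - 1 - s) - s * (INR j - 2))) by (field; lra).
  apply Rmult_le_compat_l; [lra |]. assert (s * (INR j - 1 - s) <= S * (INR j - 1 - s)) by nra. lra. }
 destruct (Rle_dec 1 x) as [H1 | H1].
 - set (y := x ^ Datatypes.S j). assert (HY : forall i, (2 <= i <= j)%nat -> x ^ i <= y).
  { intros i Hi. unfold y. apply Rle_pow; [lra | lia]. }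
  eapply Rle_trans; [| apply (side_total x y th k ltac:(lra) HY ltac:(fold S; lra) Hth)]. fold S.
  assert (Y1 : 1 <= y) by (apply pow_R1_Rle, H1). set (yn := x ^ Datatypes.S (Datatypes.S (Datatypes.S j))).
  assert (Yn : y <= yn) by (apply Rle_pow; [lra | lia]). rewrite !Rpow_mult_distr. fold y yn K.
  assert (P1 : p0 <= p0 * y) by nra.
  assert (V : S * (yn * K + Q * (y * kap ^ Datatypes.S j) - p0) - E * y * (S + (INR j - 2))
    >= S * K * (yn - y) + y * (S * (M - p0) - E * (S + (INR j - 2)))).
  { unfold M. fold K. assert (S * p0 <= S * (p0 * y)) by nra. lra. }
  assert (V2 : y * ((M - p0) * c0) <= y * (S * (M - p0) - E * (S + (INR j - 2)))) by (apply Rmult_le_compat_l; lra).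
  assert (V3 : c * K * (yn - y) <= S * K * (yn - y)).
  { apply Rmult_le_compat_r; [lra |]. apply Rmult_le_compat_r; lra. }
  assert (L1 : lam ^ Datatypes.S (Datatypes.S (Datatypes.S j)) <= 1) by (apply pow_le_1; lra).
  assert (V4 : c * K <= (M - p0) * c0).
  { apply Rle_trans with ((1 - p) * c0 * K); [apply Rmult_le_compat_r; lra |].
   replace ((1 - p) * c0 * K) with ((1 - p) * K * c0) by ring. apply Rmult_le_compat_r; [lra |]. lra. }
  assert (V5 : y * (c * K) <= y * ((M - p0) * c0)) by (apply Rmult_le_compat_l; lra). lra.
 - assert (HY : forall i, (2 <= i <= j)%nat -> x ^ i <= 1) by (intros i _; apply pow_le_1; lra).
  eapply Rle_trans; [| apply (side_total x 1 th k ltac:(lra) HY ltac:(fold S; lra) Hth)]. fold S.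
  set (yn := x ^ Datatypes.S (Datatypes.S (Datatypes.S j))). assert (Y1 : yn <= 1) by (apply pow_le_1; lra).
  assert (Y2 : lam ^ Datatypes.S (Datatypes.S (Datatypes.S j)) <= yn) by (apply pow_incr; lra).
  assert (Y3 : yn <= x ^ Datatypes.S j) by (apply pow_decr; [lra | lia]).
  rewrite !Rpow_mult_distr. fold yn K. set (km := kap ^ Datatypes.S j) in *.
  assert (Hkm : 0 < km) by (apply pow_lt, Hkap). assert (V1 : yn * M <= yn * K + Q * (x ^ Datatypes.S j * km)).
  { unfold M. fold K km. assert (Q * (yn * km) <= Q * (x ^ Datatypes.S j * km)); [| lra].
   apply Rmult_le_compat_l; [lra |]. apply Rmult_le_compat_r; lra. }
  assert (V2 : S * (yn * M - p0) <= S * (yn * K + Q * (x ^ Datatypes.S j * km) - p0)) by nra.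
  assert (V3 : S * ((1 - yn) * M) <= 1 * ((1 - lam ^ Datatypes.S (Datatypes.S (Datatypes.S j))) * M)).
  { apply Rmult_le_compat; try lra; [pos | nra]. }
  assert (V4 : (1 - p) * c0 * M <= (M - p0) * c0) by nra.
  assert (V5 : c * M <= ((1 - p) * c0 - (1 - lam ^ Datatypes.S (Datatypes.S (Datatypes.S j)))) * M) by nra.
  assert (V6 : c * (yn * K) <= c * M).
  { apply Rmult_le_compat_l; [lra |]. apply Rle_trans with (1 * K); [nra |]; lra. }
  lra.
Qed.

Hypothesis HA1 : (M + p0 + E * INR j) / kap <= Rabs (A 1%nat t).

(** The linear term exceeds the others by (1 - x) (x (M + E j) - p0) up to a factor: zero at x = 1
    and positive for p < x < 1, which is why the circle is taken inside radius [kap]. *)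
Lemma circle_sign x (z : C) : lam <= x < 1 -> Cmod z = x * kap ->
 (0 < A 1%nat t -> 0 < radial (Fld A (S (S (S j))) t z) z) /\ (A 1%nat t < 0 -> radial (Fld A (S (S (S j))) t z) z < 0).
Proof.
 intros Hx Hz. destruct M_facts as (F1 & F2 & F3 & F4 & F5 & F6).
 assert (B := radial_total x z ltac:(lra) Hz). apply Rabs_le_between in B. assert (Hzp : 0 < Cmod z) by nra.
 replace (Q * kap ^ S j + kap ^ S (S (S j))) with M in B by (unfold M; ring). assert (HEj : 0 <= E * INR j) by pos.
 assert (V : p0 + x ^ 2 * (E * INR j + M) < x * (M + p0 + E * INR j)).
 { assert (0 < (1 - x) * (x * (M + E * INR j) - p0)); [| lra].
  apply Rmult_lt_0_compat; [lra |]. assert (p0 < x * M) by nra. nra. }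
 assert (V2 : x * (M + p0 + E * INR j) <= Rabs (A 1%nat t) * Cmod z).
 { rewrite Hz. apply Rle_trans with ((M + p0 + E * INR j) / kap * (x * kap)); [right; field; lra |].
  apply Rmult_le_compat_r; [lra | lra]. }
 assert (V3 : Cmod z * (p0 + x ^ 2 * (E * INR j + M)) < Rabs (A 1%nat t) * (Cmod z * Cmod z)) by nra.
 split; intros H; [rewrite (Rabs_pos_eq (A 1%nat t)) in V3 by lra | rewrite (Rabs_left (A 1%nat t)) in V3 by lra]; lra.
Qed.

End Coefficients.

(** * The differential equation *)

(** Time is clamped so that the coefficients become continuous and bounded on the whole line, and
    the leading coefficient 1 is added at index n. *)
Definition sys (n : nat) (P : nat -> R -> R) (w : R) (i : nat) (t : R) : R :=
 if (i <? n)%nat then P i (clamp w t) else 1.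

Lemma sys_lt n P w i t : (i < n)%nat -> 0 <= t <= w -> sys n P w i t = P i t.
Proof. intros Hi Ht. unfold sys. rewrite (proj2 (Nat.ltb_lt i n) Hi), clamp_id by exact Ht. reflexivity. Qed.

Lemma sys_lead n P w t : sys n P w n t = 1.
Proof. unfold sys. rewrite Nat.ltb_irrefl. reflexivity. Qed.

Lemma clamp_within w t : 0 < w -> filterlim (clamp w) (locally t) (within (fun s => 0 <= s <= w) (locally (clamp w t))).
Proof.
 intros Hw D HD. unfold filtermap. assert (H := clamp_continuous w t _ HD). unfold filtermap in H.
 revert H. apply filter_imp. intros s Hs. apply Hs. apply clamp_in. lra.
Qed.

Lemma good_sys_sys n P w : 0 < w -> (forall i, (i < n)%nat -> cont_on 0 w (P i)) -> good_sys n (sys n P w).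
Proof.
 intros Hw HP. assert (Hc : forall i t, (i <= n)%nat -> continuous (sys n P w i) t).
 { intros i t Hi. unfold sys. destruct (i <? n)%nat eqn:Ei; [| apply continuous_const].
  apply Nat.ltb_lt in Ei. assert (Hcl := clamp_in w t ltac:(lra)).
  exact (filterlim_comp _ _ _ (clamp w) (P i) _ _ _ (clamp_within w t Hw) (HP i Ei (clamp w t) Hcl)). }
 split; [pos |].
 assert (Hb : forall k, (k <= n)%nat -> exists B, 0 <= B /\ forall i t, (i <= k)%nat -> Rabs (sys n P w i t) <= B).
 { assert (H1 : forall i, (i <= n)%nat -> exists B, 0 <= B /\ forall t, Rabs (sys n P w i t) <= B).
  { intros i Hi. destruct (continuous_bounded (fun t => Rabs (sys n P w i t)) 0 w ltac:(lra)) as (t0 & _ & Hmax).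
   - intros t. apply (continuous_comp (sys n P w i) Rabs); [apply Hc, Hi | apply continuous_Rabs].
   - exists (Rabs (sys n P w i t0)). split; [pos |]. intros t.
    assert (Hcl := clamp_in w t ltac:(lra)). assert (B := Hmax (clamp w t) Hcl). cbv beta in B.
    replace (sys n P w i t) with (sys n P w i (clamp w t)); [exact B |].
    unfold sys. rewrite (clamp_id w (clamp w t) Hcl). reflexivity. }
  induction k as [| k IH]; intros Hk.
  - destruct (H1 0%nat Hk) as (B & HB & H). exists B. split; [lra |]. intros i t Hi.
   replace i with 0%nat by lia. apply H.
  - destruct (IH ltac:(lia)) as (B1 & HB1 & H). destruct (H1 (S k) Hk) as (B2 & HB2 & H2).
   exists (B1 + B2). split; [lra |]. intros i t Hi. destruct (Nat.eq_dec i (S k)) as [-> | Hne].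
   + generalize (H2 t). lra.
   + generalize (H i t ltac:(lia)). lra. }
 apply (Hb n). lia.
Qed.

Lemma pow_n_Cpow (z : C) k : pow_n (K := C_Ring) z k = (z ^ k)%C.
Proof. induction k as [| k IH]; [reflexivity |]. simpl. rewrite IH. reflexivity. Qed.

Lemma Fld_rhs n P w t z : (1 <= n)%nat -> 0 <= t <= w -> Fld (sys n P w) n t z = rhs n P t z.
Proof.
 intros Hn Ht. unfold rhs. assert (H : forall k, (k < n)%nat -> Fld (sys n P w) k t z =
  sum_n (G := C_AbelianMonoid) (fun i => Cmult (RtoC (P i t)) (pow_n (K := C_Ring) z i)) k).
 { induction k as [| k IH]; intros Hk.
  - rewrite sum_O. cbn [Fld]. rewrite sys_lt by assumption. simpl. rewrite Cmult_1_r. reflexivity.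
  - rewrite sum_Sn. cbn [Fld]. rewrite IH by lia. rewrite sys_lt by assumption. rewrite (pow_n_Cpow z (S k)). reflexivity. }
 destruct n as [| k]; [lia |]. cbn [Fld]. rewrite sys_lead, H by lia. rewrite (pow_n_Cpow z (S k)).
 replace (S k - 1)%nat with k by lia. ring.
Qed.

Lemma is_derive_C (phi : R -> C) t (v : C) :
 @is_derive R_AbsRing C_R_NormedModule phi t v <-> cder phi t v.
Proof.
 split.
 - intros H. split.
  + exact (filterdiff_comp' (U := R_NormedModule) (V := C_R_NormedModule) (W := R_NormedModule) phi (fun z : C => fst z) t _ _ H
    (filterdiff_linear (U := C_R_NormedModule) _ (is_linear_fst (U := R_NormedModule) (V := R_NormedModule)))).
  + exact (filterdiff_comp' (U := R_NormedModule) (V := C_R_NormedModule) (W := R_NormedModule) phi (fun z : C => snd z) t _ _ H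
    (filterdiff_linear (U := C_R_NormedModule) _ (is_linear_snd (U := R_NormedModule) (V := R_NormedModule)))).
 - intros [H1 H2]. assert (D1 := is_derive_scal_l (V := C_R_NormedModule) (fun s => Re (phi s)) t (Re v) (RtoC 1) H1).
  assert (D2 := is_derive_scal_l (V := C_R_NormedModule) (fun s => Im (phi s)) t (Im v) Ci H2).
  assert (D := is_derive_plus (V := C_R_NormedModule) _ _ _ _ _ D1 D2).
  replace v with (@plus C_R_NormedModule (scal (Re v) (RtoC 1)) (scal (Im v) Ci)).
  + apply (is_derive_ext (V := C_R_NormedModule)) with (2 := D). intros s.
   apply C_eq; unfold Re, Im; simpl; unfold scal, plus; simpl; unfold mult; simpl; ring.
  + apply C_eq; unfold Re, Im; simpl; unfold scal, plus; simpl; unfold mult; simpl; ring.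
Qed.

Lemma sol_of_is_solution n P w c phi : (1 <= n)%nat -> 0 < w -> is_solution n P w c phi ->
 sol n (sys n P w) w (fun t => phi (clamp w t)) /\ phi (clamp w 0) = c /\ phi (clamp w w) = phi w.
Proof.
 intros Hn Hw (H0 & H1 & H2). split; [split |].
 - intros t. assert (Hcl := clamp_in w t ltac:(lra)).
  assert (L := filterlim_comp _ _ _ (clamp w) phi _ _ _ (clamp_within w t Hw) (H1 (clamp w t) Hcl)). split.
  + apply (filterlim_comp _ _ _ (fun s => phi (clamp w s)) (fun z : C => fst z) _ _ _ L).
   destruct (phi (clamp w t)) as [x y]. exact (continuous_fst (U := R_UniformSpace) (V := R_UniformSpace) x y).
  + apply (filterlim_comp _ _ _ (fun s => phi (clamp w s)) (fun z : C => snd z) _ _ _ L).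
   destruct (phi (clamp w t)) as [x y]. exact (continuous_snd (U := R_UniformSpace) (V := R_UniformSpace) x y).
 - intros t Ht. rewrite Fld_rhs by (assumption || lra). rewrite clamp_id by lra.
  apply (cder_ext_open phi _ 0 w t); [lra | | apply is_derive_C, H2, Ht].
  intros s Hs. rewrite clamp_id by lra. reflexivity.
 - rewrite !clamp_id by lra. split; [pos | reflexivity].
Qed.

Lemma is_solution_of_sol n P w phi : (1 <= n)%nat -> 0 < w -> sol n (sys n P w) w phi -> is_solution n P w (phi 0) phi.
Proof.
 intros Hn Hw [Cp Dp]. split; [reflexivity | split].
 - intros t _. assert (L : filterlim phi (locally t) (locally (phi t))).
  { destruct (Cp t) as [C1 C2]. apply filterlim_locally. intros eps.
   assert (B1 := proj1 (filterlim_locally _ _) C1 eps). assert (B2 := proj1 (filterlim_locally _ _) C2 eps).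
   generalize (filter_and _ _ B1 B2). apply filter_imp. intros s Hs. exact Hs. }
  intros D HD. assert (H := L D HD). unfold filtermap in *. unfold within. revert H. apply filter_imp. intros s Hs _. exact Hs.
 - intros t Ht. apply is_derive_C. rewrite <- (Fld_rhs n P w) by (assumption || lra). apply Dp, Ht.
Qed.

Lemma displacement_Fl n P w c v : (1 <= n)%nat -> 0 < w ->
 displacement n P w c v <-> Fl n (sys n P w) w c (c + v)%C.
Proof.
 intros Hn Hw. split.
 - intros (phi & Hs & ->). destruct (sol_of_is_solution n P w c phi Hn Hw Hs) as (S & E0 & E1).
  exists (fun t => phi (clamp w t)). split; [exact S | split; [pos |]]. rewrite E1. ring.
 - intros (phi & S & E0 & E1). exists phi. rewrite E1. split; [rewrite <- E0; apply is_solution_of_sol; assumption | ring].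
Qed.

Lemma zero_mult_zm n P w c k : (1 <= n)%nat -> 0 < w -> zm n (sys n P w) w c k -> zero_mult n P w c k.
Proof.
 (* Balls of the uniform structure on the complex plane are squares; half the radius makes the
    square fit into the disc. *)
 intros Hn Hw (r & h & Hr & Hc & H). exists (r / 2), h. split; [lra | split; [| pos]]. intros z [B1 B2].
 assert (Hz : Cmod (z - c) < r).
 { eapply Rle_lt_trans; [apply Cmod_le_Re_Im |]. change (Rabs (Re z - Re c) + Rabs (Im z - Im c) < r).
  change (Rabs (Re z - Re c) < r / 2) in B1. change (Rabs (Im z - Im c) < r / 2) in B2. lra. }
 destruct (H z Hz) as [H1 H2]. split; [| apply hol_is_derive, H2]. apply displacement_Fl; assumption.
Qed.

Lemma num_periodic_of_counted n P w N : (1 <= n)%nat -> 0 < w ->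
 counted n (sys n P w) w (fun _ => True) N -> num_periodic_solutions n P w N.
Proof.
 intros Hn Hw (ps & H1 & H2 & H3 & H4). exists (map fst ps), (map snd ps).
 split; [rewrite !length_map; reflexivity | split; [pos | split; [| split; [| lia]]]].
 - intros j Hj. rewrite length_map in Hj.
  (* Both defaults are written as projections of one default pair, so that [map_nth] applies to the
     list of pairs. *)
  rewrite (nth_indep _ _ (fst (RtoC 0, 0%nat))) by (rewrite length_map; exact Hj).
  rewrite (nth_indep _ 0%nat (snd (RtoC 0, 0%nat))) by (rewrite length_map; exact Hj).
  rewrite !map_nth. assert (Hin := nth_In ps (RtoC 0, 0%nat) Hj).
  destruct (nth j ps (RtoC 0, 0%nat)) as [c k]. apply zero_mult_zm; try assumption. apply (H2 c k Hin).
 - intros c Hc. apply H3; [trivial |]. apply displacement_Fl in Hc; try assumption. rewrite Cplus_0_r in Hc. exact Hc.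
Qed.

Lemma bernoulli_le d k : 0 <= d <= 1 -> 1 - INR k * d <= (1 - d) ^ k.
Proof.
 intros Hd. induction k as [| k IH]; [simpl; lra |]. rewrite S_INR. simpl.
 assert (0 <= (1 - d) ^ k) by pos. assert (K := pos_INR k). assert (0 <= INR k * d * d) by pos. nra.
Qed.

Theorem theorem1p2 (n : nat) (w : R) (P : nat -> R -> R) (K : R) :
  (5 <= n)%nat ->
  0 < w ->
  (forall i, (i < n)%nat -> cont_on 0 w (P i)) ->
  (forall t, 0 <= t <= w -> Rabs (P 0%nat t) < K) ->
  (forall t, 0 <= t <= w -> P (n - 2)%nat t <= 0) ->
  (forall t i, 0 <= t <= w -> (2 <= i <= n - 1)%nat -> i <> (n - 2)%nat ->
     Rabs (P i t) <=
       (K - Rpower K (INR (n - 2) / INR n) * P (n - 2)%nat t - Rabs (P 0%nat t))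
       / (INR (n - 4) * Rpower K (INR i / INR n))
       * sin (PI / INR (n - 2))) ->
  (forall t, 0 <= t <= w ->
     Rabs (P 1%nat t) >=
       (K + Rabs (P 0%nat t) - Rpower K (INR (n - 2) / INR n) * P (n - 2)%nat t
        + INR (n - 3) / INR (n - 4)
          * (K - Rpower K (INR (n - 2) / INR n) * P (n - 2)%nat t - Rabs (P 0%nat t))
          * sin (PI / INR (n - 2)))
       / Rpower K (1 / INR n)) ->
  num_periodic_solutions n P w n.
Proof.
 intros Hn Hw Hcont HK HPq HPi HP1. apply num_periodic_of_counted; [lia | lra |].
 (* The degree is written as j + 3, so that n - 2, n - 3 and n - 4 become j + 1, j and j - 1. *)
 assert (HA := good_sys_sys n P w Hw Hcont). destruct (Nat.lt_exists_pred 2 n ltac:(lia)) as (n1 & -> & Hn1).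
 destruct (Nat.lt_exists_pred 1 n1 ltac:(lia)) as (n2 & -> & Hn2).
 destruct (Nat.lt_exists_pred 0 n2 ltac:(lia)) as (j & -> & _). assert (Hj : (2 <= j)%nat) by lia. clear Hn1 Hn2.
 replace (S (S (S j)) - 2)%nat with (S j) in * by lia. replace (S (S (S j)) - 4)%nat with (j - 1)%nat in * by lia.
 replace (S (S (S j)) - 3)%nat with j in * by lia. replace (S (S (S j)) - 1)%nat with (S (S j)) in * by lia.
 assert (J : 2 <= INR j) by (apply (le_INR 2), Hj).
 rewrite (minus_INR j 1) in HPi, HP1 by lia. simpl (INR 1) in HPi, HP1.
 set (n := S (S (S j))) in *. set (m := S j) in *. set (A := sys n P w) in *.
 assert (HK0 : 0 < K) by (generalize (HK 0 ltac:(lra)) (Rabs_pos (P 0%nat 0)); lra).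
 assert (Hnn : 0 < INR n) by (apply lt_0_INR; unfold n; lia).
 set (kap := Rpower K (1 / INR n)) in *. assert (Hkap : 0 < kap) by apply exp_pos.
 assert (Hpow : forall i, Rpower K (INR i / INR n) = kap ^ i).
 { intros i. rewrite <- Rpower_pow by exact Hkap. unfold kap. rewrite Rpower_mult. f_equal. field. lra. }
 assert (Hkn : kap ^ n = K).
 { rewrite <- Hpow. replace (INR n / INR n) with 1 by (field; lra). apply Rpower_1, HK0. }
 rewrite Hpow in HP1. assert (Hkm : 0 < kap ^ m) by pos.
 destruct (al_facts m ltac:(unfold m; lia)) as (Hal & Em & Hm3 & Hpi). set (s := sin (PI / INR m)) in *.
 assert (Hs : 0 < s < 1).
 { split; [apply sin_gt_0; lra |]. rewrite <- sin_PI2. apply sin_increasing_1; lra. }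
 destruct (continuous_bounded (fun t => Rabs (A 0%nat t)) 0 w ltac:(lra)) as (t0 & Ht0 & Hmax).
 { intros t. apply (continuous_comp (A 0%nat) Rabs); [apply HA; lia | apply continuous_Rabs]. }
 assert (EA : forall i t, (i < n)%nat -> 0 <= t <= w -> A i t = P i t) by (intros; apply sys_lt; assumption).
 (* The maximum of |P_0| relative to K; that it is below 1 is the strictness from which all later
    margins are taken. *)
 set (p := Rabs (A 0%nat t0) / K). assert (EpK : p * K = Rabs (A 0%nat t0)) by (unfold p; field; lra).
 assert (Hp : 0 <= p < 1).
 { assert (B := HK t0 Ht0). rewrite <- EA in B by (assumption || unfold n; lia).
  split; [apply Rdiv_le_0_compat; [pos | lra] |]. apply Rmult_lt_reg_r with K; lra. }
 set (c0 := s * (1 - s) / (INR j - 1)). assert (Hc0 : 0 < c0) by (apply Rdiv_lt_0_compat; [pos |]; lra).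
 (* By Bernoulli 1 - lam^n <= n d, and d is chosen so that this uses at most half of the slack (1 -
    p) c0 on the rays; the other half is left for [c]. The bound (1 - p) / 2 keeps lam above p, as
    the circle estimate requires. *)
 assert (Hpc : 0 < (1 - p) * c0) by pos. set (d := Rmin ((1 - p) / 2) ((1 - p) * c0 / (2 * INR n))).
 assert (Hd0 : 0 < d) by (apply Rmin_pos; [lra | pos]). assert (Hd1 : d <= (1 - p) / 2) by apply Rmin_l.
 assert (Hd2 : INR n * d <= (1 - p) * c0 / 2).
 { apply Rle_trans with (INR n * ((1 - p) * c0 / (2 * INR n))); [apply Rmult_le_compat_l; [lra | apply Rmin_r] | right; field; lra]. }
 set (lam := 1 - d). assert (Hlam : p < lam < 1) by (unfold lam; lra).
 assert (Hbern := bernoulli_le d n ltac:(lra)). fold lam in Hbern. set (c := Rmin s ((1 - p) * c0 / 2)).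
 assert (Hc : 0 < c) by (apply Rmin_pos; lra). assert (Hc1 : c <= s) by apply Rmin_l.
 assert (Hc2 : c <= (1 - p) * c0 - (1 - lam ^ n)) by (assert (c <= (1 - p) * c0 / 2) by apply Rmin_r; lra).
 set (Q := fun t => - P m t). set (E := fun t => (kap ^ n + kap ^ m * Q t - Rabs (A 0%nat t)) * s / (INR j - 1)).
 assert (HQ : forall t, 0 <= t <= w -> 0 <= Q t) by (intros t Ht; unfold Q; generalize (HPq t Ht); lra).
 assert (Hpt : forall t, 0 <= t <= w -> Rabs (A 0%nat t) <= p * kap ^ n) by (intros t Ht; rewrite Hkn, EpK; apply Hmax, Ht).
 assert (HE : forall t, 0 <= t <= w -> 0 <= E t).
 { intros t Ht. apply Rdiv_le_0_compat; [| lra]. apply Rmult_le_pos; [| lra].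
  assert (0 <= kap ^ m * Q t) by (apply Rmult_le_pos; [lra | apply HQ, Ht]).
  assert (p * kap ^ n <= 1 * kap ^ n) by nra. generalize (Hpt t Ht). lra. }
 assert (Hmid : forall t, 0 <= t <= w -> forall i, (2 <= i <= S (S j))%nat -> i <> S j -> Rabs (A i t) * kap ^ i <= E t).
 { intros t Ht i Hi Hne. assert (B := HPi t i Ht Hi Hne). rewrite !Hpow in B. assert (Pi := pow_lt kap i Hkap).
  rewrite !EA by (assumption || unfold n; lia). unfold E, Q. rewrite Hkn, EA by (assumption || unfold n; lia).
  apply Rmult_le_compat_r with (r := kap ^ i) in B; [| lra]. eapply Rle_trans; [exact B |]. right. field. lra. }
 assert (Hq : forall t, 0 <= t <= w -> A (S j) t = - Q t).
 { intros t Ht. rewrite EA by (assumption || unfold n; lia). unfold Q, m. ring. }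
 assert (HA1 : forall t, 0 <= t <= w -> (kap ^ n + kap ^ m * Q t + Rabs (A 0%nat t) + E t * INR j) / kap <= Rabs (A 1%nat t)).
 { intros t Ht. assert (B := HP1 t Ht). rewrite !EA by (assumption || unfold n; lia). apply Rge_le in B.
  eapply Rle_trans; [| exact B]. right. unfold E, Q. rewrite Hkn, EA by (assumption || unfold n; lia). field. lra. }
 assert (Hray : forall t rho k, 0 <= t <= w -> lam * kap <= rho -> (1 <= k <= m - 1)%nat ->
  c * rho ^ n <= (-1) ^ k * side (INR k * (PI / INR m)) (Fld A n t (polar rho (INR k * (PI / INR m))))).
 { intros t rho k Ht Hrho Hk. replace rho with (rho / kap * kap) by (field; lra).
  assert (K1 : 1 <= INR k) by (apply (le_INR 1); lia).
  assert (K2 : INR k <= INR m - 1) by (replace (INR m - 1) with (INR (m - 1)) by (rewrite minus_INR by lia; reflexivity); apply le_INR; lia).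
  apply (ray_lower A t j kap (Q t) (Rabs (A 0%nat t)) (E t)) with (s := s) (p := p) (lam := lam); try assumption; auto.
  - apply sys_lead.
  - apply Rmult_le_reg_r with kap; [lra |]. replace (rho / kap * kap) with rho by (field; lra). exact Hrho.
  - unfold s. rewrite <- (Rmin_left (sin (PI / INR m)) (sin (PI / INR m))) by lra.
   apply sin_between; try lra. split; nra.
  - fold m. rewrite <- Em at 2. ring. }
 assert (Hsign : forall t z x, 0 <= t <= w -> lam <= x < 1 -> Cmod z = x * kap ->
  (0 < A 1%nat t -> 0 < radial (Fld A n t z) z) /\ (A 1%nat t < 0 -> radial (Fld A n t z) z < 0)).
 { intros t z x Ht Hx Hz.
  apply (circle_sign A t j kap (Q t) (Rabs (A 0%nat t)) (E t)) with (p := p) (lam := lam) (x := x); try assumption; auto. apply sys_lead. }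
 assert (Hne : forall t, 0 <= t <= w -> A 1%nat t <> 0).
 { intros t Ht E0. assert (B := HA1 t Ht). rewrite E0, Rabs_R0 in B.
  assert (0 < (kap ^ n + kap ^ m * Q t + Rabs (A 0%nat t) + E t * INR j) / kap); [| lra].
  apply Rdiv_lt_0_compat; [| lra]. assert (0 <= kap ^ m * Q t) by (apply Rmult_le_pos; [lra | apply HQ, Ht]).
  assert (0 <= E t * INR j) by (apply Rmult_le_pos; [apply HE, Ht | lra]). generalize (Rabs_pos (A 0%nat t)). lra. }
 (* P_1 is continuous and never zero, so its sign is constant in time: it decides whether the disc
    repels or attracts. *)
 assert (Hsg : (forall t, 0 <= t <= w -> 0 < A 1%nat t) \/ (forall t, 0 <= t <= w -> A 1%nat t < 0)).
 { assert (Hc1' : forall t, continuous (A 1%nat) t) by (intros t; apply HA; unfold n; lia).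
  destruct (Rlt_dec 0 (A 1%nat 0)) as [H0 | H0]; [left | right]; intros t Ht; apply Rnot_le_lt; intros Hle.
  - destruct (IVT_cont (fun u => - A 1%nat u) 0 t) as (x & Hx & Ex); try lra.
   + intros u. apply (continuous_opp (V := R_NormedModule)), Hc1'.
   + apply (Hne x); lra.
  - destruct (IVT_cont (A 1%nat) 0 t) as (x & Hx & Ex); try lra; [pos |]. apply (Hne x); lra. }
 (* The circle estimate holds for all radii from lam kap up to, but excluding, kap; the second
    radius is the midpoint. *)
 assert (Hr2 : lam * kap < (1 + lam) / 2 * kap) by nra. assert (Hr : 0 < lam * kap) by pos.
 apply (total_count m A w (lam * kap) ((1 + lam) / 2 * kap) c); try assumption.
 - intros t. apply sys_lead.
 - lia.
 - destruct Hsg as [H | H]; [right | left]; split; intros t z Ht Hz.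
  + apply (Hsign t z lam Ht ltac:(lra) Hz), H, Ht.
  + apply (Hsign t z ((1 + lam) / 2) Ht ltac:(lra) Hz), H, Ht.
  + apply (Hsign t z lam Ht ltac:(lra) Hz), H, Ht.
  + apply (Hsign t z ((1 + lam) / 2) Ht ltac:(lra) Hz), H, Ht.
Qed.
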